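(* Let $k$ be an algebraically closed field of characteristic zero. Let $X=\mathrm{Spec}(\mathfrak{R})$ and $Y=\mathrm{Spec}(\mathfrak{D})$ be the affine surfaces defined in the context. Let $X$ be equipped with the $SL_2(k)$-action defined by its structure as a homogeneous space for $SL_2(k)$, let $\mathbb{A}_k^5$ be equipped with the $SL_2(k)$-action induced by the irreducible $SL_2$-module of dimension $5$, and let $\mathbb{A}_k^4$ be equipped with any algebraic $SL_2(k)$-action. Then: (a) There exists an equivariant algebraic embedding $X\to\mathbb{A}_k^5$. (b) There exists an algebraic embedding $X\to\mathbb{A}_k^4$. (c) There is no equivariant algebraic embedding $X\to\mathbb{A}_k^4$. (d) There is no algebraic embedding $X\to\mathbb{A}_k^3$. (e) The cylinders $X\times\mathbb{A}_k^1$ and $Y\times\mathbb{A}_k^1$ are not isomorphic as algebraic $k$-varieties.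
   Context: Embeddings are understood to be closed embeddings. Let $\mathfrak{D}=k[x_0,x_1,x_2]$ with $2x_0x_2-x_1^2=1$, i.e. $\mathfrak{D}$ is the quotient of the polynomial ring $k[X_0,X_1,X_2]$ by the ideal $(2X_0X_2-X_1^2-1)$. Let $\mu$ be the $k$-automorphism of $\mathfrak{D}$ with $\mu(x_i)=-x_i$ for $i=0,1,2$, and let $\mathfrak{R}=\mathfrak{D}^{\langle\mu\rangle}$ be the ring of invariants, so $\mathfrak{R}=k[x_0^2,x_0x_1,x_0x_2,x_1^2,x_1x_2,x_2^2]$. Put $Y=\mathrm{Spec}(\mathfrak{D})$ and $X=\mathrm{Spec}(\mathfrak{R})=Y/\langle\mu\rangle$. The surfaces are homogeneous spaces for $SL_2(k)$: $Y\cong_k SL_2(k)/T$ and $X\cong_k SL_2(k)/N$, where $T$ is the one-dimensional (diagonal) torus of $SL_2(k)$ and $N$ is its normalizer. Concretely, the $SL_2(k)$-action on $\mathbb{A}_k^3$ induced by the irreducible $SL_2$-module of dimension $3$ (with invariant quadratic form $2X_0X_2-X_1^2$) restricts to $Y\subset\mathbb{A}_k^3$, commutes with $\mu$, and hence descends to $X$. *)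

(* Defs.v *)
From HB Require Import structures.
From mathcomp Require Import all_boot all_order all_algebra ring_quotient.
From mathcomp Require Import boolp mpoly ring.

Set Implicit Arguments.
Unset Strict Implicit.
Unset Printing Implicit Defensive.

Import GRing.Theory.
Local Open Scope ring_scope.
Local Open Scope quotient_scope.

(* Affine k-varieties are handled through their coordinate rings, by the
   anti-equivalence between affine k-schemes and commutative k-algebras:
   Spec A is represented by [A : comAlgType k], a k-morphism Spec A -> Spec B
   by its comorphism [{lrmorphism B -> A}], and affine n-space by
   [{mpoly k[n]}]. *)

(* [quot_alg I] is [{ideal_quot I}] with the k-algebra structure of A. *)
Section QuotientAlgebra.
Variables (k : fieldType) (A : comAlgType k) (I : idealr A).
Local Notation Q := {ideal_quot I}.

Definition quot_scale (c : k) (x : Q) : Q := \pi_Q (c%:A) * x.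

Fact quot_scaleA a b x : quot_scale a (quot_scale b x) = quot_scale (a * b) x.
Proof.
by rewrite /quot_scale mulrA -rmorphM /= -scalerAl mul1r scalerA.
Qed.

Fact quot_scale1 : left_id 1 quot_scale.
Proof. by move=> x; rewrite /quot_scale scale1r rmorph1 mul1r. Qed.

Fact quot_scaleDr : right_distributive quot_scale +%R.
Proof. by move=> c x y; rewrite /quot_scale mulrDr. Qed.

Fact quot_scaleDl x : {morph quot_scale^~ x : a b / a + b}.
Proof. by move=> a b; rewrite /quot_scale scalerDl rmorphD mulrDl. Qed.

Definition quot_alg := Q.
HB.instance Definition _ := GRing.ComNzRing.on quot_alg.
HB.instance Definition _ := GRing.Zmodule_isLmodule.Build k quot_alg
  quot_scaleA quot_scale1 quot_scaleDr quot_scaleDl.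

Fact quot_scaleAl (c : k) (x y : quot_alg) : c *: (x * y) = c *: x * y.
Proof. by rewrite /GRing.scale /= /quot_scale mulrA. Qed.
HB.instance Definition _ :=
  GRing.Lmodule_isLalgebra.Build k quot_alg quot_scaleAl.
HB.instance Definition _ := GRing.Lalgebra_isComAlgebra.Build k quot_alg.

Definition quot_pi (x : A) : quot_alg := \pi_Q x.

Fact quot_pi_zmod : zmod_morphism quot_pi.
Proof. by move=> x y; rewrite /quot_pi rmorphB. Qed.
Fact quot_pi_monoid : monoid_morphism quot_pi.
Proof.
by split=> [|x y]; rewrite /quot_pi ?rmorph1 ?rmorphM.
Qed.
Fact quot_pi_scale : scalable quot_pi.
Proof.
move=> c x; rewrite /GRing.scale /= /quot_scale /quot_pi -rmorphM /=.
by rewrite -scalerAl mul1r.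
Qed.
HB.instance Definition _ :=
  GRing.isZmodMorphism.Build A quot_alg quot_pi quot_pi_zmod.
HB.instance Definition _ :=
  GRing.isMonoidMorphism.Build A quot_alg quot_pi quot_pi_monoid.
HB.instance Definition _ :=
  GRing.isScalable.Build k A quot_alg *:%R quot_pi quot_pi_scale.

Definition quot_repr (x : quot_alg) : A := repr (x : Q).

Lemma quot_reprK : cancel quot_repr quot_pi.
Proof. by move=> x; apply: (@reprK _ Q x). Qed.

Lemma quot_piP x y : reflect (quot_pi x = quot_pi y) (x - y \in I).
Proof. by rewrite Quotient.idealrBE; apply: eqP. Qed.

End QuotientAlgebra.

Section Surfaces.
Variable k : closedFieldType.

Definition quadric : {mpoly k[3]} := 2%:R *: ('X_0 * 'X_2) - 'X_1 ^+ 2.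

Definition quadric_ideal (p : {mpoly k[3]}) : bool :=
  `[< exists q, p = q * (quadric - 1) >].

Fact quadric_idealr : idealr_closed quadric_ideal.
Proof.
split.
- by apply/asboolP; exists 0; rewrite mul0r.
- apply/asboolP=> -[q].
  have [i hi] : exists i : k, i ^+ 2 = -1.
    have [x hx] := @solve_monicpoly k 2 (fun j => if j == 0%N then -1 else 0) isT.
    by exists x; rewrite hx !big_ord_recl big_ord0 /= expr0 mulr1 mul0r !addr0.
  move=> /(congr1 (meval (fun j : 'I_3 => if j == 1 then i else 0))).
  rewrite rmorph1 rmorphM /= /quadric !rmorphB /= mevalZ rmorphM rmorphXn /=.
  rewrite !mevalXU /= rmorph1 mul0r mulr0 hi sub0r opprK subrr mulr0.
  by move/eqP; rewrite oner_eq0.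
- move=> a p q /asboolP[u ->] /asboolP[v ->]; apply/asboolP.
  by exists (a * u + v); rewrite mulrDl mulrA.
Qed.
HB.instance Definition _ := isIdealr.Build {mpoly k[3]} quadric_ideal
  quadric_idealr.

(* Y = Spec Dring *)
Definition Dring : Type := quot_alg (quadric_ideal : idealr {mpoly k[3]}).
HB.instance Definition _ := GRing.ComAlgebra.on Dring.

Definition piD : {mpoly k[3]} -> Dring := @quot_pi _ _ _.
HB.instance Definition _ := GRing.LRMorphism.on piD.

(* A polynomial substitution fixing the quadratic form descends to Dring. *)
Section Descend.
Variable u : {lrmorphism {mpoly k[3]} -> {mpoly k[3]}}.
Hypothesis fix_quadric : u quadric = quadric.

Definition descend of u quadric = quadric : Dring -> Dring :=
  fun x => piD (u (quot_repr x)).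

Local Notation f := (descend fix_quadric).

Lemma descendE p : f (piD p) = piD (u p).
Proof.
apply/quot_piP; rewrite -rmorphB /=.
have /quot_piP/asboolP[q ->] := quot_reprK (piD p).
apply/asboolP; exists (u q).
rewrite rmorphM; congr (_ * _).
by rewrite rmorphB rmorph1; congr (_ - _); apply: fix_quadric.
Qed.

Lemma piD_onto (x : Dring) : exists p, x = piD p.
Proof. by exists (quot_repr x); rewrite [RHS]quot_reprK. Qed.

Fact descend_zmod : zmod_morphism f.
Proof.
move=> x y; have [p ->] := piD_onto x; have [q ->] := piD_onto y.
by rewrite -rmorphB /= !descendE !rmorphB.
Qed.
Fact descend_monoid : monoid_morphism f.
Proof.
split=> [|x y]; first by rewrite -(rmorph1 piD) descendE !rmorph1.
have [p ->] := piD_onto x; have [q ->] := piD_onto y.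
by rewrite -rmorphM /= !descendE !rmorphM.
Qed.
Fact descend_scale : scalable f.
Proof.
move=> c x; have [p ->] := piD_onto x.
by rewrite -linearZ /= !descendE !linearZ.
Qed.
HB.instance Definition _ := GRing.isZmodMorphism.Build Dring Dring f descend_zmod.
HB.instance Definition _ := GRing.isMonoidMorphism.Build Dring Dring f descend_monoid.
HB.instance Definition _ := GRing.isScalable.Build k Dring Dring *:%R f descend_scale.
End Descend.

Definition negX : 3.-tuple {mpoly k[3]} := [tuple - 'X_i | i < 3].

Definition neg_poly : {mpoly k[3]} -> {mpoly k[3]} := comp_mpoly negX.
HB.instance Definition _ := GRing.LRMorphism.on neg_poly.

Lemma neg_polyX i : neg_poly 'X_i = - 'X_i.
Proof. by rewrite /neg_poly comp_mpolyXU -tnth_nth tnth_mktuple. Qed.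

Lemma quadric_subst (u : {lrmorphism {mpoly k[3]} -> {mpoly k[3]}}) :
  u quadric = 2%:R *: (u 'X_0 * u 'X_2) - u 'X_1 ^+ 2.
Proof. by rewrite /quadric linearB linearZ /= rmorphM rmorphXn. Qed.

Fact neg_quadric : neg_poly quadric = quadric.
Proof. by rewrite quadric_subst /= !neg_polyX mulrNN sqrrN. Qed.

Definition mu : Dring -> Dring := descend neg_quadric.
HB.instance Definition _ := GRing.LRMorphism.on mu.

Lemma muX i : mu (piD 'X_i) = - piD 'X_i.
Proof. by rewrite /mu descendE /= neg_polyX rmorphN. Qed.

Lemma dring_ind (B : comAlgType k) (f h : {lrmorphism Dring -> B}) :
  (forall i, f (piD 'X_i) = h (piD 'X_i)) -> f =1 h.
Proof.
move=> eq_fh x; have [p ->] := piD_onto x.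
elim/mpolyind: p => [|c m p _ _ IH]; first by rewrite !rmorph0.
rewrite !linearP /= IH; congr (_ *: _ + _).
rewrite mpolyXE_id !rmorph_prod; apply: eq_bigr => i _.
by rewrite !rmorphXn /= eq_fh.
Qed.

Lemma muK : involutive mu.
Proof.
move=> x; apply: (@dring_ind _ (mu \o mu) idfun) => i /=.
by rewrite muX rmorphN /= muX opprK.
Qed.

Definition mu_fixed : {pred Dring} := fun x => mu x == x.

Fact mu_fixed_subalg : subalg_closed mu_fixed.
Proof.
split=> [|c x y|x y]; rewrite !unfold_in /mu_fixed ?rmorph1 //.
- by move=> /eqP mx /eqP my; rewrite linearP /= mx my.
- by move=> /eqP mx /eqP my; rewrite rmorphM /= mx my.
Qed.
HB.instance Definition _ :=
  GRing.isSubalgClosed.Build k Dring mu_fixed mu_fixed_subalg.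

(* X = Spec Rring *)
Record Rring := MkRring {Rval :> Dring; _ : Rval \in mu_fixed}.
HB.instance Definition _ := [isSub for Rval].
HB.instance Definition _ := [Choice of Rring by <:].
HB.instance Definition _ := [SubChoice_isSubComNzRing of Rring by <:].
HB.instance Definition _ := [SubZmodule_isSubLmodule of Rring by <:].
HB.instance Definition _ :=
  [SubNzRing_SubLmodule_isSubLalgebra of Rring by <:].
HB.instance Definition _ := [SubLalgebra_isSubAlgebra of Rring by <:].
End Surfaces.

Section SL2.
Variable k : closedFieldType.

Record SL2 := MkSL2 {SL2val :> 'M[k]_2; _ : \det SL2val == 1}.
HB.instance Definition _ := [isSub for SL2val].
HB.instance Definition _ := [Choice of SL2 by <:].

Lemma det_SL2 (g : SL2) : \det g = 1. Proof. exact/eqP/(valP g). Qed.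

Fact SL2_one_subproof : \det (1%:M : 'M[k]_2) == 1.
Proof. by rewrite det1. Qed.
Fact SL2_mul_subproof (g h : SL2) : \det (g *m h) == 1.
Proof. by rewrite det_mulmx !det_SL2 mulr1. Qed.
Fact SL2_inv_subproof (g : SL2) : \det (invmx g) == 1.
Proof. by rewrite det_inv det_SL2 invr1. Qed.

Definition SL2_one := MkSL2 SL2_one_subproof.
Definition SL2_mul g h := MkSL2 (SL2_mul_subproof g h).
Definition SL2_inv g := MkSL2 (SL2_inv_subproof g).

Fact SL2_mulA : associative SL2_mul.
Proof. by move=> f g h; apply/val_inj/mulmxA. Qed.
Fact SL2_mul1 : left_id SL2_one SL2_mul.
Proof. by move=> g; apply/val_inj/mul1mx. Qed.
Fact SL2_mulr1 : right_id SL2_one SL2_mul.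
Proof. by move=> g; apply/val_inj/mulmx1. Qed.
Fact SL2_unit (g : SL2) : (g : 'M_2) \in unitmx.
Proof. by rewrite unitmxE det_SL2 unitr1. Qed.
Fact SL2_mulV : left_inverse SL2_one SL2_inv SL2_mul.
Proof. by move=> g; apply/val_inj/mulVmx/SL2_unit. Qed.
Fact SL2_mulrV : right_inverse SL2_one SL2_inv SL2_mul.
Proof. by move=> g; apply/val_inj/mulmxV/SL2_unit. Qed.
HB.instance Definition _ := isGroup.Build SL2
  SL2_mulA SL2_mul1 SL2_mulr1 SL2_mulV SL2_mulrV.

(* The A-valued function u on the k-points of SL_2 lies in k[SL_2] (x) A: it is
   given by a polynomial over A in the four matrix entries. *)
Definition regular_on_SL2 (A : comAlgType k) (u : SL2 -> A) : Prop :=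
  exists P : {mpoly A[2 * 2]}, forall g : SL2,
    u g = P.@[fun i => (mxvec g 0 i)%:A].

(* An algebraic left action of SL_2(k) on Spec A; [pullback g f] is the function
   x |-> f (g x), whence the order of the factors in [pullbackM]. The last
   field says that SL_2 x Spec A -> Spec A is a morphism of varieties. *)
Record SL2_action (A : comAlgType k) := MkSL2Action {
  pullback :> SL2 -> {lrmorphism A -> A};
  pullback1 : forall f, pullback 1%g f = f;
  pullbackM : forall g h f, pullback (g * h)%g f = pullback h (pullback g f);
  pullback_regular : forall f, regular_on_SL2 (fun g => pullback g f)
}.

Section Regular.
Variable A : comAlgType k.
Implicit Types u v : SL2 -> A.

Lemma regular_cst (a : A) : regular_on_SL2 (fun=> a).
Proof. by exists a%:MP => g; rewrite mevalC. Qed.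

Lemma regular_add u v : regular_on_SL2 u -> regular_on_SL2 v ->
  regular_on_SL2 (fun g => u g + v g).
Proof. by move=> [P hP] [Q hQ]; exists (P + Q) => g; rewrite mevalD hP hQ. Qed.

Lemma regular_mul u v : regular_on_SL2 u -> regular_on_SL2 v ->
  regular_on_SL2 (fun g => u g * v g).
Proof. by move=> [P hP] [Q hQ]; exists (P * Q) => g; rewrite mevalM hP hQ. Qed.

Lemma regular_ext u v : u =1 v -> regular_on_SL2 u -> regular_on_SL2 v.
Proof. by move=> uv [P hP]; exists P => g; rewrite -uv. Qed.

Lemma regular_sum (J : Type) (r : seq J) (F : J -> SL2 -> A) :
  (forall j, regular_on_SL2 (F j)) ->
  regular_on_SL2 (fun g => \sum_(j <- r) F j g).
Proof.
move=> hF; elim: r => [|j r IH].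
  by apply: regular_ext (regular_cst 0) => g; rewrite big_nil.
by apply: regular_ext (regular_add (hF j) IH) => g; rewrite big_cons.
Qed.

Lemma regular_prod (J : Type) (r : seq J) (F : J -> SL2 -> A) :
  (forall j, regular_on_SL2 (F j)) ->
  regular_on_SL2 (fun g => \prod_(j <- r) F j g).
Proof.
move=> hF; elim: r => [|j r IH].
  by apply: regular_ext (regular_cst 1) => g; rewrite big_nil.
by apply: regular_ext (regular_mul (hF j) IH) => g; rewrite big_cons.
Qed.

Lemma regular_exp u n : regular_on_SL2 u -> regular_on_SL2 (fun g => u g ^+ n).
Proof.
move=> hu; elim: n => [|n IH].
  by apply: regular_ext (regular_cst 1) => g; rewrite expr0.
by apply: regular_ext (regular_mul hu IH) => g; rewrite exprS.
Qed.

Lemma regular_entry i j : regular_on_SL2 (fun g : SL2 => (g i j)%:A : A).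
Proof. by exists 'X_(mxvec_index i j) => g; rewrite mevalXU mxvecE. Qed.
End Regular.


Definition lin_poly (c d : k) : {poly k} := c%:P + d *: 'X.

(* The matrix of g on the irreducible module of dimension n+1 (binary forms of
   degree n), in the coordinates X_i = u^(n-i) v^i / i! where (u, v) are the
   coordinates of the standard module: X_i (g w) = \sum_j sym_mx g i j X_j w,
   with X_i (g w) = (g00 u + g01 v)^(n-i) (g10 u + g11 v)^i / i!.
   With this normalisation the invariant form for n = 2 is 2 X_0 X_2 - X_1^2
   (lemma [module_quadric]). *)
Definition sym_mx n (g : 'M[k]_2) : 'M[k]_n.+1 :=
  \matrix_(i, j) (j`!%:R / i`!%:R *
    (lin_poly (g 0 0) (g 0 1) ^+ (n - i) * lin_poly (g 1 0) (g 1 1) ^+ i)`_j).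

Definition bin_form n (P a b : {poly k}) : {poly k} :=
  \sum_(j < n.+1) P`_j *: (a ^+ (n - j) * b ^+ j).

Lemma coef_lin_mul (c d : k) (P : {poly k}) j :
  (lin_poly c d * P)`_j = c * P`_j + (if j is j'.+1 then d * P`_j' else 0).
Proof.
rewrite mulrDl coefD coefCM -scalerAl coefZ coefXM.
by case: j => //=; rewrite mulr0.
Qed.

Lemma bin_form_lin n (P a b : {poly k}) (c d : k) : (size P <= n.+1)%N ->
  bin_form n.+1 (lin_poly c d * P) a b = (c *: a + d *: b) * bin_form n P a b.
Proof.
move=> szP; rewrite /bin_form.
under eq_bigr do rewrite coef_lin_mul scalerDl.
rewrite big_split /= mulrDl; congr (_ + _).
  rewrite big_ord_recr /= (nth_default 0 szP) mulr0 scale0r addr0 mulr_sumr.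
  apply: eq_bigr => j _; rewrite subSn -1?ltnS // exprS.
  by rewrite -mulrA -scalerAl -scalerAr scalerA.
rewrite big_ord_recl /= scale0r add0r mulr_sumr.
apply: eq_bigr => j _; rewrite /bump add1n subSS exprS -scalerAr -scalerAl scalerA.
by rewrite [d * _]mulrC; congr (_ *: _); ring.
Qed.

Lemma size_lin_mul (c d : k) n (P : {poly k}) :
  (size P <= n.+1)%N -> (size (lin_poly c d * P)%R <= n.+2)%N.
Proof.
move=> szP; apply/leq_sizeP => j lt_nj.
rewrite coef_lin_mul (leq_sizeP _ _ szP) ?(leq_trans _ lt_nj) // mulr0 add0r.
case: j lt_nj => //= j lt_nj.
by rewrite (leq_sizeP _ _ szP) ?mulr0.
Qed.

Lemma bin_form_exp m n (c d : k) (P a b : {poly k}) : (size P <= n.+1)%N ->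
  (size (lin_poly c d ^+ m * P)%R <= (m + n).+1)%N /\
  bin_form (m + n) (lin_poly c d ^+ m * P) a b =
    (c *: a + d *: b) ^+ m * bin_form n P a b.
Proof.
move=> szP; elim: m => [|m [szm IH]]; first by rewrite add0n !expr0 !mul1r.
rewrite exprS -mulrA addSn; split; first exact: size_lin_mul.
by rewrite bin_form_lin // IH exprS mulrA.
Qed.

Lemma bin_form_row n i (c d c' d' : k) (a b : {poly k}) : (i <= n)%N ->
  bin_form n (lin_poly c d ^+ (n - i) * lin_poly c' d' ^+ i) a b =
  (c *: a + d *: b) ^+ (n - i) * (c' *: a + d' *: b) ^+ i.
Proof.
move=> le_in.
have [//|sz1 E1] := @bin_form_exp i 0 c' d' 1 a b; first by rewrite size_poly1.
rewrite addn0 mulr1 in sz1 E1.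
have [_] := @bin_form_exp (n - i) i c d (lin_poly c' d' ^+ i) a b sz1.
rewrite subnK // => ->; rewrite E1 /bin_form big_ord1 coef1 scale1r.
by rewrite subnn !expr0 !mulr1.
Qed.

Lemma sym_mx1 n : (forall m, m`!%:R != 0 :> k) -> sym_mx n 1 = 1.
Proof.
move=> fact_neq0; apply/matrixP => i j; rewrite !mxE !eqxx /=.
have -> : lin_poly 1 0 = 1 by rewrite /lin_poly scale0r addr0.
have -> : lin_poly 0 1 = 'X by rewrite /lin_poly scale1r add0r.
rewrite expr1n mul1r coefXn [_ == _ :> nat]eq_sym.
rewrite -[_ == _ :> nat]/(i == j); have [->|_] := eqVneq i j.
  by rewrite mulr1 divff.
by rewrite mulr0.
Qed.

Hypothesis char0 : [pchar k] =i pred0.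

Lemma fact_neq0 m : m`!%:R != 0 :> k.
Proof. by rewrite (pcharf0P k).1 // -lt0n fact_gt0. Qed.

Lemma sym_mxM n g h : sym_mx n (g *m h) = sym_mx n g *m sym_mx n h.
Proof.
apply/matrixP => i l; rewrite !mxE.
pose a := lin_poly (h 0 0) (h 0 1); pose b := lin_poly (h 1 0) (h 1 1).
have linE r : lin_poly (\sum_j g r j * h j 0) (\sum_j g r j * h j 1) =
              g r 0 *: a + g r 1 *: b.
  rewrite !big_ord_recl !big_ord0 !addr0 /a /b /lin_poly.
  rewrite (_ : lift ord0 ord0 = 1); last exact: val_inj.
  by rewrite -!mul_polyC !polyCD !polyCM; ring.
rewrite !linE -bin_form_row -1?ltnS // coef_sum mulr_sumr.
apply: eq_bigr => j _; rewrite !mxE coefZ -/a -/b.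
have := fact_neq0 j; have := fact_neq0 i.
move: (_`_j) (_`_l) => u v i0 j0.
by field; apply/andP; split.
Qed.

Definition module_tuple n (g : 'M[k]_2) : n.+1.-tuple {mpoly k[n.+1]} :=
  [tuple \sum_j sym_mx n g i j *: 'X_j | i < n.+1].

Definition module_pullback n (g : SL2) : {mpoly k[n.+1]} -> {mpoly k[n.+1]} :=
  comp_mpoly (module_tuple n g).
HB.instance Definition _ n g := GRing.LRMorphism.on (@module_pullback n g).

Lemma module_pullbackX n g i :
  module_pullback g 'X_i = \sum_j sym_mx n g i j *: 'X_j.
Proof. by rewrite /module_pullback comp_mpolyXU -tnth_nth tnth_mktuple. Qed.

Lemma mpoly_hom_eq n (B : comAlgType k) (f h : {lrmorphism {mpoly k[n]} -> B}) :
  (forall i, f 'X_i = h 'X_i) -> f =1 h.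
Proof.
move=> eq_fh; elim/mpolyind => [|c m p _ _ IH]; first by rewrite !rmorph0.
rewrite !linearP /= IH; congr (_ *: _ + _).
rewrite mpolyXE_id !rmorph_prod; apply: eq_bigr => i _.
by rewrite !rmorphXn /= eq_fh.
Qed.

Fact module_pullback1 n (f : {mpoly k[n.+1]}) : module_pullback 1%g f = f.
Proof.
apply: (@mpoly_hom_eq _ _ (module_pullback 1%g) idfun) => i /=.
rewrite module_pullbackX sym_mx1; last exact: fact_neq0.
rewrite (bigD1 i) //= !mxE eqxx scale1r big1 ?addr0 // => j /negPf ne_ji.
by rewrite !mxE eq_sym ne_ji scale0r.
Qed.

Fact module_pullbackM n g h (f : {mpoly k[n.+1]}) :
  module_pullback (g * h)%g f = module_pullback h (module_pullback g f).
Proof.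
apply: (@mpoly_hom_eq _ _ (module_pullback (g * h)%g)
          (module_pullback h \o module_pullback g)) => i /=.
rewrite !module_pullbackX [SL2val _]/= sym_mxM linear_sum /=.
under [RHS]eq_bigr do rewrite linearZ /= module_pullbackX scaler_sumr.
rewrite exchange_big /=; apply: eq_bigr => l _.
by rewrite mxE scaler_suml; apply: eq_bigr => j _; rewrite scalerA.
Qed.

Lemma regular_coef_exp (A : comAlgType k) (c d : SL2 -> k) m j :
  regular_on_SL2 (fun g => (c g)%:A : A) ->
  regular_on_SL2 (fun g => (d g)%:A : A) ->
  regular_on_SL2 (fun g => ((lin_poly (c g) (d g) ^+ m)`_j)%:A : A).
Proof.
move=> hc hd; elim: m j => [|m IH] j.
  apply: regular_ext (regular_cst (((1 : {poly k})`_j)%:A : A)) => g.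
  by rewrite expr0.
pose F g : A := (c g)%:A * ((lin_poly (c g) (d g) ^+ m)`_j)%:A +
  (d g)%:A * (if j is j'.+1 then ((lin_poly (c g) (d g) ^+ m)`_j')%:A else 0).
apply: (@regular_ext _ F) => [g|].
  rewrite /F exprS coef_lin_mul scalerDl -!scalerAl !mul1r scalerA.
  by case: j {F} => [|j] /=; rewrite ?scaler0 ?scale0r // scalerA.
apply: regular_add; first exact: regular_mul.
by apply: regular_mul => //; case: j {F} => [|j]; [apply: regular_cst|].
Qed.

Lemma regular_sym_mx (A : comAlgType k) n i j :
  regular_on_SL2 (fun g : SL2 => (sym_mx n g i j)%:A : A).
Proof.
pose c : A := (j`!%:R / i`!%:R : k)%:A.
apply: (@regular_ext _ (fun g : SL2 => c * \sum_(r < j.+1)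
    ((lin_poly (g 0 0) (g 0 1) ^+ (n - i))`_r)%:A *
    ((lin_poly (g 1 0) (g 1 1) ^+ i)`_(j - r))%:A)) => [g|].
  rewrite mxE coefM -[RHS]/(in_alg A _) rmorphM rmorph_sum; congr (_ * _).
  by apply: eq_bigr => r _; rewrite rmorphM.
apply: regular_mul; first exact: regular_cst.
apply: regular_sum => r; apply: regular_mul; apply: regular_coef_exp;
  exact: regular_entry.
Qed.

Lemma regular_mpoly_hom n (A : comAlgType k)
    (u : SL2 -> {lrmorphism {mpoly k[n]} -> A}) :
  (forall i, regular_on_SL2 (fun g => u g 'X_i)) ->
  forall f, regular_on_SL2 (fun g => u g f).
Proof.
move=> hu; elim/mpolyind => [|c m p _ _ IH].
  by apply: regular_ext (regular_cst 0) => g; rewrite rmorph0.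
apply: (@regular_ext _ (fun g => c%:A * \prod_i (u g 'X_i) ^+ m i + u g p)).
  move=> g; rewrite linearP mulr_algl mpolyXE_id rmorph_prod /=.
  by congr (_ *: _ + _); apply: eq_bigr => i _; rewrite rmorphXn.
apply: regular_add => //; apply: regular_mul; first exact: regular_cst.
by apply: regular_prod => i; apply: regular_exp.
Qed.

Fact module_regular n (f : {mpoly k[n.+1]}) :
  regular_on_SL2 (fun g => module_pullback g f).
Proof.
apply: (@regular_mpoly_hom _ _ (fun g => module_pullback g)) => i.
apply: (@regular_ext _ (fun g : SL2 => \sum_j (sym_mx n g i j)%:A * 'X_j)).
  by move=> g /=; rewrite module_pullbackX; apply: eq_bigr => j _; rewrite mulr_algl.
apply: regular_sum => j; apply: regular_mul; last exact: regular_cst.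
exact: regular_sym_mx.
Qed.

Definition diag_SL2_mx : 'M[k]_2 := \matrix_(i, j)
  if i == j then (if i == 0 then 2 else 2^-1) else 0.
Definition unip_SL2_mx (b c : k) : 'M[k]_2 := \matrix_(i, j)
  if i == j then 1 else (if i == 0 then b else c).

Lemma det2E (M : 'M[k]_2) : \det M = M 0 0 * M 1 1 - M 0 1 * M 1 0.
Proof.
rewrite (expand_det_row _ 0) !big_ord_recl big_ord0 addr0.
rewrite /cofactor !det_mx11 !mxE /= expr0 expr1 mul1r mulN1r mulrN.
by congr (M _ _ * M _ _ - M _ _ * M _ _); apply: val_inj.
Qed.

Lemma natr_inj_char0 : injective (fun m : nat => m%:R : k).
Proof.
have neq m p : (m < p)%N -> m%:R <> p%:R :> k.
  move=> lt_mp /esym/eqP; rewrite -subr_eq0 -natrB 1?ltnW //.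
  by rewrite (pcharf0P k).1 // subn_eq0 leqNgt lt_mp.
by move=> m p /= e; case: (ltngtP m p) => // /neq; rewrite e.
Qed.

Lemma coef_1DX m i : (i <= m)%N -> ((1%:P + 'X : {poly k}) ^+ m)`_i != 0.
Proof.
move=> le_im; rewrite addrC exprD1n coef_sum.
rewrite (bigD1 (Ordinal (le_im : (i < m.+1)%N))) //= coefMn coefXn eqxx.
rewrite big1 ?addr0 => [|j /negPf ne_ji].
  by rewrite (pcharf0P k).1 // -lt0n bin_gt0.
by rewrite coefMn coefXn eq_sym; have := ne_ji; rewrite -val_eqE /= => ->; rewrite mul0rn.
Qed.

Lemma sym_mx_irreducible n (U : {vspace 'cV[k]_n.+1}) :
  (forall (g : SL2) v, v \in U -> sym_mx n g *m v \in U) ->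
  U = 0%VS \/ U = fullv.
Proof.
move=> stableU.
have two0 : 2%:R != 0 :> k by have := fact_neq0 2.
have stab (M : 'M[k]_2) v : \det M == 1 -> v \in U -> sym_mx n M *m v \in U.
  by move=> detM; apply: (stableU (MkSL2 detM)).
have [->|U_neq0] := eqVneq U 0%VS; [by left | right].
have key v i : v \in U -> v i 0 != 0 -> delta_mx i 0 \in U.
  move=> vU vi_neq0.
  pose lam (l : 'I_n.+1) : k := 2 ^+ n / 4%:R ^+ l.
  have lam_inj : injective lam.
    move=> l m /(mulfI (expf_neq0 n two0))/invr_inj.
    rewrite -!natrX => /natr_inj_char0/eqP.
    by rewrite eqn_exp2l // => /eqP/val_inj.
  have TE (w : 'cV_n.+1) l : (sym_mx n diag_SL2_mx *m w) l 0 = lam l * w l 0.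
    have four : 4%:R ^+ l = 2 ^+ l * 2 ^+ l :> k by rewrite -exprMn -natrM.
    have symE j : sym_mx n diag_SL2_mx l j = lam l *+ (l == j).
      rewrite !mxE /= /lin_poly scale0r addr0 add0r.
      rewrite -rmorphXn exprZn -scalerAr coefZ coefCM coefXn.
      rewrite eq_sym -[_ == _ :> nat]/(l == j).
      have [<-|_] := eqVneq l j; last by rewrite !mulr0.
      rewrite divff ?fact_neq0 // mul1r mulr1 /lam.
      rewrite -[X in _ ^+ X / _](subnK (ltn_ord l : (l <= n)%N)) exprD.
      rewrite four exprVn.
      have : (2%:R : k) ^+ l != 0 by rewrite expf_neq0.
      rewrite mulr1n; move: (_ ^+ l) (_ ^+ (n - l)) => x y x0.
      by field.
    rewrite mxE (bigD1 l) //= symE eqxx big1 ?addr0 // => j /negPf ne.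
    by rewrite symE eq_sym ne mul0r.
  have wU s : exists2 w, w \in U &
      forall l, w l 0 = v l 0 * \prod_(j <- s) (lam l - lam j).
    elim: s => [|j s [w wU wE]].
      by exists v => // l; rewrite big_nil mulr1.
    exists (sym_mx n diag_SL2_mx *m w - lam j *: w).
      rewrite memvB ?memvZ ?stab // det2E !mxE /=.
      by rewrite mulfV // mul0r subr0.
    by move=> l; rewrite mxE TE !mxE wE big_cons; ring.
  have [w {}wU wE] := wU (enum (predC1 i)).
  have c_neq0 : w i 0 != 0.
    rewrite wE mulf_neq0 // prodf_seq_neq0; apply/allP => j.
    by rewrite mem_enum /= subr_eq0 (inj_eq lam_inj) eq_sym.
  suff -> : delta_mx i 0 = (w i 0)^-1 *: w by rewrite memvZ.
  apply/colP => l; rewrite !mxE eqxx andbT.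
  have [->|ne_li] := eqVneq l i; first by rewrite mulVf.
  rewrite [w l 0]wE (big_rem l) ?mem_enum //= subrr mul0r mulr0.
  by rewrite mulr0.
have mulE M j l : (sym_mx n M *m delta_mx j (0 : 'I_1)) l 0 = sym_mx n M l j.
  by rewrite -colE mxE.
have [i eiU] : exists i, delta_mx i 0 \in U.
  have vU := memv_pick U; have v_neq0 : vpick U != 0 by rewrite vpick0.
  have [i vi_neq0] : exists i, vpick U i 0 != 0.
    apply/existsP; apply: contraNT v_neq0 => /existsPn v0.
    by apply/eqP/colP => i; rewrite [RHS]mxE; apply/eqP/negbNE/v0.
  by exists i; apply: key vi_neq0.
have e0U : delta_mx 0 0 \in U.
  apply: (key (sym_mx n (unip_SL2_mx 1 0) *m delta_mx i 0)).
    by rewrite stab // det2E !mxE /= mulr1 mulr0 subr0.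
  rewrite mulE !mxE /= /lin_poly scale1r subn0 expr0 mulr1.
  by rewrite !mulf_neq0 ?invr_eq0 ?fact_neq0 // coef_1DX // -ltnS.
have eU j : delta_mx j 0 \in U.
  apply: (key (sym_mx n (unip_SL2_mx 0 1) *m delta_mx 0 0)).
    by rewrite stab // det2E !mxE /= mulr1 mul0r subr0.
  rewrite mulE !mxE /= /lin_poly scale1r scale0r addr0 expr1n mul1r.
  by rewrite !mulf_neq0 ?invr_eq0 ?fact_neq0 // coef_1DX.
apply/vspaceP => v; rewrite memvf [v]matrix_sum_delta.
by apply: rpred_sum => l _; rewrite big_ord1 memvZ.
Qed.

(* Affine (n+1)-space with the action of the irreducible module of dimension
   n+1; irreducibility is [sym_mx_irreducible]. *)
Definition irreducible_module n : SL2_action {mpoly k[n.+1]} :=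
  MkSL2Action (@module_pullback1 n) (@module_pullbackM n) (@module_regular n).

Lemma coef_lin2 (a b c d : k) :
  [/\ (lin_poly a b * lin_poly c d)`_0 = a * c,
      (lin_poly a b * lin_poly c d)`_1 = a * d + b * c &
      (lin_poly a b * lin_poly c d)`_2 = b * d].
Proof.
have E j : (lin_poly c d)`_j = if j is j'.+1 then if j' is 0 then d else 0 else c.
  rewrite -[lin_poly c d]mulr1 coef_lin_mul !coef1.
  by case: j => [|[|j]]; rewrite ?coef1 ?mulr1 ?mulr0 ?addr0 ?add0r.
by split; rewrite coef_lin_mul !E ?addr0 ?mulr0 ?add0r.
Qed.

Lemma module2_pullbackX (g : SL2) :
  let a := g 0 0 in let b := g 0 1 in let c := g 1 0 in let d := g 1 1 in
  let u := @module_pullback 2 g in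
  [/\ u 'X_0 =
        (a ^+ 2) *: 'X_0 + (2 * a * b) *: 'X_1 + (2 * b ^+ 2) *: 'X_2,
      u 'X_1 =
        (a * c) *: 'X_0 + (a * d + b * c) *: 'X_1 + (2 * b * d) *: 'X_2 &
      u 'X_2 =
        (c ^+ 2 / 2) *: 'X_0 + (c * d) *: 'X_1 + (d ^+ 2) *: 'X_2].
Proof.
move=> a b c d u; rewrite {}/u.
have two0 : 2%:R != 0 :> k by have := fact_neq0 2.
have e1 : lift ord0 ord0 = 1 :> 'I_3 by apply: val_inj.
have e2 : lift ord0 (lift ord0 ord0) = 2%:R :> 'I_3 by apply: val_inj.
have E (i j : 'I_3) (p q : nat) : i = p :> nat -> j = q :> nat ->
    sym_mx 2 g i j = q`!%:R / p`!%:R * (lin_poly a b ^+ (2 - p) * lin_poly c d ^+ p)`_q.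
  by move=> <- <-; rewrite mxE.
have [f0 f1 f2] : [/\ 0`! = 1, 1`! = 1 & 2`! = 2]%N by [].
split; rewrite module_pullbackX !big_ord_recl big_ord0 addr0 e2 e1 addrA.
- rewrite (E _ _ 0 0) // (E _ _ 0 1) // (E _ _ 0 2) // f0 f1 f2 subn0.
  have [] := coef_lin2 a b a b; rewrite !(expr0, mulr1) -expr2 => -> -> ->.
  by congr (_ *: _ + _ *: _ + _ *: _); field; rewrite ?oner_neq0.
- rewrite (E _ _ 1 0) // (E _ _ 1 1) // (E _ _ 1 2) // f0 f1 f2.
  have [] := coef_lin2 a b c d; rewrite (_ : 2 - 1 = 1)%N // !expr1 => -> -> ->.
  by congr (_ *: _ + _ *: _ + _ *: _); field; rewrite ?oner_neq0.
- rewrite (E _ _ 2 0) // (E _ _ 2 1) // (E _ _ 2 2) // f0 f1 f2 subnn.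
  have [] := coef_lin2 c d c d; rewrite !(expr0, mul1r) -expr2 => -> -> ->.
  by congr (_ *: _ + _ *: _ + _ *: _); field; rewrite ?oner_neq0.
Qed.

Fact module_quadric (g : SL2) : module_pullback g (quadric k) = quadric k.
Proof.
have two0 : 2%:R != 0 :> k by have := fact_neq0 2.
have : g 0 0 * g 1 1 - g 0 1 * g 1 0 = 1.
  by rewrite -det2E det_SL2.
rewrite quadric_subst /=; have /= [-> -> ->] := module2_pullbackX g.
move: (g 0 0) (g 0 1) (g 1 0) (g 1 1) => a b c d det1.
have {}det1 : a%:MP * d%:MP - b%:MP * c%:MP = 1 :> {mpoly k[3]}.
  by rewrite -!mpolyCM -mpolyCB det1.
have half : 2 * (2^-1)%:MP = 1 :> {mpoly k[3]}.
  by rewrite -(rmorph_nat (@mpolyC 3 k)) -mpolyCM divff.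
rewrite /quadric -!mul_mpolyC !(expr2, mpolyCD, mpolyCM).
rewrite !mpolyC1.
move: det1 half; move: (a%:MP) (b%:MP) (c%:MP) (d%:MP) (_^-1)%:MP.
move: 'X_0 'X_1 'X_2 => x0 x1 x2 {two0}a {}b {}c {}d t det1 half.
transitivity ((a * d - b * c) ^+ 2 * (2 * (x0 * x2) - x1 ^+ 2)
  + (2 * t - 1) * (c ^+ 2 * x0 * (a ^+ 2 * x0 + 2 * a * b * x1 + 2 * b ^+ 2 * x2))).
  by ring.
by rewrite det1 half subrr mul0r addr0 expr1n mul1r.
Qed.

Definition Y_pullback (g : SL2) : Dring k -> Dring k :=
  descend (module_quadric g).
HB.instance Definition _ g := GRing.LRMorphism.on (Y_pullback g).

Lemma Y_pullbackE g p : Y_pullback g (piD p) = piD (module_pullback g p).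
Proof. by rewrite /Y_pullback descendE. Qed.

Fact Y_pullback1 x : Y_pullback 1%g x = x.
Proof.
by have [p ->] := piD_onto x; rewrite Y_pullbackE module_pullback1.
Qed.

Fact Y_pullbackM g h x : Y_pullback (g * h)%g x = Y_pullback h (Y_pullback g x).
Proof.
by have [p ->] := piD_onto x; rewrite !Y_pullbackE module_pullbackM.
Qed.

Lemma regular_lin (A B : comAlgType k) (f : {linear A -> B}) (u : SL2 -> A) :
  regular_on_SL2 u -> regular_on_SL2 (fun g => f (u g)).
Proof.
move=> [P hP]; exists (\sum_(m <- msupp P) f P@_m *: 'X_[m]) => g.
rewrite hP mevalE !raddf_sum; apply: eq_bigr => m _ /=.
rewrite mevalZ mevalX.
have E (C : comAlgType k) : \prod_i ((mxvec g 0 i)%:A ^+ m i : C) =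
    (\prod_i mxvec g 0 i ^+ m i)%:A.
  rewrite -[RHS]/(in_alg C _) rmorph_prod.
  by apply: eq_bigr => i _; rewrite rmorphXn.
by rewrite !E !mulr_algr linearZ.
Qed.

Fact Y_regular x : regular_on_SL2 (fun g => Y_pullback g x).
Proof.
have [p ->] := piD_onto x.
apply: regular_ext (regular_lin (@piD k) (module_regular p)) => g.
by rewrite Y_pullbackE.
Qed.

Definition Y_action : SL2_action (Dring k) :=
  MkSL2Action Y_pullback1 Y_pullbackM Y_regular.

Lemma Y_pullback_mu g x : mu (Y_pullback g x) = Y_pullback g (mu x).
Proof.
apply: (@dring_ind _ _ (@mu k \o Y_pullback g) (Y_pullback g \o @mu k)) => i /=.
rewrite muX rmorphN /= Y_pullbackE module_pullbackX linear_sum /= linear_sum -sumrN.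
by apply: eq_bigr => j _; rewrite !linearZ /= muX scalerN.
Qed.

Fact X_pullback_subproof g (x : Rring k) : Y_pullback g x \in @mu_fixed k.
Proof.
have /eqP mux : Rval x \in @mu_fixed k := valP x.
by rewrite unfold_in /mu_fixed Y_pullback_mu mux.
Qed.

Definition X_pullback g (x : Rring k) : Rring k :=
  MkRring (X_pullback_subproof g x).

Fact X_pullback_zmod g : zmod_morphism (X_pullback g).
Proof. by move=> x y; apply: val_inj; rewrite /= rmorphB. Qed.
Fact X_pullback_monoid g : monoid_morphism (X_pullback g).
Proof. by split=> [|x y]; apply: val_inj; rewrite /= ?rmorph1 ?rmorphM. Qed.
Fact X_pullback_scale g : scalable (X_pullback g).
Proof. by move=> c x; apply: val_inj; rewrite /= linearZ. Qed.
HB.instance Definition _ g := GRing.isZmodMorphism.Build (Rring k) (Rring k)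
  (X_pullback g) (X_pullback_zmod g).
HB.instance Definition _ g := GRing.isMonoidMorphism.Build (Rring k) (Rring k)
  (X_pullback g) (X_pullback_monoid g).
HB.instance Definition _ g := GRing.isScalable.Build k (Rring k) (Rring k) *:%R
  (X_pullback g) (X_pullback_scale g).

Fact X_pullback1 x : X_pullback 1%g x = x.
Proof. by apply: val_inj; rewrite /= Y_pullback1. Qed.

Fact X_pullbackM g h x : X_pullback (g * h)%g x = X_pullback h (X_pullback g x).
Proof. by apply: val_inj; rewrite /= Y_pullbackM. Qed.

Fact reynolds_subproof (x : Dring k) : (2^-1 : k) *: (x + mu x) \in @mu_fixed k.
Proof. by rewrite unfold_in /mu_fixed linearZ linearD /= muK addrC. Qed.

Definition reynolds (x : Dring k) : Rring k := MkRring (reynolds_subproof x).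

Fact reynolds_linear : linear reynolds.
Proof.
move=> c x y; apply: val_inj => /=.
by rewrite !linearP /= scalerA mulrC -scalerA -scalerDr !scalerDr addrACA.
Qed.
HB.instance Definition _ :=
  GRing.isLinear.Build k (Dring k) (Rring k) *:%R reynolds reynolds_linear.

Lemma reynoldsK x : reynolds (Rval x) = x.
Proof.
apply: val_inj => /=; have /eqP -> : Rval x \in @mu_fixed k := valP x.
rewrite -mulr2n -scaler_nat scalerA mulVf ?scale1r //.
by have := fact_neq0 2.
Qed.

Fact X_regular x : regular_on_SL2 (fun g => X_pullback g x).
Proof.
apply: regular_ext (regular_lin reynolds (Y_regular (Rval x))) => g.
by rewrite -[LHS]/(reynolds (Rval (X_pullback g x))) reynoldsK.
Qed.

Definition X_action : SL2_action (Rring k) :=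
  MkSL2Action X_pullback1 X_pullbackM X_regular.

End SL2.

Section Varieties.
Variable k : closedFieldType.

(* f is the comorphism of a morphism Spec A -> Spec B *)
Definition closed_embedding (A B : comAlgType k) (f : {lrmorphism B -> A}) :=
  forall a, exists b, f b = a.

Definition equivariant (A B : comAlgType k) (rA : SL2_action A)
    (rB : SL2_action B) (f : {lrmorphism B -> A}) :=
  forall (g : SL2 k) (b : B), f (rB g b) = rA g (f b).

(* Spec A x A^1 = Spec A[t], with k acting on A[t] through A *)
Definition cylinder (A : comAlgType k) : Type := {poly A}.
Section Cyl.
Variable A : comAlgType k.
HB.instance Definition _ := GRing.ComNzRing.on (cylinder A).
Definition cyl_scale (c : k) (p : {poly A}) : {poly A} := c%:A *: p.
Fact cyl_scaleA a b p : cyl_scale a (cyl_scale b p) = cyl_scale (a * b) p.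
Proof. by rewrite /cyl_scale scalerA -scalerAl mul1r scalerA. Qed.
Fact cyl_scale1 : left_id 1 cyl_scale.
Proof. by move=> p; rewrite /cyl_scale !scale1r. Qed.
Fact cyl_scaleDr : right_distributive cyl_scale +%R.
Proof. by move=> c p q; rewrite /cyl_scale scalerDr. Qed.
Fact cyl_scaleDl p : {morph cyl_scale^~ p : a b / a + b}.
Proof. by move=> a b; rewrite /cyl_scale !scalerDl. Qed.
HB.instance Definition _ := GRing.Zmodule_isLmodule.Build k (cylinder A)
  cyl_scaleA cyl_scale1 cyl_scaleDr cyl_scaleDl.
Fact cyl_scaleAl (c : k) (p q : cylinder A) : c *: (p * q) = c *: p * q.
Proof. exact: (@scalerAl A {poly A}). Qed.
HB.instance Definition _ :=
  GRing.Lmodule_isLalgebra.Build k (cylinder A) cyl_scaleAl.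
HB.instance Definition _ := GRing.Lalgebra_isComAlgebra.Build k (cylinder A).
End Cyl.

Definition isomorphic (A B : comAlgType k) :=
  exists f : {lrmorphism A -> B}, bijective f.
End Varieties.

(* Main.v *)
(* The products x_i x_j span, modulo the equation of Y, a copy of the irreducible module V(4), and they
   generate the even functions; this gives (a).  Four suitable even functions already generate, which
   gives (b).

   (d): If X were the surface f = 0 in 3-space, the brackets of the coordinates for the invariant Poisson
   structure of Y, which is odd under mu, would be an odd multiple of the gradient of f.  An odd function
   on Y has a zero, where all these brackets would vanish, although the coordinates generate the even
   functions.  (e) is the same argument one dimension higher, with the Jacobian of Y x A^1 in place of
   the Poisson bracket.

   (c): The action gives locally nilpotent derivations E, F of B = k[x1..x4], whose invariants form
   a polynomial ring k[tau] with tau vanishing on X, and there is a vector field xi commuting with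
   the action such that xi tau = tau.  The matrix x x^T on X extends to a covariant symmetric matrix C
   of trace 1 over B.  Restricted to X, a covariant vector vanishes, because its lift to Y is a multiple
   of x, which is odd.  Primitivity then excludes covariant vectors over B altogether, so C commutes with
   xi C; hence the trace-free part of C satisfies a first order linear equation along xi, which forces
   the characteristic cubic of C to have a root in k[tau].  An eigenvector for it is covariant. *)
Require Import Defs.
From HB Require Import structures.
From mathcomp Require Import all_boot all_order all_algebra all_fingroup mpoly.
From mathcomp Require Import boolp ring zify.

Set Implicit Arguments.
Unset Strict Implicit.
Unset Printing Implicit Defensive.

Import GRing.Theory.
Local Open Scope ring_scope.

(** The action on 4-space in (c) is arbitrary and need not be linear, so no representation is at
    hand: everything is extracted from the derivations E, F and H = [E, F]. Local nilpotency makes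
    the functions and the vector fields on 4-space sl_2-modules in which highest weight vectors lift
    along equivariant maps; C comes from lifting x0^2, and xi from lifting the constant divergence
    1. Covariant vectors are excluded by descent: on X the matrix C is the projector x x^T, so C^2
    sends a covariant vector to one divisible by tau, the determinant of three covariant vectors is
    divisible by every power of tau, and all covariant vectors are parallel to one eigenvector p of
    C; a norm form over k[tau] then yields another one orthogonal to p. The cubic has a root
    because, with s^2 = tau, xi is (s/2) d/ds, which vanishes only at s = 0: the linear equation
    forces the multiplicities of the nonzero roots of the discriminant and of Cardano's radicand to
    be multiples of 2 and of 3, so both radicals lie in k[s]. *)

Section Divisibility.
Variable R : idomainType.
Implicit Types a b d e x : R.

Definition dvr (a b : R) : Prop := exists c, b = c * a.

Lemma dvr0 a : dvr a 0. Proof. by exists 0; rewrite mul0r. Qed.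
Lemma dvrr a : dvr a a. Proof. by exists 1; rewrite mul1r. Qed.
Lemma dvr_mull a b c : dvr a b -> dvr a (c * b).
Proof. by case=> d ->; exists (c * d); rewrite mulrA. Qed.
Lemma dvr_mulr a b c : dvr a b -> dvr a (b * c).
Proof. by rewrite mulrC; apply: dvr_mull. Qed.
Lemma dvrD a b c : dvr a b -> dvr a c -> dvr a (b + c).
Proof. by case=> d -> [e ->]; exists (d + e); rewrite mulrDl. Qed.
Lemma dvrN a b : dvr a b -> dvr a (- b).
Proof. by case=> d ->; exists (- d); rewrite mulNr. Qed.
Lemma dvrB a b c : dvr a b -> dvr a c -> dvr a (b - c).
Proof. by move=> ab ac; apply/dvrD/dvrN. Qed.
Lemma dvr_sum a (I : Type) (r : seq I) (P : pred I) (F : I -> R) :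
  (forall i, P i -> dvr a (F i)) -> dvr a (\sum_(i <- r | P i) F i).
Proof. by move=> aF; elim/big_ind: _ => //; [apply: dvr0 | apply: dvrD]. Qed.
Lemma dvr_cancel a b d : d != 0 -> dvr (a * d) (b * d) -> dvr a b.
Proof. by move=> d0 [c /eqP]; rewrite mulrA (inj_eq (mulIf d0)) => /eqP ->; exists c. Qed.

(* The scaling by x makes the gcd compatible with products. *)
Definition gcd_domain := forall a b, exists d, [/\ dvr d a, dvr d b &
  forall x e, dvr e (x * a) -> dvr e (x * b) -> dvr e (x * d)].

(** For [x = 1] this says that the common divisors of the family are units; the factor [x] allows
    the property to be applied to multiples. *)
Definition primitive (I : Type) (u : I -> R) :=
  forall x e, (forall i, dvr e (x * u i)) -> dvr e x.

Lemma primitive_neq0 (I : finType) (u : I -> R) : primitive u -> exists i, u i != 0.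
Proof.
move=> pu; apply/existsP; rewrite -[X in is_true X]negbK negb_exists; apply/negP => /forallP u0.
have [] := pu 1 0; last by move=> c /eqP; rewrite mulr0 oner_eq0.
by move=> i; have /negPn/eqP -> := u0 i; rewrite mulr0; apply: dvrr.
Qed.

(** [u j] divides [v j * u i] for every [i], so by primitivity it divides [v j]; the quotient at one
    index with [u j != 0] serves for all. *)
Lemma parallel_primitive (I : finType) (u v : I -> R) : primitive u ->
  (forall i j, v i * u j = v j * u i) -> exists h, forall i, v i = h * u i.
Proof.
move=> pu par; have [j uj0] := primitive_neq0 pu.
have [|h vj] := pu (v j) (u j).
  by move=> i; rewrite -par; apply/dvr_mull/dvrr.
exists h => i; apply: (mulIf uj0); rewrite par vj; ring.
Qed.

Hypothesis gcdR : gcd_domain.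

Lemma gcd_seq (I : Type) (s : seq I) (v : I -> R) : exists d,
  (forall x e, dvr e (x * d) -> forall i, List.In i s -> dvr e (x * v i)) /\
  (forall x e, (forall i, List.In i s -> dvr e (x * v i)) -> dvr e (x * d)).
Proof.
elim: s => [|i s [d [dv gd]]]; first by exists 0; split=> // x e _; rewrite mulr0; apply: dvr0.
have [d' [d'v d'd gd']] := gcdR (v i) d; exists d'; split=> [x e ed j /= [<-|js]|x e ev].
- by case: d'v => c ->; rewrite mulrCA; apply: dvr_mull.
- by apply: dv => //; case: d'd => c ->; rewrite mulrCA; apply: dvr_mull.
- by apply: gd'; [apply: ev; left | apply: gd => j js; apply: ev; right].
Qed.

Lemma gcd_family (I : finType) (v : I -> R) : exists d,
  (forall i, dvr d (v i)) /\ (forall x e, (forall i, dvr e (x * v i)) -> dvr e (x * d)).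
Proof.
have [d [dv gd]] := gcd_seq (enum I) v.
have InE i : List.In i (enum I).
  have: i \in enum I by rewrite mem_enum.
  elim: (enum I) => //= j s IH; rewrite inE => /orP[/eqP ->|/IH]; by [left | right].
exists d; split=> [i|x e ev]; last by apply: gd.
by rewrite -[v i]mul1r; apply: dv => //; rewrite mul1r; apply: dvrr.
Qed.

Lemma primitive_part (I : finType) (v : I -> R) : (exists i, v i != 0) ->
  exists g u, [/\ g != 0, primitive u & forall i, v i = g * u i].
Proof.
move=> [i0 vi0]; have [g [gv gg]] := gcd_family v.
have [u uP] := choice gv; exists g, u.
have g0 : g != 0 by apply: contraNneq vi0 => g0; rewrite uP g0 mulr0.
split=> // [x e eu|i]; last by rewrite uP mulrC.
apply: (dvr_cancel g0); apply: gg => i; rewrite uP.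
by case: (eu i) => c cE; exists c; rewrite [RHS]mulrA -cE; ring.
Qed.

End Divisibility.

(** * Gauss's lemma and gcds in polynomial rings *)

Section Gauss.
Variable R : idomainType.
Implicit Types (p q : {poly R}) (x e : R).

Lemma dvr_polyC e p : (forall i, dvr e p`_i) -> dvr e%:P p.
Proof.
move=> ep; have [c cP] := choice ep; exists (\poly_(i < size p) c i).
apply/polyP => i; rewrite coefMC coef_poly; case: ltnP => // /(nth_default 0) ->.
by rewrite mul0r.
Qed.

Lemma dvr_coef e p : dvr e%:P p -> forall i, dvr e p`_i.
Proof. by case=> c -> i; rewrite coefMC; apply/dvr_mull/dvrr. Qed.

Definition primitive_poly q := forall x e, dvr e%:P (x%:P * q) -> dvr e x.

(** Induction on the size of [p], splitting off its leading term. Descending induction on [j] shows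
    that [e] divides [x * q]_j *
    p[for every coefficient of]q[; primitivity of]q[then removes]q[_j]. *)
Lemma gauss q p x e : primitive_poly q ->
  dvr e%:P (x%:P * (p * q)) -> dvr e%:P (x%:P * p).
Proof.
move=> pq; have [n] := ubnP (size p); elim: n => // n IH in p x *.
case: (eqVneq p 0) => [-> _ _|p0 sp H]; first by rewrite mulr0; apply: dvr0.
set a := lead_coef p; set m := (size p).-1; pose p' := p - a *: 'X^m.
have sp' : (size p' < n)%N.
  have : (size p' < size p)%N.
    rewrite -(prednK (n := size p)) ?lt0n ?size_poly_eq0 // ltnS.
    apply/leq_sizeP => j lej; rewrite coefB coefZ coefXn.
    case: eqP => [->|nej]; first by rewrite mulr1 subrr.
    rewrite mulr0 subr0 nth_default // -(prednK (n := size p)) ?lt0n ?size_poly_eq0 //.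
    by rewrite ltn_neqAle lej andbT eq_sym; apply/eqP.
  by move/leq_trans; apply; rewrite -ltnS.
have pE : p = p' + a *: 'X^m by rewrite subrK.
(* descending on j, [e] divides [x * q`_j * p] *)
have step j : (forall i, (j < i)%N -> dvr e%:P ((x * q`_i)%:P * p)) ->
    dvr e%:P ((x * q`_j)%:P * p).
  move=> Hj; have top : dvr e (x * q`_j * a).
    (* In the coefficient of degree m + j of p q, every term besides a q_j contains a coefficient of
       p of index above m, which is 0, or one of q of index above j, covered by [Hj]. *)
    have := dvr_coef H (m + j)%N; rewrite coefCM coefM.
    have lemj : (m < (m + j).+1)%N by rewrite ltnS leq_addr.
    rewrite (bigD1 (Ordinal lemj)) //= addKn mulrDr => Ht.
    move: Ht; rewrite -[p`_m]/(lead_coef p) -/a; set u := \sum_(_ < _ | _) _ => Ht.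
    rewrite (_ : x * q`_j * a = x * (a * q`_j) + x * u - x * u); last by ring.
    apply: dvrB => //; rewrite mulr_sumr; apply: dvr_sum => i nim.
    have {}nim : nat_of_ord i != m by rewrite -val_eqE in nim.
    case: (ltnP m i) => lmi.
      rewrite (nth_default 0 (n := i)) ?mul0r ?mulr0; first exact: dvr0.
      by rewrite (leq_trans _ lmi) // /m; case: (size p).
    have lj : (j < m + j - i)%N by rewrite ltn_subRL ltn_add2r ltn_neqAle nim.
    have := dvr_coef (Hj _ lj) i; rewrite coefCM; congr (dvr e _); ring.
  rewrite pE mulrDr; apply: dvrD.
    apply: IH sp' _; rewrite polyCM.
    have -> : x%:P * (q`_j)%:P * (p' * q) = (q`_j)%:P * (x%:P * (p * q)) - (x * q`_j * a)%:P * ('X^m * q).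
      by rewrite pE !polyCM -mul_polyC; ring.
    apply: dvrB; first exact: dvr_mull.
    by case: top => c ->; exists (c%:P * ('X^m * q)); rewrite polyCM; ring.
  rewrite -mul_polyC mulrA -polyCM; case: top => c ->; exists (c%:P * 'X^m).
  by rewrite polyCM; ring.
have all_j k j : (size q <= j + k)%N -> dvr e%:P ((x * q`_j)%:P * p).
  elim: k j => [|k IHk] j lej.
    by rewrite addn0 in lej; rewrite nth_default // mulr0 polyC0 mul0r; apply: dvr0.
  by apply: step => i lji; apply: IHk; rewrite (leq_trans lej) // addnS -addSn leq_add2r.
apply: dvr_polyC => i; apply: pq; apply: dvr_polyC => j.
have := dvr_coef (all_j (size q) j (leq_addl _ _)) i; rewrite !coefCM.
by rewrite mulrAC.
Qed.

Hypothesis gcdR : gcd_domain R.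

Lemma primitive_poly_part p : p != 0 ->
  exists c p0, [/\ c != 0, primitive_poly p0 & p = c%:P * p0].
Proof.
move=> p0; have [|g [u [g0 pu uP]]] := @primitive_part _ gcdR 'I_(size p) (fun i => p`_i).
  have lt_p : ((size p).-1 < size p)%N by rewrite prednK ?lt0n ?size_poly_eq0.
  by exists (Ordinal lt_p); rewrite -[_`__]/(lead_coef p) lead_coef_eq0.
pose v i := if insub i is Some j then u j else 0.
have vP (i : 'I_(size p)) : v i = u i by rewrite /v valK.
exists g, (\poly_(i < size p) v i); split=> // [x e H|].
  by apply: pu => i; have := dvr_coef H i; rewrite coefCM coef_poly ltn_ord vP.
apply/polyP => i; rewrite coefCM coef_poly; case: ltnP => lti; last by rewrite mulr0 nth_default.
by rewrite -[i]/(nat_of_ord (Ordinal lti)) vP uP.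
Qed.

(** Pseudo-division gives [c *: p = r * g] with a constant [c]; since [g] is primitive, Gauss's
    lemma makes [c] divide [r]. *)
Lemma dvdp_primitive g p : primitive_poly g -> g %| p -> dvr g p.
Proof.
move=> pg /Pdiv.Idomain.dvdpP[[c r] /= c0 E].
have : dvr c%:P (1%:P * (r * g)) by rewrite polyC1 mul1r -E -mul_polyC; apply/dvr_mulr/dvrr.
move/(gauss pg); rewrite polyC1 mul1r => -[r' rE]; exists r'.
have cP0 : c%:P != 0 by rewrite polyC_eq0.
by apply: (mulfI cP0); rewrite mul_polyC E rE; ring.
Qed.

Lemma dvr_dvdp p q : dvr p q -> p %| q.
Proof. by case=> c ->; apply: dvdp_mull. Qed.

(** The gcd is the gcd of the contents times the primitive part of the pseudo-gcd [gcdp]. The scaled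
    universal property is checked separately on contents and on primitive parts. *)
Lemma gcd_domain_poly : gcd_domain {poly R}.
Proof.
move=> p q; case: (eqVneq p 0) => [->|p0].
  by exists q; split=> [||x e _]; [apply: dvr0 | apply: dvrr |].
case: (eqVneq q 0) => [->|q0].
  by exists p; split=> [||x e]; [apply: dvrr | apply: dvr0 |].
have [cp [pp [cp0 ppp pE]]] := primitive_poly_part p0.
have [cq [qq [cq0 pqq qE]]] := primitive_poly_part q0.
have pp0 : pp != 0 by apply: contraNneq p0; rewrite pE => ->; rewrite mulr0.
have g0 : gcdp pp qq != 0 by rewrite gcdp_eq0 (negPf pp0).
have [cg [g [cg0 pg gE]]] := primitive_poly_part g0.
have gD : g %| gcdp pp qq by rewrite gE dvdp_mull.
have Dg : gcdp pp qq %| g by rewrite gE mul_polyC dvdpZl.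
have [s [sp sq sg]] := gcdR cp cq.
exists (s%:P * g); split=> [||x e].
- case: sp => c cE; have [r rE] := dvdp_primitive pg (dvdp_trans gD (dvdp_gcdl _ _)).
  by exists (c%:P * r); rewrite pE cE rE polyCM; ring.
- case: sq => c cE; have [r rE] := dvdp_primitive pg (dvdp_trans gD (dvdp_gcdr _ _)).
  by exists (c%:P * r); rewrite qE cE rE polyCM; ring.
case: (eqVneq e 0) => [->|e0].
  case=> c /eqP; rewrite mulr0 mulf_eq0 (negPf p0) orbF => /eqP ->.
  by rewrite !mul0r => _; apply: dvr0.
case: (eqVneq x 0) => [->|x0]; first by rewrite !mul0r => _ _; apply: dvr0.
have [ce [ee [ce0 pee eE]]] := primitive_poly_part e0.
have [cx [xx [cx0 pxx xE]]] := primitive_poly_part x0.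
have content c r : primitive_poly r -> dvr e (x * (c%:P * r)) -> dvr ce (cx * c).
  move=> pr [d dE]; apply: (pxx (cx * c) ce); apply: (gauss pr).
  exists (d * ee); transitivity (x * (c%:P * r)); first by rewrite xE polyCM; ring.
  by rewrite dE eE; ring.
have dvde c r : c != 0 -> dvr e (x * (c%:P * r)) -> ee %| xx * r.
  move=> c0 [d dE]; have : ee %| (cx * c) *: (xx * r).
    apply: dvr_dvdp; exists (d * ce%:P); rewrite -mul_polyC polyCM.
    transitivity (x * (c%:P * r)); first by rewrite xE; ring.
    by rewrite dE eE; ring.
  by rewrite dvdpZr // mulf_neq0.
rewrite pE qE => ep eq.
have [a aE] := sg _ _ (content _ _ ppp ep) (content _ _ pqq eq).
have : ee %| xx * g.
  apply: dvdp_trans (dvdp_mul (dvdpp xx) Dg).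
  by rewrite (eqp_dvdr _ (mulp_gcdr _ _ _)) dvdp_gcd (dvde cp) ?(dvde cq).
case/(dvdp_primitive pee) => b bE; exists (a%:P * b).
rewrite eE {1}xE; transitivity ((cx * s)%:P * (xx * g)); first by rewrite polyCM; ring.
by rewrite aE bE polyCM; ring.
Qed.

End Gauss.

Section PrincipalKernel.
Variables (S : idomainType) (L : comNzRingType) (chi : {rmorphism {poly S} -> L}).
Hypothesis gcdS : gcd_domain S.
Hypothesis chi_idom : forall p q, chi (p * q) = 0 -> chi p = 0 \/ chi q = 0.
Hypothesis chi_inj : forall c, chi c%:P = 0 -> c = 0.

Lemma primitive_generates f : primitive_poly f -> chi f = 0 ->
  (forall p, chi p = 0 -> p != 0 -> (size f <= size p)%N) ->
  forall p, chi p = 0 -> dvr f p.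
Proof.
move=> pf f0 fmin p p0; apply: dvdp_primitive => //.
rewrite /dvdp; apply/negPn/negP => r0.
have fn0 : f != 0.
  apply/negP => /eqP fE; have [] := pf 1 0; last by move=> c /eqP; rewrite mulr0 oner_eq0.
  by rewrite fE mulr0; apply: dvr0.
have : (size (p %% f)%R < size f)%N by rewrite Pdiv.Idomain.ltn_modp.
rewrite ltnNge fmin //; have /(congr1 chi) := Pdiv.WeakIdomain.divp_eq p f.
by rewrite -mul_polyC rmorphD !rmorphM f0 p0 !mulr0 add0r => <-.
Qed.

(** The kernel is a prime ideal of [{poly S}] that meets the constants in 0. It is generated by the
    primitive part of an element of least degree. *)
Lemma principal_kernel : (exists2 p, p != 0 & chi p = 0) ->
  exists2 f, chi f = 0 & forall p, chi p = 0 -> dvr f p.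
Proof.
move=> [p p_n0 p0].
have [f [fn0 f0] fmin] : exists2 f, f != 0 /\ chi f = 0 &
    forall p, chi p = 0 -> p != 0 -> (size f <= size p)%N.
  have ex : exists n, `[< exists p, [/\ p != 0, chi p = 0 & size p = n] >].
    by exists (size p); apply/asboolP; exists p.
  case: (ex_minnP ex) => n /asboolP[f [fn0 f0 <-]] fmin; exists f => // q q0 qn0.
  by apply: fmin; apply/asboolP; exists q.
have [c [g [c0 pg gE]]] := primitive_poly_part gcdS fn0.
have g0 : chi g = 0.
  by move: f0; rewrite gE => /chi_idom[/chi_inj/eqP|//]; rewrite (negPf c0).
exists g => //; apply: primitive_generates => // q q0 qn0.
by rewrite (leq_trans _ (fmin q q0 qn0)) // gE mul_polyC size_scale.
Qed.
End PrincipalKernel.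

(** * Multivariate polynomial rings have gcds *)

Section MpolyGcd.
Variable k : fieldType.

Section Uni.
Variable n : nat.
Local Notation S := {mpoly k[n]}.

Definition mpoly_of_uni (p : {poly S}) : {mpoly k[n.+1]} :=
  (map_poly (@mwiden n k) p).['X_ord_max].

Fact mpoly_of_uni_zmod : zmod_morphism mpoly_of_uni.
Proof. by move=> p q; rewrite /mpoly_of_uni rmorphB hornerD hornerN. Qed.
Fact mpoly_of_uni_monoid : monoid_morphism mpoly_of_uni.
Proof. by split=> [|p q]; rewrite /mpoly_of_uni ?rmorph1 ?hornerC // rmorphM hornerM. Qed.
HB.instance Definition _ := GRing.isZmodMorphism.Build _ _ mpoly_of_uni mpoly_of_uni_zmod.
HB.instance Definition _ := GRing.isMonoidMorphism.Build _ _ mpoly_of_uni mpoly_of_uni_monoid.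

Lemma mpoly_of_uniC c : mpoly_of_uni c%:P = mwiden c.
Proof. by rewrite /mpoly_of_uni map_polyC hornerC. Qed.
Lemma mpoly_of_uniX : mpoly_of_uni 'X = 'X_ord_max.
Proof. by rewrite /mpoly_of_uni map_polyX hornerX. Qed.

Lemma muniK : cancel (@muni n k) mpoly_of_uni.
Proof.
move=> p; rewrite muniE rmorph_sum [RHS]mpolyE; apply: eq_bigr => m _ /=.
rewrite -!mul_polyC rmorphM -mul_mpolyC rmorphXn /= mpoly_of_uniX mpoly_of_uniC.
rewrite mwidenM mwidenC mwidenX mul_mpolyC -scalerAl; congr (_ *: _).
rewrite mpolyXn -mpolyXD; congr 'X_[_]; apply/mnmP => i.
rewrite mnmDE mulmnE mnm1E; case: (unliftP ord_max i) => [j ->|->].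
  have -> : lift ord_max j = widen_ord (leqnSn n) j by apply: val_inj; rewrite /= /bump leqNgt ltn_ord.
  rewrite mnmwiden_widen mnmE -val_eqE /= gtn_eqF ?mul0n ?addn0 //; exact: ltn_ord.
by rewrite mnmwiden_ordmax eqxx mul1n.
Qed.

Lemma muni_of_uni : cancel mpoly_of_uni (@muni n k).
Proof.
elim/poly_ind => [|p c IH]; first by rewrite !rmorph0.
rewrite (rmorphD mpoly_of_uni) (rmorphM mpoly_of_uni) (rmorphD (@muni n k)) (rmorphM (@muni n k)) /= IH mpoly_of_uniX mpoly_of_uniC.
congr (_ * _ + _).
  rewrite muniE msuppX big_seq1 mcoeffX eqxx scale1r mnm1E eqxx expr1.
  rewrite (_ : [multinom _ | _ < _] = 0%MM) ?mpolyX0 ?scale1r //.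
  apply/mnmP => i; rewrite mnmE mnm0E mnm1E -val_eqE /= gtn_eqF //; exact: ltn_ord.
elim/mpolyind: c {p IH} => [|c m p _ _ IH]; first by rewrite mwiden0 !rmorph0.
rewrite mwidenD (rmorphD (@muni n k)) /= IH polyCD; congr (_ + _).
rewrite mwidenZ muniZ mwidenX muniE msuppX big_seq1 mcoeffX eqxx scale1r.
rewrite mnmwiden_ordmax expr0 -[X in _ = X%:P]mul_mpolyC polyCM mul_polyC; congr (_ *: _).
rewrite -mul_polyC mulr1; congr ('X_[_])%:P; apply/mnmP => i.
by rewrite mnmE mnmwiden_widen.
Qed.
End Uni.

Lemma gcd_domain_iso (R S : idomainType) (f : {rmorphism R -> S})
  (g : {rmorphism S -> R}) : cancel f g -> cancel g f -> gcd_domain S -> gcd_domain R.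
Proof.
move=> fK gK gcdS p q; have [d [dp dq gd]] := gcdS (f p) (f q).
have back a b : dvr a (f b) -> dvr (g a) b.
  by case=> c cE; exists (g c); rewrite -rmorphM -cE fK.
have forth a b : dvr a b -> dvr (f a) (f b).
  by case=> c ->; exists (f c); rewrite rmorphM.
exists (g d); split=> [||x e /forth ep /forth eq]; [exact: back|exact: back|].
rewrite -(fK e); apply: back; rewrite rmorphM gK.
by apply: gd; rewrite -rmorphM.
Qed.

Lemma gcd_domain_mpoly n : gcd_domain {mpoly k[n]}.
Proof.
elim: n => [|n IH] p q.
  case: (eqVneq p 0) => [->|p0].
    by exists q; split=> [||x e _]; [apply: dvr0 | apply: dvrr |].
  have [c pE] : exists c, p = c%:MP by exists (p@_0%MM); apply: nvar0_mpolyC.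
  have c0 : c != 0 by apply: contraNneq p0 => c0; rewrite pE c0 mpolyC0.
  exists p; split=> //; first exact: dvrr.
  by exists (q * (c^-1)%:MP); rewrite pE -mulrA -mpolyCM mulVf // mulr1.
exact: (gcd_domain_iso (@muniK n) (@muni_of_uni n) (gcd_domain_poly IH)).
Qed.
End MpolyGcd.

(** * The ring of Y inside a field of rational functions *)

Section DringDomain.
Variable k : fieldType.
Hypothesis char0 : [pchar k] =i pred0.
Local Notation S := {mpoly k[2]}.

Lemma nat_neq0 n : (n.+1)%:R != 0 :> k.
Proof. by rewrite (pcharf0P k).1. Qed.

(** A common divisor of X_0 and 1 + X_1^2 has degree at most 1. In degree 1 it would be associated
    to X_0 and vanish at the origin, where 1 + X_1^2 has the value 1. *)
Lemma dvr_mpolyX_coprime (e x : S) :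
  dvr e (x * 'X_0) -> dvr e (x * (1 + 'X_1 ^+ 2)) -> dvr e x.
Proof.
have [d [[c0 E0] [c1 E1] gd]] := gcd_domain_mpoly ('X_0 : S) (1 + 'X_1 ^+ 2).
move=> e0 e1; have [c cE] := gd _ _ e0 e1.
have X0n0 : 'X_0 != 0 :> S by rewrite -msize_poly_eq0 msizeX.
have dn0 : d != 0 by apply: contraNneq X0n0; rewrite E0 => ->; rewrite mulr0.
have c0n0 : c0 != 0 by apply: contraNneq X0n0; rewrite E0 => ->; rewrite mul0r.
have /(congr1 (fun p : S => msize p)) := E0.
rewrite msizeX mdeg1 msizeM // => sz.
have cst (p : S) : p != 0 -> (msize p <= 1)%N -> exists2 a, a != 0 & p = a%:MP.
  move=> pn0 /msize1_polyC pE; exists (p@_0%MM) => //.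
  by apply: contraNneq pn0 => c0'; rewrite pE c0' mpolyC0.
case: (leqP (msize d) 1) => sd.
  have [a a0 dE] := cst _ dn0 sd; exists (a^-1%:MP * c).
  rewrite -mulrA -cE dE mulrC -mulrA -mpolyCM mulfV // mpolyC1 mulr1 //.
have [a a0 cE0] : exists2 a, a != 0 & c0 = a%:MP.
  by apply: cst => //; move: sz sd; move: (msize c0) (msize d) => a b; lia.
have : (1 + 'X_1 ^+ 2 : S).@[fun _ => 0] = 0.
  have : ('X_0 : S).@[fun _ => 0] = 0 by rewrite mevalXU.
  rewrite E0 E1 !mevalM cE0 mevalC => /eqP; rewrite mulf_eq0 (negPf a0) /= => /eqP ->.
  by rewrite mulr0.
by rewrite mevalD meval1 rmorphXn /= mevalXU expr0n addr0 => /eqP; rewrite oner_eq0.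
Qed.

Local Notation "x %:F" := (@tofrac S x).
Local Notation x2val := ((1 + 'X_1 ^+ 2 : S)%:F / (2%:R * 'X_0 : S)%:F).

(** Solves the equation of Y for the last coordinate: X_2 becomes (1 + X_1^2) / (2 X_0) in k(X_0,
    X_1). *)
Definition chi : {poly S} -> {fraction S} :=
  horner_eval x2val \o map_poly (@tofrac S).
HB.instance Definition _ := GRing.RMorphism.on chi.

Lemma chiC c : chi c%:P = c%:F.
Proof. by rewrite /chi /= /horner_eval map_polyC hornerC. Qed.

Lemma chiX : chi 'X = x2val.
Proof. by rewrite /chi /= /horner_eval map_polyX hornerX. Qed.

Lemma twoX0_neq0 : (2%:R * 'X_0 : S)%:F != 0.
Proof.
rewrite tofrac_eq0 mulf_neq0 //; last by rewrite -msize_poly_eq0 msizeX.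
by rewrite -(rmorph_nat (@mpolyC 2 k)) mpolyC_eq0 nat_neq0.
Qed.

Definition lin : {poly S} := (2%:R * 'X_0)%:P * 'X - (1 + 'X_1 ^+ 2)%:P.

Lemma chi_lin : chi lin = 0.
Proof. by rewrite rmorphB rmorphM /= !chiC chiX mulrC mulfVK ?subrr // twoX0_neq0. Qed.

Lemma lin_primitive : primitive_poly lin.
Proof.
move=> x e /dvr_coef H; have := H 0%N; have := H 1%N.
rewrite !coefCM !coefB !coefCM !coefC !coefX /= !mulr0 mulr1 subr0 sub0r mulrN.
move=> H1 /dvrN; rewrite opprK; apply: dvr_mpolyX_coprime.
have -> : x * 'X_0 = (2^-1 : k)%:MP * (x * (2%:R * 'X_0)); last exact: dvr_mull.
have E : (2^-1 : k)%:MP * 2%:R = 1 :> S.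
  by rewrite -(rmorph_nat (@mpolyC 2 k)) -mpolyCM mulVf ?mpolyC1 // nat_neq0.
by move: (_%:MP) E => h E; transitivity (x * 'X_0 * (h * 2%:R)); [rewrite E mulr1 | ring].
Qed.

Lemma mpoly_of_lin :
  mpoly_of_uni lin = 2%:R *: ('X_0 * 'X_2) - 'X_1 ^+ 2 - 1 :> {mpoly k[3]}.
Proof.
rewrite /lin rmorphB rmorphM /= !mpoly_of_uniC mpoly_of_uniX.
rewrite mwidenM (rmorph_nat (@mwiden 2 k)) [mwiden (1 + _)]mwidenD mwiden1.
rewrite (rmorphXn (@mwiden 2 k)) /= !mwidenX !mnmwiden1.
rewrite (_ : widen_ord _ _ = 0 :> 'I_3); last exact: val_inj.
rewrite (_ : widen_ord _ _ = 1 :> 'I_3); last exact: val_inj.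
rewrite (_ : ord_max = 2%:R :> 'I_3); last exact: val_inj.
rewrite -mul_mpolyC (rmorph_nat (@mpolyC 3 k)); ring.
Qed.

(** [lin] is the equation cleared of denominators. It is primitive of degree one and [chi] is
    injective on constants, so [lin] generates the kernel. *)
Lemma quadric_kernel (p : {mpoly k[3]}) : chi (muni p) = 0 <->
  exists q, p = q * (2%:R *: ('X_0 * 'X_2) - 'X_1 ^+ 2 - 1).
Proof.
split=> [chip|[q ->]]; last first.
  rewrite -mpoly_of_lin -(muniK q) -rmorphM /= muni_of_uni rmorphM /=.
  by rewrite chi_lin mulr0.
have chi_inj c : chi c%:P = 0 -> c = 0.
  by move/eqP; rewrite chiC tofrac_eq0 => /eqP.
have [|q qE] := primitive_generates lin_primitive chi_lin _ chip.
  move=> f f0 fn0; case: (leqP 2 (size f)) => [|/size1_polyC fE].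
    by apply: leq_trans; rewrite /lin -polyCN size_MXaddC; case: ifP => // _; rewrite ltnS size_polyC leq_b1.
  by move: f0 fn0; rewrite fE => /chi_inj ->; rewrite polyC0 eqxx.
exists (mpoly_of_uni q).
by rewrite -mpoly_of_lin -rmorphM /= -qE; apply/esym/muniK.
Qed.
End DringDomain.

Section DringFacts.
Variable k : closedFieldType.
Hypothesis char0 : [pchar k] =i pred0.
Local Notation D := (Dring k).

Lemma quadric_idealP (p : {mpoly k[3]}) : quadric_ideal p <-> chi (muni p) = 0.
Proof.
split=> [/asboolP H|H]; first exact/(quadric_kernel char0).
by apply/asboolP/(quadric_kernel char0).
Qed.

Lemma piD_eq0 (p : {mpoly k[3]}) : piD p = 0 <-> chi (muni p) = 0.
Proof.
rewrite -quadric_idealP -[in X in X <-> _](rmorph0 (@piD k)).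
by split=> [/quot_piP|H]; [rewrite subr0 | apply/quot_piP; rewrite subr0].
Qed.

Lemma Dring_integral (a b : D) : a * b = 0 -> a = 0 \/ b = 0.
Proof.
have [p ->] := piD_onto a; have [q ->] := piD_onto b.
rewrite -rmorphM /= !piD_eq0 (rmorphM (@muni 2 k)) rmorphM /= => /eqP.
by rewrite mulf_eq0 => /orP[/eqP|/eqP]; [left|right].
Qed.

End DringFacts.

Lemma mpoly_alg_ind n (R : comNzRingType) (K : {mpoly R[n]} -> Prop) :
  (forall c, K c%:MP) -> (forall i, K 'X_i) ->
  (forall p q, K p -> K q -> K (p + q)) -> (forall p q, K p -> K q -> K (p * q)) ->
  forall p, K p.
Proof.
move=> KC KX KD KM; elim/mpolyind => [|c m p _ _ Kp]; first by rewrite -mpolyC0.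
apply: (KD) => //; rewrite -mul_mpolyC; apply: (KM) => //; rewrite mpolyXE_id.
elim/big_ind: _ => [||i _]; [by rewrite -mpolyC1 | exact: (KM) |].
by elim: (m i) => [|e IH]; rewrite ?expr0 -?mpolyC1 // exprS; apply: (KM).
Qed.

Lemma mderivXU n (R : comNzRingType) (i j : 'I_n) :
  ('X_j : {mpoly R[n]})^`M(i) = (i == j)%:R.
Proof.
rewrite mderivX mnm1E eq_sym; case: eqP => [<-|_]; last by rewrite scale0r.
rewrite scale1r (_ : _ - _ = 0)%MM ?mpolyX0 //.
by apply/mnmP => l; rewrite mnmBE subnn mnm0E.
Qed.

Definition derivation (A B : comNzRingType) (f d : A -> B) :=
  (forall a b, d (a + b) = d a + d b) /\ (forall a b, d (a * b) = f a * d b + f b * d a).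

Lemma derivation_chain n (A T : comNzRingType) (f : {rmorphism A -> T}) (h : 'I_n -> T)
    (U : comNzRingType) (g : {rmorphism T -> U}) (d : T -> U) :
  derivation g d -> (forall a, d (f a) = 0) ->
  forall P, d (mmap f h P) = \sum_i g (mmap f h P^`M(i)) * d (h i).
Proof.
move=> [dD dM] d0; elim/mpoly_alg_ind => [c|i|p q IHp IHq|p q IHp IHq].
- rewrite mmapC d0 big1 // => i _; rewrite mderivC mmap0 rmorph0 mul0r //.
- rewrite mmapX mmap1U (bigD1 i) //= mderivXU eqxx !rmorph1 mul1r.
  by rewrite big1 ?addr0 // => j ne; rewrite mderivXU (negPf ne) mmap0 rmorph0 mul0r.
- rewrite mmapD dD IHp IHq -big_split; apply: eq_bigr => i _ /=.
  by rewrite mderivD mmapD rmorphD mulrDl.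
rewrite rmorphM dM IHp IHq !mulr_sumr -big_split; apply: eq_bigr => i _ /=.
by rewrite mderivM rmorphD !rmorphM rmorphD !rmorphM /=; ring.
Qed.

Section ScalarPolynomials.
Variable k : closedFieldType.
Hypothesis char0 : [pchar k] =i pred0.

Lemma fresh_scalar (l : seq k) : exists s, s \notin l.
Proof.
pose r := [seq i%:R : k | i <- iota 0 (size l).+1].
have ur : uniq r by rewrite map_inj_uniq ?iota_uniq //; apply: natr_inj_char0.
apply: contrapT => H; have : (size r <= size l)%N.
  apply: uniq_leq_size ur _ => s _; apply/negPn/negP => sl; apply: H; by exists s.
by rewrite size_map size_iota ltnn.
Qed.

Variable A : comAlgType k.

(** [A] may have zero divisors, so roots cannot simply be counted; but differences of distinct
    scalars are units, so one linear factor after another splits off. *)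
Lemma poly_eq0_off (l : seq k) (p : {poly A}) :
  (forall s, s \notin l -> p.[s%:A] = 0) -> p = 0.
Proof.
have [n] := ubnP (size p); elim: n => // n IH in p l *; rewrite ltnS => sp H.
case: (eqVneq p 0) => // pn0; have [s sl] := fresh_scalar l.
have /factor_theorem[q qE] : root p s%:A by apply/rootP/H.
have qn0 : q != 0 by apply: contraNneq pn0; rewrite qE => ->; rewrite mul0r.
rewrite qE (IH q (s :: l)) ?mul0r //.
  by move: sp; rewrite qE size_Mmonic ?monicXsubC // size_XsubC addn2.
move=> r; rewrite inE negb_or => /andP[rs rl].
have := H r rl; rewrite qE hornerM hornerXsubC -scalerBl mulr_algr => E.
by rewrite -[LHS]scale1r -(mulVf (x := r - s)) ?subr_eq0 // -scalerA E scaler0.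
Qed.

Lemma poly_eq_off (l : seq k) (p q : {poly A}) :
  (forall s, s \notin l -> p.[s%:A] = q.[s%:A]) -> p = q.
Proof.
move=> H; apply/eqP; rewrite -subr_eq0; apply/eqP/(@poly_eq0_off l) => s sl.
by rewrite hornerD hornerN H // subrr.
Qed.

Lemma poly_eq_scalars (p q : {poly A}) : (forall s : k, p.[s%:A] = q.[s%:A]) -> p = q.
Proof. by move=> H; apply: (@poly_eq_off [::]) => s _. Qed.
End ScalarPolynomials.

(** * The Lie algebra action attached to an algebraic action *)

Section ActionDerivation.
Variable k : closedFieldType.
Hypothesis char0 : [pchar k] =i pred0.
Variables (A : comAlgType k) (rho : SL2_action A).
Implicit Types (n m : 'M[k]_2) (f g : A).

Definition orbit_poly f : {mpoly A[2 * 2]} := sval (cid (pullback_regular rho f)).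

Lemma orbit_polyP f (g : SL2 k) : rho g f = (orbit_poly f).@[fun i => (mxvec g 0 i)%:A].
Proof. by rewrite /orbit_poly; case: cid. Qed.

Definition lie n f : A := \sum_i
  (orbit_poly f)^`M(i).@[fun i => (mxvec 1%:M 0 i)%:A] * (mxvec n 0 i)%:A.

Lemma lieD n m f : lie (n + m) f = lie n f + lie m f.
Proof.
by rewrite /lie -big_split; apply: eq_bigr => i _; rewrite linearD mxE scalerDl mulrDr.
Qed.

Lemma lieZ c n f : lie (c *: n) f = c *: lie n f.
Proof.
rewrite /lie scaler_sumr; apply: eq_bigr => i _.
by rewrite linearZ mxE -scalerA scalerAr.
Qed.

Lemma lieB n m f : lie (n - m) f = lie n f - lie m f.
Proof. by rewrite -scaleN1r lieD lieZ scaleN1r. Qed.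

Definition line n f : {poly A} := mmap (@polyC A)
  (fun i => (mxvec 1%:M 0 i)%:A%:P + (mxvec n 0 i)%:A%:P * 'X) (orbit_poly f).

Lemma line_horner n f r :
  (line n f).[r%:A] = (orbit_poly f).@[fun i => (mxvec (1%:M + r *: n) 0 i)%:A].
Proof.
rewrite /line; elim/mpoly_alg_ind: (orbit_poly f) => [c|i|p q IHp IHq|p q IHp IHq].
- by rewrite mmapC hornerC mevalC.
- rewrite mmapX mmap1U hornerD hornerM !hornerC hornerX mevalXU linearD linearZ /= !mxE.
  by rewrite scalerDl -scalerAl mul1r scalerA mulrC.
- by rewrite mmapD hornerD IHp IHq mevalD.
by rewrite rmorphM hornerM IHp IHq mevalM.
Qed.

Lemma line_coef1 n f : (line n f)`_1 = lie n f.
Proof.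
have -> : (line n f)`_1 = (line n f)^`().[0] by rewrite horner_coef0 coef_deriv.
rewrite /line (@derivation_chain _ _ _ _ _ _ idfun); first last.
- by move=> a; rewrite derivC.
- by split=> a b; rewrite ?derivD // derivM /=; ring.
rewrite /lie horner_sum; apply: eq_bigr => i _ /=.
rewrite derivD derivC add0r derivM derivC mul0r add0r derivX mulr1 hornerM hornerC.
congr (_ * _); elim/mpoly_alg_ind: (_^`M(_)) => [c|j|p q IHp IHq|p q IHp IHq].
- by rewrite mmapC hornerC mevalC.
- by rewrite mmapX mmap1U hornerD hornerM !hornerC hornerX mevalXU mulr0 addr0.
- by rewrite mmapD hornerD IHp IHq mevalD.
by rewrite rmorphM hornerM IHp IHq mevalM.
Qed.

(* Nilpotent directions, along which the group contains a whole line. *)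
Section Unipotent.
Variable n : 'M[k]_2.
Hypothesis det_n : forall r, \det (1%:M + r *: n) == 1.
Hypothesis sqr_n : n *m n = 0.

Definition unip r : SL2 k := MkSL2 (det_n r).

Lemma unipE r f : rho (unip r) f = (line n f).[r%:A].
Proof. by rewrite orbit_polyP line_horner. Qed.

Lemma unip_add r s : unip (r + s) = (unip r * unip s)%g.
Proof.
apply: val_inj; rewrite /= mulmxDl mul1mx mulmxDr mulmx1.
by rewrite -scalemxAl -scalemxAr sqr_n !scaler0 addr0 scalerDl addrA addrAC.
Qed.

Lemma unip0 : unip 0 = 1%g.
Proof. by apply: val_inj; rewrite /= scale0r addr0. Qed.

Lemma line_coef0 f : (line n f)`_0 = f.
Proof. by rewrite -horner_coef0 -(scale0r (1 : A)) -unipE unip0 pullback1. Qed.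

Lemma lineD f g : line n (f + g) = line n f + line n g.
Proof. by apply: (poly_eq_scalars char0) => s; rewrite hornerD -!unipE rmorphD. Qed.
Lemma lineM f g : line n (f * g) = line n f * line n g.
Proof. by apply: (poly_eq_scalars char0) => s; rewrite hornerM -!unipE rmorphM. Qed.
Lemma lineZ c f : line n (c *: f) = c%:A *: line n f.
Proof.
by apply: (poly_eq_scalars char0) => s; rewrite hornerZ -!unipE linearZ /= mulr_algl.
Qed.

Lemma lie_derivation : derivation idfun (lie n).
Proof.
split=> f g; rewrite -!line_coef1 ?lineD ?coefD // lineM coefM !big_ord_recl big_ord0 /=.
by rewrite addr0 !line_coef0 /bump /=; ring.
Qed.

Lemma lieZr c f : lie n (c *: f) = c *: lie n f.
Proof. by rewrite -!line_coef1 lineZ coefZ mulr_algl. Qed.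

Lemma lie0 : lie n 0 = 0.
Proof. by have := lieZr 0 0; rewrite !scale0r. Qed.

Lemma lie_sum (I : Type) (r : seq I) (P : pred I) (F : I -> A) :
  lie n (\sum_(i <- r | P i) F i) = \sum_(i <- r | P i) lie n (F i).
Proof.
apply: (big_morph (lie n)) => [f g|]; first by case: lie_derivation.
exact: lie0.
Qed.

(** On the one-parameter group r |-> 1 + r n, replacing [f] by its translate shifts the variable of
    [line n f]. Differentiating the shift at 0 gives the differential equation of an exponential. *)
Lemma line_coefS f i : (line n f)`_i.+1 *+ i.+1 = lie n ((line n f)`_i).
Proof.
have : (line n f)^`() = \poly_(j < size (line n f)) lie n (line n f)`_j.
  apply: (poly_eq_scalars char0) => r.
  pose L2 : {poly A} := line n (rho (unip r) f).
  have E : L2 = line n f \Po ('X + r%:A%:P).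
    apply: (poly_eq_scalars char0) => s; rewrite -unipE -pullbackM -unip_add unipE.
    by rewrite horner_comp hornerD hornerX hornerC addrC scalerDl addrC.
  have /(congr1 (fun p : {poly A} => p^`().[0])) := E.
  rewrite deriv_comp derivD derivX derivC addr0 mulr1 horner_comp hornerD hornerX hornerC add0r => <-.
  rewrite horner_coef0 coef_deriv /= line_coef1 unipE.
  rewrite horner_coef lie_sum horner_poly; apply: eq_bigr => j _.
  have -> : r%:A ^+ j = (r ^+ j)%:A :> A by rewrite -[RHS]/(in_alg A _) rmorphXn.
  by rewrite !mulr_algr lieZr.
move/(congr1 (fun p : {poly A} => p`_i)); rewrite coef_deriv => ->.
rewrite coef_poly; case: ltnP => // /(nth_default 0) ->.
by rewrite lie0.
Qed.

(** Thus [line n f] is the exponential series of the derivation, and local nilpotency is the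
    finiteness of its degree. *)
Lemma lie_iter f i : iter i (lie n) f = i`!%:R *: (line n f)`_i.
Proof.
elim: i => [|i IH] /=; first by rewrite scale1r line_coef0.
by rewrite IH lieZr -line_coefS -[X in _ *: X]scaler_nat scalerA -natrM mulnC -factS.
Qed.

Lemma lie_nilp f : exists N, forall i, (N <= i)%N -> iter i (lie n) f = 0.
Proof.
by exists (size (line n f)) => i le; rewrite lie_iter nth_default ?scaler0.
Qed.
End Unipotent.

Section Conjugation.
Variables n m : 'M[k]_2.
Hypothesis det_n : forall r, \det (1%:M + r *: n) == 1.
Hypothesis det_m : forall r, \det (1%:M + r *: m) == 1.
Hypothesis sqr_m : m *m m = 0.

Let conj s : 'M[k]_2 := n + s *: (m *m n - n *m m) - (s ^+ 2) *: (m *m n *m m).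

Let conjE s r : 1%:M + r *: conj s = (1%:M + s *: m) *m (1%:M + r *: n) *m (1%:M + (- s) *: m).
Proof.
have -> : conj s = (1%:M + s *: m) *m n *m (1%:M - s *: m).
  rewrite /conj mulmxDl mul1mx mulmxBr mulmx1 mulmxDl -!scalemxAl -!scalemxAr scalerDr scalerN expr2 -scalerA.
  by rewrite opprD !addrA; congr (_ - _); rewrite -!addrA; congr (_ + _); rewrite addrC.
have aK : (1%:M + s *: m) *m (1%:M - s *: m) = 1%:M.
  rewrite mulmxDl mul1mx mulmxBr mulmx1 -scalemxAl -scalemxAr sqr_m !scaler0 subr0.
  by rewrite addrNK.
by rewrite scaleNr (mulmxDr (1%:M + s *: m) 1%:M) mulmx1 [RHS]mulmxDl aK -scalemxAr -scalemxAl.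
Qed.

Let det_conj s r : \det (1%:M + r *: conj s) == 1.
Proof.
by rewrite conjE !det_mulmx (eqP (det_m _)) (eqP (det_n _)) (eqP (det_m _)) !mulr1.
Qed.

Lemma lie_conj s f :
  rho (unip det_m s) (lie (conj s) f) = lie n (rho (unip det_m s) f).
Proof.
pose gp := rho (unip det_m s); pose gm := rho (unip det_m (- s)).
have gK x : gp (gm x) = x.
  by rewrite /gp /gm -pullbackM -(unip_add det_m sqr_m) addNr unip0 pullback1.
have E : line (conj s) f = map_poly gm (line n (gp f)).
  apply: (poly_eq_scalars char0) => r.
  have EU : unip (det_conj s) r = (unip det_m s * unip det_n r * unip det_m (- s))%g.
    by apply: val_inj; rewrite /= conjE.
  rewrite -(unipE (det_conj s)) EU !pullbackM (unipE det_n).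
  by rewrite -/gm -/gp -[in RHS](rmorph1 gm) -linearZ /= horner_map.
by rewrite -line_coef1 E coef_map line_coef1 gK.
Qed.

(** [lie_conj] for all [s] at once, as an identity of polynomials in s. Its coefficients of degree 1
    and 2 are the two commutator formulas that follow. *)
Lemma lie_conj_poly f :
  line m (lie n f) + line m (lie (m *m n - n *m m) f) * 'X
    - line m (lie (m *m n *m m) f) * 'X^2 =
  \poly_(i < size (line m f)) lie n (line m f)`_i.
Proof.
apply: (poly_eq_scalars char0) => s.
have := lie_conj s f; rewrite /conj lieB lieD !lieZ linearB linearD !linearZ /=.
rewrite !(unipE det_m) scalerN hornerD hornerN hornerD !hornerM !hornerX => E.
have -> : (s%:A * s%:A : A) = (s ^+ 2)%:A by rewrite expr2 -scalerAl mul1r scalerA.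
rewrite !mulr_algr E horner_coef (lie_sum det_n) horner_poly.
apply: eq_bigr => j _.
have -> : s%:A ^+ j = (s ^+ j)%:A :> A by rewrite -[RHS]/(in_alg A _) rmorphXn.
by rewrite !mulr_algr (lieZr det_n).
Qed.

Lemma lie_comm f :
  lie (m *m n - n *m m) f = lie n (lie m f) - lie m (lie n f).
Proof.
have /(congr1 (fun p : {poly A} => p`_1)) := lie_conj_poly f.
rewrite coefB coefD coefMX coefMXn /= subr0 line_coef1 (line_coef0 det_m) coef_poly.
case: ltnP => [_|/(nth_default 0) E].
  by rewrite line_coef1 => <-; rewrite addrAC subrr add0r.
move=> H; rewrite -(line_coef1 m) E (lie0 det_n).
by rewrite -H addrAC subrr add0r.
Qed.

Lemma lie_comm2 f : let H := lie (m *m n - n *m m) in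
  lie m (H f) - H (lie m f) = lie (m *m n *m m) f *+ 2.
Proof.
move=> H; have /(congr1 (fun p : {poly A} => p`_2)) := lie_conj_poly f.
rewrite coefB coefD coefMX coefMXn /= line_coef1 (line_coef0 det_m) coef_poly -/(H f).
have l0 : lie n 0 = 0 by apply: lie0.
have -> : (if (2 < size (line m f))%N then lie n (line m f)`_2 else 0) = lie n (line m f)`_2.
  by case: ltnP => // /(nth_default 0) ->.
have key : lie n (line m f)`_2 *+ 2 = lie n (lie m (lie m f)).
  by rewrite -scaler_nat -(lieZr det_n) scaler_nat (line_coefS det_m sqr_m) line_coef1.
move=> /(congr1 (fun x => x *+ 2)); rewrite key mulrnBl mulrnDl (line_coefS det_m sqr_m) line_coef1 => E.
rewrite /H !lie_comm; rewrite /H !lie_comm in E.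
have [mD _] := lie_derivation det_m.
have mB x y : lie m (x - y) = lie m x - lie m y.
  by rewrite mD -scaleN1r (lieZr det_m) scaleN1r.
rewrite !mB in E *; move: E.
move: (lie m (lie n (lie m f))) (lie m (lie m (lie n f))) (lie n (lie m (lie m f))) (lie (m *m n *m m) f) => x y z t E.
have -> : t *+ 2 = y + (x - y) *+ 2 - z by rewrite -E; ring.
ring.
Qed.
End Conjugation.
End ActionDerivation.

Definition e12 (k : nzRingType) : 'M[k]_2 := delta_mx 0 1.
Definition e21 (k : nzRingType) : 'M[k]_2 := delta_mx 1 0.

(** Pulling back functions reverses products, hence brackets, so the raising operator is the
    derivative along the lower triangular matrix: it sends x2 to x1, x1 to x0 and x0 to 0. *)
HB.lock Definition lE (k : closedFieldType) (A : comAlgType k) (rho : SL2_action A) (a : A) :=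
  lie rho (e21 k) a.
HB.lock Definition lF (k : closedFieldType) (A : comAlgType k) (rho : SL2_action A) (a : A) :=
  lie rho (e12 k) a.

Section SL2Derivations.
Variable k : closedFieldType.
Hypothesis char0 : [pchar k] =i pred0.
Local Notation e12 := (e12 k).
Local Notation e21 := (e21 k).

Lemma det_e12 r : \det (1%:M + r *: e12) == 1.
Proof. by rewrite det2E !mxE /= !mulr1n !mulr0n !mulr0 !addr0 mul1r mulr0 subr0. Qed.
Lemma det_e21 r : \det (1%:M + r *: e21) == 1.
Proof. by rewrite det2E !mxE /= !mulr1n !mulr0n !mulr0 !addr0 mul1r mul0r subr0. Qed.
Lemma sqr_e12 : e12 *m e12 = 0.
Proof. by rewrite mul_delta_mx_0. Qed.
Lemma sqr_e21 : e21 *m e21 = 0.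
Proof. by rewrite mul_delta_mx_0. Qed.

Lemma lie_equivariant (A A' : comAlgType k) (rA : SL2_action A) (rA' : SL2_action A')
    (f : {lrmorphism A -> A'}) n (det_n : forall r, \det (1%:M + r *: n) == 1) :
  (forall g a, f (rA g a) = rA' g (f a)) ->
  forall a, f (lie rA n a) = lie rA' n (f a).
Proof.
move=> fE a; have E : line rA' n (f a) = map_poly f (line rA n a).
  apply: (poly_eq_scalars char0) => s.
  rewrite -(unipE _ det_n) -fE (unipE _ det_n) -horner_map /=.
  by rewrite linearZ /= rmorph1.
by rewrite -!line_coef1 E coef_map.
Qed.

Section OneAlgebra.
Variables (A : comAlgType k) (rho : SL2_action A).
Local Notation lE := (lE rho).
Local Notation lF := (lF rho).
Lemma lEE a : lE a = lie rho e21 a. Proof. by rewrite lE.unlock. Qed.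
Lemma lFE a : lF a = lie rho e12 a. Proof. by rewrite lF.unlock. Qed.
Definition lH a := lE (lF a) - lF (lE a).

Let e_mul : e12 *m e21 *m e12 = e12 :> 'M[k]_2.
Proof. by rewrite /e12 /e21 !mul_delta_mx. Qed.
Let e_mul' : e21 *m e12 *m e21 = e21 :> 'M[k]_2.
Proof. by rewrite /e12 /e21 !mul_delta_mx. Qed.

Lemma lHE a : lH a = lie rho (e12 *m e21 - e21 *m e12) a.
Proof.
by rewrite (lie_comm char0 rho det_e21 det_e12 sqr_e12) /lH !(lEE, lFE).
Qed.

Lemma lED a b : lE (a + b) = lE a + lE b.
Proof. by rewrite !lEE; case: (lie_derivation char0 rho det_e21) => + _; apply. Qed.
Lemma lFD a b : lF (a + b) = lF a + lF b.
Proof. by rewrite !lFE; case: (lie_derivation char0 rho det_e12) => + _; apply. Qed.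
Lemma lEM a b : lE (a * b) = a * lE b + b * lE a.
Proof. by rewrite !lEE; case: (lie_derivation char0 rho det_e21) => _; apply. Qed.
Lemma lFM a b : lF (a * b) = a * lF b + b * lF a.
Proof. by rewrite !lFE; case: (lie_derivation char0 rho det_e12) => _; apply. Qed.
Lemma lEZ c a : lE (c *: a) = c *: lE a.
Proof. by rewrite !lEE; exact: (lieZr char0 rho det_e21). Qed.
Lemma lFZ c a : lF (c *: a) = c *: lF a.
Proof. by rewrite !lFE; exact: (lieZr char0 rho det_e12). Qed.

Lemma lE_linear : linear lE.
Proof. by move=> c a b; rewrite lED lEZ. Qed.
Lemma lF_linear : linear lF.
Proof. by move=> c a b; rewrite lFD lFZ. Qed.
HB.instance Definition _ := GRing.isLinear.Build k A A _ lE lE_linear.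
HB.instance Definition _ := GRing.isLinear.Build k A A _ lF lF_linear.
Lemma lH_linear : linear lH.
Proof. by move=> c a b; rewrite /lH lFD lED lED lFD !(lEZ, lFZ) scalerBr; move: (c *: _) (c *: _) => *; ring. Qed.
HB.instance Definition _ := GRing.isLinear.Build k A A _ lH lH_linear.

Lemma lE0 : lE 0 = 0. Proof. exact: linear0. Qed.
Lemma lF0 : lF 0 = 0. Proof. exact: linear0. Qed.
Lemma lEN a : lE (- a) = - lE a. Proof. exact: linearN. Qed.
Lemma lFN a : lF (- a) = - lF a. Proof. exact: linearN. Qed.
Lemma lEMn a i : lE (a *+ i) = lE a *+ i. Proof. exact: raddfMn. Qed.
Lemma lFMn a i : lF (a *+ i) = lF a *+ i. Proof. exact: raddfMn. Qed.
Lemma lHD a b : lH (a + b) = lH a + lH b. Proof. exact: linearD. Qed.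
Lemma lHZ c a : lH (c *: a) = c *: lH a. Proof. exact: linearZ. Qed.
Lemma lE1 : lE 1 = 0.
Proof. by have := lEM 1 1; rewrite !mul1r => /eqP; rewrite -subr_eq subrr eq_sym => /eqP. Qed.
Lemma lF1 : lF 1 = 0.
Proof. by have := lFM 1 1; rewrite !mul1r => /eqP; rewrite -subr_eq subrr eq_sym => /eqP. Qed.
Lemma lH1 : lH 1 = 0. Proof. by rewrite /lH lE1 lF1 lE0 lF0 subrr. Qed.

Lemma lHM a b : lH (a * b) = a * lH b + b * lH a.
Proof.
rewrite /lH lEM lFM lED lFD !(lEM, lFM).
move: (lE (lF b)) (lE (lF a)) (lF (lE b)) (lF (lE a)) (lE a) (lF a) (lE b) (lF b) => *; ring.
 Qed.

Lemma lHE_comm a : lH (lE a) - lE (lH a) = lE a *+ 2.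
Proof.
have H := lie_comm2 char0 rho det_e12 det_e21 sqr_e21 a.
rewrite /= e_mul' in H; rewrite !lHE.
have N b : lie rho (e12 *m e21 - e21 *m e12) b = - lie rho (e21 *m e12 - e12 *m e21) b.
  by rewrite -(opprB (e21 *m e12)) -scaleN1r lieZ scaleN1r.
by rewrite !N lEN opprK addrC !lEE -H.
Qed.

Lemma lHF_comm a : lH (lF a) - lF (lH a) = - (lF a *+ 2).
Proof.
have H := lie_comm2 char0 rho det_e21 det_e12 sqr_e12 a.
by rewrite /= e_mul in H; rewrite !lHE !lFE -H opprB.
Qed.

Lemma lE_nilp a : exists N, forall i, (N <= i)%N -> iter i lE a = 0.
Proof.
have [N HN] := lie_nilp char0 rho det_e21 sqr_e21 a; exists N => i /HN.
by rewrite (eq_iter (f' := lie rho e21)) // => b; rewrite lEE.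
Qed.
Lemma lF_nilp a : exists N, forall i, (N <= i)%N -> iter i lF a = 0.
Proof.
have [N HN] := lie_nilp char0 rho det_e12 sqr_e12 a; exists N => i /HN.
by rewrite (eq_iter (f' := lie rho e12)) // => b; rewrite lFE.
Qed.
End OneAlgebra.

Section Equivariant.
Variables (A A' : comAlgType k) (rA : SL2_action A) (rA' : SL2_action A').
Variable f : {lrmorphism A -> A'}.
Hypothesis fE : forall g a, f (rA g a) = rA' g (f a).

Lemma equiv_lE a : f (lE rA a) = lE rA' (f a).
Proof. by rewrite !lEE; exact: (lie_equivariant det_e21 fE). Qed.
Lemma equiv_lF a : f (lF rA a) = lF rA' (f a).
Proof. by rewrite !lFE; exact: (lie_equivariant det_e12 fE). Qed.
Lemma equiv_lH a : f (lH rA a) = lH rA' (f a).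
Proof. by rewrite /lH rmorphB /= !(equiv_lE, equiv_lF). Qed.
End Equivariant.
End SL2Derivations.

(** * Points of Y and zeros of odd functions *)

Section DringMaps.
Variable k : closedFieldType.
Variables (U : comNzRingType) (h : {rmorphism {mpoly k[3]} -> U}).
Hypothesis h_quadric : h (quadric k) = 1.

Definition of_quadric of h (quadric k) = 1 : Dring k -> U := fun x => h (quot_repr x).
Local Notation f := (of_quadric h_quadric).

Lemma of_quadricE p : f (piD p) = h p.
Proof.
have /quot_piP/asboolP[q E] : piD (quot_repr (piD p)) = piD p by apply: quot_reprK.
by apply/eqP; rewrite -subr_eq0 -rmorphB /= E rmorphM rmorphB h_quadric rmorph1 subrr mulr0.
Qed.

Fact of_quadric_zmod : zmod_morphism f.
Proof.
move=> x y; have [p ->] := piD_onto x; have [q ->] := piD_onto y.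
by rewrite -rmorphB /= !of_quadricE rmorphB.
Qed.
Fact of_quadric_monoid : monoid_morphism f.
Proof.
split=> [|x y]; first by rewrite -(rmorph1 (@piD k)) of_quadricE rmorph1.
have [p ->] := piD_onto x; have [q ->] := piD_onto y.
by rewrite -rmorphM /= !of_quadricE rmorphM.
Qed.
HB.instance Definition _ := GRing.isZmodMorphism.Build (Dring k) U f of_quadric_zmod.
HB.instance Definition _ := GRing.isMonoidMorphism.Build (Dring k) U f of_quadric_monoid.
End DringMaps.

Section DringGeometry.
Variable k : closedFieldType.
Hypothesis char0 : [pchar k] =i pred0.
Local Notation D := (Dring k).
Local Notation x0 := (piD 'X_0 : D).
Local Notation x1 := (piD 'X_1 : D).
Local Notation x2 := (piD 'X_2 : D).
Local Notation nat_n0 := (nat_neq0 char0).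

Lemma x_rel : x1 ^+ 2 = x0 * x2 *+ 2 - 1.
Proof.
have : piD (quadric k) = 1.
  rewrite -(rmorph1 (@piD k)); apply/quot_piP/asboolP; exists 1; by rewrite mul1r.
rewrite /quadric linearB /= linearZ /= rmorphM rmorphXn /= scaler_nat => H.
by rewrite -[X in _ - X]H opprB addrC subrK.
Qed.

Definition point (v : 'I_3 -> k) := 2%:R * v 0 * v 2%:R - v 1 ^+ 2 = 1.

Lemma quadric_point v : point v -> (quadric k).@[v] = 1.
Proof. by rewrite /point /quadric mevalB mevalZ mevalM rmorphXn /= !mevalXU mulrA. Qed.

Definition ev v (pv : point v) : D -> k :=
  @of_quadric k k (meval v) (quadric_point pv).
HB.instance Definition _ v pv := GRing.RMorphism.on (@ev v pv).

Lemma evE v (pv : point v) p : ev pv (piD p) = p.@[v].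
Proof. exact: of_quadricE. Qed.

Lemma evX v (pv : point v) i : ev pv (piD 'X_i) = v i.
Proof. by rewrite evE mevalXU. Qed.

Lemma evZ v (pv : point v) c a : ev pv (c *: a) = c * ev pv a.
Proof. by have [p ->] := piD_onto a; rewrite -linearZ /= !evE mevalZ. Qed.

Definition emb_hom := chi (k:=k) \o @muni 2 k.
HB.instance Definition _ := GRing.RMorphism.on emb_hom.
Lemma emb_quadric : emb_hom (quadric k) = 1.
Proof.
have /(quadric_kernel char0) : exists q, quadric k - 1 = q * (2%:R *: ('X_0 * 'X_2) - 'X_1 ^+ 2 - 1).
  by exists 1; rewrite mul1r.
by rewrite -[chi _]/(emb_hom _) rmorphB rmorph1 => /eqP; rewrite subr_eq0 => /eqP.
Qed.

Definition emb : D -> {fraction {mpoly k[2]}} := of_quadric emb_quadric.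
HB.instance Definition _ := GRing.RMorphism.on emb.

Lemma emb_inj : injective emb.
Proof.
move=> a b; have [p ->] := piD_onto a; have [q ->] := piD_onto b => /eqP.
rewrite -subr_eq0 -rmorphB -rmorphB /= /emb of_quadricE => /eqP /(piD_eq0 char0).
by rewrite rmorphB => /eqP; rewrite subr_eq0 => /eqP.
Qed.

Lemma D_cancel (a b c : D) : a != 0 -> a * b = a * c -> b = c.
Proof.
move=> a0 /eqP; rewrite -subr_eq0 -mulrBr => /eqP/(Dring_integral char0)[/eqP|/eqP].
  by rewrite (negPf a0).
by rewrite subr_eq0 => /eqP.
Qed.

Lemma curve1 s : point (fun i => [:: 1; s; (1 + s ^+ 2) / 2%:R]`_i).
Proof. by rewrite /point /= mulr1 mulrC divfK ?nat_n0 // addrK. Qed.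
Lemma curve2 s : point (fun i => [:: - (1 + s ^+ 2); s; - 2^-1]`_i).
Proof. by rewrite /point /= mulrAC !mulrN mulfV ?nat_n0 // mulNr mul1r opprK addrK. Qed.

(** If [P] were not constant, [P - c] would have a root in the closed field. *)
Lemma poly_zero_or_const (P : {poly k}) (c : k) : (forall s, P.[s] <> c) -> exists d, forall s, P.[s] = d.
Proof.
move=> H; exists (P`_0) => s; suff -> : P = (P`_0)%:P by rewrite hornerC coefC eqxx.
apply/size1_polyC; rewrite leqNgt; apply/negP => sP.
have : size (P - c%:P) != 1%N.
  by rewrite size_polyDl ?size_polyN ?size_polyC ?(leq_ltn_trans (leq_b1 _)) // gtn_eqF.
move/(closed_rootP) => [r]; rewrite /root hornerD hornerN hornerC subr_eq0 => /eqP.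
exact: H.
Qed.

(* The two rational curves [x0 = 1] and [x2 = -1/2] meet, and they join a
   point to its antipode, at which [g] takes opposite values. *)
Lemma odd_zero (g : D) : mu g = - g ->
  exists v (pv : point v), ev pv g = 0 /\ (v 0 != 0 \/ v 2%:R != 0).
Proof.
move=> mug; apply: contrapT => Hno; have [p gE] := piD_onto g.
have onecurve (c : 'I_3 -> {poly k}) (pc : forall s, point (fun i => (c i).[s])) :
    (forall s, (c 0).[s] != 0 \/ (c 2%:R).[s] != 0) ->
    exists d, forall s v (pv : point v), (forall i, v i = (c i).[s]) -> ev pv g = d.
  move=> nz; have E s v (pv : point v) : (forall i, v i = (c i).[s]) -> ev pv g = (mmap (@polyC k) c p).[s].
    move=> vE; rewrite gE evE; elim/mpoly_alg_ind: (p) => [a|i|a b Ha Hb|a b Ha Hb].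
    - by rewrite mevalC mmapC hornerC.
    - by rewrite mevalXU mmapX mmap1U vE.
    - by rewrite mevalD mmapD hornerD Ha Hb.
    by rewrite mevalM rmorphM hornerM Ha Hb.
  have [|d dE] := @poly_zero_or_const (mmap (@polyC k) c p) 0.
    by move=> s H; apply: Hno; exists _, (pc s); split; [rewrite (E s) | apply: nz].
  by exists d => s v pv vE; rewrite (E s) // dE.
pose c1 (i : 'I_3) : {poly k} := [:: 1; 'X; (1 + 'X ^+ 2) * (2^-1)%:P]`_i.
pose c2 (i : 'I_3) : {poly k} := [:: - (1 + 'X ^+ 2); 'X; (- 2^-1)%:P]`_i.
have c1E s i : (c1 i).[s] = [:: 1; s; (1 + s ^+ 2) / 2%:R]`_i.
  by case: i => -[|[|[|//]]] lt; rewrite /c1 /= ?hornerE ?hornerXn //.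
have c2E s i : (c2 i).[s] = [:: - (1 + s ^+ 2); s; - 2^-1]`_i.
  by case: i => -[|[|[|//]]] lt; rewrite /c2 /= ?hornerE ?hornerXn //.
have [||d1 d1E] := onecurve c1.
- by move=> s; have := curve1 s; rewrite /point !c1E.
- by move=> s; left; rewrite c1E oner_neq0.
have [||d2 d2E] := onecurve c2.
- by move=> s; have := curve2 s; rewrite /point !c2E.
- by move=> s; right; rewrite c2E oppr_eq0 invr_eq0 nat_n0.
(* The curves meet where 1 = -(1 + s^2) and (1 + s^2)/2 = -1/2; both equations say s^2 = -2. *)
have [s0 s0E] : exists s : k, s ^+ 2 = - 2%:R.
  have [s] := @solve_monicpoly k 2 (fun j => if j == 0%N then - 2%:R else 0) isT.
  by rewrite !big_ord_recl big_ord0 /= expr0 mulr1 mul0r !addr0; exists s.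
have d12 : d1 = d2.
  rewrite -(d1E s0 _ (curve1 s0)) => [|i]; last by rewrite c1E.
  apply: (d2E s0) => i; rewrite c2E s0E.
  have e1 : 1 + - 2%:R = - 1 :> k by ring.
  by case: i => -[|[|[|//]]] lt //=; rewrite ?e1 ?mulN1r ?opprK // s0E e1 mulN1r.
(* The parameter 0 gives the antipodal points (1, 0, 1/2) and (-1, 0, -1/2), one on each curve. *)
have ant : d1 = - d2.
  pose v := fun i : 'I_3 => [:: 1; 0; (1 + 0 ^+ 2) / 2%:R]`_i : k.
  pose w := fun i : 'I_3 => [:: - (1 + 0 ^+ 2); 0; - 2^-1]`_i : k.
  rewrite -(d1E 0 _ (curve1 0)) => [|i]; last by rewrite c1E.
  rewrite -(d2E 0 _ (curve2 0)) => [|i]; last by rewrite c2E.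
  rewrite -rmorphN /= -mug gE [mu _]descendE !evE comp_mpoly_meval.
  apply: meval_eq => i; rewrite -tnth_nth tnth_mktuple mevalN mevalXU.
  by case: i => -[|[|[|//]]] lt /=; rewrite ?expr0n /= ?addr0 ?opprK ?oppr0 ?mul1r.
have d0 : d1 = 0.
  move: ant; rewrite -d12 => /eqP; rewrite -addr_eq0 -mulr2n -mulr_natl mulf_eq0.
  by rewrite (negPf (nat_n0 1)) => /eqP.
apply: Hno; exists _, (curve1 0); split; last by left; rewrite /= oner_neq0.
by rewrite (d1E 0) // => i; rewrite c1E.
Qed.
End DringGeometry.

(** * Rotation fields and the Poisson bracket on Y *)

Section DringCalculus.
Variable k : closedFieldType.
Hypothesis char0 : [pchar k] =i pred0.
Local Notation D := (Dring k).
Local Notation R := (Rring k).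
Local Notation x0 := (piD 'X_0 : D).
Local Notation x1 := (piD 'X_1 : D).
Local Notation x2 := (piD 'X_2 : D).
Local Notation nat_n0 := (nat_neq0 char0).
Local Notation E := (lE (Y_action char0)).
Local Notation F := (lF (Y_action char0)).
Local Notation H := (lH (Y_action char0)).

Lemma line_from (a b c d : D) n :
  (forall r, \det (1%:M + r *: n) == 1) ->
  (forall g : SL2 k, forall r, (g : 'M_2) = 1%:M + r *: n ->
    Y_pullback char0 g a = b + r *: c + (r ^+ 2) *: d) ->
  lie (Y_action char0) n a = c.
Proof.
move=> det_n ga; rewrite -line_coef1.
have -> : line (Y_action char0) n a = b%:P + c%:P * 'X + d%:P * 'X^2.
  apply: (poly_eq_scalars char0) => s; rewrite -(unipE _ det_n).
  rewrite [LHS](ga (unip det_n s) s) //.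
  have sq : (s ^+ 2)%:A = s%:A * s%:A :> D by rewrite -scalerAl mul1r scalerA expr2.
  rewrite !hornerD !hornerM !hornerX !hornerC -(mulr_algl s c) -(mulr_algl (s ^+ 2) d) sq.
  by move: (s%:A) => t; ring.
by rewrite !coefD coefC !coefCM coefX coefXn /= mulr1 mulr0 add0r addr0.
Qed.

Let subst_e12 (g : SL2 k) r : (g : 'M_2) = 1%:M + r *: e12 k ->
  [/\ g 0 0 = 1, g 0 1 = r, g 1 0 = 0 & g 1 1 = 1].
Proof. by move=> ->; rewrite !mxE /= !mulr1n !mulr0n !mulr0 !addr0 mulr1 add0r. Qed.
Let subst_e21 (g : SL2 k) r : (g : 'M_2) = 1%:M + r *: e21 k ->
  [/\ g 0 0 = 1, g 0 1 = 0, g 1 0 = r & g 1 1 = 1].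
Proof. by move=> ->; rewrite !mxE /= !mulr1n !mulr0n !mulr0 !addr0 mulr1 add0r. Qed.

Let pull i (g : SL2 k) : Y_pullback char0 g (piD 'X_i) = piD (module_pullback g 'X_i).
Proof. by rewrite Y_pullbackE. Qed.

Lemma piDZ c p : piD (c *: p) = c *: piD p :> D. Proof. exact: linearZ. Qed.
Lemma piDD p q : piD (p + q) = piD p + piD q :> D. Proof. exact: rmorphD. Qed.

Let pull_e12 (g : SL2 k) r : (g : 'M_2) = 1%:M + r *: e12 k ->
  [/\ Y_pullback char0 g x0 = x0 + r *: (x1 *+ 2) + (r ^+ 2) *: (2%:R *: x2),
      Y_pullback char0 g x1 = x1 + r *: (x2 *+ 2) + (r ^+ 2) *: 0 &
      Y_pullback char0 g x2 = x2 + r *: 0 + (r ^+ 2) *: 0].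
Proof.
move=> /subst_e12[ga gb gc gd]; rewrite !pull; have [-> -> ->] := module2_pullbackX char0 g.
rewrite ga gb gc gd !(mulr0, mul0r, mul1r, mulr1, expr0n, scale0r, add0r, addr0, expr1n, scaler0) /=.
rewrite !scale1r !(piDD, piDZ) /= -[x1 *+ 2]scaler_nat -[x2 *+ 2]scaler_nat !scalerA; split=> //.
- by rewrite (mulrC r) (mulrC (r ^+ 2)).
by rewrite mulrC.
Qed.

Let pull_e21 (g : SL2 k) r : (g : 'M_2) = 1%:M + r *: e21 k ->
  [/\ Y_pullback char0 g x0 = x0 + r *: 0 + (r ^+ 2) *: 0,
      Y_pullback char0 g x1 = x1 + r *: x0 + (r ^+ 2) *: 0 &
      Y_pullback char0 g x2 = x2 + r *: x1 + (r ^+ 2) *: (2^-1 *: x0)].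
Proof.
move=> /subst_e21[ga gb gc gd]; rewrite !pull; have [-> -> ->] := module2_pullbackX char0 g.
rewrite ga gb gc gd !(mulr0, mul0r, mul1r, mulr1, expr0n, scale0r, add0r, addr0, expr1n, scaler0) /=.
rewrite !scale1r ?scale0r !(piDD, piDZ) /= ?scalerA ?scale0r ?addr0; split=> //.
- by rewrite addrC.
by rewrite addrC addrA addrAC.
Qed.

Ltac from_pull d P det := rewrite ?lEE ?lFE; apply: (@line_from _ _ _ d);
  [move=> r; exact: det
  | let g := fresh in let r := fresh in move=> g r /P[? ? ?]; eassumption].

Lemma E_x0 : E x0 = 0. Proof. from_pull (0 : D) pull_e21 det_e21. Qed.
Lemma E_x1 : E x1 = x0. Proof. from_pull (0 : D) pull_e21 det_e21. Qed.
Lemma E_x2 : E x2 = x1. Proof. from_pull (2^-1 *: x0 : D) pull_e21 det_e21. Qed.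
Lemma F_x0 : F x0 = x1 *+ 2. Proof. from_pull (2%:R *: x2 : D) pull_e12 det_e12. Qed.
Lemma F_x1 : F x1 = x2 *+ 2. Proof. from_pull (0 : D) pull_e12 det_e12. Qed.
Lemma F_x2 : F x2 = 0. Proof. from_pull (0 : D) pull_e12 det_e12. Qed.
Lemma H_x0 : H x0 = x0 *+ 2.
Proof. by rewrite /lH F_x0 E_x0 (lF0 char0) subr0 (lEMn char0) /= E_x1. Qed.
Lemma H_x1 : H x1 = 0.
Proof. by rewrite /lH F_x1 E_x1 (lEMn char0) /= E_x2 F_x0 subrr. Qed.
Lemma H_x2 : H x2 = - (x2 *+ 2).
Proof. by rewrite /lH F_x2 E_x2 (lE0 char0) F_x1 add0r. Qed.

Lemma mu_equiv g x : mu (Y_action char0 g x) = Y_action char0 g (mu x).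
Proof. exact: Y_pullback_mu. Qed.
Lemma mu_E a : mu (E a) = E (mu a). Proof. exact: (equiv_lE char0 mu_equiv). Qed.
Lemma mu_F a : mu (F a) = F (mu a). Proof. exact: (equiv_lF char0 mu_equiv). Qed.
Lemma mu_H a : mu (H a) = H (mu a). Proof. exact: (equiv_lH char0 mu_equiv). Qed.

(** Locked, so that [ring] sees an atom whose only property is [halfE]. *)
Definition dhalf : D := locked ((2^-1 : k)%:A).
Lemma halfE : dhalf *+ 2 = 1.
Proof. by rewrite /dhalf -lock -scaler_nat scalerA mulfV ?scale1r // nat_n0. Qed.
Lemma mu_half : mu dhalf = dhalf.
Proof. by rewrite /dhalf -lock linearZ rmorph1. Qed.

(* The Poisson bracket of the quadric, through the rotation fields. *)
Definition bracket (a b : D) : D :=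
  - (dhalf * x0) * (F a * H b - H a * F b) + x2 * (H a * E b - E a * H b)
  + x1 * (E a * F b - F a * E b).

Ltac gen a := move: (E a) (F a) (H a); move=> ? ? ?.

Lemma bracket_anti a b : bracket a b = - bracket b a.
Proof. rewrite /bracket; gen a; gen b; move: dhalf x0 x1 x2 => *; ring. Qed.
Lemma bracketxx a : bracket a a = 0.
Proof. rewrite /bracket; gen a; move: dhalf x0 x1 x2 => *; ring. Qed.
Lemma bracketD a b c : bracket a (b + c) = bracket a b + bracket a c.
Proof.
rewrite /bracket (lED char0) (lFD char0) (lHD char0); gen a; gen b; gen c; move: dhalf x0 x1 x2 => *; ring.
Qed.
Lemma bracketM a b c : bracket a (b * c) = b * bracket a c + c * bracket a b.
Proof.
rewrite /bracket (lEM char0) (lFM char0) (lHM char0).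
gen a; gen b; gen c; move: dhalf x0 x1 x2 => *; ring.
Qed.
Lemma bracketZ a c b : bracket a (c *: b) = c *: bracket a b.
Proof.
rewrite /bracket (lEZ char0) (lFZ char0) (lHZ char0) -(mulr_algl c (E b)) -(mulr_algl c (F b)) -(mulr_algl c (H b)) -(mulr_algl c (_ + _)).
gen a; gen b; move: dhalf x0 x1 x2 (c%:A) => *; ring.
Qed.
Lemma mu_bracket a b : mu (bracket a b) = - bracket (mu a) (mu b).
Proof.
have gen (h p q r e1 f1 h1 e2 f2 h2 : D) :
  mu (- (h * p) * (f1 * h2 - h1 * f2) + r * (h1 * e2 - e1 * h2) + q * (e1 * f2 - f1 * e2)) =
  - (mu h * mu p) * (mu f1 * mu h2 - mu h1 * mu f2) + mu r * (mu h1 * mu e2 - mu e1 * mu h2)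
  + mu q * (mu e1 * mu f2 - mu f1 * mu e2).
  by rewrite !(rmorphD, rmorphN, rmorphM).
rewrite /bracket [LHS]gen [mu dhalf]mu_half [mu x0]muX [mu x1]muX [mu x2]muX.
rewrite [mu (E a)]mu_E [mu (E b)]mu_E [mu (F a)]mu_F [mu (F b)]mu_F [mu (H a)]mu_H [mu (H b)]mu_H.
move: (mu a) (mu b) => u v; gen u; gen v; move: dhalf x0 x1 x2 => *; ring.
Qed.

Lemma bracket01 : bracket x0 x1 = x0 *+ 2.
Proof.
rewrite /bracket E_x0 F_x0 H_x0 E_x1 F_x1 H_x1.
move: halfE (x_rel k); move: dhalf x0 x1 x2 => h a b c hE r.
transitivity (a * (a * c *+ 2 - b ^+ 2) *+ 2 + 2%:R * a * a * c * (h *+ 2 - 1)); first by ring.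
rewrite r hE; ring.
Qed.
Lemma bracket02 : bracket x0 x2 = x1 *+ 2.
Proof.
rewrite /bracket E_x0 F_x0 H_x0 E_x2 F_x2 H_x2.
move: halfE (x_rel k); move: dhalf x0 x1 x2 => h a b c hE r.
transitivity (b * (a * c *+ 2 - b ^+ 2) *+ 2 + 2%:R * a * b * c * (h *+ 2 - 1)); first by ring.
rewrite r hE; ring.
Qed.
Lemma bracket12 : bracket x1 x2 = x2 *+ 2.
Proof.
rewrite /bracket E_x1 F_x1 H_x1 E_x2 F_x2 H_x2.
move: halfE (x_rel k); move: dhalf x0 x1 x2 => h a b c hE r.
transitivity (c * (a * c *+ 2 - b ^+ 2) *+ 2 + 2%:R * a * c * c * (h *+ 2 - 1)); first by ring.
rewrite r hE; ring.
Qed.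

Lemma D_ind (K : D -> Prop) : (forall c, K c%:A) -> K x0 -> K x1 -> K x2 ->
  (forall a b, K a -> K b -> K (a + b)) -> (forall a b, K a -> K b -> K (a * b)) ->
  forall a, K a.
Proof.
move=> KC K0 K1 K2 KD KM a; have [p ->] := piD_onto a.
elim/mpoly_alg_ind: p => [c|i|p q Kp Kq|p q Kp Kq].
- by rewrite -alg_mpolyC linearZ /= rmorph1; apply: (KC).
- case: i => -[|[|[|//]]] lt.
  + by rewrite (_ : Ordinal lt = 0); last exact: val_inj.
  + by rewrite (_ : Ordinal lt = 1); last exact: val_inj.
  + by rewrite (_ : Ordinal lt = 2%:R); last exact: val_inj.
- by rewrite rmorphD; apply: (KD).
- by rewrite rmorphM; apply: (KM).
Qed.

(* The relation module of the rotation fields is spanned by [kappa]. *)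
Lemma fields_rel a : x2 * E a *+ 2 + x1 * H a = x0 * F a.
Proof.
elim/D_ind: a => [c||||a b IHa IHb|a b IHa IHb].
- by rewrite (lEZ char0) (lFZ char0) (lHZ char0) (lE1 char0) (lF1 char0) (lH1 char0) !scaler0 !mulr0 mul0rn addr0.
- rewrite E_x0 F_x0 H_x0; ring.
- rewrite E_x1 F_x1 H_x1; ring.
- rewrite E_x2 F_x2 H_x2; ring.
- rewrite (lED char0) (lFD char0) (lHD char0).
  transitivity ((x2 * E a *+ 2 + x1 * H a) + (x2 * E b *+ 2 + x1 * H b)).
    gen a; gen b; move: x0 x1 x2 => *; ring.
  by rewrite IHa IHb mulrDr.
rewrite (lEM char0) (lFM char0) (lHM char0).
transitivity (a * (x2 * E b *+ 2 + x1 * H b) + b * (x2 * E a *+ 2 + x1 * H a)).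
  gen a; gen b; move: x0 x1 x2 => *; ring.
by rewrite IHa IHb; gen a; gen b; move: x0 x1 x2 => *; ring.
Qed.

(* [u * v] is the cross product of two rows [r] orthogonal to [kappa];
   [lambda] is a covector with [lambda . kappa = 1]. *)
Let cross_id (h p q r e1 f1 h1 e2 f2 h2 : D) :
  let br := - (h * p) * (f1 * h2 - h1 * f2) + r * (h1 * e2 - e1 * h2) + q * (e1 * f2 - f1 * e2) in
  r * e1 *+ 2 + q * h1 = p * f1 -> r * e2 *+ 2 + q * h2 = p * f2 ->
  q ^+ 2 = p * r *+ 2 - 1 -> h *+ 2 = 1 ->
  [/\ f1 * h2 - h1 * f2 = - (r * br *+ 2), h1 * e2 - e1 * h2 = p * br &
      e1 * f2 - f1 * e2 = - (q * br)].
Proof.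
move=> br r1 r2 rel hE.
pose v1 := p * f1 - (r * e1 *+ 2 + q * h1); pose v2 := p * f2 - (r * e2 *+ 2 + q * h2).
have v10 : v1 = 0 by rewrite /v1 r1 subrr.
have v20 : v2 = 0 by rewrite /v2 r2 subrr.
have lk : h *+ 2 * p * r + p * r - q ^+ 2 = 1 by rewrite rel hE; ring.
split.
- transitivity ((f1 * h2 - h1 * f2) * (h *+ 2 * p * r + p * r - q ^+ 2)
    + r * (h1 * v2 - h2 * v1) - q * (f1 * v2 - f2 * v1)).
    by rewrite lk v10 v20; ring.
  by rewrite /v1 /v2 /br; ring.
- transitivity ((h1 * e2 - e1 * h2) * (h *+ 2 * p * r + p * r - q ^+ 2)
    + q * (e1 * v2 - e2 * v1) + h * p * (h1 * v2 - h2 * v1)).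
    by rewrite lk v10 v20; ring.
  by rewrite /v1 /v2 /br; ring.
- transitivity ((e1 * f2 - f1 * e2) * (h *+ 2 * p * r + p * r - q ^+ 2)
    - h * p * (f1 * v2 - f2 * v1) - r * (e1 * v2 - e2 * v1)).
    by rewrite lk v10 v20; ring.
  by rewrite /v1 /v2 /br; ring.
Qed.

Lemma cross_fields a b :
  [/\ F a * H b - H a * F b = - (x2 * bracket a b *+ 2),
      H a * E b - E a * H b = x0 * bracket a b &
      E a * F b - F a * E b = - (x1 * bracket a b)].
Proof. exact: cross_id (fields_rel a) (fields_rel b) (x_rel k) halfE. Qed.

End DringCalculus.

Section AlgHom.
Variables (k : fieldType) (n : nat) (A : comAlgType k) (v : 'I_n -> A).
Definition alg_hom : {mpoly k[n]} -> A := mmap (in_alg A) v.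
HB.instance Definition _ := GRing.RMorphism.on alg_hom.
Fact alg_hom_scale : scalable alg_hom.
Proof. by move=> c p; rewrite /alg_hom mmapZ /= mulr_algl. Qed.
HB.instance Definition _ := GRing.isScalable.Build k _ _ _ alg_hom alg_hom_scale.
Lemma alg_homX i : alg_hom 'X_i = v i.
Proof. by rewrite /alg_hom mmapX mmap1U. Qed.
End AlgHom.

Section RvalMorphism.
Variable k : closedFieldType.
Fact Rval_zmod : zmod_morphism (@Rval k). Proof. by []. Qed.
Fact Rval_monoid : monoid_morphism (@Rval k). Proof. by []. Qed.
Fact Rval_scale : scalable (@Rval k). Proof. by []. Qed.
HB.instance Definition _ := GRing.isZmodMorphism.Build (Rring k) (Dring k) (@Rval k) Rval_zmod.
HB.instance Definition _ := GRing.isMonoidMorphism.Build (Rring k) (Dring k) (@Rval k) Rval_monoid.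
HB.instance Definition _ := GRing.isScalable.Build k (Rring k) (Dring k) _ (@Rval k) Rval_scale.
End RvalMorphism.

(** * Generators of the even functions and their brackets *)

Section RringFacts.
Variable k : closedFieldType.
Hypothesis char0 : [pchar k] =i pred0.
Local Notation D := (Dring k).
Local Notation R := (Rring k).
Local Notation x0 := (piD 'X_0 : D).
Local Notation x1 := (piD 'X_1 : D).
Local Notation x2 := (piD 'X_2 : D).
Local Notation nat_n0 := (nat_neq0 char0).
Local Notation bracket := (bracket char0).

Lemma muR (r : R) : mu (Rval r) = Rval r.
Proof. exact/eqP/(valP r). Qed.

Fact even_prod_subproof (i j : 'I_3) : piD 'X_i * piD 'X_j \in @mu_fixed k.
Proof. by rewrite unfold_in /mu_fixed rmorphM /= !muX mulrNN. Qed.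
Definition even_prod i j : R := MkRring (even_prod_subproof i j).
Local Notation xx := even_prod.

(** Every element of D is e + sum_i x_i o_i with e and the o_i generated by the products x_i x_j. If
    it is even, its odd part equals its own opposite and vanishes. *)
Lemma Rring_ind (K : R -> Prop) : (forall c, K c%:A) -> (forall i j, K (xx i j)) ->
  (forall a b, K a -> K b -> K (a + b)) -> (forall a b, K a -> K b -> K (a * b)) ->
  forall r, K r.
Proof.
move=> KC KX KD KM.
have K0 : K 0 by rewrite -(scale0r 1).
have Ksum (f : 'I_3 -> R) : (forall i, K (f i)) -> K (\sum_i f i).
  by move=> Kf; elim/big_ind: _.
have dec (a : D) : exists e (o : 'I_3 -> R), [/\ K e, forall i, K (o i) &
    a = Rval e + \sum_i piD 'X_i * Rval (o i)].
  have [p ->] := piD_onto a; elim/mpoly_alg_ind: p => [c|i|p q Kp Kq|p q Kp Kq].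
  - exists c%:A, (fun=> 0); split=> //; rewrite big1 ?addr0 => [|i _]; last by rewrite mulr0.
    by rewrite -alg_mpolyC linearZ /= rmorph1.
  - exists 0, (fun j => (j == i)%:R%:A); split=> //.
    rewrite (bigD1 i) //= eqxx scale1r mulr1 big1 ?addr0 ?add0r // => j /negPf ->.
    by rewrite /= scale0r mulr0.
  - have [e [o [Ke Ko E1]]] := Kp; have [e' [o' [Ke' Ko' E2]]] := Kq; rewrite rmorphD /= E1 E2.
    exists (e + e'), (fun i => o i + o' i); split=> [|i|]; [exact: KD|exact: KD|].
    by rewrite /= addrACA -big_split; congr (_ + _); apply: eq_bigr => i _; rewrite mulrDr.
  have [e [o [Ke Ko E1]]] := Kp; have [e' [o' [Ke' Ko' E2]]] := Kq.
  exists (e * e' + \sum_i \sum_j xx i j * (o i * o' j)), (fun i => e * o' i + e' * o i).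
  split=> [|i|]; [| by apply: (KD); apply: (KM) |].
    by apply: (KD); [apply: (KM) | apply: (Ksum) => i; apply: (Ksum) => j; apply: (KM); [exact: KX | apply: (KM)]].
  have RD (r s : R) : Rval (r + s) = Rval r + Rval s by [].
  have RM (r s : R) : Rval (r * s) = Rval r * Rval s by [].
  have RS (f : 'I_3 -> R) : Rval (\sum_i f i) = \sum_i Rval (f i) by apply: (big_morph _ RD).
  have -> : piD (p * q) = piD p * piD q by apply: rmorphM.
  rewrite E1 E2; set S := \sum_i piD 'X_i * Rval (o i); set S' := \sum_i piD 'X_i * Rval (o' i).
  have -> : \sum_i piD 'X_i * Rval (e * o' i + e' * o i) = Rval e * S' + Rval e' * S.
    rewrite /S /S' !mulr_sumr -big_split; apply: eq_bigr => i _ /=.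
    by rewrite mulrDr; congr (_ + _); rewrite mulrCA.
  rewrite RD RM RS; have -> : \sum_i Rval (\sum_j xx i j * (o i * o' j)) = S * S'.
    rewrite /S mulr_suml; apply: eq_bigr => i _; rewrite RS mulr_sumr.
    by apply: eq_bigr => j _; rewrite mulrACA.
  by move: (Rval e) (Rval e') S S' => *; ring.
move=> r; have [e [o [Ke _ E]]] := dec (Rval r).
suff -> : r = e by [].
apply: val_inj => /=; set s := \sum_i _ in E.
have mus : mu s = - s.
  rewrite rmorph_sum -sumrN; apply: eq_bigr => i _; rewrite rmorphM /= muX muR mulNr //.
have : Rval e + s = Rval e - s by rewrite -{1}E -{1}(muR r) E rmorphD /= mus muR.
move/addrI/eqP; rewrite -addr_eq0 -mulr2n -scaler_nat => /eqP s0.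
by rewrite E -[s]scale1r -(mulVf (nat_n0 1)) -scalerA s0 scaler0 addr0.
Qed.

(* Relations of the Veronese surface x_i x_j on the conic cone, plus the equation of the quadric. *)
Lemma xx_rels : [/\ xx 0 0 * xx 1 1 = xx 0 1 ^+ 2,
  xx 0 2%:R = (2^-1 : k)%:A * (1 + xx 1 1), xx 0 0 * xx 1 2%:R = xx 0 1 * xx 0 2%:R,
  xx 0 0 * xx 2%:R 2%:R = xx 0 2%:R ^+ 2 & xx 2%:R 2%:R * xx 0 1 = xx 1 2%:R * xx 0 2%:R].
Proof.
split; apply: val_inj; rewrite /= ?expr2 /=; move: (x_rel k); move: x0 x1 x2 => a b c r; try by ring.
by rewrite -[b * b]expr2 r mulr_algl addrC subrK -scaler_nat scalerA mulVf ?scale1r // nat_n0.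
Qed.

Lemma xx_rels2 : xx 2%:R 2%:R * xx 1 1 = xx 1 2%:R ^+ 2.
Proof. by apply: val_inj => /=; move: x0 x1 x2 => a b c; ring. Qed.

Lemma xxC i j : xx i j = xx j i.
Proof. by apply: val_inj; rewrite /= mulrC. Qed.

Lemma ord3P (K : 'I_3 -> Prop) : K 0 -> K 1 -> K 2%:R -> forall i, K i.
Proof.
move=> K0 K1 K2 [[|[|[|//]]] lt].
- by rewrite (_ : Ordinal lt = 0); last exact: val_inj.
- by rewrite (_ : Ordinal lt = 1); last exact: val_inj.
- by rewrite (_ : Ordinal lt = 2%:R); last exact: val_inj.
Qed.

Section DerivationVanishing.
Variables (U : comNzRingType) (g : {rmorphism R -> U}) (d : R -> U).
Hypothesis d_der : derivation g d.
Hypothesis d_cst : forall c, d c%:A = 0.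

Let dD a b : d (a + b) = d a + d b. Proof. by case: d_der. Qed.
Let dM a b : d (a * b) = g a * d b + g b * d a. Proof. by case: d_der. Qed.
Let d1 : d 1 = 0. Proof. by rewrite -(d_cst 1) scale1r. Qed.

Lemma derivation_gen0 : (forall i j, d (xx i j) = 0) -> forall r, d r = 0.
Proof.
move=> dx; elim/Rring_ind => // a b da db; rewrite ?dD ?dM da db ?addr0 //.
by rewrite !mulr0 addr0.
Qed.

Let reg i := forall y, g (xx i i) * y = 0 -> y = 0.

(** Where x0 is invertible, x0^2 and x0 x1 are local coordinates of X: differentiating the relations
    determines the other products up to the regular factor x0^2. *)
Lemma derivation_eq0 : reg 0 -> d (xx 0 0) = 0 -> d (xx 0 1) = 0 -> forall r, d r = 0.
Proof.
move=> reg0 d00 d01; have [r1 r2 r3 r4 _] := xx_rels.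
have d11 : d (xx 1 1) = 0.
  by apply: reg0; have := congr1 d r1; rewrite expr2 !dM d00 d01 !mulr0 !addr0.
have d02 : d (xx 0 2%:R) = 0 by rewrite r2 dM d_cst dD d1 d11 addr0 !mulr0 addr0.
have d12 : d (xx 1 2%:R) = 0.
  by apply: reg0; have := congr1 d r3; rewrite !dM d00 d01 d02 !mulr0 !addr0.
have d22 : d (xx 2%:R 2%:R) = 0.
  by apply: reg0; have := congr1 d r4; rewrite expr2 !dM d00 d02 !mulr0 !addr0.
apply: derivation_gen0; do 2!(apply: ord3P) => //; by rewrite xxC.
Qed.

Lemma derivation_eq0' : reg 2%:R -> d (xx 2%:R 2%:R) = 0 -> d (xx 1 2%:R) = 0 -> forall r, d r = 0.
Proof.
move=> reg2 d22 d12; have [_ r2 _ r4 r5] := xx_rels.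
have d11 : d (xx 1 1) = 0.
  by apply: reg2; have := congr1 d xx_rels2; rewrite expr2 !dM d22 d12 !mulr0 !addr0.
have d02 : d (xx 0 2%:R) = 0 by rewrite r2 dM d_cst dD d1 d11 addr0 !mulr0 addr0.
have d01 : d (xx 0 1) = 0.
  by apply: reg2; have := congr1 d r5; rewrite !dM d22 d12 d02 !mulr0 !addr0.
have d00 : d (xx 0 0) = 0.
  by apply: reg2; have := congr1 d r4; rewrite expr2 !dM d22 d02 !mulr0 addr0 add0r.
apply: derivation_gen0; do 2!(apply: ord3P) => //; by rewrite xxC.
Qed.
End DerivationVanishing.

Local Notation br a b := (bracket (Rval a) (Rval b)).

Lemma bracketMl a b c : bracket (a * b) c = a * bracket b c + b * bracket a c.
Proof. by rewrite bracket_anti bracketM opprD -!mulrN -(bracket_anti char0 a) -(bracket_anti char0 b). Qed.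
Lemma bracket_cst a c : bracket a c%:A = 0.
Proof.
rewrite bracketZ; have := bracketM char0 a 1 1; rewrite !mul1r => /eqP.
by rewrite -subr_eq subrr eq_sym => /eqP ->; rewrite scaler0.
Qed.

Lemma brackets_xx :
  [/\ br (xx 0 0) (xx 0 1) = x0 ^+ 3 *+ 4,
      br (xx 0 0) (xx 2%:R 2%:R) = x0 * x1 * x2 *+ 8 &
      br (xx 0 1) (xx 1 2%:R) = x0 * x1 * x2 *+ 4 + x1 ^+ 3 *+ 2].
Proof.
have B a b c d : bracket (a * b) (c * d) = a * (c * bracket b d + d * bracket b c)
    + b * (c * bracket a d + d * bracket a c) by rewrite bracketMl !bracketM.
rewrite /= !B [bracket x0 x0]bracketxx [bracket x1 x1]bracketxx bracket01 bracket02 bracket12.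
by move: x0 x1 x2 => *; split; ring.
Qed.

(** A certificate that the brackets have no common zero. They yield 4 x0^3, 2 x1 and 4 x1^3; with y
    = x1^2 and 2 x0 x2 = 1 + y the identity reads 1 = (1 + y)^3 - 3 y - (3 + y) y^2. *)
Lemma brackets_unimodular :
  1 = x2 ^+ 3 *+ 2 * br (xx 0 0) (xx 0 1)
      - dhalf k * x1 *+ 3 * (br (xx 0 0) (xx 2%:R 2%:R) - br (xx 0 1) (xx 1 2%:R))
      - (3%:R + x1 ^+ 2) * dhalf k ^+ 2 * x1
        * (br (xx 0 1) (xx 1 2%:R) *+ 2 - br (xx 0 0) (xx 2%:R 2%:R)).
Proof.
have [-> -> ->] := brackets_xx; move: (halfE char0) (x_rel k); move: (dhalf k) x0 x1 x2 => h a b c hE r.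
have -> : a * b * c *+ 8 - (a * b * c *+ 4 + b ^+ 3 *+ 2) = b *+ 2.
  by transitivity (b * (a * c *+ 2 - b ^+ 2) *+ 2); [ring | rewrite r; ring].
have -> : h * b *+ 3 * (b *+ 2) = b ^+ 2 *+ 3 by transitivity (b ^+ 2 *+ 3 * (h *+ 2)); [ring | rewrite hE mulr1].
have -> : (a * b * c *+ 4 + b ^+ 3 *+ 2) *+ 2 - a * b * c *+ 8 = b ^+ 3 *+ 4 by ring.
transitivity ((a * c *+ 2) ^+ 3 - b ^+ 2 *+ 3 - (3%:R + b ^+ 2) * b ^+ 4 * (h *+ 2) ^+ 2); last by ring.
have -> : a * c *+ 2 = 1 + b ^+ 2 by rewrite r; ring.
by rewrite hE; ring.
Qed.

(** The unit ideal is expressed through arbitrary predicates closed like ideals; they are later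
    instantiated with the zeros at a point and with conductors such as the c for which c v is a
    multiple of b. *)
Lemma brackets_generate (K : {pred D}) : (forall a b c, a \in K -> b \in K -> a + c * b \in K) ->
  0 \in K -> (forall a b : R, br a b \in K) -> 1 \in K.
Proof.
move=> KD K0 KR.
have KM b c : b \in K -> c * b \in K by move=> Kb; rewrite -[_ * _]add0r; apply: (KD).
have Ka b c : b \in K -> c \in K -> b + c \in K by move=> Kb Kc; rewrite -[c]mul1r; apply: (KD).
have KN a : a \in K -> - a \in K by move=> Ka'; rewrite -mulN1r; apply: (KM).
rewrite brackets_unimodular; apply: (Ka); [apply: (Ka)|].
- by apply: (KM); apply: (KR).
- by apply: (KN); apply: (KM); apply: (Ka); [apply: (KR) | apply: (KN); apply: (KR)].
apply: (KN); apply: (KM); apply: (Ka); last by apply: (KN); apply: (KR).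
by rewrite mulr2n; apply: (Ka); apply: (KR).
Qed.
End RringFacts.

Lemma sum5 (V : nmodType) (f : 'I_5 -> V) :
  \sum_j f j = f 0 + (f 1 + (f 2%:R + (f 3%:R + f 4%:R))).
Proof.
rewrite 5!big_ord_recl big_ord0 addr0.
by congr (_ + (f _ + (f _ + (f _ + f _)))); apply: val_inj.
Qed.

(** * Binary quartics and the embeddings into 5-space and 4-space *)

Section Quartic.
Variables (k : closedFieldType) (K : fieldType) (sc : {rmorphism k -> K}) (X Y Z : K).
Let scD a b : sc (a + b) = sc a + sc b. Proof. exact: rmorphD. Qed.
Let scM a b : sc (a * b) = sc a * sc b. Proof. exact: rmorphM. Qed.

(** For X = u^2, Y = u v, Z = v^2/2 this is the binary quartic with coefficients [P]. The monomial
    u^2 v^2 equals both Y^2 and 2 X Z; its lift 2 (X Z + Y^2) / 3 is the one that stays in the copy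
    of V(4) inside Sym^2 V(2), complementary to the invariant 2 X Z - Y^2. *)
Definition quartic_val (P : {poly k}) := sc P`_0 * X ^+ 2 + sc P`_1 * (X * Y)
  + 2%:R * sc P`_2 * ((X * Z + Y ^+ 2) / 3%:R) + 2%:R * sc P`_3 * (Y * Z) + 4%:R * sc P`_4 * Z ^+ 2.

Lemma quartic_valE a1 b1 a2 b2 a3 b3 a4 b4 :
  quartic_val (lin_poly a1 b1 * (lin_poly a2 b2 * (lin_poly a3 b3 * (lin_poly a4 b4 * 1)))) =
  sc a1 * sc a2 * sc a3 * sc a4 * X ^+ 2
  + (sc b1 * sc a2 * sc a3 * sc a4 + sc a1 * sc b2 * sc a3 * sc a4
     + sc a1 * sc a2 * sc b3 * sc a4 + sc a1 * sc a2 * sc a3 * sc b4) * (X * Y)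
  + 2%:R * (sc b1 * sc b2 * sc a3 * sc a4 + sc b1 * sc a2 * sc b3 * sc a4
     + sc b1 * sc a2 * sc a3 * sc b4 + sc a1 * sc b2 * sc b3 * sc a4
     + sc a1 * sc b2 * sc a3 * sc b4 + sc a1 * sc a2 * sc b3 * sc b4)
     * ((X * Z + Y ^+ 2) / 3%:R)
  + 2%:R * (sc a1 * sc b2 * sc b3 * sc b4 + sc b1 * sc a2 * sc b3 * sc b4
     + sc b1 * sc b2 * sc a3 * sc b4 + sc b1 * sc b2 * sc b3 * sc a4) * (Y * Z)
  + 4%:R * (sc b1 * sc b2 * sc b3 * sc b4) * Z ^+ 2.
Proof.
have c1 j : (1 : {poly k})`_j = (j == 0%N)%:R by rewrite coef1.
rewrite /quartic_val !coef_lin_mul !c1 /= !(mulr0, mulr1, addr0, add0r).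
rewrite !scD !scM.
ring.
Qed.

Lemma quartic_valD (P : {poly k}) (n : K) : 3%:R != 0 :> K -> 6%:R != 0 :> K -> n != 0 ->
  1%:R / n * sc P`_0 * (X * X) + (1%:R / n * sc P`_1 * (X * Y)
    + (2%:R / n * sc P`_2 * (3%:R^-1 * (X * Z + Y * Y))
    + (6%:R / n * sc P`_3 * (3%:R^-1 * (Y * Z)) + 24%:R / n * sc P`_4 * (6%:R^-1 * (Z * Z)))))
  = quartic_val P / n.
Proof.
move=> n3 n6 n0; rewrite /quartic_val.
move: (sc _) (sc _) (sc _) (sc _) (sc _) => *; field; by apply/and3P.
Qed.

Definition Y0 a b := sc a ^+ 2 * X + 2%:R * sc a * sc b * Y + 2%:R * sc b ^+ 2 * Z.
Definition Y1 a b c d := sc a * sc c * X + (sc a * sc d + sc b * sc c) * Y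
    + 2%:R * sc b * sc d * Z.
Definition Y2 c d := sc c ^+ 2 / 2%:R * X + sc c * sc d * Y + sc d ^+ 2 * Z.

(** [Y0], [Y1], [Y2] are the transformed coordinates of the quadric. Acting on the quartic gives the
    same result as acting on the coordinates and then forming the five products. *)
Lemma quartic_val_forms a b c d (p := lin_poly a b) (q := lin_poly c d) :
  2%:R != 0 :> K -> 3%:R != 0 :> K -> 6%:R != 0 :> K -> 24%:R != 0 :> K ->
  [/\ quartic_val (p ^+ 4 * q ^+ 0) / 1%:R = Y0 a b * Y0 a b,
      quartic_val (p ^+ 3 * q ^+ 1) / 1%:R = Y0 a b * Y1 a b c d,
      quartic_val (p ^+ 2 * q ^+ 2) / 2%:R = 3%:R^-1 * (Y0 a b * Y2 c d + Y1 a b c d * Y1 a b c d),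
      quartic_val (p ^+ 1 * q ^+ 3) / 6%:R = 3%:R^-1 * (Y1 a b c d * Y2 c d) &
      quartic_val (p ^+ 0 * q ^+ 4) / 24%:R = 6%:R^-1 * (Y2 c d * Y2 c d)].
Proof.
move=> n2 n3 n6 n24.
have e4 : p ^+ 4 * q ^+ 0 = p * (p * (p * (p * 1))) by ring.
have e3 : p ^+ 3 * q ^+ 1 = p * (p * (p * (q * 1))) by ring.
have e2 : p ^+ 2 * q ^+ 2 = p * (p * (q * (q * 1))) by ring.
have e1 : p ^+ 1 * q ^+ 3 = p * (q * (q * (q * 1))) by ring.
have e0 : p ^+ 0 * q ^+ 4 = q * (q * (q * (q * 1))) by ring.
rewrite e4 e3 e2 e1 e0 !quartic_valE /Y0 /Y1 /Y2.
move: (sc a) (sc b) (sc c) (sc d) => {e4 e3 e2 e1 e0 p q} {}a {}b {}c {}d.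
split; field; rewrite ?n2 ?n3 ?n6 ?n24 ?oner_neq0 //.
Qed.
End Quartic.

Section Embeddings.
Variable k : closedFieldType.
Hypothesis char0 : [pchar k] =i pred0.
Local Notation D := (Dring k).
Local Notation R := (Rring k).
Local Notation x0 := (piD 'X_0 : D).
Local Notation x1 := (piD 'X_1 : D).
Local Notation x2 := (piD 'X_2 : D).
Local Notation nat_n0 := (nat_neq0 char0).
Local Notation xx := (@even_prod k).

Lemma closed_embedding_gen (A : comAlgType k) (f : {lrmorphism A -> R}) :
  (forall i j, exists b, f b = xx i j) -> closed_embedding f.
Proof.
move=> fx; elim/Rring_ind => // [c|a b [a' <-] [b' <-]|a b [a' <-] [b' <-]].
- by exists c%:A; rewrite linearZ /= rmorph1.
- by exists (a' + b'); rewrite rmorphD.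
- by exists (a' * b'); rewrite rmorphM.
Qed.

Lemma sextuple (K : 'I_3 -> 'I_3 -> Prop) : (forall i j, K i j -> K j i) ->
  K 0 0 -> K 0 1 -> K 0 2%:R -> K 1 1 -> K 1 2%:R -> K 2%:R 2%:R -> forall i j, K i j.
Proof. by move=> Ks a b c d e f; apply: ord3P; apply: ord3P => //; apply: (Ks). Qed.

Definition emb4 : 'I_4 -> R := fun i =>
  [:: xx 0 1; xx 1 1; xx 2%:R 2%:R; xx 0 0 - xx 1 2%:R *+ 2]`_i.

Lemma embedding4 : exists f : {lrmorphism {mpoly k[4]} -> R}, closed_embedding f.
Proof.
exists (alg_hom emb4); apply: closed_embedding_gen.
have im i : exists b, alg_hom emb4 b = emb4 i by exists 'X_i; rewrite alg_homX.
have imD a b : (exists a', alg_hom emb4 a' = a) -> (exists b', alg_hom emb4 b' = b) ->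
    exists c, alg_hom emb4 c = a + b.
  by move=> [a' <-] [b' <-]; exists (a' + b'); rewrite rmorphD.
have imM a b : (exists a', alg_hom emb4 a' = a) -> (exists b', alg_hom emb4 b' = b) ->
    exists c, alg_hom emb4 c = a * b.
  by move=> [a' <-] [b' <-]; exists (a' * b'); rewrite rmorphM.
have imC c : exists b, alg_hom emb4 b = c%:A.
  by exists c%:A; rewrite linearZ /= rmorph1.
have i01 := im 0; have i11 := im 1; have i22 := im 2%:R; have is_ := im 3%:R.
have i1 : exists b, alg_hom emb4 b = 1 by exists 1; rewrite rmorph1.
have i12 : exists b, alg_hom emb4 b = xx 1 2%:R.
  (* With y = x1^2 this is x1 x2 times (1 + y)^2 - (2 + y) y = 1: the first summand uses 2 x0 x2 = 1
     + y, and in the second [emb4 0 * emb4 0 - emb4 3 * emb4 1] is 2 x1^3 x2. *)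
  have -> : xx 1 2%:R = 2%:R%:A * emb4 2%:R * emb4 0 * (1 + emb4 1)
     + (- 2^-1)%:A * (2%:R%:A + emb4 1) * (emb4 0 * emb4 0 + (-1)%:A * emb4 3%:R * emb4 1).
    apply: val_inj; rewrite /= !scaler_nat scaleNr scaleN1r -[_ *: 1]/((2^-1 : k)%:A).
    move: (x_rel k) (halfE char0); rewrite /dhalf -lock; move: ((2^-1)%:A : D) x0 x1 x2 => h a b c r hE.
    have r' : a * c *+ 2 = 1 + b ^+ 2 by rewrite r; ring.
    transitivity (b * c * (a * c *+ 2) * (1 + b ^+ 2) - h *+ 2 * (2%:R + b ^+ 2) * b ^+ 3 * c).
      by rewrite r' hE; ring.
    by ring.
  by repeat first [exact: (im) | exact: (i1) | exact: (imC) | apply: (imD) | apply: (imM)].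
have i00 : exists b, alg_hom emb4 b = xx 0 0.
  have -> : xx 0 0 = emb4 3%:R + xx 1 2%:R + xx 1 2%:R by rewrite /emb4 /= -addrA -mulr2n subrK.
  by apply: (imD); [apply: (imD)|].
have i02 : exists b, alg_hom emb4 b = xx 0 2%:R.
  have [_ -> _ _ _] := xx_rels char0.
  by apply: (imM); [exact: imC | apply: (imD)].
by apply: sextuple => // i j; rewrite xxC.
Qed.

(** A basis of V(4) in the normalisation u^(4-i) v^i / i! of [sym_mx]; the middle entry is the
    V(4)-component of x0 x2, up to the constant fixed by the equation of Y. *)
Definition emb5 : 'I_5 -> R := fun i =>
  [:: xx 0 0; xx 0 1; (3%:R^-1 : k) *: (xx 0 2%:R + xx 1 1);
      (3%:R^-1 : k) *: xx 1 2%:R; (6%:R^-1 : k) *: xx 2%:R 2%:R]`_i.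

Lemma embedding5_onto : closed_embedding (alg_hom emb5).
Proof.
apply: closed_embedding_gen.
have im i : exists b, alg_hom emb5 b = emb5 i by exists 'X_i; rewrite alg_homX.
have imD a b : (exists a', alg_hom emb5 a' = a) -> (exists b', alg_hom emb5 b' = b) ->
    exists c, alg_hom emb5 c = a + b.
  by move=> [a' <-] [b' <-]; exists (a' + b'); rewrite rmorphD.
have imZ c b : (exists b', alg_hom emb5 b' = b) -> exists d, alg_hom emb5 d = c *: b.
  by move=> [b' <-]; exists (c *: b'); rewrite linearZ.
have i1 : exists b, alg_hom emb5 b = 1 by exists 1; rewrite rmorph1.
have i02 : exists b, alg_hom emb5 b = xx 0 2%:R.
  have -> : xx 0 2%:R = emb5 2%:R + (3%:R^-1) *: 1.
    apply: val_inj => /=; move: (x_rel k); rewrite expr2 => ->.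
    rewrite -scalerDr addrA subrK -mulrS -scaler_nat scalerA mulVf ?scale1r //; exact: nat_n0.
  by apply: (imD) => //; apply: (imZ).
have i11 : exists b, alg_hom emb5 b = xx 1 1.
  have [_ e _ _ _] := xx_rels char0.
  have -> : xx 1 1 = 2%:R *: xx 0 2%:R + (-1) *: 1.
    by rewrite e mulr_algl scalerA mulfV ?nat_n0 // scale1r scaleN1r addrC addKr.
  by apply: (imD); apply: (imZ).
have i12 : exists b, alg_hom emb5 b = xx 1 2%:R.
  have -> : xx 1 2%:R = 3%:R *: emb5 3%:R by rewrite scalerA mulfV ?nat_n0 // scale1r.
  exact: imZ.
have i22 : exists b, alg_hom emb5 b = xx 2%:R 2%:R.
  have -> : xx 2%:R 2%:R = 6%:R *: emb5 4%:R by rewrite scalerA mulfV ?nat_n0 // scale1r.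
  exact: imZ.
apply: sextuple => //; [by move=> i j; rewrite xxC| exact: (im 0)| exact: (im 1)].
Qed.

Definition scal : k -> {fraction {mpoly k[2]}} := emb char0 \o in_alg D.
HB.instance Definition _ := GRing.RMorphism.on scal.
Lemma emb_scal c a : emb char0 (c *: a) = scal c * emb char0 a.
Proof. by rewrite /scal /= -rmorphM mulr_algl. Qed.

Lemma embD a b : emb char0 (a + b) = emb char0 a + emb char0 b.
Proof. exact: rmorphD. Qed.
Lemma scalD a b : scal (a + b) = scal a + scal b. Proof. exact: rmorphD. Qed.
Lemma scalM a b : scal (a * b) = scal a * scal b. Proof. exact: rmorphM. Qed.
Lemma scalX a n : scal (a ^+ n) = scal a ^+ n. Proof. exact: rmorphXn. Qed.
Lemma scalV a : scal a^-1 = (scal a)^-1. Proof. exact: fmorphV. Qed.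
Lemma scaln n : scal n%:R = n%:R. Proof. exact: rmorph_nat. Qed.

Local Notation X0 := (emb char0 x0).
Local Notation X1 := (emb char0 x1).
Local Notation X2 := (emb char0 x2).

Local Notation Y0 := (Y0 scal X0 X1 X2).
Local Notation Y1 := (Y1 scal X0 X1 X2).
Local Notation Y2 := (Y2 scal X0 X1 X2).

Lemma Y0E a b : emb char0 (piD ((a ^+ 2) *: 'X_0 + (2%:R * a * b) *: 'X_1 + (2%:R * b ^+ 2) *: 'X_2)) = Y0 a b.
Proof. by rewrite !piDD !piDZ !embD !emb_scal [scal (_ * b ^+ _)]scalM !scalX !scalM !scaln. Qed.
Lemma Y1E a b c d : emb char0 (piD ((a * c) *: 'X_0 + (a * d + b * c) *: 'X_1 + (2%:R * b * d) *: 'X_2))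
  = Y1 a b c d.
Proof. by rewrite !piDD !piDZ !embD !emb_scal !scalD !scalM !scaln. Qed.
Lemma Y2E c d : emb char0 (piD ((c ^+ 2 / 2%:R) *: 'X_0 + (c * d) *: 'X_1 + (d ^+ 2) *: 'X_2)) = Y2 c d.
Proof. by rewrite !piDD !piDZ !embD !emb_scal [scal (c ^+ _ * _)]scalM !scalX scalM scalV !scaln. Qed.

Lemma embM a b : emb char0 (a * b) = emb char0 a * emb char0 b.
Proof. exact: rmorphM. Qed.

Lemma emb5_val (j : 'I_5) : emb char0 (Rval (emb5 j)) =
  [:: X0 * X0; X0 * X1; 3%:R^-1 * (X0 * X2 + X1 * X1); 3%:R^-1 * (X1 * X2); 6%:R^-1 * (X2 * X2)]`_j.
Proof.
have RD (r s : R) : Rval (r + s) = Rval r + Rval s by [].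
have RZ c (r : R) : Rval (c *: r) = c *: Rval r by [].
case: j => -[|[|[|[|[|//]]]]] lt; rewrite /emb5 [nth]lock /= -lock ?RZ.
- exact: embM.
- exact: embM.
- by rewrite [LHS]emb_scal RD embD !embM scalV scaln.
- by rewrite [LHS]emb_scal embM scalV scaln.
by rewrite [LHS]emb_scal embM scalV scaln.
Qed.

Lemma sym4_val (M : 'M[k]_2) (i : 'I_5) :
  emb char0 (Rval (\sum_j sym_mx 4 M i j *: emb5 j)) =
  quartic_val scal X0 X1 X2 (lin_poly (M 0 0) (M 0 1) ^+ (4 - i) * lin_poly (M 1 0) (M 1 1) ^+ i) / (i`!)%:R.
Proof.
have [n3 n6 ni] : [/\ 3%:R != 0 :> {fraction {mpoly k[2]}},
    6%:R != 0 :> {fraction {mpoly k[2]}} & (i`!)%:R != 0 :> {fraction {mpoly k[2]}}].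
  by split; rewrite -scaln fmorph_eq0 // ?nat_n0 // -(prednK (fact_gt0 i)) nat_n0.
have RD (r s : R) : Rval (r + s) = Rval r + Rval s by [].
have RZ c (r : R) : Rval (c *: r) = c *: Rval r by [].
have sE (j : 'I_5) (q : nat) : j = q :> nat -> sym_mx 4 M i j = q`!%:R / i`!%:R
   * (lin_poly (M 0 0) (M 0 1) ^+ (4 - i) * lin_poly (M 1 0) (M 1 1) ^+ i)`_q.
  by move=> <-; rewrite mxE.
move: (lin_poly _ _ ^+ _ * _) sE => P sE.
rewrite (big_morph (@Rval k) RD (erefl (Rval (0 : R)))) (big_morph (emb char0) embD (rmorph0 (emb char0))).
rewrite (eq_bigr (fun j => scal (sym_mx 4 M i j) * emb char0 (Rval (emb5 j)))); last first.
  by move=> j _; apply: emb_scal.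
rewrite sum5.
rewrite (sE _ 0%N) // (sE _ 1%N) // (sE _ 2%N) // (sE _ 3%N) // (sE _ 4%N) //.
rewrite 5!emb5_val; have [-> -> -> -> ->] : [/\ 0`! = 1, 1`! = 1, 2`! = 2, 3`! = 6 & 4`! = 24]%N by [].
rewrite !scalM !scalV !scaln. exact: (quartic_valD scal X0 X1 X2 P n3 n6 ni).
Qed.

(** Compared on the coordinates after embedding D into the field k(X_0, X_1), where the denominators
    of [sym_mx] are handled by [field]. *)
Lemma embedding5_equivariant :
  equivariant (X_action char0) (irreducible_module char0 4) (alg_hom emb5).
Proof.
move=> g b; pose h1 := alg_hom emb5 \o irreducible_module char0 4 g.
pose h2 := X_action char0 g \o alg_hom emb5.
suff : h1 =1 h2 by apply.
apply: mpoly_hom_eq => i; rewrite /h1 /h2 /= module_pullbackX linear_sum /= alg_homX.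
under eq_bigr do rewrite linearZ /= alg_homX.
apply: val_inj; apply: (@emb_inj _ char0); rewrite [LHS]sym4_val.
have [u0 u1 u2] := module2_pullbackX char0 g.
have y0 : emb char0 (Y_pullback char0 g x0) = Y0 (g 0 0) (g 0 1) by rewrite Y_pullbackE u0 Y0E.
have y1 : emb char0 (Y_pullback char0 g x1) = Y1 (g 0 0) (g 0 1) (g 1 0) (g 1 1) by rewrite Y_pullbackE u1 Y1E.
have y2 : emb char0 (Y_pullback char0 g x2) = Y2 (g 1 0) (g 1 1) by rewrite Y_pullbackE u2 Y2E.
have [n2 n3 n6] : [/\ 2%:R != 0 :> {fraction {mpoly k[2]}}, 3%:R != 0 :> {fraction {mpoly k[2]}} &
    6%:R != 0 :> {fraction {mpoly k[2]}}].
  by split; rewrite -scaln fmorph_eq0 nat_n0.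
pose ey a := emb char0 (Y_pullback char0 g a).
have eyM a c : ey (a * c) = ey a * ey c by rewrite /ey !rmorphM.
have eyD a c : ey (a + c) = ey a + ey c by rewrite /ey !rmorphD.
have eyZ a c : ey (a *: c) = scal a * ey c by rewrite /ey linearZ emb_scal.
have RD (r s : R) : Rval (r + s) = Rval r + Rval s by [].
have RZ c (r : R) : Rval (c *: r) = c *: Rval r by [].
rewrite -[RHS]/(ey (Rval (emb5 i))).
have n24 : 24%:R != 0 :> {fraction {mpoly k[2]}} by rewrite -scaln fmorph_eq0 nat_n0.
have [q4 q3 q2 q1 q0] := quartic_val_forms scal X0 X1 X2 (g 0 0) (g 0 1) (g 1 0) (g 1 1) n2 n3 n6 n24.
case: i => -[|[|[|[|[|//]]]]] lt; rewrite /emb5 [nth]lock /= -lock ?RZ.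
- by rewrite [LHS]q4 [RHS]eyM /ey y0.
- by rewrite [LHS]q3 [RHS]eyM /ey y0 y1.
- by rewrite [LHS]q2 [RHS]eyZ RD eyD !eyM /ey y0 y1 y2 scalV scaln.
- by rewrite [LHS]q1 [RHS]eyZ eyM /ey y1 y2 scalV scaln.
by rewrite [LHS]q0 [RHS]eyZ eyM /ey y2 scalV scaln.
Qed.
End Embeddings.

Lemma mpoly_chain (k : comNzRingType) n (A : comNzRingType) (f : {rmorphism {mpoly k[n]} -> A})
    (U : comNzRingType) (g : {rmorphism A -> U}) (d : A -> U) :
  derivation g d -> (forall c, d (f c%:MP) = 0) ->
  forall p, d (f p) = \sum_i g (f p^`M(i)) * d (f 'X_i).
Proof.
move=> [dD dM] d0; elim/mpoly_alg_ind => [c|i|p q IHp IHq|p q IHp IHq].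
- by rewrite d0 big1 // => i _; rewrite mderivC !rmorph0 mul0r.
- rewrite (bigD1 i) //= mderivXU eqxx !rmorph1 mul1r.
  by rewrite big1 ?addr0 // => j ne; rewrite mderivXU (negPf ne) !rmorph0 mul0r.
- rewrite rmorphD dD IHp IHq -big_split; apply: eq_bigr => i _ /=.
  by rewrite mderivD !rmorphD mulrDl.
rewrite rmorphM dM IHp IHq !mulr_sumr -big_split; apply: eq_bigr => i _ /=.
by rewrite mderivM !(rmorphD, rmorphM) /=; ring.
Qed.

(** Partial derivatives lower the degree, so by induction they all vanish and [p] is constant in
    characteristic 0. This serves to show that maps out of polynomial rings are injective. *)
Lemma deriv_stable_eq0 (k : fieldType) (char0 : [pchar k] =i pred0) n
    (K : {mpoly k[n]} -> Prop) : (forall p, K p -> forall i, K p^`M(i)) ->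
  (forall c, K c%:MP -> c = 0) -> forall p, K p -> p = 0.
Proof.
move=> Kd Kc p Kp; have [b] : exists b, forall m, m \in msupp p -> (mdeg m < b)%N.
  by exists (msize p) => m; apply: msize_mdeg_lt.
elim: b => [|b IH] in p Kp * => Hb.
  by apply/mpolyP => m; rewrite mcoeff0; apply/eqP; rewrite mcoeff_eq0; apply/negP => /Hb.
have d0 i : p^`M(i) = 0.
  apply: IH; first exact: Kd.
  move=> m; rewrite -[_ \in _]negbK -mcoeff_eq0 mcoeff_deriv => nz.
  have /Hb : (m + U_(i))%MM \in msupp p by rewrite -[_ \in _]negbK -mcoeff_eq0; apply: contraNneq nz => ->; rewrite mul0rn.
  by rewrite mdegD mdeg1 addn1 ltnS.
have pE : p = (p@_0%MM)%:MP.
  apply/mpolyP => m; rewrite mcoeffC; case: (eqVneq 0%MM m) => [<-|m0]; first by rewrite mulr1.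
  rewrite mulr0; have /existsP[i mi] : [exists i, m i != 0%N].
    rewrite -negb_forall; apply: contra m0 => /forallP H; apply/eqP/mnmP => i.
    by rewrite mnm0E; apply/esym/eqP.
  have /(congr1 (fun q : {mpoly _[_]} => q@_(m - U_(i)))) := d0 i.
  rewrite mcoeff_deriv mcoeff0 submK ?lep1mP // -mulr_natr => /eqP.
  by rewrite mulf_eq0 (negPf (nat_neq0 char0 _)) orbF => /eqP.
by rewrite pE (Kc (p@_0%MM)) ?mpolyC0 // -pE.
Qed.

Lemma mderiv_mwiden (k : fieldType) n (p : {mpoly k[n]}) i :
  (mwiden p)^`M(widen_ord (leqnSn n) i) = mwiden p^`M(i).
Proof.
elim/mpoly_alg_ind: p => [c|j|p q IHp IHq|p q IHp IHq].
- by rewrite mwidenC !mderivC mwiden0.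
- rewrite mwidenX mnmwiden1 !mderivXU.
  rewrite (_ : (widen_ord _ i == widen_ord _ j) = (i == j)) //; by case: (i == j); rewrite ?mwiden1 ?mwiden0.
- by rewrite mwidenD !mderivD mwidenD IHp IHq.
by rewrite mwidenM !mderivM mwidenD !mwidenM IHp IHq.
Qed.

Lemma mderiv_mwiden_max (k : fieldType) n (p : {mpoly k[n]}) : (mwiden p)^`M(ord_max) = 0.
Proof.
elim/mpoly_alg_ind: p => [c|j|p q IHp IHq|p q IHp IHq].
- by rewrite mwidenC mderivC.
- by rewrite mwidenX mnmwiden1 mderivXU -val_eqE /= gtn_eqF.
- by rewrite mwidenD mderivD IHp IHq addr0.
by rewrite mwidenM mderivM IHp IHq mul0r mulr0 addr0.
Qed.

(** * No embedding into 3-space *)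

Section NoEmbedding3.
Variable k : closedFieldType.
Hypothesis char0 : [pchar k] =i pred0.
Local Notation D := (Dring k).
Local Notation R := (Rring k).
Local Notation xx := (@even_prod k).
Local Notation bracket := (bracket char0).

Lemma phi_cst n (f : {lrmorphism {mpoly k[n]} -> R}) c : Rval (f c%:MP) = c%:A.
Proof.
by rewrite -alg_mpolyC; transitivity (Rval (c *: f 1)); [congr Rval; exact: linearZ | rewrite (rmorph1 f)].
Qed.

Lemma bracket0 a : bracket a 0 = 0.
Proof. by have := bracketZ char0 a 0 0; rewrite !scale0r. Qed.

Section Bracket.
Variables (n : nat) (f : {lrmorphism {mpoly k[n]} -> R}).
Local Notation B := {mpoly k[n]}.
Local Notation phi p := (Rval (f p)).

Lemma bracket_chain (a : D) p :
  bracket a (phi p) = \sum_i phi p^`M(i) * bracket a (phi 'X_i).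
Proof.
have H := @mpoly_chain k n D (@Rval k \o f) D idfun (bracket a); apply: H => [|c].
  by split=> b c; [exact: bracketD | exact: bracketM].
by rewrite /= phi_cst bracket_cst.
Qed.

Hypothesis f_onto : closed_embedding f.

Lemma bracket_images_unimodular (K : {pred D}) : (forall a b c, a \in K -> b \in K -> a + c * b \in K) ->
  0 \in K -> (forall i j, bracket (phi 'X_i) (phi 'X_j) \in K) -> 1 \in K.
Proof.
move=> KD K0 KX.
have KM b c : b \in K -> c * b \in K by move=> Kb; rewrite -[_ * _]add0r; apply: (KD).
have Ka b c : b \in K -> c \in K -> b + c \in K by move=> Kb Kc; rewrite -[c]mul1r; apply: (KD).
have Ksum m (F : 'I_m -> D) : (forall i, F i \in K) -> \sum_i F i \in K.
  by move=> KF; elim/big_ind: _.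
apply: (brackets_generate (char0 := char0) KD K0) => a b.
have [p <-] := f_onto a; have [q <-] := f_onto b.
rewrite bracket_chain; apply: (Ksum) => i; apply: (KM).
rewrite bracket_anti bracket_chain -mulN1r; apply: (KM).
by apply: (Ksum) => j; apply: (KM).
Qed.

Lemma bracket_images_neq0 v (pv : point v) : exists i j, ev pv (bracket (phi 'X_i) (phi 'X_j)) != 0.
Proof.
apply: contrapT => H; have : 1 \in [pred d | ev pv d == 0].
  apply: bracket_images_unimodular => [a b c|| i j]; rewrite !inE ?rmorph0 //.
    by move=> /eqP a0 /eqP b0; rewrite rmorphD rmorphM /= a0 b0 mulr0 addr0.
  by apply/negP => /negP nz; apply: H; exists i, j.
by rewrite inE rmorph1 oner_eq0.
Qed.
End Bracket.

Lemma alg_neq0 (c : k) : c%:A = 0 :> D -> c = 0.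
Proof.
have pv := curve1 char0 0; move/(congr1 (ev pv)); rewrite evZ rmorph1 mulr1 rmorph0 //.
Qed.

(* A closed surface in affine 3-space is a hypersurface f = 0. The gradient of f
   restricted to X is an odd multiple of the bracket vector, hence vanishes at
   some point, where the three coordinates would be independent to first order. *)
Lemma no_embedding3_bracket (f : {lrmorphism {mpoly k[3]} -> R}) : closed_embedding f ->
  bracket (Rval (f 'X_0)) (Rval (f 'X_1)) = 0.
Proof.
move=> f_onto; apply: contrapT => /eqP b01.
pose phi p := Rval (f p).
pose r i := phi 'X_i; pose b (i : 'I_3) := [:: bracket (r 1) (r 2%:R); bracket (r 2%:R) (r 0); bracket (r 0) (r 1)]`_i.
have chain a p : bracket a (phi p) = \sum_i phi p^`M(i) * bracket a (r i) by apply: bracket_chain.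
have sum3 (V : nmodType) (F : 'I_3 -> V) : \sum_i F i = F 0 + F 1 + F 2%:R.
  by rewrite !big_ord_recl big_ord0 addr0 addrA; congr (F _ + F _ + F _); apply: val_inj.
have [h [h0 hP]] : exists h, phi h = 0 /\ forall p, phi p = 0 -> exists q, p = q * h.
  pose chi0 : {rmorphism {poly {mpoly k[2]}} -> D} := (@Rval k \o f) \o @mpoly_of_uni k 2.
  have chi_idom p q : chi0 (p * q) = 0 -> chi0 p = 0 \/ chi0 q = 0.
    by rewrite rmorphM => /(Dring_integral char0).
  (* If c(r0, r1) = 0, bracketing with r0 and r1 shows that both partial derivatives of c also
     vanish there, because the bracket of r0 and r1 is not 0. *)
  have chi_inj c : chi0 c%:P = 0 -> c = 0.
    apply: (deriv_stable_eq0 char0 (K := fun c => chi0 c%:P = 0)) => {c} [c c0 i|c]; last first.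
      by rewrite /chi0 /= mpoly_of_uniC mwidenC phi_cst => /alg_neq0.
    have {}c0 : phi (mwiden c) = 0 by rewrite -mpoly_of_uniC.
    have w2 : (mwiden c)^`M(2%:R) = 0.
      by rewrite (_ : 2%:R = ord_max) ?mderiv_mwiden_max //; apply: val_inj.
    have wi (j : 'I_2) (l : 'I_3) : j = l :> nat -> (mwiden c)^`M(l) = mwiden c^`M(j).
      by move=> jl; rewrite (_ : l = widen_ord (leqnSn 2) j) ?mderiv_mwiden //; apply: val_inj.
    have two a : phi (mwiden c^`M(0)) * bracket a (r 0) + phi (mwiden c^`M(1)) * bracket a (r 1) = 0.
      have := chain a (mwiden c); rewrite sum3 w2 (wi 0 0) // (wi 1 1) // c0.
      by rewrite /phi [Rval (f 0)](rmorph0 (@Rval k \o f)) mul0r addr0 bracket0 => <-.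
    have p0 : phi (mwiden c^`M(0)) = 0.
      have := two (r 1); rewrite bracketxx mulr0 addr0 bracket_anti => /(Dring_integral char0)[//|/eqP].
      by rewrite oppr_eq0 (negPf b01).
    have p1 : phi (mwiden c^`M(1)) = 0.
      have := two (r 0); rewrite bracketxx mulr0 add0r => /(Dring_integral char0)[//|/eqP].
      by rewrite (negPf b01).
    rewrite /chi0 /= mpoly_of_uniC; case: i => -[|[|//]] lt.
      by rewrite (_ : Ordinal lt = 0) ?p0; last exact: val_inj.
    by rewrite (_ : Ordinal lt = 1) ?p1; last exact: val_inj.
  have chi0E p : chi0 (muni p) = phi p by rewrite /chi0 /= muniK.
  have [ex|nex] := pselect (exists2 p, p != 0 & chi0 p = 0).
    have [h h0 hP] := principal_kernel (@gcd_domain_mpoly k 2) chi_idom chi_inj ex.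
    exists (mpoly_of_uni h); split=> // p p0; have [|q qE] := hP (muni p); first by rewrite chi0E.
    by exists (mpoly_of_uni q); rewrite -rmorphM /= -qE; apply/esym/muniK.
  exists 0; split=> [|p p0]; first by rewrite /phi [LHS](rmorph0 (@Rval k \o f)).
  exists 0; rewrite mulr0; apply/eqP/negPn/negP => pn0; apply: nex; exists (muni p); last by rewrite chi0E.
  by apply: contraNneq pn0 => p0'; rewrite -[p](@muniK k 2) p0' rmorph0.
pose v i := phi h^`M(i).
have vb a : \sum_i v i * bracket a (r i) = 0 by rewrite -chain h0 bracket0.
have unim (K : {pred D}) : (forall a b c, a \in K -> b \in K -> a + c * b \in K) ->
    0 \in K -> (forall i, b i \in K) -> 1 \in K.
  move=> KD K0 Kb; apply: (bracket_images_unimodular f_onto KD K0).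
  have KN a : a \in K -> - a \in K by move=> Ka; rewrite -[- a]add0r -mulN1r; apply: KD.
  have k0 : bracket (r 1) (r 2%:R) \in K := Kb 0.
  have k1 : bracket (r 2%:R) (r 0) \in K := Kb 1.
  have k2 : bracket (r 0) (r 1) \in K := Kb 2%:R.
  by do 2!apply: ord3P; rewrite ?bracketxx //; rewrite bracket_anti; apply: (KN).
have anti3 (a0 a1 a2 c0 c1 c2 : D) : a0 * 0 + a1 * c2 + a2 * (- c1) = 0 ->
    a0 * (- c2) + a1 * 0 + a2 * c0 = 0 -> a0 * c1 + a1 * (- c0) + a2 * 0 = 0 ->
    [/\ a0 * c1 = c0 * a1, a1 * c2 = c1 * a2 & a2 * c0 = c2 * a0].
  move=> e0 e1 e2; split; apply/eqP; rewrite -subr_eq0; apply/eqP.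
  - by rewrite -e2; ring.
  - by rewrite -e0; ring.
  by rewrite -e1; ring.
(* The three relations [vb (r 0)], [vb (r 1)], [vb (r 2%:R)] together say that the cross product of
   v and b is zero. *)
have par i j : b i * v j = v i * b j.
  have e0 := vb (r 0); have e1 := vb (r 1); have e2 := vb (r 2%:R).
  rewrite !sum3 !bracketxx in e0 e1 e2.
  rewrite (bracket_anti char0 (r 0) (r 2%:R)) in e0.
  rewrite (bracket_anti char0 (r 1) (r 0)) in e1.
  rewrite (bracket_anti char0 (r 2%:R) (r 1)) in e2.
  have [f01 f12 f20] := anti3 _ _ _ _ _ _ e0 e1 e2.
  move: i j; do 2!apply: ord3P; rewrite /b /=; first [exact: mulrC
    | exact: esym f01 | exact: esym f12 | exact: esym f20
    | by rewrite mulrC f01 mulrC | by rewrite mulrC f12 mulrC | by rewrite mulrC f20 mulrC].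
(* Each b_i multiplies v into the multiples of b, by parallelism; the b_i generate the unit ideal,
   so v itself is a multiple. *)
have [g gP] : exists g, forall i, v i = g * b i.
  have : 1 \in [pred c | `[< exists g, forall i, c * v i = g * b i >]].
    apply: unim => [a c e||i]; rewrite ?inE.
    - move=> /asboolP[ga gaP] /asboolP[gc gcP]; apply/asboolP; exists (ga + e * gc) => i.
      by rewrite mulrDl gaP -mulrA gcP mulrA -mulrDl.
    - by apply/asboolP; exists 0 => i; rewrite !mul0r.
    by apply/asboolP; exists (v i) => j; apply: par.
  rewrite inE => /asboolP[g gP]; exists g => i; by rewrite -gP mul1r.
have mub i : mu (b i) = - b i.
  by move: i; apply: ord3P; rewrite /b /= mu_bracket !muR.
have mug : mu g = - g.
  apply/eqP; rewrite -addr_eq0.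
  have : 1 \in [pred c | c * (mu g + g) == 0].
    apply: unim => [a c e||i]; rewrite ?inE ?mul0r //.
      by move=> /eqP a0 /eqP c0; rewrite mulrDl -mulrA c0 a0 mulr0 addr0.
    have := muR (f h^`M(i)); rewrite -/(phi _) -/(v i) gP rmorphM /= mub mulrN => /eqP.
    by rewrite eq_sym -addr_eq0 -mulrDl addrC mulrC.
  by rewrite inE mul1r.
have [w [pw [evg w02]]] := odd_zero char0 mug.
have ev0 p : phi p = 0 -> forall i, ev pw (phi p^`M(i)) = 0.
  move=> /hP[q ->] i; rewrite mderivM.
  have -> : phi (q^`M(i) * h + q * h^`M(i)) = phi q^`M(i) * phi h + phi q * v i.
    by rewrite /phi !rmorphD !rmorphM.
  by rewrite h0 mulr0 add0r gP !rmorphM /= evg mul0r mulr0.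
pose s a := sval (cid (f_onto a)); have sK a : f (s a) = a by rewrite /s; case: cid.
(* The derivative in the direction c at the zero of g. The gradient of h vanishes there, so every
   direction of 3-space descends to a point derivation of R. *)
pose del (c : 'rV[k]_3) p := \sum_i c 0 i * ev pw (phi p^`M(i)).
pose d c a := del c (s a).
have delB c p q : del c (p - q) = del c p - del c q.
  rewrite /del -sumrB; apply: eq_bigr => i _; rewrite -mulrBr mderivB; congr (_ * _).
  by rewrite /phi !rmorphB.
have dE c p : d c (f p) = del c p.
  apply/eqP; rewrite -subr_eq0 -[d c _]/(del c (s (f p))) -delB; apply/eqP; apply: big1 => i _; rewrite ev0 ?mulr0 //.
  by have e : f (s (f p) - p) = 0; [rewrite rmorphB /= sK subrr | rewrite /phi e].
have d_der c : derivation (ev pw \o @Rval k) (d c).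
  split=> x y; rewrite -(sK x) -(sK y) -?(rmorphD f) -?(rmorphM f) !dE /del.
    rewrite -big_split; apply: eq_bigr => i _ /=; rewrite mderivD -mulrDr; congr (_ * _).
    by rewrite /phi !rmorphD.
  rewrite !mulr_sumr -big_split; apply: eq_bigr => i _ /=; rewrite mderivM.
  have -> : ev pw (phi ((s x)^`M(i) * s y + s x * (s y)^`M(i))) =
     ev pw (phi (s x)^`M(i)) * ev pw (Rval (f (s y))) + ev pw (Rval (f (s x))) * ev pw (phi (s y)^`M(i)).
    by rewrite /phi !rmorphD !rmorphM.
  by ring.
have d_cst c a : d c a%:A = 0.
  rewrite -[a%:A](_ : f a%:MP = _); last by rewrite -alg_mpolyC linearZ /= rmorph1.
  by rewrite dE; apply: big1 => i _; rewrite mderivC /phi !rmorph0 mulr0.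
(* Two linear conditions on three-dimensional directions leave a nonzero solution. Near the chosen
   point two of the products are local coordinates, so the resulting derivation is zero, although it
   sends X_j to c_j. *)
have killing (u1 u2 : R) : exists2 c, c != 0 & d c u1 = 0 /\ d c u2 = 0.
  pose M : 'M[k]_(3, 2) := \matrix_(i, j) ev pw (phi (s (if j == 0 then u1 else u2))^`M(i)).
  have : kermx M != 0 by rewrite -mxrank_eq0 mxrank_ker subn_eq0 -ltnNge (leq_ltn_trans (rank_leq_col M)).
  case/rowV0Pn => c /sub_kermxP cM c0; exists c => //.
  have E j : d c (if j == 0 then u1 else u2) = (c *m M) 0 j.
    by rewrite mxE /d /del; apply: eq_bigr => i _; rewrite mxE.
  by split; [have := E 0 | have := E 1]; rewrite cM mxE.
have reg i : w i != 0 -> forall y, (ev pw \o @Rval k) (xx i i) * y = 0 -> y = 0.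
  move=> wi y /=; rewrite rmorphM /= !evX => /eqP.
  by rewrite !mulf_eq0 !(negPf wi) => /eqP.
have [c c0 dc0] : exists2 c, c != 0 & forall a, d c a = 0.
  case: w02 => [w0|w2].
    have [c c0 [d00 d01]] := killing (xx 0 0) (xx 0 1); exists c => //.
    by apply: (derivation_eq0 char0 (d_der c) (d_cst c)) => //; apply: reg.
  have [c c0 [d22 d12]] := killing (xx 2%:R 2%:R) (xx 1 2%:R); exists c => //.
  by apply: (derivation_eq0' char0 (d_der c) (d_cst c)) => //; apply: reg.
case/eqP: c0; apply/rowP => j; rewrite mxE.
have := dc0 (f 'X_j); rewrite dE /del (bigD1 j) //= mderivXU eqxx /phi !rmorph1 mulr1.
by rewrite big1 ?addr0 // => i ne; rewrite mderivXU (negPf ne) !rmorph0 mulr0.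
Qed.

Lemma no_embedding3 : ~ exists f : {lrmorphism {mpoly k[3]} -> R}, closed_embedding f.
Proof.
move=> [f f_onto].
have [i [j nz]] := bracket_images_neq0 f_onto (curve1 char0 0).
have {}nz : bracket (Rval (f 'X_i)) (Rval (f 'X_j)) != 0.
  by apply: contraNneq nz => ->; rewrite rmorph0.
have ij : i != j by apply: contraNneq nz => ->; rewrite bracketxx.
(* A permutation of the coordinates carrying 0 and 1 to i and j. *)
pose p : {perm 'I_3} := (tperm 1%R (tperm 0%R i j) * tperm 0%R i)%g.
have p0 : p 0 = i.
  have n1 : tperm 0 i j != 0.
    by apply/eqP => e; case/eqP: ij; rewrite -(tpermK 0 i j) e tpermL.
  by rewrite permM (tpermD (x := 1)) ?tpermL.
have p1 : p 1 = j by rewrite permM tpermL tpermK.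
pose f' := alg_hom (fun l => f 'X_(p l)).
pose h := f' \o alg_hom (fun l => 'X_(p^-1 l)%g).
have fE : f =1 h by apply: mpoly_hom_eq => l; rewrite /h /= !alg_homX permKV.
have f'_onto : closed_embedding f'.
  by move=> a; have [b <-] := f_onto a; rewrite fE; eexists.
have e0 : f' 'X_0 = f 'X_i by rewrite -p0; apply: alg_homX.
have e1 : f' 'X_1 = f 'X_j by rewrite -p1; apply: alg_homX.
by case/eqP: nz; rewrite -e0 -e1; apply: no_embedding3_bracket f'_onto.
Qed.
End NoEmbedding3.

(** * Jacobians in three variables and the cylinders *)

Section TriDerivation.
Variables (A U : comNzRingType) (i : {rmorphism A -> U}) (Cst : A -> Prop).
Variables (I : Type) (G : I -> A) (S : A -> A -> A -> U).
Hypothesis G_dense : forall d, derivation i d -> (forall c, Cst c -> d c = 0) ->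
  (forall p, d (G p) = 0) -> forall a, d a = 0.
Hypothesis S_der : forall b c, derivation i (fun a => S a b c).
Hypothesis S_cst : forall a b c, Cst a -> S a b c = 0.
Hypothesis S_rot : forall a b c, S a b c = S b c a.
Hypothesis S_anti : forall a b c, S a b c = - S b a c.
Hypothesis S_diag : forall a c, S a a c = 0.

(** Density of [G] is applied to one argument at a time; cyclic symmetry brings each argument to the
    first place. *)
Lemma triderivation_eq0 : (forall p q r, S (G p) (G q) (G r) = 0) -> forall a b c, S a b c = 0.
Proof.
move=> SG.
have s2 p q c : S c (G p) (G q) = 0.
  by move: c; apply: (G_dense (S_der _ _)) => [c /S_cst //|r].
have s3 p b c : S c (G p) b = 0.
  by move: c; apply: (G_dense (S_der _ _)) => [c /S_cst //|r]; rewrite -S_rot s2.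
move=> a b c; move: a; apply: (G_dense (S_der b c)) => [a /S_cst //|p].
by rewrite -S_rot s3.
Qed.
End TriDerivation.

Section CoefficientwiseDerivation.
Variables (A : comNzRingType) (d : A -> A).
Hypothesis d_der : derivation idfun d.
Let dD a b : d (a + b) = d a + d b. Proof. by case: d_der. Qed.
Let dM a b : d (a * b) = a * d b + b * d a. Proof. by case: d_der. Qed.
Let d0 : d 0 = 0. Proof. by apply: (addrI (d 0)); rewrite -dD !addr0. Qed.

Definition coefw (p : {poly A}) : {poly A} := \poly_(i < size p) d p`_i.
Lemma coef_coefw p i : (coefw p)`_i = d p`_i.
Proof. by rewrite coef_poly; case: ltnP => // /(nth_default 0) ->. Qed.
Lemma coefw_der : derivation idfun coefw.
Proof.
split=> p q; apply/polyP => i; first by rewrite coefD !coef_coefw coefD dD.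
rewrite coefD !coef_coefw !coefM (big_morph d dD d0).
rewrite [X in _ + X](reindex_inj rev_ord_inj) -big_split; apply: eq_bigr => j _ /=.
by rewrite !coef_coefw dM subSS subKn // -ltnS.
Qed.
Lemma coefwC c : coefw c%:P = (d c)%:P.
Proof. by apply/polyP => i; rewrite coef_coefw !coefC; case: eqP. Qed.
Lemma coefw_map (f : {rmorphism A -> A}) : (forall a, f (d a) = d (f a)) ->
  forall p, map_poly f (coefw p) = coefw (map_poly f p).
Proof. by move=> fd p; apply/polyP => i; rewrite coef_map /= !coef_coefw coef_map /= fd. Qed.
End CoefficientwiseDerivation.

Lemma deriv_derivation (A : comNzRingType) : derivation idfun (@deriv A).
Proof. by split=> p q; rewrite ?derivD // derivM addrC [_^`() * q]mulrC. Qed.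

Section Jacobian.
Variables (A : comNzRingType) (l1 l2 l3 : A) (e f h t : A -> A).
Definition wedge2 a b : A :=
  l1 * (f a * h b - h a * f b) + l2 * (h a * e b - e a * h b) + l3 * (e a * f b - f a * e b).
(** The Jacobian of three functions on Y x A^1: the Poisson bivector of Y wedged with the derivation
    [t] along the line. *)
Definition wedge3 a b c := wedge2 a b * t c + wedge2 b c * t a + wedge2 c a * t b.

Lemma wedge3_rot a b c : wedge3 a b c = wedge3 b c a.
Proof. by rewrite /wedge3 -addrA addrC. Qed.
Lemma wedge2_anti a b : wedge2 a b = - wedge2 b a.
Proof. rewrite /wedge2; ring. Qed.
Lemma wedge3_anti a b c : wedge3 a b c = - wedge3 b a c.
Proof.
by rewrite /wedge3 (wedge2_anti a b) (wedge2_anti b c) (wedge2_anti c a) !mulNr -!opprD addrAC.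
Qed.
Lemma wedge3_diag a c : wedge3 a a c = 0.
Proof. rewrite /wedge3 /wedge2; ring. Qed.
Lemma wedge3_der : derivation idfun e -> derivation idfun f -> derivation idfun h ->
  derivation idfun t -> forall b c, derivation idfun (fun a => wedge3 a b c).
Proof.
move=> [eD eM] [fD fM] [hD hM] [tD tM] b c; split=> x y; rewrite /wedge3 /wedge2.
  rewrite eD fD hD tD; ring.
rewrite eM fM hM tM /=; ring.
Qed.
Lemma wedge3_cst a b c : e a = 0 -> f a = 0 -> h a = 0 -> t a = 0 -> wedge3 a b c = 0.
Proof. by move=> ea fa ha ta; rewrite /wedge3 /wedge2 ea fa ha ta; ring. Qed.
Lemma wedge3_morph (m : {rmorphism A -> A}) : m l1 = - l1 -> m l2 = - l2 -> m l3 = - l3 ->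
  (forall a, m (e a) = e (m a)) -> (forall a, m (f a) = f (m a)) ->
  (forall a, m (h a) = h (m a)) -> (forall a, m (t a) = t (m a)) ->
  forall a b c, m (wedge3 a b c) = - wedge3 (m a) (m b) (m c).
Proof.
move=> m1 m2 m3 me mf mh mt a b c; rewrite /wedge3 /wedge2.
rewrite !(rmorphD, rmorphM, rmorphB, rmorphN) /= m1 m2 m3 !me !mf !mh !mt; ring.
Qed.
End Jacobian.

Lemma wedge3_polyCX (A : comNzRingType) (l1 l2 l3 : A) (e f h : A -> A) a b :
  derivation idfun e -> derivation idfun f -> derivation idfun h ->
  wedge3 l1%:P l2%:P l3%:P (coefw e) (coefw f) (coefw h) (@deriv A) a%:P b%:P 'X =
  (wedge2 l1 l2 l3 e f h a b)%:P.
Proof.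
move=> de df dh; rewrite /wedge3 derivX !derivC !mulr0 !addr0 mulr1 /wedge2.
by rewrite !(coefwC de) !(coefwC df) !(coefwC dh) !(polyCD, polyCN, polyCM).
Qed.

Section JacobianTransport.
Variables (A U : comNzRingType) (i f : {rmorphism A -> U}) (g : U -> A).
Hypotheses (fK : cancel f g) (gK : cancel g f).
Variables (J : U -> U -> U -> U) (Cst : A -> Prop) (G : 'I_3 -> A) (M : {rmorphism U -> U}).
Hypothesis G_dense : forall d, derivation i d -> (forall c, Cst c -> d c = 0) ->
  (forall p, d (G p) = 0) -> forall a, d a = 0.
Hypothesis J_der : forall b c, derivation idfun (fun a => J a b c).
Hypothesis J_rot : forall a b c, J a b c = J b c a.
Hypothesis J_anti : forall a b c, J a b c = - J b a c.
Hypothesis J_diag : forall a c, J a a c = 0.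
Hypothesis J_cstf : forall c y z, Cst c -> J (f c) y z = 0.
Hypothesis J_csti : forall c y z, Cst c -> J (i c) y z = 0.
Let JR a b c := J (i a) (i b) (i c).
Hypothesis J_reg : forall y, JR (G 0) (G 1) (G 2%:R) * y = 0 -> y = 0.
Hypothesis J_uni : forall K : {pred U}, (forall a b c, a \in K -> b \in K -> a + c * b \in K) ->
  0 \in K -> (forall a b c, JR a b c \in K) -> 1 \in K.
Hypothesis M_i : forall a, M (i a) = i a.
Hypothesis M_J : forall a b c, M (JR a b c) = - JR a b c.

(** The Jacobian transported back through [f] is proportional to the original one, as both are
    alternating triderivations; unimodularity makes the factor H a function. It is odd, since the
    transported Jacobian takes invariant values while the original is anti-invariant. *)
Lemma jacobian_transport : exists H, M H = - H /\
  forall (F : comNzRingType) (e : {rmorphism U -> F}), e H = 0 -> False.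
Proof.
have gD a b : g (a + b) = g a + g b by apply: (can_inj fK); rewrite gK rmorphD /= !gK.
have gM a b : g (a * b) = g a * g b by apply: (can_inj fK); rewrite gK rmorphM /= !gK.
have g1 : g 1 = 1 by apply: (can_inj fK); rewrite gK rmorph1.
have g0 : g 0 = 0 by apply: (can_inj fK); rewrite gK rmorph0.
have gN t : g (- t) = - g t by apply/eqP; rewrite -addr_eq0 -gD addNr g0.
pose J' a b c : U := i (g (J (f a) (f b) (f c))).
have der' b c : derivation i (fun a => J' a b c).
  have [jD jM] := J_der (f b) (f c); split=> x y; rewrite /J'.
    by rewrite rmorphD jD gD rmorphD.
  by rewrite rmorphM jM gD !gM /= !fK rmorphD !rmorphM.
have derR b c : derivation i (fun a => JR a b c).
  have [jD jM] := J_der (i b) (i c); split=> x y; rewrite /JR.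
    by rewrite rmorphD jD.
  by rewrite rmorphM jM.
have prop a b c : J' a b c * JR (G 0) (G 1) (G 2%:R) = JR a b c * J' (G 0) (G 1) (G 2%:R).
  pose S a b c := J' a b c * JR (G 0) (G 1) (G 2%:R) - JR a b c * J' (G 0) (G 1) (G 2%:R).
  apply/eqP; rewrite -subr_eq0; apply/eqP; rewrite -/(S a b c).
  have S_rot r y z : S r y z = S y z r.
    by rewrite /S /J' /JR J_rot (J_rot (i r)).
  have S_anti r y z : S r y z = - S y r z.
    by rewrite /S /J' /JR J_anti (J_anti (i r)) gN rmorphN !mulNr -opprB opprK addrC.
  have S_diag r z : S r r z = 0.
    by rewrite /S /J' /JR !J_diag g0 rmorph0 !mul0r subr0.
  have S_base : S (G 0) (G 1) (G 2%:R) = 0 by rewrite /S mulrC subrr.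
  apply: (triderivation_eq0 (i := i) G_dense) => //.
  - move=> y z; have [d1 d2] := der' y z; have [d3 d4] := derR y z.
    by split=> r s; rewrite /S ?d1 ?d2 ?d3 ?d4; ring.
  - by move=> r y z cr; rewrite /S /J' /JR (J_cstf _ _ cr) (J_csti _ _ cr) g0 rmorph0 !mul0r subr0.
  have r0 y z : S y z y = 0 by rewrite S_rot S_rot S_diag.
  have l0 y z : S z y y = 0 by rewrite S_rot S_diag.
  have b1 : S (G 1) (G 2%:R) (G 0) = 0 by rewrite -S_rot.
  have b2 : S (G 2%:R) (G 0) (G 1) = 0 by rewrite S_rot.
  do 3!apply: ord3P;
    first [exact: S_diag | exact: r0 | exact: l0 | exact: S_base | exact: b1 | exact: b2
      | by rewrite S_anti ?S_base ?b1 ?b2 oppr0].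
have [H HP] : exists H, forall a b c, J' a b c = H * JR a b c.
  have : 1 \in [pred y | `[< exists H, forall a b c, y * J' a b c = H * JR a b c >]].
    apply: J_uni => [a c e||a b c]; rewrite ?inE.
    - move=> /asboolP[Ga GaP] /asboolP[Gc GcP]; apply/asboolP; exists (Ga + e * Gc) => *.
      by rewrite mulrDl GaP -mulrA GcP mulrA -mulrDl.
    - by apply/asboolP; exists 0 => *; rewrite !mul0r.
    apply/asboolP; exists (J' a b c) => u v w; apply/eqP; rewrite -subr_eq0; apply/eqP.
    apply: J_reg; have := prop u v w; have := prop a b c.
    move: (JR (G 0) _ _) (J' (G 0) _ _) (JR u v w) (J' u v w) (JR a b c) (J' a b c).
    move=> c1 c2 c3 c4 c5 c6 e1 e2.
    transitivity (c5 * (c4 * c1) - (c6 * c1) * c3); first by ring.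
    by rewrite e1 e2; ring.
  by rewrite inE => /asboolP[H HP]; exists H => *; rewrite -HP mul1r.
exists H; split.
  apply/eqP; rewrite -addr_eq0.
  have : 1 \in [pred y | y * (M H + H) == 0].
    apply: J_uni => [a c e||a b c]; rewrite ?inE ?mul0r //.
      by move=> /eqP a0 /eqP c0; rewrite mulrDl -mulrA c0 a0 mulr0 addr0.
    have := M_i (g (J (f a) (f b) (f c))).
    rewrite -/(J' a b c) HP rmorphM /= M_J mulrN => /eqP.
    by rewrite eq_sym -addr_eq0 -mulrDl addrC mulrC.
  by rewrite inE mul1r.
move=> F e eH.
(* Every [i a] is in the image of [f], so [i (g (JR a b c))] is a transported Jacobian, hence a
   multiple of H. At a zero of H unimodularity would give 1 = 0. *)
have : 1 \in [pred y | `[< forall c, e (i (g (c * y))) = 0 >]].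
  apply: J_uni => [a c r||a b c]; rewrite ?inE.
  - move=> /asboolP aP /asboolP cP; apply/asboolP => z.
    by rewrite mulrDr gD mulrA rmorphD rmorphD aP cP addr0.
  - by apply/asboolP => z; rewrite mulr0 g0 !rmorph0.
  apply/asboolP => z; rewrite gM /JR -(gK (i a)) -(gK (i b)) -(gK (i c)) rmorphM.
  by rewrite -/(J' _ _ _) HP !rmorphM /= eH mul0r mulr0.
rewrite inE => /asboolP/(_ 1); rewrite mulr1 g1 !rmorph1 => /eqP.
by rewrite oner_eq0.
Qed.
End JacobianTransport.

Section Cylinders.
Variable k : closedFieldType.
Hypothesis char0 : [pchar k] =i pred0.
Local Notation D := (Dring k).
Local Notation R := (Rring k).
Local Notation x0 := (piD 'X_0 : D).
Local Notation x1 := (piD 'X_1 : D).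
Local Notation x2 := (piD 'X_2 : D).
Local Notation xx := (@even_prod k).
Local Notation bracket := (bracket char0).
Local Notation E := (lE (Y_action char0)).
Local Notation F := (lF (Y_action char0)).
Local Notation H := (lH (Y_action char0)).

Let derE : derivation idfun E. Proof. by split=> a b; [exact: lED | exact: lEM]. Qed.
Let derF : derivation idfun F. Proof. by split=> a b; [exact: lFD | exact: lFM]. Qed.
Let derH : derivation idfun H. Proof. by split=> a b; [exact: lHD | exact: lHM]. Qed.

Definition jac := wedge3 (- (dhalf k * x0))%:P x2%:P x1%:P (coefw E) (coefw F) (coefw H) (@deriv D).

Lemma jac_der b c : derivation idfun (fun a => jac a b c).
Proof.
apply: wedge3_der; [exact: coefw_der|exact: coefw_der|exact: coefw_der|].
exact: deriv_derivation.
Qed.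

Lemma jac_bracket a b : jac a%:P b%:P 'X = (bracket a b)%:P.
Proof.
have := @wedge3_polyCX D (- (dhalf k * x0)) x2 x1 E F H a b derE derF derH.
by rewrite -[wedge2 _ _ _ _ _ _ a b]/(bracket a b).
Qed.

Definition incl : {poly R} -> {poly D} := map_poly (@Rval k).
HB.instance Definition _ := GRing.RMorphism.on incl.

Lemma map_mu_incl p : map_poly (@mu k) (incl p) = incl p.
Proof. by apply/polyP => i; rewrite !coef_map /= muR. Qed.

Lemma mu_jac p q r : map_poly (@mu k) (jac (incl p) (incl q) (incl r)) = - jac (incl p) (incl q) (incl r).
Proof.
have e0 : mu (- (dhalf k * x0)) = - - (dhalf k * x0).
  have e1 : mu (- (dhalf k * x0)) = - mu (dhalf k * x0) by exact: rmorphN.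
  have e2 : mu (dhalf k * x0) = mu (dhalf k) * mu x0 by exact: rmorphM.
  by rewrite e1 e2 mu_half [mu x0]muX mulrN.
pose M : {rmorphism {poly D} -> {poly D}} := map_poly (@mu k).
have m0 : M (- (dhalf k * x0))%:P = - (- (dhalf k * x0))%:P.
  by rewrite /M /= map_polyC -polyCN; apply: (congr1 polyC e0).
have m2 : M x2%:P = - x2%:P.
  by rewrite /M /= map_polyC -polyCN; apply: (congr1 polyC (muX _ _)).
have m1 : M x1%:P = - x1%:P.
  by rewrite /M /= map_polyC -polyCN; apply: (congr1 polyC (muX _ _)).
have mE a : M (coefw E a) = coefw E (M a) by apply: coefw_map => //; apply: mu_E.
have mF a : M (coefw F a) = coefw F (M a) by apply: coefw_map => //; apply: mu_F.
have mH a : M (coefw H a) = coefw H (M a) by apply: coefw_map => //; apply: mu_H.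
have mT a : M a^`() = (M a)^`() by rewrite /M /= deriv_map.
have Mi a : M (incl a) = incl a by apply: map_mu_incl.
have e := @wedge3_morph {poly D} _ _ _ _ _ _ _ M m0 m2 m1 mE mF mH mT (incl p) (incl q) (incl r).
by apply: (etrans e); rewrite !Mi.
Qed.

Lemma jac_unimodular (K : {pred {poly D}}) : (forall a b c, a \in K -> b \in K -> a + c * b \in K) ->
  0 \in K -> (forall a b : R, jac (incl a%:P) (incl b%:P) (incl 'X) \in K) -> 1 \in K.
Proof.
move=> KD K0 KX.
have := @brackets_generate _ char0 [pred c | c%:P \in K]; rewrite !inE polyC1; apply=> [a b c||a b].
- by rewrite !inE polyCD polyCM; apply: (KD).
- by rewrite polyC0.
by rewrite inE -jac_bracket; have := KX a b; rewrite /incl !map_polyC map_polyX.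
Qed.

Lemma poly_D_cancel (a : D) (p : {poly D}) : a != 0 -> a%:P * p = 0 -> p = 0.
Proof.
move=> a0 /polyP ap; apply/polyP => i; have := ap i; rewrite coefCM !coef0.
by move/(Dring_integral char0) => [/eqP|//]; rewrite (negPf a0).
Qed.

Lemma x0_neq0 : x0 != 0.
Proof.
apply/eqP => /(congr1 (ev (curve1 char0 0))); rewrite evX rmorph0 /= => /eqP.
by rewrite oner_eq0.
Qed.

(** Local coordinates of X x A^1 where x0 is invertible, which suffices to determine derivations. *)
Definition gens (i : 'I_3) : {poly R} := [:: (xx 0 0)%:P; (xx 0 1)%:P; 'X]`_i.

Lemma dense_gens (d : {poly R} -> {poly D}) : derivation incl d ->
  (forall c, (exists a : k, c = a%:A%:P) -> d c = 0) ->
  (forall i, d (gens i) = 0) -> forall a, d a = 0.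
Proof.
move=> [dD dM] dc dG.
have dU : d (xx 0 0)%:P = 0 := dG 0.
have dV : d (xx 0 1)%:P = 0 := dG 1.
have dX : d 'X = 0 := dG 2%:R.
have dR (r : R) : d r%:P = 0.
  pose d' r := d r%:P; pose i' : {rmorphism R -> {poly D}} := incl \o @polyC R.
  have der' : derivation i' d' by split=> a b; rewrite /d' ?polyCD ?polyCM.
  have cst' c : d' c%:A = 0 by apply: dc; exists c.
  have reg' y : i' (xx 0 0) * y = 0 -> y = 0.
    rewrite /i' /= /incl map_polyC /=; apply: poly_D_cancel.
    apply/eqP => /(Dring_integral char0)[] /eqP; exact/negP/x0_neq0.
  exact: (derivation_eq0 char0 der' cst' reg' dU dV).
by elim/poly_ind => [|p c IH]; [exact: dR | rewrite dD dM dX IH dR !mulr0 !addr0].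
Qed.

Lemma cylinders_not_isomorphic : ~ isomorphic (cylinder R) (cylinder D).
Proof.
move=> [f [g fK gK]].
have f_cst (c : k) : f (c%:A : R)%:P = (c%:A : D)%:P.
  have e (A : comAlgType k) : (c%:A : A)%:P = (c *: (1 : cylinder A) : cylinder A).
    by rewrite -[RHS]/(cyl_scale c 1) /cyl_scale alg_polyC.
  by rewrite !e; apply: etrans (linearZ _ _) _; rewrite /= rmorph1.
have cst0 (c : k) b e : jac (c%:A)%:P b e = 0.
  apply: wedge3_cst; rewrite ?(coefwC derE) ?(coefwC derF) ?(coefwC derH) ?derivC //.
  - by rewrite (lEZ char0) (lE1 char0) scaler0.
  - by rewrite (lFZ char0) (lF1 char0) scaler0.
  by rewrite (lHZ char0) (lH1 char0) scaler0.
have i_cst (c : k) : incl (c%:A)%:P = (c%:A)%:P by rewrite /incl map_polyC.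
pose Cst (c : {poly R}) := exists a : k, c = a%:A%:P.
have JF c y z : Cst c -> jac (f c) y z = 0 by move=> [a ->]; rewrite f_cst cst0.
have JI c y z : Cst c -> jac (incl c) y z = 0 by move=> [a ->]; rewrite i_cst cst0.
have J_reg y : jac (incl (gens 0)) (incl (gens 1)) (incl (gens 2%:R)) * y = 0 -> y = 0.
  have -> : jac (incl (gens 0)) (incl (gens 1)) (incl (gens 2%:R)) = (x0 ^+ 3 *+ 4)%:P.
    have [<- _ _] := brackets_xx char0.
    by rewrite -jac_bracket /gens /= /incl !map_polyC map_polyX.
  apply: poly_D_cancel; rewrite -[x0 ^+ 3 *+ 4]mulr_natr; apply/eqP => /(Dring_integral char0)[|/eqP].
    rewrite !exprS expr0 mulr1 => /(Dring_integral char0)[/eqP|/(Dring_integral char0)[]/eqP]; exact/negP/x0_neq0.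
  by rewrite -scaler_nat => /eqP/(alg_neq0 char0)/eqP; rewrite (negPf (nat_neq0 char0 3)).
pose M : {rmorphism {poly D} -> {poly D}} := map_poly (@mu k).
have MI a : M (incl a) = incl a by apply: map_mu_incl.
have MJ a b c : M (jac (incl a) (incl b) (incl c)) = - jac (incl a) (incl b) (incl c) by apply: mu_jac.
have uni (K : {pred {poly D}}) : (forall a b c, a \in K -> b \in K -> a + c * b \in K) ->
    0 \in K -> (forall a b c, jac (incl a) (incl b) (incl c) \in K) -> 1 \in K.
  by move=> KD K0 KJ; apply: jac_unimodular KD K0 _ => a b; apply: KJ.
pose f' : {rmorphism {poly R} -> {poly D}} := f.
have [G [MG Gno]] := @jacobian_transport {poly R} {poly D} incl f' g fK gK jac Cst gens M dense_gens jac_der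
  (@wedge3_rot _ _ _ _ _ _ _ _) (@wedge3_anti _ _ _ _ _ _ _ _) (@wedge3_diag _ _ _ _ _ _ _ _) JF JI J_reg uni MI MJ.
have muG : mu G`_0 = - G`_0.
  by have /(congr1 (fun p : {poly D} => p`_0)) := MG; rewrite coef_map coefN.
have [w [pw [evG _]]] := odd_zero char0 muG.
pose e0 : {rmorphism {poly D} -> k} := ev pw \o horner_eval 0.
apply: (Gno _ e0); by rewrite /e0 /= /horner_eval horner_coef0.
Qed.
End Cylinders.

(** * Locally nilpotent sl_2-modules *)

Section IteratedLinear.
Variables (k : fieldType) (V : lmodType k) (T : {linear V -> V}).
Lemma iter_linear i : linear (iter i T).
Proof. by elim: i => [|i IH] c u v //=; rewrite IH linearP. Qed.
Lemma iter0 i : iter i T 0 = 0.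
Proof. by elim: i => //= i ->; rewrite linear0. Qed.
Lemma iterZ i c v : iter i T (c *: v) = c *: iter i T v.
Proof. by have := iter_linear i c v 0; rewrite !addr0 iter0 addr0. Qed.
Lemma iterD i u v : iter i T (u + v) = iter i T u + iter i T v.
Proof. by have := iter_linear i 1 u v; rewrite !scale1r. Qed.
Lemma iterB i u v : iter i T (u - v) = iter i T u - iter i T v.
Proof. by rewrite iterD -scaleN1r iterZ scaleN1r. Qed.
End IteratedLinear.

Section PolynomialsInOperator.
Variables (k : fieldType) (V : lmodType k) (H : {linear V -> V}).
Implicit Types (p q : {poly k}) (v w : V).

Definition hp p v := \sum_(i < size p) p`_i *: iter i H v.

Lemma hpE N p v : (size p <= N)%N -> hp p v = \sum_(i < N) p`_i *: iter i H v.
Proof.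
move=> le; rewrite /hp (big_ord_widen N (fun i => p`_i *: iter i H v)) // big_mkcond.
by apply: eq_bigr => i _; case: ltnP => // /(nth_default 0) ->; rewrite scale0r.
Qed.

Lemma hp_linear p : linear (hp p).
Proof.
move=> c u v; rewrite /hp scaler_sumr -big_split; apply: eq_bigr => i _ /=.
by rewrite iter_linear scalerDr !scalerA mulrC.
Qed.
HB.instance Definition _ p := GRing.isLinear.Build k V V _ (hp p) (hp_linear p).

Lemma hpD p q v : hp (p + q) v = hp p v + hp q v.
Proof.
set N := maxn (size p) (size q).
rewrite (@hpE N (p + q)) ?size_polyD // (@hpE N p) ?leq_maxl // (@hpE N q) ?leq_maxr //.
by rewrite -big_split; apply: eq_bigr => i _; rewrite coefD scalerDl.
Qed.
Lemma hpC c v : hp c%:P v = c *: v.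
Proof. by rewrite (@hpE 1) ?size_polyC ?leq_b1 // big_ord1 coefC. Qed.
Lemma hpXM p v : hp (p * 'X) v = H (hp p v).
Proof.
rewrite (@hpE (size p).+1) ?(leq_trans (size_polyMleq _ _)) ?size_polyX ?addn2 //.
rewrite big_ord_recl coefMX /= scale0r add0r linear_sum; apply: eq_bigr => i _.
by rewrite linearZ coefMX /bump.
Qed.
Lemma hpZ c p v : hp (c *: p) v = c *: hp p v.
Proof.
rewrite (@hpE (size p) (c *: p)) ?size_scale_leq // /hp scaler_sumr.
by apply: eq_bigr => i _; rewrite coefZ scalerA.
Qed.
Lemma hpM p q v : hp (p * q) v = hp p (hp q v).
Proof.
elim/poly_ind: p => [|p c IH]; first by rewrite mul0r -polyC0 !hpC !scale0r.
by rewrite mulrDl mulrAC !hpD !hpXM IH mul_polyC hpZ hpC.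
Qed.
Lemma hp_mull p q v : hp q v = 0 -> hp (p * q) v = 0.
Proof. by move=> q0; rewrite hpM q0 linear0. Qed.
Lemma hpX v : hp 'X v = H v.
Proof. by rewrite -['X]mul1r hpXM -polyC1 hpC scale1r. Qed.

Lemma hp_gcd p q v : hp p v = 0 -> hp q v = 0 -> hp (gcdp p q) v = 0.
Proof.
move=> p0 q0; have [[a b] /= /eqpP[[c1 c2] /= /andP[_ c20] e]] := Bezoutp p q.
have : hp (c1 *: (a * p + b * q)) v = 0 by rewrite hpZ hpD !hp_mull ?addr0 ?scaler0.
by rewrite e hpZ => /eqP; rewrite scaler_eq0 (negPf c20) => /eqP.
Qed.

Lemma hp_eigen p e v : H v = e *: v -> hp p v = p.[e] *: v.
Proof.
move=> He; elim/poly_ind: p => [|p c IH]; first by rewrite horner0 -polyC0 hpC.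
by rewrite hpD hpXM IH linearZ /= He hpC hornerMXaddC scalerDl scalerA.
Qed.

Lemma hp_XsubC e v : hp ('X - e%:P) v = H v - e *: v.
Proof. by rewrite -polyCN hpD hpX hpC scaleNr. Qed.

(** The hypothesis on [q] says that [e] is at most a simple root of [p]. Hence the gcd of a power of
    X - e with [p] divides X - e, and by Bezout it kills [v]. *)
Lemma hp_sep e a p v : hp (('X - e%:P) ^+ a) v = 0 -> hp p v = 0 ->
  (forall q, p = q * ('X - e%:P) -> q.[e] != 0) -> H v = e *: v.
Proof.
move=> va pv sep; suff : hp ('X - e%:P) v = 0.
  by rewrite hp_XsubC => /eqP; rewrite subr_eq0 => /eqP.
case: a va => [|a] va.
  by rewrite expr0 -polyC1 hpC scale1r in va; rewrite va linear0.
have g0 := hp_gcd va pv.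
have one (q : {poly k}) : coprimep ('X - e%:P) q -> gcdp (('X - e%:P) ^+ a.+1) q %= 1.
  by move=> cop; rewrite -size_poly_eq1 -/(coprimep _ _) coprimep_expl.
suff : gcdp (('X - e%:P) ^+ a.+1) p %| 'X - e%:P by move/divpK <-; apply: hp_mull.
case: (boolP (root p e)) => [/factor_theorem[q qE]|nr]; last first.
  by rewrite (eqp_dvdl _ (one p _)) ?dvd1p // coprimep_sym coprimep_XsubC.
have cop : coprimep ('X - e%:P) q by rewrite coprimep_sym coprimep_XsubC; apply: sep.
have : gcdp (('X - e%:P) ^+ a.+1) p %| ('X - e%:P) * gcdp (('X - e%:P) ^+ a) q.
  by rewrite qE exprS [q * _]mulrC (eqp_dvdr _ (mulp_gcdr _ _ _)) dvdpp.
move/dvdp_trans; apply; rewrite -[X in _ %| X]mulr1 dvdp_mul //.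
by rewrite (eqp_dvdl _ (_ : _ %= 1)) ?dvdpp // -size_poly_eq1 -/(coprimep _ _) coprimep_expl.
Qed.
End PolynomialsInOperator.

Section Sl2Module.
Variables (k : fieldType) (V : lmodType k) (E F H : {linear V -> V}).
Hypothesis char0 : [pchar k] =i pred0.
Hypothesis EF : forall v, E (F v) = F (E v) + H v.
Hypothesis HE : forall v, H (E v) = E (H v) + E v *+ 2.
Hypothesis HF : forall v, H (F v) = F (H v) - F v *+ 2.
Hypothesis E_nilp : forall v, exists N, iter N E v = 0.
Hypothesis F_nilp : forall v, exists N, iter N F v = 0.
Let nat_n0 n : n.+1%:R != 0 :> k. Proof. by rewrite (pcharf0P k).1. Qed.

Lemma H_iterF m w : H (iter m F w) = iter m F (H w) - iter m F w *+ (2 * m).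
Proof.
elim: m => [|m IH]; first by rewrite muln0 mulr0n subr0.
by rewrite !iterS HF IH linearB raddfMn -addrA -opprD -mulrnDr mulnS addnC.
Qed.

(** The falling factorial X (X - 1) ... (X - m + 1). *)
Definition ff m : {poly k} := \prod_(i < m) ('X - i%:R%:P).

Lemma EiterF m w : E w = 0 ->
  E (iter m.+1 F w) = m.+1%:R *: iter m F (H w - m%:R *: w).
Proof.
move=> Ew; elim: m => [|m IH]; first by rewrite /= EF Ew linear0 add0r scale1r scale0r subr0.
rewrite iterS EF IH linearZ H_iterF !iterB !iterZ linearB linearZ /=.
move: (F (iter m F (H w))) (F (iter m F w)) => a b.
rewrite !scaler_nat !mulrnBl -!mulrnA addrACA -opprD -mulrnDr -mulrSr.
by congr (_ + - _); congr (_ *+ _); lia.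
Qed.

Lemma EFiter m w : E w = 0 -> iter m E (iter m F w) = m`!%:R *: hp H (ff m) w.
Proof.
elim: m w => [|m IH] w Ew.
  by rewrite /ff big_ord0 -polyC1 hpC !scale1r.
have EH u : E u = 0 -> E (H u) = 0.
  by move=> Eu; have /esym := HE u; rewrite Eu linear0 mul0rn addr0.
rewrite iterSr EiterF // iterZ IH; last by rewrite linearB linearZ /= EH // Ew scaler0 subrr.
by rewrite scalerA -natrM -factS /ff big_ord_recr /= hpM hp_XsubC.
Qed.

Lemma hp_E p v : hp H p (E v) = E (hp H (p \Po ('X + 2%:R%:P)) v).
Proof.
elim/poly_ind: p v => [|p c IH] v; first by rewrite comp_poly0 -polyC0 !hpC !scale0r linear0.
rewrite comp_poly_MXaddC !hpD !hpM hpX HE !hpC.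
have -> : E (H v) + E v *+ 2 = E (H v + v *+ 2) by rewrite linearD raddfMn.
rewrite IH -linearZ -linearD /=; congr (E (hp H _ _ + _)).
by rewrite hpD hpX hpC scaler_nat.
Qed.

Lemma hp_Eiter m p v : hp H p (iter m E v) = iter m E (hp H (p \Po ('X + (2 * m)%:R%:P)) v).
Proof.
elim: m v p => [|m IH] v p; first by rewrite muln0 addr0 comp_polyXr.
rewrite iterS hp_E IH -iterS; congr (iter _ E (hp H _ v)).
rewrite -comp_polyA; congr (_ \Po _).
by rewrite comp_polyD comp_polyC comp_polyX -addrA -polyCD -natrD mulnS addnC.
Qed.

(** Replaces finite dimensionality. By induction on the nilpotency order under E, some p(H) v with a
    shifted p is killed by E; on such a vector F^n = 0 gives a falling factorial of H that
    vanishes. *)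
Lemma H_torsion v : exists2 p, p != 0 & hp H p v = 0.
Proof.
have [m] := E_nilp v; elim: m v => [|m IH] v; first by move=> /= ->; exists 1; rewrite ?oner_neq0 ?linear0.
rewrite iterSr => /IH[p p0]; rewrite hp_E; set w := hp H _ v => Ew.
have [n Fw] := F_nilp w; have := EFiter n Ew; rewrite Fw iter0 => /esym/eqP.
rewrite scaler_eq0 -(prednK (fact_gt0 n)) (negPf (nat_n0 _)) /= => /eqP ffw.
exists (ff n * (p \Po ('X + 2%:R%:P))); last by rewrite hpM.
rewrite mulf_neq0 //; first by apply/prodf_neq0 => i _; rewrite polyXsubC_eq0.
by rewrite comp_poly_eq0 // size_XaddC.
Qed.

Lemma ff_sep (e : k) m q : ff m = q * ('X - e%:P) -> q.[e] != 0.
Proof.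
move=> E1; have : e \in [seq i%:R | i <- iota 0 m].
  have : root (ff m) e by rewrite E1 rootM root_XsubC eqxx orbT.
  rewrite /ff /root horner_prod prodf_seq_eq0 => /hasP[i _ /=].
  rewrite hornerXsubC subr_eq0 => /eqP ->; apply: map_f.
  by rewrite mem_iota ltn_ord.
case/mapP => i; rewrite mem_iota => lti eE; move: lti; rewrite /= add0n => lti.
have E2 : ff m = \prod_(j < m | j != Ordinal lti) ('X - j%:R%:P) * ('X - e%:P).
  by rewrite /ff (bigD1 (Ordinal lti)) //= mulrC eE.
have Xn0 : 'X - e%:P != 0 by rewrite polyXsubC_eq0.
have -> : q = \prod_(j < m | j != Ordinal lti) ('X - j%:R%:P).
  by apply: (mulIf Xn0); rewrite -E1 E2.
rewrite horner_prod; apply/prodf_neq0 => j jni; rewrite hornerXsubC subr_eq0 eE.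
apply: contraNneq jni => /eqP; rewrite -val_eqE /=.
have nat_inj a b : (a < b)%N -> a%:R != b%:R :> k.
  by move=> lab; rewrite eq_sym -subr_eq0 -natrB 1?ltnW // -(prednK (n := (b - a)%N)) ?subn_gt0.
case: (ltngtP i j) => // /nat_inj; first by move=> /negPf ->.
by rewrite eq_sym => /negPf ->.
Qed.

(** Falling factorials have simple roots, so H is semisimple on the kernel of E. *)
Lemma ker_E_eigen e a w : E w = 0 -> hp H (('X - e%:P) ^+ a) w = 0 -> H w = e *: w.
Proof.
move=> Ew wa; have [n Fw] := F_nilp w; have := EFiter n Ew; rewrite Fw iter0 => /esym/eqP.
rewrite scaler_eq0 -(prednK (fact_gt0 n)) (negPf (nat_n0 _)) /= => /eqP ffw.
exact: (hp_sep wa ffw (@ff_sep e n)).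
Qed.

(** E F^(n+1) w = (n+1)(d-n) F^n w, and the factor is nonzero for n > d; so vanishing of a power of
    F descends to the exponent d+1. *)
Lemma highest_weight_nilp (d : nat) w : E w = 0 -> H w = d%:R *: w -> iter d.+1 F w = 0.
Proof.
move=> Ew Hw; have [n] := F_nilp w; elim: n => [|n IH] Fn; first by have -> : w = 0 by []; rewrite iter0.
case: (leqP n.+1 d.+1) => [le|lt]; first by rewrite -(subnK le) ssrnat.iterD Fn iter0.
apply: IH; have := EiterF n Ew; rewrite Fn linear0 Hw -scalerBl iterZ scalerA => /esym/eqP.
rewrite scaler_eq0 mulf_eq0 (negPf (nat_n0 n)) /= => /orP[|/eqP //].
by rewrite -opprB oppr_eq0 -natrB 1?ltnW // -(prednK (n := (n - d)%N)) ?subn_gt0 // (negPf (nat_n0 _)).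
Qed.

Section Lift.
Variables (W : lmodType k) (E' F' H' : {linear W -> W}) (psi : {linear V -> W}).
Hypothesis psiE : forall v, psi (E v) = E' (psi v).
Hypothesis psiF : forall v, psi (F v) = F' (psi v).
Hypothesis psiH : forall v, psi (H v) = H' (psi v).
Variable d : nat.

(** Complete reducibility made explicit: a preimage is first projected to the generalized eigenspace
    of H for [d], then corrected by multiples of F^m E^m v1. These map to 0 downstairs, because the
    image is killed by E'. *)
Lemma highest_weight_lift v : E' (psi v) = 0 -> H' (psi v) = d%:R *: psi v ->
  exists v', [/\ E v' = 0, H v' = d%:R *: v' & psi v' = psi v].
Proof.
move=> E0 Hd; pose X := 'X - d%:R%:P : {poly k}.
have psi_hp p u : psi (hp H p u) = hp H' p (psi u).
  elim/poly_ind: p => [|p c IH]; first by rewrite -polyC0 !hpC !scale0r linear0.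
  by rewrite !hpD !hpXM !hpC linearD linearZ /= psiH IH.
(* Write p = q (X - d)^m with q(d) nonzero. Applying q(H)/q(d) leaves a vector killed by a power of
   H - d and keeps the image, on which H acts as d. *)
have [a [v1 [v1a psi1]]] : exists a v1, hp H (X ^+ a.+1) v1 = 0 /\ psi v1 = psi v.
  have [p p0 pv] := H_torsion v; have [m [q /implyP/(_ p0) qd pE]] := multiplicity_XsubC p d%:R.
  exists m, (q.[d%:R]^-1 *: hp H q v); split.
    by rewrite linearZ /= -hpM exprS -mulrA [_ ^+ _ * q]mulrC -pE hp_mull ?scaler0.
  by rewrite linearZ /= psi_hp (hp_eigen q Hd) scalerA mulVf ?scale1r.
have pit i u : psi (iter i F u) = iter i F' (psi u) by elim: i => //= i IHi; rewrite psiF IHi.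
have pitE i u : psi (iter i E u) = iter i E' (psi u) by elim: i => //= i IHi; rewrite psiE IHi.
have [m] := E_nilp v1; elim: m v1 v1a psi1 => [|m IH] v1 v1a psi1 Em.
  have v10 : v1 = 0 by [].
  by exists v1; split=> //; rewrite v10 !linear0 ?scaler0.
case: m IH Em => [|m] IH Em; first by exists v1; split=> //; apply: ker_E_eigen v1a.
(* Each E raises the weight by 2, so w is a highest weight vector of weight d + 2 (m + 1). *)
pose w := iter m.+1 E v1; pose e : k := (d + 2 * m.+1)%:R.
have Ew : E w = 0 by [].
have He : H w = e *: w.
  apply: (@ker_E_eigen _ a.+1) => //.
  rewrite hp_Eiter rmorphXn /= comp_polyB comp_polyX comp_polyC -addrA -polyCN -polyCD.
  have -> : (2 * m.+1)%:R - e = - d%:R by rewrite /e natrD opprD addrCA subrr addr0.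
  by rewrite polyCN -/X v1a iter0 linear0.
have HFw : H (iter m.+1 F w) = d%:R *: iter m.+1 F w.
  by rewrite H_iterF He iterZ -scaler_nat -scalerBl /e natrD addrK.
(* E^(m+1) F^(m+1) w = c w, and c is nonzero because the weight e exceeds the roots 0, ..., m of the
   falling factorial. *)
pose c := m.+1`!%:R * (ff m.+1).[e].
have c0 : c != 0.
  rewrite mulf_neq0 // ?horner_prod; first by rewrite -(prednK (fact_gt0 _)).
  apply/prodf_neq0 => i _; rewrite hornerXsubC -natrB; last by have := ltn_ord i; lia.
  by rewrite -(prednK (n := (_ - _)%N)) //; have := ltn_ord i; lia.
apply: (IH (v1 - c^-1 *: iter m.+1 F w)).
- rewrite linearB linearZ /= v1a sub0r (hp_eigen _ HFw) horner_exp hornerXsubC subrr exprS mul0r.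
  by rewrite scale0r scaler0 oppr0.
- rewrite linearB linearZ /= psiF pit pitE iterSr psi1 E0 iter0 -iterS iter0 scaler0 subr0 //.
rewrite iterB iterZ EFiter // (hp_eigen _ He) !scalerA -mulrA -/c.
by rewrite mulVf // scale1r subrr.
Qed.
End Lift.
End Sl2Module.

Lemma mcoeff_euler (k : comNzRingType) n (p : {mpoly k[n]}) i m :
  ('X_i * p^`M(i))@_m = p@_m *+ m i.
Proof.
elim/mpolyind: p => [|c l p _ _ IH]; first by rewrite mderiv0 mulr0 !mcoeff0 mul0rn.
rewrite mderivD mulrDr !mcoeffD IH mulrnDl; congr (_ + _).
rewrite mderivZ mderivX -!scalerAr !mcoeffZ.
case li: (l i) => [|a].
  by rewrite mul0r mulr0 mcoeffX; case: eqP => [<-|_]; rewrite ?li ?mulr0n ?mulr0 ?mul0rn.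
rewrite -mpolyXD addmC submK ?lep1mP ?li // mcoeffX.
case: eqP => [<-|_]; last by rewrite !mulr0 mul0rn.
by rewrite li !mulr1 mulr_natr.
Qed.

(** * Highest weight vectors among the functions on Y *)

Section HighestWeightVectors.
Variable k : closedFieldType.
Hypothesis char0 : [pchar k] =i pred0.
Local Notation D := (Dring k).
Local Notation x0 := (piD 'X_0 : D).
Local Notation x1 := (piD 'X_1 : D).
Local Notation x2 := (piD 'X_2 : D).
Local Notation E := (lE (Y_action char0)).
Local Notation F := (lF (Y_action char0)).
Local Notation H := (lH (Y_action char0)).
Local Notation S := {mpoly k[2]}.

Let px (i : 'I_2) : D := if i == 0 then x0 else x1.
Definition proj01 : S -> D := alg_hom px.
HB.instance Definition _ := GRing.LRMorphism.on proj01.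

Lemma proj01X0 : proj01 'X_0 = x0. Proof. exact: alg_homX. Qed.
Lemma proj01X1 : proj01 'X_1 = x1. Proof. exact: alg_homX. Qed.
Lemma proj01C c : proj01 c%:MP = c%:A.
Proof. by rewrite -alg_mpolyC; apply: etrans (linearZ _ _) _; rewrite /= rmorph1. Qed.

Lemma ord2P (K : 'I_2 -> Prop) : K 0 -> K 1 -> forall i, K i.
Proof.
move=> K0 K1 [[|[|//]] lt].
- by rewrite (_ : Ordinal lt = 0); last exact: val_inj.
- by rewrite (_ : Ordinal lt = 1); last exact: val_inj.
Qed.

Lemma D_cancelr (a b : D) : a * b = 0 -> b <> 0 -> a = 0.
Proof. by case/(Dring_integral char0). Qed.

Lemma sum2 (V : nmodType) (f : 'I_2 -> V) : \sum_i f i = f 0 + f 1.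
Proof. by rewrite !big_ord_recl big_ord0 addr0; congr (f _ + f _); apply: val_inj. Qed.

Lemma chain01 (d : D -> D) : derivation idfun d -> (forall c, d c%:A = 0) ->
  forall p, d (proj01 p) = proj01 p^`M(0) * d x0 + proj01 p^`M(1) * d x1.
Proof.
move=> dd dc p; rewrite -proj01X0 -proj01X1.
rewrite -(sum2 (fun i => proj01 p^`M(i) * d (proj01 'X_i))).
by apply: (@mpoly_chain k 2 D proj01 D idfun d dd) => c; rewrite /= proj01C.
Qed.

Lemma lE_cst c : E c%:A = 0. Proof. by rewrite (lEZ char0) (lE1 char0) scaler0. Qed.
Lemma lF_cst c : F c%:A = 0. Proof. by rewrite (lFZ char0) (lF1 char0) scaler0. Qed.
Lemma lH_cst c : H c%:A = 0. Proof. by rewrite (lHZ char0) (lH1 char0) scaler0. Qed.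
Lemma lE_der (A : comAlgType k) (rho : SL2_action A) : derivation idfun (lE rho).
Proof. by split=> a b; [exact: lED | exact: (lEM char0)]. Qed.
Lemma lF_der (A : comAlgType k) (rho : SL2_action A) : derivation idfun (lF rho).
Proof. by split=> a b; [exact: lFD | exact: (lFM char0)]. Qed.
Lemma lH_der (A : comAlgType k) (rho : SL2_action A) : derivation idfun (lH rho).
Proof. by split=> a b; [exact: lHD | exact: (lHM char0)]. Qed.

Lemma x_nz : x0 <> 0 /\ x1 <> 0.
Proof.
split=> /(congr1 (ev (curve1 char0 1))); rewrite evX rmorph0 /= => /eqP; by rewrite oner_eq0.
Qed.

Lemma proj01_inj p : proj01 p = 0 -> p = 0.
Proof.
have [x0n x1n] := x_nz.
apply: (deriv_stable_eq0 char0 (K := fun p => proj01 p = 0)) => [{}p p0|c]; last first.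
  by rewrite proj01C => /(alg_neq0 char0).
have d1 : proj01 p^`M(1) = 0.
  have := chain01 (lE_der (Y_action char0)) lE_cst p; rewrite p0 (lE0 char0) [E x0](E_x0 char0) [E x1](E_x1 char0) mulr0 add0r => e.
  exact: (D_cancelr (esym e) x0n).
have d0 : proj01 p^`M(0) = 0.
  have := chain01 (lF_der (Y_action char0)) lF_cst p; rewrite p0 (lF0 char0) d1 mul0r addr0 F_x0.
  rewrite -scaler_nat -scalerAr => /esym/eqP; rewrite scaler_eq0 (negPf (nat_neq0 char0 1)) /=.
  by move/eqP => e; exact: (D_cancelr e x1n).
by elim/ord2P.
Qed.

(** 2 x0 x2 = 1 + x1^2 eliminates x2 at the cost of a power of x0. *)
Lemma clear_x2 (a : D) : exists n p, x0 ^+ n * a = proj01 p.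
Proof.
elim/D_ind: a => [c||||a b [n [p pE]] [m [q qE]]|a b [n [p pE]] [m [q qE]]].
- by exists 0%N, c%:MP; rewrite expr0 mul1r proj01C.
- by exists 0%N, 'X_0; rewrite expr0 mul1r proj01X0.
- by exists 0%N, 'X_1; rewrite expr0 mul1r proj01X1.
- exists 1%N, ((2^-1 : k) *: (1 + 'X_1 ^+ 2)); rewrite expr1.
  have -> : proj01 (2^-1 *: (1 + 'X_1 ^+ 2)) = 2^-1 *: (1 + x1 ^+ 2).
    apply: etrans (linearZ _ _) _; rewrite /= rmorphD rmorph1; congr (_ *: (_ + _)).
    by rewrite -proj01X1; apply: rmorphXn.
  by rewrite (x_rel k) addrC subrK -scaler_nat scalerA mulVf ?scale1r // (nat_neq0 char0).
- exists (n + m)%N, ('X_0 ^+ m * p + 'X_0 ^+ n * q).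
  have -> : proj01 ('X_0 ^+ m * p + 'X_0 ^+ n * q) = x0 ^+ m * proj01 p + x0 ^+ n * proj01 q.
    by rewrite -proj01X0 !rmorphD !rmorphM !rmorphXn.
  by rewrite -pE -qE exprD; move: (x0 ^+ n) (x0 ^+ m) => *; ring.
exists (n + m)%N, (p * q); rewrite rmorphM /= -pE -qE exprD.
by move: (x0 ^+ n) (x0 ^+ m) => *; ring.
Qed.

(** On polynomials in x0 and x1, E is x0 d/dx1 and H is 2 x0 d/dx0. Once x2 is cleared, E f = 0
    removes x1 and the weight fixes the exponent of x0. *)
Lemma highest_weight_D (w : nat) f : E f = 0 -> H f = f *+ (2 * w) -> exists c, f = c *: x0 ^+ w.
Proof.
move=> Ef Hf; have [x0n x1n] := x_nz.
have [n [p pE]] := clear_x2 f.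
have EX : E (x0 ^+ n) = 0.
  by elim: n {pE} => [|n IH]; rewrite ?expr0 ?(lE1 char0) // exprS (lEM char0) // IH E_x0 !mulr0 addr0.
have HX : H (x0 ^+ n) = x0 ^+ n *+ (2 * n).
  elim: n {pE EX} => [|n IH]; first by rewrite expr0 (lH1 char0) // muln0.
  by rewrite exprS (lHM char0) // IH H_x0 mulnS; move: (x0 ^+ n) x0 => *; ring.
have d1 : p^`M(1) = 0.
  apply: proj01_inj; have := chain01 (lE_der (Y_action char0)) lE_cst p.
  rewrite -pE (lEM char0) // Ef EX !mulr0 addr0 [E x0](E_x0 char0) [E x1](E_x1 char0) mulr0 add0r => e.
  exact: (D_cancelr (esym e) x0n).
have d0 : 'X_0 * p^`M(0) = p *+ (n + w).
  apply/eqP; rewrite -subr_eq0; apply/eqP/proj01_inj.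
  have := chain01 (lH_der (Y_action char0)) lH_cst p.
  rewrite -pE (lHM char0) // Hf HX [H x0](H_x0 char0) [H x1](H_x1 char0) mulr0 addr0 => e.
  have -> : proj01 ('X_0 * p^`M(0) - p *+ (n + w)) = x0 * proj01 p^`M(0) - x0 ^+ n * f *+ (n + w).
    by rewrite pE -proj01X0 rmorphB rmorphM rmorphMn.
  have : (x0 * proj01 p^`M(0) - x0 ^+ n * f *+ (n + w)) *+ 2 = 0.
    move: e; move: (x0 ^+ n) => y; move: (proj01 _) => z; move: x0 => x e.
    transitivity (z * (x *+ 2) - (y * f *+ (n + w)) *+ 2); first by move: (_ *+ (n + w)) => *; ring.
    rewrite -e mulrnAr mulrnAr (mulrC f) -mulrnDr -mulnDr -mulrnA mulnC (addnC w).
    exact: subrr.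
  by rewrite -scaler_nat => /eqP; rewrite scaler_eq0 (negPf (nat_neq0 char0 1)) => /eqP.
exists (p@_(U_(0%R : 'I_2) *+ (n + w))%MM).
apply: (@D_cancel _ char0 (x0 ^+ n)).
  by elim: n {pE EX HX d0} => [|n IH]; rewrite ?expr0 ?exprS ?oner_neq0 //;
   apply/eqP => /(Dring_integral char0)[//|] /eqP; apply/negP.
rewrite pE [p in LHS](_ : p = (p@_(U_(0%R : 'I_2) *+ (n + w))%MM) *: 'X_0 ^+ (n + w)).
  apply: etrans (linearZ _ _) _; rewrite /= rmorphXn /= proj01X0 exprD.
  by rewrite scalerAr.
apply/mpolyP => m; rewrite mcoeffZ mpolyXn mcoeffX.
have c0 := congr1 (fun q : S => q@_m) d0; rewrite mcoeff_euler mcoeffMn in c0.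
have c1 : p@_m *+ m 1 = 0 by rewrite -mcoeff_euler d1 mulr0 mcoeff0.
case: eqP => [<-|ne]; first by rewrite mulr1.
rewrite mulr0; apply/eqP/negPn/negP => pm; case: ne; apply/mnmP => i.
have inj a b : p@_m *+ a = p@_m *+ b -> a = b.
  by rewrite -[LHS]mulr_natr -[RHS]mulr_natr => /(mulfI pm)/(natr_inj_char0 char0).
have m0 := inj _ _ c0; have m1 : m 1 = 0%N by apply: inj; rewrite c1 mulr0n.
by rewrite mulmnE mnm1E; elim/ord2P: i; rewrite ?m0 ?m1 /= ?mul1n ?mul0n.
Qed.
End HighestWeightVectors.

(** * Linear algebra and covariants in dimension three *)

Fact I3_01 : 0 + 1 = 1 :> 'I_3. Proof. exact: val_inj. Qed.
Fact I3_02 : 0 + 2%:R = 2%:R :> 'I_3. Proof. exact: val_inj. Qed.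
Fact I3_11 : 1 + 1 = 2%:R :> 'I_3. Proof. exact: val_inj. Qed.
Fact I3_12 : 1 + 2%:R = 0 :> 'I_3. Proof. exact: val_inj. Qed.
Fact I3_21 : 2%:R + 1 = 0 :> 'I_3. Proof. exact: val_inj. Qed.
Fact I3_22 : 2%:R + 2%:R = 1 :> 'I_3. Proof. exact: val_inj. Qed.
Definition I3 := (I3_01, I3_02, I3_12, I3_21, I3_22, I3_11).

Lemma sum3 (V : nmodType) (f : 'I_3 -> V) : \sum_i f i = f 0 + f 1 + f 2%:R.
Proof.
rewrite !big_ord_recl big_ord0 addr0 addrA.
by congr (f _ + f _ + f _); apply: val_inj.
Qed.

Section Matrix3.
Variable R : comNzRingType.
Implicit Types (A B : 'M[R]_3) (u v w : 'I_3 -> R) (a b : R).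

(** Addition in ['I_3] is modulo 3, so cross products and cofactors have cyclic formulas without
    signs. *)
Definition cross u v (i : 'I_3) : R := u (i + 1) * v (i + 2%:R) - u (i + 2%:R) * v (i + 1).
Definition dot u v : R := u 0 * v 0 + u 1 * v 1 + u 2%:R * v 2%:R.
Definition mulv A u i := dot (A i) u.
Definition outer u v : 'M[R]_3 := \matrix_(i, j) (u i * v j).
Definition axial A (i : 'I_3) : R := A (i + 1) (i + 2%:R) - A (i + 2%:R) (i + 1).
Definition skew3 u : 'M[R]_3 := \matrix_(i, j) (if j == i + 1 then - u (i + 2%:R)
  else if j == i + 2%:R then u (i + 1) else 0).
Definition adj3 A : 'M[R]_3 := \matrix_(i, j)
  (A (j + 1) (i + 1) * A (j + 2%:R) (i + 2%:R) - A (j + 1) (i + 2%:R) * A (j + 2%:R) (i + 1)).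
Definition det3 A : R := A 0 0 * adj3 A 0 0 + A 0 1 * adj3 A 1 0 + A 0 2%:R * adj3 A 2%:R 0.

Lemma tr3 A : \tr A = A 0 0 + A 1 1 + A 2%:R 2%:R. Proof. exact: sum3. Qed.
Lemma mul3 A B i j : (A *m B) i j = A i 0 * B 0 j + A i 1 * B 1 j + A i 2%:R * B 2%:R j.
Proof. by rewrite mxE sum3. Qed.
Lemma scal3 a i j : (a%:M : 'M[R]_3) i j = if i == j then a else 0.
Proof. by rewrite mxE; case: eqP. Qed.

Local Ltac entries := rewrite /det3 ?tr3 /adj3 ?mxE ?sum3 /= ?mxE ?I3 /= ?mulr1n ?mulr0n ?mxE ?I3 /=; ring.

Lemma mul_adj3 A : A *m adj3 A = (det3 A)%:M.
Proof. by apply/matrixP; elim/ord3P; elim/ord3P; entries. Qed.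
Lemma adj3_mul A : adj3 A *m A = (det3 A)%:M.
Proof. by apply/matrixP; elim/ord3P; elim/ord3P; entries. Qed.
Lemma adj3_adj3 A : adj3 (adj3 A) = det3 A *: A.
Proof. by apply/matrixP; elim/ord3P; elim/ord3P; entries. Qed.
Lemma det3_sub A a : det3 (A - a%:M) = det3 A - a * \tr (adj3 A) + a ^+ 2 * \tr A - a ^+ 3.
Proof. entries. Qed.
Lemma tr_adj3_sub A a : \tr (adj3 (A - a%:M)) = \tr (adj3 A) - (a * \tr A) *+ 2 + a ^+ 2 *+ 3.
Proof. entries. Qed.
Lemma adj3_poly A : adj3 A = A *m A - \tr A *: A + (\tr (adj3 A))%:M.
Proof. by apply/matrixP; elim/ord3P; elim/ord3P; entries. Qed.
Lemma adj3_tr A : adj3 A^T = (adj3 A)^T.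
Proof. by apply/matrixP; elim/ord3P; elim/ord3P; entries. Qed.
End Matrix3.

Ltac entries := rewrite /mulv /det3 ?tr3 /dot /cross /axial /skew3 /adj3 ?mxE ?sum3 /= ?mxE ?I3 /= ?mulr1n ?mulr0n ?mxE ?I3 /=.

Section Covariants.
Variables (R : comNzRingType) (d : R -> R) (n : 'I_3 -> R).
Hypothesis d_der : derivation idfun d.
Implicit Types (A B : 'M[R]_3) (u v w : 'I_3 -> R) (a b : R).

(** [d] acts on the components as the infinitesimal rotation with axis [n]: in orthonormal
    coordinates this describes equivariant maps to V(2), and [covM] those to its tensor square. *)
Definition covV u := forall i, d (u i) = cross n u i.
Definition covM A := forall i j, d (A i j) = cross n (fun l => A l j) i + cross n (A i) j.

Let dD a b : d (a + b) = d a + d b. Proof. by case: d_der. Qed.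
Let dM a b : d (a * b) = a * d b + b * d a. Proof. by case: d_der. Qed.
Let d0 : d 0 = 0. Proof. by apply: (addrI (d 0)); rewrite -dD !addr0. Qed.
Let dN a : d (- a) = - d a. Proof. by apply: (addrI (d a)); rewrite -dD !subrr d0. Qed.
Let d1 : d 1 = 0. Proof. by apply: (addrI (d 1)); rewrite addr0 -[in RHS](mul1r 1) dM !mul1r. Qed.

Lemma der_zero : d 0 = 0. Proof. exact: d0. Qed.
Lemma der_opp a : d (- a) = - d a. Proof. exact: dN. Qed.
Lemma der_one : d 1 = 0. Proof. exact: d1. Qed.
Lemma der_exp a i : d a = 0 -> d (a ^+ i) = 0.
Proof. by move=> da; elim: i => [|i IH]; rewrite ?expr0 ?exprS ?dM ?IH ?da ?mulr0 ?addr0. Qed.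

Lemma cov_dot u v : covV u -> covV v -> d (dot u v) = 0.
Proof. by move=> cu cv; rewrite /dot !(dD, dM) !cu !cv; entries; ring. Qed.
Lemma cov_cross u v : covV u -> covV v -> covV (cross u v).
Proof. by move=> cu cv; elim/ord3P; rewrite {1}/cross !(dD, dN, dM) !cu !cv; entries; ring. Qed.
Lemma cov_outer u v : covV u -> covV v -> covM (outer u v).
Proof.
by move=> cu cv; elim/ord3P; elim/ord3P; rewrite !mxE !(dD, dM) !cu !cv; entries; ring.
Qed.
Lemma cov_axial A : covM A -> covV (axial A).
Proof. by move=> cA; elim/ord3P; rewrite {1}/axial !(dD, dN) !cA; entries; ring. Qed.
Lemma cov_skew u : covV u -> covM (skew3 u).
Proof.
by move=> cu; elim/ord3P; elim/ord3P; rewrite !mxE /= ?I3 ?(dN, d0) ?cu; entries; ring.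
Qed.
Lemma covMD A B : covM A -> covM B -> covM (A + B).
Proof. by move=> cA cB i j; rewrite mxE dD cA cB; entries; ring. Qed.
Lemma covMN A : covM A -> covM (- A).
Proof. by move=> cA i j; rewrite mxE dN cA; entries; ring. Qed.
Lemma covMB A B : covM A -> covM B -> covM (A - B).
Proof. by move=> cA cB; apply/covMD/covMN. Qed.
Lemma covMZ a A : d a = 0 -> covM A -> covM (a *: A).
Proof. by move=> da cA i j; rewrite mxE dM cA da; entries; ring. Qed.
Lemma cov_scal a : d a = 0 -> covM a%:M.
Proof. by move=> da; elim/ord3P; elim/ord3P; rewrite !mxE /= ?da ?d0; entries; ring. Qed.
Lemma covMM A B : covM A -> covM B -> covM (A *m B).
Proof.
move=> cA cB; elim/ord3P; elim/ord3P; rewrite !mul3 !(dD, dM) !cA !cB;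
  rewrite /cross !mul3 ?I3; ring.
Qed.
Lemma covMV A u : covM A -> covV u -> covV (mulv A u).
Proof. by move=> cA cu; elim/ord3P; rewrite /mulv {1}/dot !(dD, dM) !cA !cu; entries; ring. Qed.
Lemma cov_tr A : covM A -> d (\tr A) = 0.
Proof. by move=> cA; rewrite tr3 !dD !cA; entries; ring. Qed.
Lemma cov_adj A : covM A -> covM (adj3 A).
Proof.
by move=> cA; elim/ord3P; elim/ord3P; rewrite mxE !(dD, dN, dM) !cA; entries; ring.
Qed.
Lemma cov_det A : covM A -> d (det3 A) = 0.
Proof. by move=> cA; have cB := cov_adj cA; rewrite /det3 !(dD, dM) !cB !cA; entries; ring. Qed.
End Covariants.

Section RankOne.
Variable R : idomainType.
Hypothesis gcdR : gcd_domain R.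
Hypothesis two0 : 2%:R != 0 :> R.
Implicit Types (A B : 'M[R]_3) (u v w : 'I_3 -> R) (a b t : R).

Lemma adj3_eq0 A : adj3 A = 0 -> forall i j k l, A i j * A k l = A i l * A k j.
Proof.
move=> adj0.
have key i j : A (j + 1) (i + 1) * A (j + 2%:R) (i + 2%:R) = A (j + 1) (i + 2%:R) * A (j + 2%:R) (i + 1).
  by apply/eqP; rewrite -subr_eq0; move/matrixP/(_ i j): adj0; rewrite !mxE => ->.
have [[k00 k01] k02] := (key 0 0, key 0 1, key 0 2%:R).
have [[k10 k11] k12] := (key 1 0, key 1 1, key 1 2%:R).
have [[k20 k21] k22] := (key 2%:R 0, key 2%:R 1, key 2%:R 2%:R).
rewrite !I3 in k00 k01 k02 k10 k11 k12 k20 k21 k22.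
have close (a b c e x y z t : R) : x * y = z * t ->
    (a * b - c * e = x * y - z * t \/ a * b - c * e = z * t - x * y) -> a * b = c * e.
  by move=> -> []; rewrite subrr => /eqP; rewrite subr_eq0 => /eqP.
elim/ord3P; elim/ord3P; elim/ord3P; elim/ord3P; first [by ring
 | apply: (close _ _ _ _ _ _ _ _ k00); first [by left; ring | by right; ring]
 | apply: (close _ _ _ _ _ _ _ _ k01); first [by left; ring | by right; ring]
 | apply: (close _ _ _ _ _ _ _ _ k02); first [by left; ring | by right; ring]
 | apply: (close _ _ _ _ _ _ _ _ k10); first [by left; ring | by right; ring]
 | apply: (close _ _ _ _ _ _ _ _ k11); first [by left; ring | by right; ring]
 | apply: (close _ _ _ _ _ _ _ _ k12); first [by left; ring | by right; ring]
 | apply: (close _ _ _ _ _ _ _ _ k20); first [by left; ring | by right; ring]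
 | apply: (close _ _ _ _ _ _ _ _ k21); first [by left; ring | by right; ring]
 | apply: (close _ _ _ _ _ _ _ _ k22); first [by left; ring | by right; ring]].
Qed.

(** A nonzero row is g u with u primitive. Vanishing minors make each row a multiple of u, and by
    symmetry the vector of multiples is again a multiple of u. *)
Lemma rank_one A : A^T = A -> adj3 A = 0 -> A != 0 ->
  exists h u, primitive u /\ forall i j, A i j = h * u i * u j.
Proof.
move=> symA /adj3_eq0 minor A0.
have sA i j : A i j = A j i by rewrite -{1}symA mxE.
have [i0 /existsP[j0 Aij]] : exists i, [exists j, A i j != 0].
  apply/existsP; apply: contraNT A0 => /existsPn A0; apply/eqP/matrixP => i j.
  by have /existsPn/(_ j)/negPn/eqP -> := A0 i; rewrite mxE.
have [g [u [g0 pu uE]]] := primitive_part gcdR (ex_intro (fun j => A i0 j != 0) j0 Aij).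
have par k : exists s, forall j, A k j = s * u j.
  apply: (parallel_primitive pu) => i j; apply: (mulfI g0).
  have := minor i0 i k j; rewrite !uE => e.
  by rewrite mulrCA -[RHS]mulrCA; move: e; rewrite ![_ * A k _]mulrC ![A k _ * _]mulrC => ->.
have [s sE] := choice par.
have [|h hE] := parallel_primitive pu (v := s).
  by move=> i j; rewrite -!sE sA.
by exists h, u; split=> // i j; rewrite sE hE.
Qed.

Section Der.
Variables (d : R -> R) (n : 'I_3 -> R).
Hypothesis d_der : derivation idfun d.
Hypothesis no_eig : forall g a, d g = a * g -> d g = 0.
Let dM a b : d (a * b) = a * d b + b * d a. Proof. by case: d_der. Qed.

(** The vector s = d(h) u + 2 h (d(u) - n x u) satisfies s_i u_j + u_i s_j = 0, so s = 0.
    Primitivity of u makes h divide d(h), which must then vanish, and u is covariant. *)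
Lemma rank_one_cov A h u : covM d n A -> A != 0 -> primitive u ->
  (forall i j, A i j = h * u i * u j) -> covV d n u /\ d h = 0.
Proof.
move=> cA A0 pu AE.
have h0 : h != 0.
  by apply: contraNneq A0 => h0; apply/eqP/matrixP => i j; rewrite AE h0 !mul0r mxE.
pose s i := d h * u i + h *+ 2 * (d (u i) - cross n u i).
have su i j : s i * u j + u i * s j = 0.
  have := cA i j; rewrite AE !dM /s /cross !AE => /eqP; rewrite -subr_eq0 => /eqP e.
  by rewrite -[RHS](mulr0 2%:R) -e; ring.
have [i ui0] := primitive_neq0 pu.
have si : s i = 0.
  have := su i i; rewrite mulrC -mulr2n -mulr_natr => /eqP; rewrite !mulf_eq0 (negPf two0) (negPf ui0) orbF /=.
  by move/eqP.
have s0 j : s j = 0.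
  by have := su i j; rewrite si mul0r add0r => /eqP; rewrite mulf_eq0 (negPf ui0) => /eqP.
have [c dh] : dvr h (d h).
  apply: pu => j; exists (- (d (u j) - cross n u j) *+ 2).
  by have /eqP := s0 j; rewrite /s addr_eq0 => /eqP ->; ring.
have dh0 := no_eig dh; split=> // j.
have := s0 j; rewrite /s dh0 mul0r add0r -mulr_natr => /eqP.
by rewrite !mulf_eq0 (negPf two0) (negPf h0) /= subr_eq0 => /eqP.
Qed.
End Der.

(** Modulo [t] the vector [w] is in the kernel of [A], so the columns of the adjugate are parallel
    to it; by symmetry the adjugate is proportional to w w^T. Later uses take t = 0 or t = tau. *)
Lemma adj3_kernel A w t : A^T = A -> (forall i, dvr t (mulv A w i)) -> forall i j k l,
  dvr t (adj3 A k l * w i * w j - adj3 A i j * w k * w l).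
Proof.
move=> symA tz; have adjC i j : adj3 A i j = adj3 A j i by rewrite -{1}symA adj3_tr mxE.
have key i l : dvr t (w (i + 1) * adj3 A (i + 2%:R) l - w (i + 2%:R) * adj3 A (i + 1) l).
  have -> : w (i + 1) * adj3 A (i + 2%:R) l - w (i + 2%:R) * adj3 A (i + 1) l =
     A (l + 1) i * mulv A w (l + 2%:R) - A (l + 2%:R) i * mulv A w (l + 1).
    by elim/ord3P: i; elim/ord3P: l; entries; ring.
  by apply: dvrB; apply: dvr_mull.
have {}key i k l : dvr t (w i * adj3 A k l - w k * adj3 A i l).
  have [[k0 k1] k2] := (key 0 l, key 1 l, key 2%:R l); rewrite !I3 in k0 k1 k2.
  by elim/ord3P: i; elim/ord3P: k; rewrite ?subrr //; try exact: dvr0; rewrite -opprB; apply: dvrN.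
move=> i j k l; have := dvrD (dvr_mulr (w j) (key i k l)) (dvr_mulr (w k) (key j l i)).
rewrite (adjC l i) (adjC j i); apply: (fun e x => eq_ind _ (dvr t) x _ e).
by move: (adj3 A k l) (adj3 A i l) (adj3 A i j) => x y z; ring.
Qed.
End RankOne.

(** * Locally nilpotent derivations *)

Section LocallyNilpotent.
Variables (R : idomainType) (d : R -> R).
Hypothesis natR : forall n, n.+1%:R != 0 :> R.
Hypothesis d_der : derivation idfun d.
Hypothesis d_nilp : forall a, exists N, iter N d a = 0.
Let dD a b : d (a + b) = d a + d b. Proof. by case: d_der. Qed.
Let dM a b : d (a * b) = a * d b + b * d a. Proof. by case: d_der. Qed.

Let itD i a b : iter i d (a + b) = iter i d a + iter i d b.
Proof. by elim: i a b => [|i IH] a b //=; rewrite IH dD. Qed.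
Let it0 i : iter i d 0 = 0.
Proof. by elim: i => [|i IH] //=; rewrite IH (der_zero d_der). Qed.

Let it_mull i a b : d a = 0 -> iter i d (a * b) = a * iter i d b.
Proof. by move=> da; elim: i => [|i IH] //=; rewrite IH dM da mulr0 addr0. Qed.

(** In the Leibniz formula only one term survives, so the largest exponent with nonzero iterate
    behaves like a degree: it is additive on products. *)
Lemma leibniz_top m n a b : iter m.+1 d a = 0 -> iter n.+1 d b = 0 ->
  iter (m + n) d (a * b) = iter m d a * iter n d b *+ 'C(m + n, m).
Proof.
have [s] := ubnP (m + n); elim: s => // s IH in m n a b * => /ltnSE le_s.
case: m => [|m] in le_s *; first by move=> a0 _; have da : d a = 0 := a0; rewrite bin0 mulr1n it_mull.
case: n => [|n] in le_s *.
  by move=> _ b0; have db : d b = 0 := b0; rewrite addn0 binn mulr1n [a * b]mulrC it_mull // mulrC.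
move=> a0 b0; rewrite addSn iterSr dM itD -addSnnS [X in _ = _ *+ X]binS mulrnDr.
have -> : iter (m.+1 + n) d (a * d b) = iter m.+1 d a * iter n.+1 d b *+ 'C(m.+1 + n, m.+1).
  by rewrite IH -?iterSr //; lia.
congr (_ + _); rewrite [b * _]mulrC addSnnS.
by rewrite IH -?iterSr //; lia.
Qed.

Lemma nilp_top a : a != 0 -> exists m, iter m d a != 0 /\ iter m.+1 d a = 0.
Proof.
move=> a0; have exN : exists N, iter N d a == 0 by have [N /eqP] := d_nilp a; exists N.
case: (ex_minnP exN) => -[|m] /eqP mE min; first by rewrite -mE eqxx in a0.
by exists m; split=> //; apply/negP => /min; rewrite ltnn.
Qed.

Lemma leibniz_top_neq0 m n a b : iter m d a != 0 -> iter n d b != 0 ->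
  iter m.+1 d a = 0 -> iter n.+1 d b = 0 -> iter (m + n) d (a * b) != 0.
Proof.
move=> am bn a0 b0; rewrite leibniz_top // -mulr_natr !mulf_neq0 //.
by case: 'C(_, _) (bin_gt0 (m + n) m) => [|c _]; rewrite ?leq_addr.
Qed.

(** If the degree of a b is 0, so are the degrees of a and b. *)
Lemma lnd_factor a b : a * b != 0 -> d (a * b) = 0 -> d a = 0.
Proof.
move=> ab0 dab; have [a0 b0] : a != 0 /\ b != 0 by apply/andP; rewrite -negb_or -mulf_eq0.
have [m [am ma]] := nilp_top a0; have [n [bn nb]] := nilp_top b0.
case: m => [|m] in am ma *; first exact: ma.
by have := leibniz_top_neq0 am bn ma nb; rewrite addSn iterSr dab it0 eqxx.
Qed.

(** A nonzero a g has degree at least that of g, whereas applying d to g lowers it. *)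
Lemma lnd_no_eig g a : d g = a * g -> d g = 0.
Proof.
move=> dg; have [->|g0] := eqVneq g 0; first exact: (der_zero d_der).
have [a0|a0] := eqVneq a 0; first by rewrite dg a0 mul0r.
have [m [am ma]] := nilp_top a0; have [n [gn ng]] := nilp_top g0.
have := leibniz_top_neq0 am gn ma ng.
by rewrite -dg -iterSr -addnS ssrnat.iterD ng it0 eqxx.
Qed.
End LocallyNilpotent.

Lemma ord4P (K : 'I_4 -> Prop) : K 0 -> K 1 -> K 2%:R -> K 3%:R -> forall i, K i.
Proof.
move=> K0 K1 K2 K3 [[|[|[|[|//]]]] lt].
- by rewrite (_ : Ordinal lt = 0); last exact: val_inj.
- by rewrite (_ : Ordinal lt = 1); last exact: val_inj.
- by rewrite (_ : Ordinal lt = 2%:R); last exact: val_inj.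
- by rewrite (_ : Ordinal lt = 3%:R); last exact: val_inj.
Qed.

Lemma sum4 (V : nmodType) (f : 'I_4 -> V) : \sum_i f i = f 0 + f 1 + f 2%:R + f 3%:R.
Proof.
rewrite !big_ord_recl big_ord0 addr0 !addrA.
by congr (f _ + f _ + f _ + f _); apply: val_inj.
Qed.

(** * The kernel of a 4 by 3 matrix through its maximal minors *)

Section KernelLine.
Variables (R : idomainType) (col : 'I_4 -> 'I_3 -> R).
Definition minor a b c := dot (cross (col a) (col b)) (col c).
(** The generalized cross product: the signed maximal minors, a vector in the kernel of the matrix
    which spans that kernel when the rank is 3. *)
Definition theta (i : 'I_4) : R := nth 0 [:: minor 1 2%:R 3%:R; - minor 0 2%:R 3%:R;
  minor 0 1 3%:R; - minor 0 1 2%:R] i.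

Lemma theta_eq0 : (forall i, theta i = 0) -> forall a b c, minor a b c = 0.
Proof.
move=> t0; have [[m0 m1] [m2 m3]] := (t0 0, t0 1, (t0 2%:R, t0 3%:R)).
rewrite /theta /= in m0 m1 m2 m3.
move/eqP: m1; rewrite oppr_eq0 => /eqP m1; move/eqP: m3; rewrite oppr_eq0 => /eqP m3.
elim/ord4P; elim/ord4P; elim/ord4P; first [
  by rewrite /minor /dot /cross ?I3; ring
| by rewrite -m0 /minor /dot /cross ?I3; ring | by rewrite -m1 /minor /dot /cross ?I3; ring
| by rewrite -m2 /minor /dot /cross ?I3; ring | by rewrite -m3 /minor /dot /cross ?I3; ring
| by rewrite -[RHS]oppr0 -m0 /minor /dot /cross ?I3; ring | by rewrite -[RHS]oppr0 -m1 /minor /dot /cross ?I3; ring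
| by rewrite -[RHS]oppr0 -m2 /minor /dot /cross ?I3; ring | by rewrite -[RHS]oppr0 -m3 /minor /dot /cross ?I3; ring].
Qed.

Lemma theta_ker v : (forall r, \sum_i v i * col i r = 0) -> forall i j, theta i * v j = theta j * v i.
Proof.
move=> v0; have := (v0 0, v0 1, v0 2%:R); rewrite !sum4 => -[[s0 s1] s2].
have E (a b : 'I_4) : dot (cross (col a) (col b)) (fun r =>
    v 0 * col 0 r + v 1 * col 1 r + v 2%:R * col 2%:R r + v 3%:R * col 3%:R r) = 0.
  by rewrite /dot s0 s1 s2 !mulr0 !addr0.
have key i j a b s : (theta i * v j - theta j * v i = s * dot (cross (col a) (col b)) (fun r =>
    v 0 * col 0 r + v 1 * col 1 r + v 2%:R * col 2%:R r + v 3%:R * col 3%:R r)) -> theta i * v j = theta j * v i.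
  by rewrite E mulr0 => /eqP; rewrite subr_eq0 => /eqP.
have [k01 k02 k03] : [/\ theta 0 * v 1 = theta 1 * v 0, theta 0 * v 2%:R = theta 2%:R * v 0
    & theta 0 * v 3%:R = theta 3%:R * v 0].
  split; [apply: (key _ _ 2%:R 3%:R 1) | apply: (key _ _ 1 3%:R (-1)) | apply: (key _ _ 1 2%:R 1)];
  by rewrite /theta /minor /dot /cross ?I3 /=; ring.
have [k12 k13 k23] : [/\ theta 1 * v 2%:R = theta 2%:R * v 1, theta 1 * v 3%:R = theta 3%:R * v 1
    & theta 2%:R * v 3%:R = theta 3%:R * v 2%:R].
  split; [apply: (key _ _ 0 3%:R 1) | apply: (key _ _ 0 2%:R (-1)) | apply: (key _ _ 0 1 1)];
  by rewrite /theta /minor /dot /cross ?I3 /=; ring.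
by elim/ord4P; elim/ord4P.
Qed.

Lemma ker_parallel v w : ~ (forall i, theta i = 0) ->
  (forall r, \sum_i v i * col i r = 0) -> (forall r, \sum_i w i * col i r = 0) ->
  forall i j, v i * w j = w i * v j.
Proof.
move=> t0 /theta_ker kv /theta_ker kw i j.
have [l tl] : exists l, theta l != 0.
  apply: contrapT => none; apply: t0 => l; apply/eqP/negPn/negP => nz; apply: none; by exists l.
apply: (mulfI (mulf_neq0 tl tl)).
transitivity ((theta l * v i) * (theta l * w j)); first by ring.
transitivity ((theta l * w i) * (theta l * v j)); last by ring.
by rewrite (kv l i) (kw l j) (kw l i) (kv l j); ring.
Qed.
End KernelLine.

Lemma natR_mpoly (k : fieldType) m : [pchar k] =i pred0 -> forall n, n.+1%:R != 0 :> {mpoly k[m]}.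
Proof.
by move=> char0 n; rewrite -(rmorph_nat (@mpolyC m k)) mpolyC_eq0 (pcharf0P k).1.
Qed.

(* If [c] is a multiple of the point [x] of the quadric then the unimodular relation extracts the factor. *)
Lemma quadric_multiple (R : comNzRingType) (x0 x1 x2 p0 p1 p2 : R) :
  x1 ^+ 2 = x0 * x2 *+ 2 - 1 -> p0 * x0 = p1 * (- (x2 *+ 2)) -> p1 * (- x1) = p2 * x0 ->
  p2 * (- (x2 *+ 2)) = p0 * (- x1) -> exists m, [/\ m = x2 * p1 *+ 2 + x1 * p2,
  p0 = - (m * x2 *+ 2), p1 = m * x0 & p2 = - (m * x1)].
Proof.
move=> rel e01 e12 e20; exists (x2 * p1 *+ 2 + x1 * p2); split=> //.
- transitivity (p0 * (x0 * x2 *+ 2 - x1 ^+ 2)); first by rewrite rel; ring.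
  transitivity ((p0 * x0) * x2 *+ 2 + x1 * (p0 * (- x1))); first by ring.
  by rewrite e01 -e20; ring.
- transitivity (p1 * (x0 * x2 *+ 2 - x1 ^+ 2)); first by rewrite rel; ring.
  by transitivity (p1 * x0 * x2 *+ 2 + x1 * (p1 * (- x1))); [ring | rewrite e12; ring].
- transitivity (p2 * (x0 * x2 *+ 2 - x1 ^+ 2)); first by rewrite rel; ring.
  by transitivity ((p2 * x0) * x2 *+ 2 - x1 * x1 * p2); [ring | rewrite -e12; ring].
Qed.

Lemma cross_orth (R : comNzRingType) (p u v : 'I_3 -> R) : dot p u = 0 -> dot p v = 0 ->
  forall i j, p i * cross u v j = p j * cross u v i.
Proof.
move=> pu pv.
have key i : p (i + 1) * cross u v (i + 2%:R) = p (i + 2%:R) * cross u v (i + 1).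
  apply/eqP; rewrite -subr_eq0; apply/eqP; rewrite -[RHS](mulr0 (u i)) -pv.
  rewrite -[LHS]addr0 -(mulr0 (v i)) -pu.
  by elim/ord3P: i; rewrite /dot /cross ?I3; ring.
have [[k0 k1] k2] := (key 0, key 1, key 2%:R); rewrite !I3 in k0 k1 k2.
by elim/ord3P; elim/ord3P.
Qed.

(** * Vector fields of an equivariantly embedded X in 4-space *)

Section EquivariantMap.
Variable k : closedFieldType.
Hypothesis char0 : [pchar k] =i pred0.
Local Notation D := (Dring k).
Local Notation B := {mpoly k[4]}.
Local Notation x0 := (piD 'X_0 : D).
Local Notation x1 := (piD 'X_1 : D).
Local Notation x2 := (piD 'X_2 : D).
Local Notation ED := (lE (Y_action char0)).
Local Notation FD := (lF (Y_action char0)).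
Local Notation HD := (lH (Y_action char0)).
Variables (rho : SL2_action B) (f : {lrmorphism B -> Rring k}).
Hypothesis f_onto : closed_embedding f.
Hypothesis f_equiv : equivariant (X_action char0) rho f.
Local Notation E := (lE rho).
Local Notation F := (lF rho).
Local Notation H := (lH rho).

Definition phi (b : B) : D := Rval (f b).
Fact phi_zmod : zmod_morphism phi. Proof. by move=> a b; rewrite /phi !rmorphB. Qed.
Fact phi_monoid : monoid_morphism phi.
Proof. by split=> [|a b]; rewrite /phi ?rmorph1 ?rmorphM. Qed.
Fact phi_scale : scalable phi.
Proof. by move=> c b; rewrite /phi !linearZ. Qed.
HB.instance Definition _ := GRing.isZmodMorphism.Build B D phi phi_zmod.
HB.instance Definition _ := GRing.isMonoidMorphism.Build B D phi phi_monoid.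
HB.instance Definition _ := GRing.isScalable.Build k B D _ phi phi_scale.

Lemma phiD a b : phi (a + b) = phi a + phi b. Proof. exact: rmorphD. Qed.
Lemma phiB a b : phi (a - b) = phi a - phi b. Proof. exact: rmorphB. Qed.
Lemma phiN a : phi (- a) = - phi a. Proof. exact: rmorphN. Qed.
Lemma phiM a b : phi (a * b) = phi a * phi b. Proof. exact: rmorphM. Qed.
Lemma phi0 : phi 0 = 0. Proof. exact: rmorph0. Qed.
Lemma phi1 : phi 1 = 1. Proof. exact: rmorph1. Qed.
Lemma phiZ c a : phi (c *: a) = c *: phi a. Proof. exact: linearZ. Qed.
Lemma phiX a n : phi (a ^+ n) = phi a ^+ n. Proof. exact: rmorphXn. Qed.
Lemma phiMn a n : phi (a *+ n) = phi a *+ n. Proof. exact: rmorphMn. Qed.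
Lemma phiC c : phi c%:MP = c%:A. Proof. by rewrite -alg_mpolyC phiZ phi1. Qed.

Fact phi_equiv g b : phi (rho g b) = Y_action char0 g (phi b).
Proof. by rewrite /phi f_equiv. Qed.
Lemma phi_E b : phi (E b) = ED (phi b). Proof. exact: (equiv_lE char0 (f := phi) phi_equiv). Qed.
Lemma phi_F b : phi (F b) = FD (phi b). Proof. exact: (equiv_lF char0 (f := phi) phi_equiv). Qed.
Lemma phi_H b : phi (H b) = HD (phi b). Proof. exact: (equiv_lH char0 (f := phi) phi_equiv). Qed.

Lemma mu_phi b : mu (phi b) = phi b. Proof. exact: muR. Qed.
Lemma phi_onto (r : D) : mu r = r -> exists b, phi b = r.
Proof.
move=> /eqP mr; have [b bE] := f_onto (MkRring (mr : r \in @mu_fixed k)).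
by exists b; rewrite /phi bE.
Qed.

Lemma E_nilp b : exists N, iter N E b = 0.
Proof. by have [N HN] := lE_nilp char0 rho b; exists N; apply: HN. Qed.
Lemma F_nilp b : exists N, iter N F b = 0.
Proof. by have [N HN] := lF_nilp char0 rho b; exists N; apply: HN. Qed.

Lemma hw_lift (r : D) d : mu r = r -> ED r = 0 -> HD r = d%:R *: r ->
  exists b, [/\ E b = 0, H b = d%:R *: b & phi b = r].
Proof.
move=> /phi_onto[b <-] Eb Hb.
apply: (@highest_weight_lift k B (lE rho) (lF rho) (lH rho) char0 _ _ _ E_nilp F_nilp
  D (lE (Y_action char0)) (lF (Y_action char0)) (lH (Y_action char0)) phi phi_E phi_F phi_H d b Eb Hb).
- by move=> v; rewrite /lH addrC subrK.
- by move=> v; rewrite -(lHE_comm char0) addrC subrK.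
- by move=> v; rewrite -[LHS](subrK (F (H v))) (lHF_comm char0) addrC.
Unshelve. all: exact: char0.
Qed.

Lemma hw_nilp d w : E w = 0 -> H w = d%:R *: w -> iter d.+1 F w = 0.
Proof.
apply: (@highest_weight_nilp k B (lE rho) (lF rho) (lH rho) char0 _ _ F_nilp d w).
- by move=> v; rewrite /lH addrC subrK.
- by move=> v; rewrite -[LHS](subrK (F (H v))) (lHF_comm char0) addrC.
Unshelve. all: exact: char0.
Qed.

Definition field_col (i : 'I_4) (r : 'I_3) : B := nth 0 [:: E 'X_i; F 'X_i; H 'X_i] r.

Lemma phi_cross a b : let s := bracket char0 (phi 'X_a) (phi 'X_b) in
  [/\ phi (cross (field_col a) (field_col b) 0) = - (x2 *+ 2) * s,
      phi (cross (field_col a) (field_col b) 1) = x0 * s &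
      phi (cross (field_col a) (field_col b) 2%:R) = - x1 * s].
Proof.
have [c0 c1 c2] := cross_fields char0 (phi 'X_a) (phi 'X_b).
move=> s; rewrite /cross !I3 /field_col /=; split.
- by rewrite phiB !phiM phi_F phi_H phi_F phi_H c0; rewrite /s; move: (bracket _ _ _) => t; ring.
- by rewrite phiB !phiM phi_E phi_H phi_E phi_H c1.
- by rewrite phiB !phiM phi_E phi_F phi_E phi_F c2 mulNr.
Qed.

(** If all minors vanished, every cross product of the [field_col] would be a multiple of one
    primitive vector c. On Y, c is m (-2 x2, x0, -x1) with m odd. At a zero of m where x0 or x2 is
    nonzero, all brackets of the coordinates would vanish. *)
Lemma theta_neq0 : ~ (forall i, theta field_col i = 0).
Proof.
move/theta_eq0 => t0.
pose pv := curve1 char0 1.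
have [a [b abn0]] := bracket_images_neq0 char0 f_onto pv.
have D0 (u : D) v (qv : point v) : ev qv u != 0 -> u <> 0.
  by move=> u0 uE; rewrite uE rmorph0 eqxx in u0.
have /D0 sn0 : ev pv (bracket char0 (phi 'X_a) (phi 'X_b)) != 0 := abn0.
have cn0 : exists i, cross (field_col a) (field_col b) i != 0.
  exists 1; apply/eqP => c0; have [_ + _] := phi_cross a b.
  rewrite c0 phi0 => /esym/(Dring_integral char0)[]; [exact: (x_nz char0).1 | exact: sn0].
have [g [c [g0 pc cE]]] := primitive_part (@gcd_domain_mpoly k 4) cn0.
have cK l : dot c (field_col l) = 0.
  apply: (mulfI g0); rewrite mulr0 -(t0 a b l) /minor /dot !cE; ring.
have cpar a' b' : exists h, forall i, cross (field_col a') (field_col b') i = h * c i.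
  apply: (parallel_primitive pc) => i j; rewrite mulrC [RHS]mulrC.
  by apply: cross_orth; apply: cK.
have [p0 p1 p2] : [/\ phi (c 0) * x0 = phi (c 1) * (- (x2 *+ 2)),
   phi (c 1) * (- x1) = phi (c 2%:R) * x0 & phi (c 2%:R) * (- (x2 *+ 2)) = phi (c 0) * (- x1)].
  have cp i j := congr1 phi (cross_orth (cK a) (cK b) i j).
  have [e01 e12] := (cp 0 1, cp 1 2%:R); have e20 := cp 2%:R 0.
  rewrite !phiM in e01 e12 e20; have [c0 c1 c2] := phi_cross a b.
  rewrite c0 c1 c2 in e01 e12 e20; move: e01 e12 e20 sn0.
  move: (bracket _ _ _) (phi (c 0)) (phi (c 1)) (phi (c 2%:R)) => s q0 q1 q2 e01 e12 e20 sn0.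
  have canc u v : u * s = v * s -> u = v.
    move=> e; have : (u - v) * s = 0 by rewrite mulrBl e subrr.
    by case/(Dring_integral char0) => // /eqP; rewrite subr_eq0 => /eqP.
  by split; apply: canc; rewrite -!mulrA.
have [m [mE pm0 pm1 pm2]] := quadric_multiple (x_rel k) p0 p1 p2.
have modd : mu m = - m.
  have e u v : mu (u * v) = mu u * mu v by exact: rmorphM.
  have eD u v : mu (u + v) = mu u + mu v by exact: rmorphD.
  have e2 u : mu (u *+ 2) = mu u *+ 2 by exact: rmorphMn.
  rewrite mE eD e2 !e [mu x2]muX [mu x1]muX !mu_phi.
  by move: (phi (c 1)) (phi (c 2%:R)) => *; ring.
have [v [qv [m0 nz]]] := odd_zero char0 modd.
have [i [j ijn0]] := bracket_images_neq0 char0 f_onto qv.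
have [h hE] := cpar i j.
have [c0 c1 _] := phi_cross i j; rewrite !hE !phiM pm0 pm1 in c0 c1.
have evM u w : ev qv (u * w) = ev qv u * ev qv w by exact: rmorphM.
have evN u : ev qv (- u) = - ev qv u by exact: rmorphN.
have ev2 u : ev qv (u *+ 2) = ev qv u *+ 2 by exact: rmorphMn.
move: ijn0; rewrite -[Rval (f 'X_i)]/(phi 'X_i) -[Rval (f 'X_j)]/(phi 'X_j).
move: (congr1 (ev qv) c0) (congr1 (ev qv) c1); rewrite !(evM, evN, ev2) m0 !evX.
move: (ev qv (bracket _ _ _)) => s.
rewrite !(mul0r, mulr0, mul0rn, oppr0) => e0 e1 /negPf s0.
case: nz => nz.
  by move/esym/eqP: e1; rewrite mulf_eq0 s0 (negPf nz).
by move/esym/eqP: e0; rewrite mulf_eq0 s0 oppr_eq0 -[v 2%:R *+ 2]mulr_natr mulf_eq0 (negPf nz) (negPf (nat_neq0 char0 1)).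
Unshelve. all: exact: char0.
Qed.

Lemma gradient_ker (a : B) : E a = 0 -> F a = 0 -> forall r, \sum_i a^`M(i) * field_col i r = 0.
Proof.
move=> Ea Fa.
have chain (d : B -> B) : derivation idfun d -> (forall c, d c%:A = 0) ->
    d a = \sum_i a^`M(i) * d 'X_i.
  move=> dd dc; apply: (@mpoly_chain k 4 B idfun B idfun d dd) => c.
  by rewrite /= -alg_mpolyC dc.
have EC c : E c%:A = 0 by rewrite (lEZ char0) (lE1 char0) scaler0.
have FC c : F c%:A = 0 by rewrite (lFZ char0) (lF1 char0) scaler0.
have HC c : H c%:A = 0 by rewrite (lHZ char0) (lH1 char0) scaler0.
have Ha : H a = 0 by rewrite /lH Ea Fa (lE0 char0) (lF0 char0) subrr.
elim/ord3P; rewrite /field_col /=.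
- by rewrite -(chain _ (lE_der char0 rho) EC).
- by rewrite -(chain _ (lF_der char0 rho) FC).
- by rewrite -(chain _ (lH_der char0 rho) HC).
Qed.

Lemma invariant_parallel (a b : B) : E a = 0 -> F a = 0 -> E b = 0 -> F b = 0 ->
  forall i j, a^`M(i) * b^`M(j) = b^`M(i) * a^`M(j).
Proof.
by move=> Ea Fa Eb Fb; apply: (ker_parallel theta_neq0); apply: gradient_ker.
Qed.

(** The orbits in X are surfaces: the relation [fields_rel] makes E, F, H dependent on X. *)
Lemma phi_theta i : phi (theta field_col i) = 0.
Proof.
have z a b c : phi (minor field_col a b c) = 0.
  have [c0 c1 c2] := phi_cross a b; have rel := fields_rel char0 (phi 'X_c).
  rewrite /minor /dot !phiD !phiM c0 c1 c2 /field_col /= phi_E phi_F phi_H.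
  move: rel; move: (bracket _ _ _) (ED _) (FD _) (HD _) => s e g h rel.
  transitivity (s * (x0 * g - (x2 * e *+ 2 + x1 * h))); last by rewrite rel subrr mulr0.
  by move: x0 x1 x2 => a0 a1 a2; ring.
by elim/ord4P: i; rewrite /theta /= ?phiN z ?oppr0.
Qed.
End EquivariantMap.

(** * The symmetric covariant matrix of trace 1 *)

Section OrthonormalCoordinates.
Variables (R : comNzRingType) (ii cc : R).
Hypotheses (hi : ii ^+ 2 + 1 = 0) (hc : cc ^+ 2 *+ 2 - 1 = 0).

(** The rotation axis of E in the coordinates cc (x0 + x2), ii x1, ii cc (x0 - x2), in which 2 x0 x2
    - x1^2 becomes a sum of three squares because ii^2 = -1 and cc^2 = 1/2. [rotF] is the axis of
    F. *)
Definition rotE (i : 'I_3) : R := nth 0 [:: - cc; 0; ii * cc] i.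
Definition rotF (i : 'I_3) : R := nth 0 [:: cc *+ 2; 0; ii * cc *+ 2] i.

(** The cofactors [p] and [q] of the two relations are supplied by hand, turning an equality modulo
    the relations into one that [ring] decides. *)
Lemma modulo_rel p q (x y : R) : x - y = (ii ^+ 2 + 1) * p + (cc ^+ 2 *+ 2 - 1) * q -> x = y.
Proof. by rewrite hi hc !mul0r addr0 => /eqP; rewrite subr_eq0 => /eqP. Qed.

Variables g00 g01 g02 g11 g12 g22 : R.
Let c00 := cc ^+ 2 * (g00 + g02 *+ 2 + g22).
Let c01 := ii * cc * (g01 + g12).
Let c02 := ii * cc ^+ 2 * (g00 - g22).
Let c11 := ii ^+ 2 * g11.
Let c12 := ii ^+ 2 * cc * (g01 - g12).
Let c22 := ii ^+ 2 * cc ^+ 2 * (g00 - g02 *+ 2 + g22).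
(** For g_ij = x_i x_j this is y y^T in the orthonormal coordinates y; only the transformation rules
    of the g_ij enter below. *)
Definition sym_coords : 'M[R]_3 := \matrix_(i, j)
  nth 0 (nth [::] [:: [:: c00; c01; c02]; [:: c01; c11; c12]; [:: c02; c12; c22]] i) j.

Lemma sym_coords_trace : \tr sym_coords = g02 *+ 2 - g11.
Proof.
rewrite tr3 !mxE /= /c00 /c11 /c22.
apply: (modulo_rel (p := g11 + cc ^+ 2 * (g00 - g02 *+ 2 + g22)) (q := g02 *+ 2)); ring.
Qed.

Variable d : R -> R.
Hypotheses (d_der : derivation idfun d) (di : d ii = 0) (dc : d cc = 0).
Let dD a b : d (a + b) = d a + d b. Proof. by case: d_der. Qed.
Let dM a b : d (a * b) = a * d b + b * d a. Proof. by case: d_der. Qed.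
Let dN a : d (- a) = - d a. Proof. exact: der_opp. Qed.
Let dMn a n : d (a *+ n) = d a *+ n.
Proof. by elim: n => [|n IH]; rewrite ?mulr0n ?mulrS ?dD ?IH ?(der_zero d_der). Qed.
Let dX (a : R) n : d a = 0 -> d (a ^+ n) = 0. Proof. exact: der_exp. Qed.
Let dE := (dD, dM, dN, dMn, dX 2 di, dX 2 dc, di, dc).

Lemma sym_coords_E : d g00 = 0 -> d g01 = g00 -> d g02 = g01 -> d g11 = g01 *+ 2 ->
  d g12 = g02 + g11 -> d g22 = g12 *+ 2 -> covM d rotE sym_coords.
Proof.
move=> e00 e01 e02 e11 e12 e22; elim/ord3P; elim/ord3P;
  rewrite /cross !mxE ?I3 /= /rotE ?I3 /=;
  rewrite /c00 /c01 /c02 /c11 /c12 /c22 !dE ?e00 ?e01 ?e02 ?e11 ?e12 ?e22.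
- apply: (modulo_rel (p := 0 + ((cc ^+ 2 * g01) *+ 2) + ((cc ^+ 2 * g12) *+ 2)) (q := 0)); ring.
- apply: (modulo_rel (p := 0 + (ii * cc * g11)) (q := 0 - (ii * cc * g00) - (ii * cc * g02))); ring.
- apply: (modulo_rel (p := 0 + (ii * cc ^+ 2 * g01) - (ii * cc ^+ 2 * g12)) (q := 0)); ring.
- apply: (modulo_rel (p := 0 + (ii * cc * g11)) (q := 0 - (ii * cc * g00) - (ii * cc * g02))); ring.
- apply: (modulo_rel (p := 0 + ((g01) *+ 2) - ((cc ^+ 2 * g01) *+ 4)) (q := 0 + ((g01) *+ 2))); ring.
- apply: (modulo_rel (p := 0 + (cc * g00) - (cc * g02) - ((cc ^+ 3 * g00) *+ 2) + ((cc ^+ 3 * g02) *+ 2)) (q := 0 + (cc * g00) - (cc * g02))); ring.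
- apply: (modulo_rel (p := 0 + (ii * cc ^+ 2 * g01) - (ii * cc ^+ 2 * g12)) (q := 0)); ring.
- apply: (modulo_rel (p := 0 + (cc * g00) - (cc * g02) - ((cc ^+ 3 * g00) *+ 2) + ((cc ^+ 3 * g02) *+ 2)) (q := 0 + (cc * g00) - (cc * g02))); ring.
- apply: (modulo_rel (p := 0) (q := 0)); ring.
Qed.

Lemma sym_coords_F : d g00 = g01 *+ 4 -> d g01 = (g11 + g02) *+ 2 -> d g02 = g12 *+ 2 ->
  d g11 = g12 *+ 4 -> d g12 = g22 *+ 2 -> d g22 = 0 -> covM d rotF sym_coords.
Proof.
move=> e00 e01 e02 e11 e12 e22; elim/ord3P; elim/ord3P;
  rewrite /cross !mxE ?I3 /= /rotF ?I3 /=;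
  rewrite /c00 /c01 /c02 /c11 /c12 /c22 !dE ?e00 ?e01 ?e02 ?e11 ?e12 ?e22.
- apply: (modulo_rel (p := 0 + ((cc ^+ 2 * g01) *+ 4) + ((cc ^+ 2 * g12) *+ 4)) (q := 0)); ring.
- apply: (modulo_rel (p := 0 + ((ii * cc * g11) *+ 2)) (q := 0 - ((ii * cc * g02) *+ 2) - ((ii * cc * g22) *+ 2))); ring.
- apply: (modulo_rel (p := 0 + ((ii * cc ^+ 2 * g01) *+ 2) - ((ii * cc ^+ 2 * g12) *+ 2)) (q := 0)); ring.
- apply: (modulo_rel (p := 0 + ((ii * cc * g11) *+ 2)) (q := 0 - ((ii * cc * g02) *+ 2) - ((ii * cc * g22) *+ 2))); ring.
- apply: (modulo_rel (p := 0 + ((g12) *+ 4) - ((cc ^+ 2 * g12) *+ 8)) (q := 0 + ((g12) *+ 4))); ring.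
- apply: (modulo_rel (p := 0 + ((cc * g02) *+ 2) - ((cc * g22) *+ 2) + ((cc ^+ 3 * g22) *+ 4) - ((cc ^+ 3 * g02) *+ 4)) (q := 0 - ((cc * g22) *+ 2) + ((cc * g02) *+ 2))); ring.
- apply: (modulo_rel (p := 0 + ((ii * cc ^+ 2 * g01) *+ 2) - ((ii * cc ^+ 2 * g12) *+ 2)) (q := 0)); ring.
- apply: (modulo_rel (p := 0 + ((cc * g02) *+ 2) - ((cc * g22) *+ 2) + ((cc ^+ 3 * g22) *+ 4) - ((cc ^+ 3 * g02) *+ 4)) (q := 0 - ((cc * g22) *+ 2) + ((cc * g02) *+ 2))); ring.
- apply: (modulo_rel (p := 0) (q := 0)); ring.
Qed.
End OrthonormalCoordinates.

Section CovariantMatrix.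
Variable k : closedFieldType.
Hypothesis char0 : [pchar k] =i pred0.
Local Notation D := (Dring k).
Local Notation B := {mpoly k[4]}.
Local Notation x0 := (piD 'X_0 : D).
Local Notation x1 := (piD 'X_1 : D).
Local Notation x2 := (piD 'X_2 : D).
Local Notation ED := (lE (Y_action char0)).
Local Notation FD := (lF (Y_action char0)).
Local Notation HD := (lH (Y_action char0)).
Variables (rho : SL2_action B) (f : {lrmorphism B -> Rring k}).
Hypothesis f_onto : closed_embedding f.
Hypothesis f_equiv : equivariant (X_action char0) rho f.
Local Notation E := (lE rho).
Local Notation F := (lF rho).
Local Notation H := (lH rho).
Local Notation phi := (phi f).

Lemma closed_sqrt (a : k) : exists b, b ^+ 2 = a.
Proof.
have [x hx] := @solve_monicpoly k 2 (fun j => if j == 0%N then a else 0) isT.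
by exists x; rewrite hx !big_ord_recl big_ord0 /= expr0 mulr1 mul0r !addr0.
Qed.

Variables (i c : k).
Hypotheses (i2 : i ^+ 2 + 1 = 0) (c2 : c ^+ 2 *+ 2 - 1 = 0).
Local Notation ii := (i%:A).
Local Notation cc := (c%:A).

Lemma scalar_rel (A : comAlgType k) : ii ^+ 2 + 1 = 0 :> A /\ cc ^+ 2 *+ 2 - 1 = 0 :> A.
Proof.
have e (x : k) : x%:A = in_alg A x by [].
split; rewrite e -rmorphXn.
  by rewrite -(rmorph1 (in_alg A)) -rmorphD i2 rmorph0.
by rewrite -(rmorph1 (in_alg A)) -rmorphMn -rmorphB c2 rmorph0.
Qed.

(** The highest component of an even vector has weight 2, hence is a multiple of the odd function x0
    and vanishes. Applying F kills the remaining components. *)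
Lemma cov_vanishes (u : 'I_3 -> B) : covV E (rotE ii cc) u -> covV F (rotF ii cc) u ->
  forall j, phi (u j) = 0.
Proof.
move=> uE uF; have [hi hc] := scalar_rel D.
have phc (a : k) : phi a%:A = a%:A by rewrite phiZ phi1.
pose v j := phi (u j).
have vE : [/\ ED (v 0) = - (ii * cc * v 1), ED (v 1) = ii * cc * v 0 + cc * v 2%:R &
    ED (v 2%:R) = - (cc * v 1)].
  split; rewrite /v -(phi_E f_equiv) uE /cross ?I3 /rotE /= phiB ?phiM ?phiN ?phiM ?phc ?phi0; ring.
have vF : [/\ FD (v 0) = - (ii * cc * v 1 *+ 2), FD (v 1) = (ii * cc * v 0 - cc * v 2%:R) *+ 2 &
    FD (v 2%:R) = cc * v 1 *+ 2].
  split; rewrite /v -(phi_F f_equiv) uF /cross ?I3 /rotF /= phiB ?phiM ?phiMn ?phiM ?phc ?phi0; ring.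
(* The component which equals x0 when v is the orthonormal coordinate vector of Y. *)
pose w0 := cc * (v 0 - ii * v 2%:R).
have EC (a : k) b : ED (a%:A * b) = a%:A * ED b by rewrite !mulr_algl (lEZ char0).
have FC (a : k) b : FD (a%:A * b) = a%:A * FD b by rewrite !mulr_algl (lFZ char0).
have EB a b : ED (a - b) = ED a - ED b by rewrite (lED char0) (lEN char0).
have FB a b : FD (a - b) = FD a - FD b by rewrite (lFD char0) (lFN char0).
have [e0 e1 e2] := vE; have [f0 f1 f2] := vF.
have Ew : ED w0 = 0.
  rewrite /w0 EC EB EC e0 e2; move: (v 1) => t; ring.
have Fw : FD w0 = - (ii * v 1 *+ 2).
  rewrite /w0 FC FB FC f0 f2; move: (v 1) hi hc; move: (i%:A : D) (c%:A : D) => I C t hi hc.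
  by apply: (modulo_rel hi hc (p := 0) (q := - (I * t *+ 2))); ring.
have Fw1 : FD (ii * v 1) = - (cc * (v 0 + ii * v 2%:R) *+ 2).
  rewrite FC f1; move: (v 0) (v 2%:R) hi hc; move: (i%:A : D) (c%:A : D) => I C t s hi hc.
  by apply: (modulo_rel hi hc (p := C * t *+ 2) (q := 0)); ring.
have Ew1 : ED (ii * v 1) = - w0.
  rewrite /w0 EC e1; move: (v 0) (v 2%:R) hi hc; move: (i%:A : D) (c%:A : D) => I C t s hi hc.
  by apply: (modulo_rel hi hc (p := C * t) (q := 0)); ring.
have Hw : HD w0 = w0 *+ (2 * 1).
  by rewrite /lH Ew (lF0 char0) subr0 Fw (lEN char0) (lEMn char0) Ew1 mulNrn opprK.
have [a wE] := highest_weight_D Ew Hw.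
have mvE j : mu (v j) = v j by exact: mu_phi.
have mw : mu w0 = w0.
  have e (p q : D) : mu (p * q) = mu p * mu q by exact: rmorphM.
  have eB (p q : D) : mu (p - q) = mu p - mu q by exact: rmorphB.
  have eC (b : k) : mu (b%:A : D) = b%:A by rewrite -[LHS]/(mu (in_alg D b)) linearZ /= rmorph1.
  by rewrite /w0 (e cc) eB (e ii) !mvE; congr (_ * (_ - _ * _)); exact: eC.
have w00 : w0 = 0.
  have : w0 *+ 2 = 0.
    rewrite mulr2n -{1}mw wE expr1.
    have -> : mu (a *: x0) = - (a *: x0).
      by apply: etrans (linearZ _ _) _; rewrite /= [mu x0]muX scalerN.
    exact: addNr.
  by rewrite -scaler_nat => /eqP; rewrite scaler_eq0 (negPf (nat_neq0 char0 1)) => /eqP.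
have v1 : v 1 = 0.
  have : (ii * v 1) *+ 2 = 0 by move: Fw; rewrite w00 (lF0 char0) => /esym/eqP; rewrite oppr_eq0 => /eqP.
  rewrite -scaler_nat => /eqP; rewrite scaler_eq0 (negPf (nat_neq0 char0 1)) /= => /eqP e.
  move: (v 1) e hi hc; move: (i%:A : D) (c%:A : D) => I C t e hi hc.
  transitivity (- (I * (I * t))); last by rewrite e mulr0 oppr0.
  by apply: (modulo_rel hi hc (p := t) (q := 0)); ring.
have w20 : cc * (v 0 + ii * v 2%:R) = 0.
  have : (cc * (v 0 + ii * v 2%:R)) *+ 2 = 0.
    by move: Fw1; rewrite v1 mulr0 (lF0 char0) => /esym/eqP; rewrite oppr_eq0 => /eqP.
  by rewrite -scaler_nat => /eqP; rewrite scaler_eq0 (negPf (nat_neq0 char0 1)) /= => /eqP.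
have [v0 v2] : v 0 = 0 /\ v 2%:R = 0.
  move: w00 w20 hi hc; rewrite /w0; move: (v 0) (v 2%:R) (i%:A : D) (c%:A : D) => t s I C e e' hi hc.
  split.
    transitivity (C * (C * (t - I * s) + C * (t + I * s))); last by rewrite e e' addr0 mulr0.
    by apply: (modulo_rel hi hc (p := 0) (q := - t)); ring.
  transitivity (C * I * (C * (t - I * s) - C * (t + I * s))); last by rewrite e e' subr0 mulr0.
  by apply: (modulo_rel hi hc (p := C ^+ 2 * s *+ 2) (q := - s)); ring.
by elim/ord3P.
Qed.

Definition pt (j : 'I_3) : D := nth 0 [:: cc * (x0 + x2); ii * x1; ii * cc * (x0 - x2)] j.

Lemma pt_unit : dot pt pt = 1.
Proof.
have [hi hc] := scalar_rel D; rewrite /dot /pt /=.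
have rel := x_rel k; rewrite -(subrK (x0 * x2 *+ 2) (x1 ^+ 2)) in rel.
transitivity (x0 * x2 *+ 2 - x1 ^+ 2); last by rewrite (x_rel k) opprB addrC subrK.
move: hi hc; move: x0 x1 x2 (i%:A : D) (c%:A : D) => X0 X1 X2 I C hi hc.
apply: (modulo_rel hi hc (p := X1 ^+ 2 + C ^+ 2 * (X0 - X2) ^+ 2) (q := X0 * X2 *+ 2)); ring.
Qed.

(** Lifting x0^2 to a highest weight vector of weight 4 and applying F produces the trace-free part;
    the multiple 1/3 of the identity raises the trace to 1. *)
Lemma covariant_matrix : exists C : 'M[B]_3, [/\ C^T = C, \tr C = 1,
  covM E (rotE ii cc) C, covM F (rotF ii cc) C & forall a b, phi (C a b) = pt a * pt b].
Proof.
have e u v : mu (u * v : D) = mu u * mu v by exact: rmorphM.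
have mx0 : mu (x0 ^+ 2) = x0 ^+ 2 by rewrite expr2 e [mu x0]muX mulrNN.
have Ex0 : ED (x0 ^+ 2) = 0 by rewrite expr2 (lEM char0) (E_x0 char0) !mulr0 addr0.
have Hx0 : HD (x0 ^+ 2) = 4%:R *: x0 ^+ 2.
  rewrite expr2 (lHM char0) (H_x0 char0) scaler_nat.
  by move: x0 => z; ring.
have [Y [EY HY phY]] := hw_lift f_onto f_equiv mx0 Ex0 Hx0.
have F5 := hw_nilp char0 EY HY; rewrite /= in F5.
have HY' : H Y = Y *+ 4 by rewrite HY scaler_nat.
have HF b n : H b = b *+ n.+2 -> H (F b) = F b *+ n.
  move=> Hb; rewrite -[LHS](subrK (F (H b))) (lHF_comm char0) Hb (lFMn char0).
  by rewrite addrC -[n.+2]addn2 mulrnDr addrK.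
have EF b : E (F b) = F (E b) + H b by rewrite /lH addrC subrK.
pose Y1 := F Y; pose Y2 := F Y1; pose Y3 := F Y2; pose Y4 := F Y3.
have H1 : H Y1 = Y1 *+ 2 by apply: HF.
have H2 : H Y2 = 0 by rewrite (HF _ 0%N).
have H3 : H Y3 = - (Y3 *+ 2) by rewrite -[LHS](subrK (F (H Y2))) (lHF_comm char0) H2 (lF0 char0) addr0.
have E1 : E Y1 = Y *+ 4 by rewrite EF EY (lF0 char0) add0r.
have E2 : E Y2 = Y1 *+ 6 by rewrite EF E1 H1 (lFMn char0) -mulrnDr.
have E3 : E Y3 = Y2 *+ 6 by rewrite EF E2 H2 (lFMn char0) addr0.
have E4 : E Y4 = Y3 *+ 4 by rewrite EF E3 H3 (lFMn char0) -/Y3 -mulrnBr.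
have F4 : F Y4 = 0 by exact: F5.
have nz n : n.+1%:R != 0 :> k := nat_neq0 char0 n.
have sc (A : comAlgType k) (n m : nat) (z : A) : ((n.+1 * m)%:R^-1 : k) *: (z *+ m) = n.+1%:R^-1 *: z *+ (m != 0%N).
  case: m => [|m]; first by rewrite !mulr0n scaler0.
  by rewrite -[z *+ _]scaler_nat scalerA natrM invfM -mulrA mulVf ?nz // mulr1.
pose q (n : nat) (z : B) : B := (n%:R^-1 : k) *: z.
have qE n z : E (q n z) = q n (E z) by exact: (lEZ char0).
have qF n z : F (q n z) = q n (F z) by exact: (lFZ char0).
have qM n m z : (0 < n)%N -> (0 < m)%N -> q (n * m)%N (z *+ m) = q n z.
  by case: n m => [|n] [|m] // _ _; rewrite /q sc mulr1n.
have q1 z : q 1%N z = z by rewrite /q invr1 scale1r.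
have qMn n z m : q n (z *+ m) = q n z *+ m by rewrite /q scalerMnr.
pose t : B := q 3 1.
have t0 : E t = 0 /\ F t = 0 by rewrite /t qE qF (lE1 char0) (lF1 char0) /q scaler0.
(* On Y the F-string of x0^2 is 4 x0 x1, 24 (x0 x2 - 1/3), 48 x1 x2, 96 x2^2; hence the divisors.
   With t = 1/3, x0 x2 is m + t and x1^2 is 2 m - t. *)
pose g01 := q 4 Y1; pose m := q 24 Y2; pose g12 := q 48 Y3; pose g22 := q 96 Y4.
exists (@sym_coords {mpoly k[4]} i%:A c%:A Y g01 (m + t) (m *+ 2 - t) g12 g22).
have [hi hc] := scalar_rel B.
have EC (a : k) : E a%:A = 0 by rewrite (lEZ char0) (lE1 char0) scaler0.
have FC (a : k) : F a%:A = 0 by rewrite (lFZ char0) (lF1 char0) scaler0.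
have Eg01 : E g01 = Y by rewrite qE E1; exact: etrans (qM 1%N 4%N _ isT isT) (q1 _).
have Em : E m = g01 by rewrite qE E2; exact: (qM 4%N 6%N).
have Eg12 : E g12 = m *+ 3.
  by rewrite qE E3 /m -qMn -(qM 24%N 2%N) // -mulrnA.
have Eg22 : E g22 = g12 *+ 2 by rewrite qE E4 /g12 -qMn -(qM 48%N 2%N) // -mulrnA.
have Fg00 : F Y = g01 *+ 4 by rewrite /g01 -qMn; apply: esym; exact: etrans (qM 1%N 4%N _ isT isT) (q1 _).
have Fg01 : F g01 = m *+ 6 by rewrite qF /m -qMn; apply: esym; exact: (qM 4%N 6%N).
have Fm : F m = g12 *+ 2 by rewrite qF /g12 -qMn; apply: esym; exact: (qM 24%N 2%N).
have Fg12 : F g12 = g22 *+ 2 by rewrite qF /g22 -qMn; apply: esym; exact: (qM 48%N 2%N).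
have Fg22 : F g22 = 0 by rewrite qF F4 /q scaler0.
split.
- by apply/matrixP; elim/ord3P; elim/ord3P; rewrite !mxE.
- rewrite sym_coords_trace //.
  have t3 : t *+ 3 = 1 by rewrite -qMn; exact: etrans (qM 1%N 3%N _ isT isT) (q1 _).
  by rewrite -t3; ring.
- apply: sym_coords_E => //; rewrite ?(lED char0) ?(lEN char0) ?(lEMn char0) ?t0.1 ?Em ?addr0 ?oppr0 ?addr0 //.
    exact: lE_der.
  by rewrite Eg12; ring.
- apply: sym_coords_F => //; rewrite ?(lFD char0) ?(lFN char0) ?(lFMn char0) ?t0.2 ?Fm ?addr0 ?oppr0 ?addr0 //.
  + exact: lF_der.
  + by rewrite Fg01; ring.
  + by ring.
have phq n z : phi (q n z) = (n%:R^-1 : k) *: phi z by exact: phiZ.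
have phF := phi_F f_equiv.
have FM a b : FD (a * b) = a * FD b + b * FD a by exact: (lFM char0).
have [fx0 fx1 fx2] : [/\ FD x0 = x1 *+ 2, FD x1 = x2 *+ 2 & FD x2 = 0].
  by split; [exact: F_x0 | exact: F_x1 | exact: F_x2].
have p1 : phi Y1 = x0 * x1 *+ 4.
  by rewrite phF phY expr2 FM fx0; move: x0 x1 => a b; ring.
have p2 : phi Y2 = x0 * x2 *+ 24 - 1 *+ 8.
  rewrite phF p1 (lFMn char0) FM fx0 fx1.
  transitivity (x0 * x2 *+ 8 + x1 ^+ 2 *+ 8); first by move: x0 x1 x2 => a b z; ring.
  by rewrite (x_rel k); move: x0 x1 x2 => a b z; ring.
have p3 : phi Y3 = x1 * x2 *+ 48.
  rewrite phF p2 (lFD char0) (lFN char0) !(lFMn char0) (lF1 char0) FM fx0 fx2.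
  by move: x0 x1 x2 => a b z; ring.
have p4 : phi Y4 = x2 ^+ 2 *+ 96.
  by rewrite phF p3 (lFMn char0) FM fx1 fx2; move: x0 x1 x2 => a b z; ring.
have scD (n : nat) (z : D) : (n.+1%:R^-1 : k) *: (z *+ n.+1) = z.
  by rewrite -[z *+ _]scaler_nat scalerA mulVf ?nz // scale1r.
have t3 : phi t *+ 3 = 1 by rewrite phq scalerMnr scD phi1.
have g01E : phi g01 = x0 * x1 by rewrite phq p1 scD.
have mE : phi m = x0 * x2 - phi t.
  have -> : phi t = (24%:R^-1 : k) *: (1 *+ 8) by rewrite -[8%N]mul1n -[24%N]/(2.+1 * 8)%N sc mulr1n phq phi1.
  by rewrite phq p2 scalerBr scD.
have g12E : phi g12 = x1 * x2 by rewrite phq p3 scD.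
have g22E : phi g22 = x2 ^+ 2 by rewrite phq p4 scD.
have phc (a : k) : phi a%:A = a%:A by rewrite phiZ phi1.
have g02E : phi (m + t) = x0 * x2 by rewrite phiD mE subrK.
have g11E : phi (m *+ 2 - t) = x1 ^+ 2.
  rewrite phiB phiMn mE (x_rel k) -t3; move: (phi t) x0 x2 => T a b; ring.
have phS (y0 y1 y2 y3 y4 y5 : B) a b : phi (sym_coords ii cc y0 y1 y2 y3 y4 y5 a b) =
    sym_coords ii cc (phi y0) (phi y1) (phi y2) (phi y3) (phi y4) (phi y5) a b.
  by elim/ord3P: a; elim/ord3P: b; rewrite !mxE /= !(phiM, phiX, phiD, phiN, phiMn, phc).
move=> a b; rewrite phS phY g01E g02E g11E g12E g22E.
elim/ord3P: a; elim/ord3P: b; rewrite !mxE /pt /=;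
  move: x0 x1 x2 (i%:A : D) (c%:A : D) => X0 X1 X2 I C; ring.
Unshelve. all: exact: char0.
Qed.
End CovariantMatrix.

Lemma horner_alg_der (k : comNzRingType) (A : comAlgType k) (d : A -> A) (t : A) (P : {poly k}) :
  derivation idfun d -> (forall c, d c%:A = 0) -> d (horner_alg t P) = horner_alg t P^`() * d t.
Proof.
move=> [dD dM] dc; elim/poly_ind: P => [|P c IH].
  by rewrite deriv0 !rmorph0 mul0r (der_zero (conj dD dM)).
rewrite derivD derivM derivX derivC addr0 mulr1 !rmorphD !rmorphM /= horner_algX horner_algC.
by rewrite dD dM dc IH /=; ring.
Qed.

Lemma antiderivative (k : fieldType) (P : {poly k}) : [pchar k] =i pred0 -> exists Q, Q^`() = P.
Proof.
move=> char0; exists (\poly_(i < (size P).+1) (if i is j.+1 then P`_j / j.+1%:R else 0)).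
apply/polyP => i; rewrite coef_deriv coef_poly ltnS.
case: ltnP => [lt|ge]; last by rewrite mul0rn nth_default.
by rewrite -[LHS]mulr_natr mulfVK // (pcharf0P k).1.
Qed.

(** * Gradients and the ring of invariants *)

Section Gradient.
Variables (k : closedFieldType) (n : nat).
Hypothesis char0 : [pchar k] =i pred0.
Local Notation B := {mpoly k[n]}.
Implicit Types p q : B.

Lemma mderiv_der i : derivation idfun (fun p => p^`M(i)).
Proof. by split=> p q; rewrite ?mderivD // mderivM /= addrC; congr (_ + _); exact: mulrC. Qed.

Lemma gradient_eq0 p : (forall i, p^`M(i) = 0) -> p = (p@_0%MM)%:MP.
Proof.
move=> dp; apply/eqP; rewrite -subr_eq0; apply/eqP.
apply: (deriv_stable_eq0 char0 (K := fun q => (forall i, q^`M(i) = 0) /\ q@_0%MM = 0)) => [q [dq _] i|c [_]|].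
- by rewrite dq; split=> [j|]; rewrite ?mderiv0 ?mcoeff0.
- by rewrite mcoeffC eqxx mulr1.
by split=> [i|]; rewrite ?mderivB ?dp ?mderivC ?subrr // mcoeffB mcoeffC eqxx mulr1 subrr.
Qed.

Lemma msize_deriv p i : p^`M(i) != 0 -> (msize p^`M(i) < msize p)%N.
Proof.
move=> d0; rewrite -(mlead_deg d0); have := mlead_supp d0; rewrite mcoeff_msupp mcoeff_deriv => nz.
have /msize_mdeg_lt : (mlead p^`M(i) + U_(i))%MM \in msupp p.
  by rewrite mcoeff_msupp; apply: contraNneq nz => ->; rewrite mul0rn.
by rewrite mdegD mdeg1 addn1.
Qed.

Lemma msize_factor p q : p * q != 0 -> (msize p <= msize (p * q))%N.
Proof.
rewrite mulf_eq0 negb_or => /andP[p0 q0]; rewrite msizeM //.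
have : (0 < msize q)%N by rewrite lt0n msize_poly_eq0.
by move: (msize p) (msize q) => a b; lia.
Qed.

(* The Lie derivative of a differential form commutes with the exterior derivative. *)
Lemma lie_gradient (d : B -> B) p i : derivation idfun d -> (forall c, d c%:A = 0) ->
  d p^`M(i) + \sum_j (d 'X_j)^`M(i) * p^`M(j) = (d p)^`M(i).
Proof.
move=> dd dc; have chain q : d q = \sum_j q^`M(j) * d 'X_j.
  by apply: (@mpoly_chain k n B idfun B idfun d dd) => c; rewrite /= -alg_mpolyC dc.
rewrite [X in _ = X^`M(i)]chain raddf_sum chain -big_split; apply: eq_bigr => j _ /=.
by rewrite mderivM mderiv_comm; ring.
Qed.
End Gradient.

Section Invariants.
Variable k : closedFieldType.
Hypothesis char0 : [pchar k] =i pred0.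
Local Notation D := (Dring k).
Local Notation B := {mpoly k[4]}.
Variables (rho : SL2_action B) (f : {lrmorphism B -> Rring k}).
Hypothesis f_onto : closed_embedding f.
Hypothesis f_equiv : equivariant (X_action char0) rho f.
Local Notation E := (lE rho).
Local Notation F := (lF rho).
Local Notation phi := (phi f).

Definition sl2_inv (a : B) := E a = 0 /\ F a = 0.

Lemma inv_C c : sl2_inv c%:MP.
Proof. by split; rewrite -alg_mpolyC ?(lEZ char0) ?(lFZ char0) ?(lE1 char0) ?(lF1 char0) scaler0. Qed.
Lemma invD a b : sl2_inv a -> sl2_inv b -> sl2_inv (a + b).
Proof. by move=> [a1 a2] [b1 b2]; split; rewrite ?(lED char0) ?(lFD char0) ?a1 ?a2 ?b1 ?b2 addr0. Qed.
Lemma invN a : sl2_inv a -> sl2_inv (- a).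
Proof. by move=> [a1 a2]; split; rewrite ?(lEN char0) ?(lFN char0) ?a1 ?a2 oppr0. Qed.
Lemma invB a b : sl2_inv a -> sl2_inv b -> sl2_inv (a - b).
Proof. by move=> ia ib; apply/invD/invN. Qed.

Lemma E_no_eig (g a : B) : E g = a * g -> E g = 0.
Proof. exact: (lnd_no_eig (natR_mpoly 4 char0) (lE_der char0 rho) (E_nilp char0 rho)). Qed.
Lemma F_no_eig (g a : B) : F g = a * g -> F g = 0.
Proof. exact: (lnd_no_eig (natR_mpoly 4 char0) (lF_der char0 rho) (F_nilp char0 rho)). Qed.
Lemma inv_factor (a b : B) : a * b != 0 -> sl2_inv (a * b) -> sl2_inv a.
Proof.
move=> ab0 [e1 e2]; split.
  exact: (lnd_factor (natR_mpoly 4 char0) (lE_der char0 rho) (E_nilp char0 rho) ab0 e1).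
exact: (lnd_factor (natR_mpoly 4 char0) (lF_der char0 rho) (F_nilp char0 rho) ab0 e2).
Qed.

Lemma phi_inv a : sl2_inv a -> exists c : k, phi a = c%:A.
Proof.
move=> [Ea Fa]; have [||c ->] := @highest_weight_D k char0 0 (phi a).
- by rewrite -(phi_E f_equiv) Ea phi0.
- by rewrite -(phi_H f_equiv) /lH Ea Fa (lE0 char0) (lF0 char0) subrr phi0 muln0 mulr0n.
by exists c; rewrite expr0.
Qed.

Lemma lE_scal c : E c%:A = 0. Proof. by rewrite (lEZ char0) (lE1 char0) scaler0. Qed.
Lemma lF_scal c : F c%:A = 0. Proof. by rewrite (lFZ char0) (lF1 char0) scaler0. Qed.

(* The content of the gradient of an invariant is a semi-invariant, hence invariant, since locally nilpotent derivations have no eigenvectors. *)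
Lemma gradient_content (d : B -> B) (a g : B) (u : 'I_4 -> B) : derivation idfun d ->
  (forall c, d c%:A = 0) -> (forall g a : B, d g = a * g -> d g = 0) -> primitive u -> d a = 0 ->
  (forall i, a^`M(i) = g * u i) -> d g = 0.
Proof.
move=> dd dc noeig pu da aE; case: (dd) => dD dM.
have [|q qE] := pu (d g) g; last exact: noeig qE.
move=> i; exists (- (d (u i) + \sum_j (d 'X_j)^`M(i) * u j)).
have := lie_gradient a i dd dc; rewrite da mderiv0 aE dM.
have -> : \sum_j (d 'X_j)^`M(i) * a^`M(j) = g * \sum_j (d 'X_j)^`M(i) * u j.
  by rewrite mulr_sumr; apply: eq_bigr => j _; rewrite aE; ring.
move: (\sum_j _) => s /= e; apply/eqP; rewrite -subr_eq0 -[X in _ == X]e; apply/eqP; ring.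
Qed.

Section Generator.
Variable tau0 : B.
Hypothesis tau0_inv : sl2_inv tau0.
Hypothesis tau0_ncst : forall c, tau0 <> c%:MP.

(** Take a nonconstant invariant t of least degree. Gradients of invariants are parallel, so that of
    an invariant b is a times that of t, where a is an invariant of lower degree; by induction a =
    P(t), and integrating P gives b. Subtracting the constant value of t on X makes it vanish
    there. *)
Lemma invariant_generator : exists tau, [/\ sl2_inv tau, phi tau = 0, primitive (fun i => tau^`M(i)) &
  forall b, sl2_inv b -> exists P : {poly k}, b = horner_alg tau P].
Proof.
have exm : exists m, `[< exists t, [/\ sl2_inv t, forall c, t <> c%:MP & msize t = m] >].
  by exists (msize tau0); apply/asboolP; exists tau0.
case: (ex_minnP exm) => m /asboolP[t [it tn tm]] min.
have noncst (a : B) : (forall c, a <> c%:MP) -> exists i, a^`M(i) != 0.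
  move=> an; apply: contrapT => none; apply: (an (a@_0%MM)); apply: (gradient_eq0 char0) => i.
  by apply/eqP/negPn/negP => nz; apply: none; exists i.
have [i0 ti0] := noncst t tn.
have [g [u [g0 pu tE]]] := primitive_part (@gcd_domain_mpoly k 4) (noncst t tn).
have ig : sl2_inv g.
  split.
    exact: (gradient_content (lE_der char0 rho) lE_scal E_no_eig pu it.1 tE).
  exact: (gradient_content (lF_der char0 rho) lF_scal F_no_eig pu it.2 tE).
(* The content g is invariant and of smaller degree than t, so minimality makes it constant: the
   gradient of t is primitive. *)
have [c gc] : exists c, g = c%:MP.
  apply: contrapT => gn.
  have gn' c : g <> c%:MP by move=> gE; apply: gn; exists c.
  have /min : `[< exists t, [/\ sl2_inv t, forall c, t <> c%:MP & msize t = msize g] >].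
    by apply/asboolP; exists g.
  rewrite leqNgt => /negP; apply; rewrite -tm; apply: leq_ltn_trans (msize_deriv ti0).
  by rewrite tE; apply: msize_factor; rewrite -tE.
have c0 : c != 0 by apply: contraNneq g0 => c0; rewrite gc c0 mpolyC0.
have uE i : u i = (c^-1)%:MP * t^`M(i) by rewrite tE gc mulrA -mpolyCM mulVf // mpolyC1 mul1r.
have gen b : sl2_inv b -> exists P : {poly k}, b = horner_alg t P.
  have [s] := ubnP (msize b); elim: s => // s IH in b * => /ltnSE le_s ib.
  have [[cb bE]|bn] := pselect (exists cb, b = cb%:MP).
    by exists cb%:P; rewrite horner_algC bE -alg_mpolyC.
  have bn' cb : b <> cb%:MP by move=> bE; apply: bn; exists cb.
  have [a aE] : exists a, forall i, b^`M(i) = a * t^`M(i).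
    have par := invariant_parallel f_onto f_equiv ib.1 ib.2 it.1 it.2.
    have [h hE] : exists h, forall i, b^`M(i) = h * u i.
      by apply: (parallel_primitive pu) => i j; rewrite !uE mulrCA par -mulrCA mulrC; ring.
    by exists (h * (c^-1)%:MP) => i; rewrite hE uE mulrA.
  have ia : sl2_inv a.
    have da (d : B -> B) : derivation idfun d -> (forall c, d c%:A = 0) -> d t = 0 -> d b = 0 -> d a = 0.
      move=> dd dc dt db; have := lie_gradient b i0 dd dc; have := lie_gradient t i0 dd dc.
      rewrite dt db mderiv0 aE (proj2 dd) => et.
      have -> : \sum_j (d 'X_j)^`M(i0) * b^`M(j) = a * \sum_j (d 'X_j)^`M(i0) * t^`M(j).
        by rewrite mulr_sumr; apply: eq_bigr => j _; rewrite aE; ring.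
      move: et; move: (\sum_j _) (d _^`M(i0)) => x y /eqP; rewrite addr_eq0 => /eqP -> e.
      apply: (mulIf ti0); rewrite mul0r -e /=; ring.
    split; [apply: (da _ (lE_der char0 rho)) | apply: (da _ (lF_der char0 rho))].
    + exact: lE_scal. + exact: it.1. + exact: ib.1.
    + exact: lF_scal. + exact: it.2. + exact: ib.2.
  have [l bl] := noncst b bn'.
  have [|P PE] := IH a _ ia.
    apply: leq_trans le_s; apply: leq_ltn_trans (msize_deriv bl).
    by rewrite aE; apply: msize_factor; rewrite -aE.
  have [Q QP] := antiderivative P char0.
  have : forall i, (b - horner_alg t Q)^`M(i) = 0.
    move=> i; rewrite mderivB aE.
    rewrite (@horner_alg_der k B (fun p => p^`M(i)) t Q (mderiv_der k i)) ?QP -?PE ?subrr // => x.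
    by rewrite alg_mpolyC mderivC.
  move/(gradient_eq0 char0); set e := _@__ => bE.
  by exists (Q + e%:P); rewrite rmorphD /= horner_algC -[b](subrK (horner_alg t Q)) bE -alg_mpolyC addrC.
have [e phe] := phi_inv it.
have dE i : (t - e%:MP)^`M(i) = t^`M(i) by rewrite mderivB mderivC subr0.
exists (t - e%:MP); split.
- by apply/invB/inv_C.
- by rewrite phiB phe phiC subrr.
- move=> x y yd; apply: pu => i; case: (yd i) => z zE; exists ((c^-1)%:MP * z).
  by rewrite uE -mulrA -zE -dE /=; ring.
move=> b /gen[P ->]; exists (P \Po ('X + e%:P)).
elim/poly_ind: P => [|P a IH]; first by rewrite comp_poly0 !rmorph0.
rewrite comp_polyD comp_polyM comp_polyX comp_polyC !rmorphD !rmorphM /= IH.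
by rewrite !horner_algX !horner_algC rmorphD /= horner_algX horner_algC -alg_mpolyC subrK.
Qed.
End Generator.

Section TauFacts.
Variable tau : B.
Hypothesis tau_inv : sl2_inv tau.
Hypothesis phi_tau : phi tau = 0.
Hypothesis tau_prim : primitive (fun i => tau^`M(i)).
Let tau_ncst := primitive_neq0 tau_prim.
Hypothesis tau_gen : forall b, sl2_inv b -> exists P : {poly k}, b = horner_alg tau P.
Local Notation "P .[tau]" := (horner_alg tau P) (at level 2, format "P .[tau]").

Lemma phi_horner (P : {poly k}) : phi P.[tau] = (P.[0])%:A.
Proof.
elim/poly_ind: P => [|P c IH]; first by rewrite rmorph0 horner0 scale0r phi0.
rewrite rmorphD rmorphM /= horner_algX horner_algC hornerMXaddC mulr0 add0r.
by rewrite phiD phiM phi_tau mulr0 add0r phiZ phi1.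
Qed.

Lemma horner_tau_inj (P : {poly k}) : P.[tau] = 0 -> P = 0.
Proof.
have [i ti] := tau_ncst.
have [s] := ubnP (size P); elim: s => // s IH in P * => /ltnSE le_s P0.
have dP : P^`() = 0.
  have [->|Pn0] := eqVneq P 0; first exact: deriv0.
  apply: IH; first exact: leq_trans (lt_size_deriv Pn0) le_s.
  apply: (mulIf ti); rewrite mul0r.
  rewrite -(@horner_alg_der k B (fun p => p^`M(i)) tau P (mderiv_der k i)) ?P0 ?mderiv0 // => x.
  by rewrite alg_mpolyC mderivC.
have PC : P = (P`_0)%:P.
  apply/polyP => -[|j]; rewrite coefC //=.
  have := congr1 (fun q : {poly k} => q`_j) dP; rewrite coef_deriv coef0 -mulr_natr => /eqP.
  by rewrite mulf_eq0 (negPf (nat_neq0 char0 j)) orbF => /eqP.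
by move: P0; rewrite PC horner_algC alg_mpolyC => /eqP; rewrite mpolyC_eq0 => /eqP ->; rewrite polyC0.
Qed.

Lemma tau_neq0 : tau != 0.
Proof. by have [i ti] := tau_ncst; apply: contraNneq ti => ->; rewrite mderiv0. Qed.

(** Factors of an invariant are invariants, hence polynomials in tau, and a factorization Q P = X
    has a constant factor. So the gcd of tau and w is 1 or tau up to a constant. *)
Lemma tau_prime (w : B) : dvr tau (w * w) -> dvr tau w.
Proof.
move=> tw; have [g [gt gw gE]] := @gcd_domain_mpoly k 4 tau w.
case: (gt) => s sE; have s_inv : sl2_inv (s * g) by rewrite -sE.
have sg0 : s * g != 0 by rewrite -sE tau_neq0.
have is' := inv_factor sg0 s_inv.
have ig : sl2_inv g by apply: (@inv_factor g s); rewrite mulrC.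
have [P PE] := tau_gen ig; have [Q QE] := tau_gen is'.
have PQ : Q * P = 'X.
  apply/eqP; rewrite -subr_eq0; apply/eqP/horner_tau_inj.
  by rewrite rmorphB rmorphM /= horner_algX -PE -QE -sE subrr.
have [Q0 P0] : Q != 0 /\ P != 0 by apply/andP; rewrite -negb_or -mulf_eq0 PQ polyX_eq0.
have unit_case (U V : {poly k}) (v : B) : size U = 1%N -> v = U.[tau] -> exists2 e, v = e%:MP & e != 0.
  move=> /eqP/size_poly1P[e e0 ->] ->; exists e => //; by rewrite horner_algC alg_mpolyC.
have sQP : (size Q + size P = 3)%N.
  have := congr1 (fun q : {poly k} => size q) PQ; rewrite size_mul // size_polyX => e.
  by rewrite -(prednK (_ : (0 < size Q + size P)%N)) ?e // addn_gt0 lt0n size_poly_eq0 Q0.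
have sQ0 : (0 < size Q)%N by rewrite lt0n size_poly_eq0.
have sP0 : (0 < size P)%N by rewrite lt0n size_poly_eq0.
have [sQ|sP] : size Q = 1%N \/ size P = 1%N by move: sQP sQ0 sP0; move: (size Q) (size P) => x y; lia.
  have [e sC e0] := unit_case Q 0 s sQ QE.
  case: gw => b wE; exists (b * (e^-1)%:MP).
  rewrite wE sE sC; transitivity (b * ((e^-1)%:MP * e%:MP) * g); last by ring.
  by rewrite -mpolyCM mulVf // mpolyC1 mulr1.
have [e gC e0] := unit_case P 0 g sP PE.
have : dvr tau (w * g) by apply: gE => //; apply/dvr_mull/dvrr.
rewrite gC => -[b bE]; exists (b * (e^-1)%:MP).
transitivity (w * (e%:MP * (e^-1)%:MP)); first by rewrite -mpolyCM mulfV // mpolyC1 mulr1.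
by rewrite mulrA bE; ring.
Qed.
End TauFacts.
End Invariants.

(* The contraction of a volume form with three fields spanning a Lie algebra of trace-free
   adjoint action is rescaled by the divergence. *)
Lemma theta_lie (R : idomainType) (J : 'I_4 -> 'I_3 -> R) (d : R -> R)
    (M : 'I_4 -> 'I_4 -> R) (a : 'I_3 -> 'I_3 -> R) : derivation idfun d ->
  a 0 0 + a 1 1 + a 2%:R 2%:R = 0 ->
  (forall i r, d (J i r) = \sum_s a r s * J i s + \sum_j M i j * J j r) ->
  forall i, d (theta J i) + \sum_j M j i * theta J j = (\sum_j M j j) * theta J i.
Proof.
move=> dd a0 dJ; case: (dd) => dD dM; have dN := der_opp dd.
have a22 : a 2%:R 2%:R = - (a 0 0 + a 1 1) by apply/eqP; rewrite -addr_eq0 addrC a0.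
elim/ord4P; rewrite /theta /= !sum4 /= /minor /dot /cross ?I3 !(dD, dN, dM) !dJ !sum3 !sum4 a22 /=; ring.
Qed.

(** * Divergence and a vector field commuting with the action *)

Section VectorFields.
Variables (k : closedFieldType) (n : nat).
Hypothesis char0 : [pchar k] =i pred0.
Local Notation B := {mpoly k[n]}.
Local Notation V := {ffun 'I_n -> B}.

Definition along (v : V) (a : B) : B := \sum_i v i * a^`M(i).
Definition divergence (v : V) : B := \sum_i (v i)^`M(i).

Lemma along_der v : derivation idfun (along v).
Proof.
split=> a b; rewrite /along /=.
  by rewrite -big_split; apply: eq_bigr => i _; rewrite mderivD mulrDr.
rewrite !mulr_sumr -big_split; apply: eq_bigr => i _ /=; rewrite mderivM; ring.
Qed.
Lemma along_scal v c : along v c%:A = 0.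
Proof. by rewrite /along big1 // => i _; rewrite alg_mpolyC mderivC mulr0. Qed.
Lemma alongX v i : along v 'X_i = v i.
Proof.
rewrite /along (bigD1 i) //= mderivXU eqxx mulr1 big1 ?addr0 // => j ne.
by rewrite mderivXU (negPf ne) mulr0.
Qed.
Lemma alongD v a b : along v (a + b) = along v a + along v b.
Proof. by case: (along_der v). Qed.
Lemma alongN v a : along v (- a) = - along v a.
Proof. exact: der_opp (along_der v) a. Qed.
Lemma alongMn2 v a : along v (a *+ 2) = along v a *+ 2.
Proof. by rewrite !mulr2n alongD. Qed.
Lemma along_linear v c (w : V) a : along (c *: v + w) a = c *: along v a + along w a.
Proof.
rewrite /along scaler_sumr -big_split; apply: eq_bigr => i _ /=.
by rewrite !ffunE mulrDl scalerAl.
Qed.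
Lemma divergence_linear : linear divergence.
Proof.
move=> c v w; rewrite /divergence scaler_sumr -big_split; apply: eq_bigr => i _ /=.
by rewrite !ffunE linearP.
Qed.
HB.instance Definition _ := GRing.isLinear.Build k V B _ divergence divergence_linear.

Section Ad.
Variable d : {linear B -> B}.
Hypothesis d_der : derivation idfun d.
(** The commutator of [d] with the field [v]. Fields are finite functions so that they form a module
    to which the lifting of highest weight vectors applies. *)
Definition ad (v : V) : V := [ffun i => d (v i) - along v (d 'X_i)].
Lemma ad_linear : linear ad.
Proof.
move=> c v w; apply/ffunP => i; rewrite !ffunE linearP along_linear scalerBr.
by move: (c *: _) (c *: _) => x y; ring.
Qed.
HB.instance Definition _ := GRing.isLinear.Build k V V _ ad ad_linear.

Let d_scal c : d c%:A = 0. Proof. by rewrite linearZ /= (der_one d_der) scaler0. Qed.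
Let chain a : d a = \sum_i a^`M(i) * d 'X_i.
Proof.
by apply: (@mpoly_chain k n B idfun B idfun d d_der) => c; rewrite /= -alg_mpolyC d_scal.
Qed.

Lemma along_ad v a : along (ad v) a = d (along v a) - along v (d a).
Proof.
pose L a := d (along v a) - along v (d a).
have [aD aM] := along_der v; have [dD dM] := d_der.
have Ld : derivation idfun L.
  split=> x y; rewrite /L; first by rewrite aD !dD aD; ring.
  by rewrite aM dM !dD aD !dM !aM /=; ring.
have Lc c : L c%:A = 0 by rewrite /L along_scal d_scal (der_zero d_der) (der_zero (along_der v)) subrr.
have LE : L a = \sum_i a^`M(i) * L 'X_i.
  by apply: (@mpoly_chain k n B idfun B idfun L Ld) => c; rewrite /= -alg_mpolyC Lc.
rewrite -[RHS]/(L a) LE; apply: eq_bigr => i _.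
by rewrite ffunE /L alongX mulrC.
Qed.

Lemma divergence_ad v : divergence (ad v) = d (divergence v) - along v (\sum_i (d 'X_i)^`M(i)).
Proof.
rewrite /divergence raddf_sum.
have -> : along v (\sum_i (d 'X_i)^`M(i)) = \sum_i \sum_j v j * ((d 'X_i)^`M(i))^`M(j).
  rewrite /along exchange_big; apply: eq_bigr => j _ /=.
  by rewrite raddf_sum mulr_sumr.
have E i : (ad v i)^`M(i) = d ((v i)^`M(i)) + \sum_j (d 'X_j)^`M(i) * (v i)^`M(j)
   - \sum_j (v j)^`M(i) * (d 'X_i)^`M(j) - \sum_j v j * ((d 'X_i)^`M(i))^`M(j).
  rewrite ffunE mderivB -(lie_gradient (v i) i d_der d_scal) -!addrA; congr (_ + (_ + _)).
  rewrite -opprD; congr (- _); rewrite /along raddf_sum -big_split; apply: eq_bigr => j _ /=.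
  by rewrite mderivM [((d _)^`M(j))^`M(i)]mderiv_comm.
rewrite (eq_bigr _ (fun i _ => E i)) !sumrB big_split /=.
have -> : \sum_i \sum_j (d 'X_j)^`M(i) * (v i)^`M(j) = \sum_i \sum_j (v j)^`M(i) * (d 'X_i)^`M(j).
  by rewrite exchange_big; apply: eq_bigr => i _; apply: eq_bigr => j _; rewrite mulrC.
by rewrite addrK.
Qed.

Hypothesis d_nilp : forall a, exists N, iter N d a = 0.
(** Induction on the nilpotency order of [a]: once the iterated commutators kill [d a], taking
    another commutator acts on their value at [a] as [d], which is locally nilpotent. *)
Lemma ad_nilp v : exists N, iter N ad v = 0.
Proof.
have key m a : iter m d a = 0 -> exists N, forall i, (N <= i)%N -> along (iter i ad v) a = 0.
  elim: m a => [|m IH] a.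
    by move=> /= ->; exists 0%N => i _; rewrite (der_zero (along_der _)).
  rewrite iterSr => /IH[N HN].
  have step i r : (N <= i)%N -> along (iter (i + r) ad v) a = iter r d (along (iter i ad v) a).
    move=> le; elim: r => [|r IHr]; first by rewrite addn0.
    by rewrite addnS /= along_ad IHr HN ?subr0 //; apply: leq_trans le _; rewrite leq_addr.
  have [M HM] := d_nilp (along (iter N ad v) a).
  exists (N + M)%N => i le.
  have -> : i = ((N + M) + (i - (N + M)))%N by rewrite subnKC.
  rewrite step ?leq_addr // step // HM.
  by elim: (i - _)%N => [|r IHr] //=; rewrite IHr (der_zero d_der).
have key' i : exists N, forall j, (N <= j)%N -> along (iter j ad v) 'X_i = 0.
  by have [m /key] := d_nilp 'X_i.
have [N HN] := choice key'; exists (\max_i N i)%N; apply/ffunP => i.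
by rewrite -alongX HN ?ffunE // leq_bigmax.
Qed.
End Ad.

Lemma ad_comp (d e : {linear B -> B}) v i : derivation idfun d -> derivation idfun e ->
  ad d (ad e v) i = d (e (v i)) - d (along v (e 'X_i)) - e (along v (d 'X_i)) + along v (e (d 'X_i)).
Proof.
move=> dd de; rewrite ffunE (along_ad de) ffunE linearB; ring.
Qed.
End VectorFields.

Definition mk_linear (k : nzRingType) (V : lmodType k) (g : V -> V) (lg : linear g) : {linear V -> V} :=
  HB.pack g (GRing.isLinear.Build k V V _ g lg).

Section CommutingField.
Variable k : closedFieldType.
Hypothesis char0 : [pchar k] =i pred0.
Local Notation D := (Dring k).
Local Notation B := {mpoly k[4]}.
Variables (rho : SL2_action B) (f : {lrmorphism B -> Rring k}).
Hypothesis f_onto : closed_embedding f.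
Hypothesis f_equiv : equivariant (X_action char0) rho f.
Local Notation E := (lE rho).
Local Notation F := (lF rho).
Local Notation H := (lH rho).
Local Notation phi := (phi f).
Variable tau : B.
Hypothesis tau_inv : sl2_inv rho tau.
Hypothesis phi_tau : phi tau = 0.
Hypothesis tau_prim : primitive (fun i => tau^`M(i)).
Hypothesis tau_gen : forall b, sl2_inv rho b -> exists P : {poly k}, b = horner_alg tau P.

(** The minors and the gradient of tau lie in the same kernel line, and that gradient is
    primitive. *)
Lemma theta_multiple : exists2 h, h != 0 & forall i, theta (field_col rho) i = h * tau^`M(i).
Proof.
have par i j : theta (field_col rho) i * tau^`M(j) = theta (field_col rho) j * tau^`M(i).
  exact: (theta_ker (v := fun i => tau^`M(i)) (gradient_ker char0 tau_inv.1 tau_inv.2)).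
have [h hE] := parallel_primitive tau_prim par; exists h => //.
apply: contra_not_neq (theta_neq0 f_onto f_equiv) => h0 i.
by rewrite hE h0 mul0r.
Qed.

Lemma lie_multiple (d : B -> B) (a : 'I_3 -> 'I_3 -> B) h : derivation idfun d ->
  (forall c, d c%:A = 0) -> (forall i, theta (field_col rho) i = h * tau^`M(i)) ->
  a 0 0 + a 1 1 + a 2%:R 2%:R = 0 ->
  (forall i r, d (field_col rho i r) = \sum_s a r s * field_col rho i s + \sum_j (d 'X_i)^`M(j) * field_col rho j r) ->
  forall i, d h * tau^`M(i) + h * (d tau)^`M(i) = (\sum_j (d 'X_j)^`M(j)) * h * tau^`M(i).
Proof.
move=> dd dc hE a0 dJ i; have := theta_lie dd a0 dJ i.
rewrite hE (proj2 dd) -(lie_gradient tau i dd dc) => e.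
rewrite -mulrA -e /=.
have -> : \sum_j (d 'X_j)^`M(i) * theta (field_col rho) j = h * \sum_j (d 'X_j)^`M(i) * tau^`M(j).
  by rewrite [RHS]mulr_sumr; apply: eq_bigr => j _; rewrite hE; ring.
by move: (\sum_j _) => s; ring.
Qed.

Let chain (d : B -> B) a : derivation idfun d -> (forall c, d c%:A = 0) ->
  d a = \sum_i a^`M(i) * d 'X_i.
Proof.
by move=> dd dc; apply: (@mpoly_chain k 4 B idfun B idfun d dd) => c; rewrite /= -alg_mpolyC dc.
Qed.
Let lH_scal c : H c%:A = 0. Proof. by rewrite (lHZ char0) (lH1 char0) scaler0. Qed.

(* [d] satisfies the hypothesis of [lie_multiple] with the matrix of its brackets with E, F, H. *)
Let lie_cols (d : B -> B) (a : 'I_3 -> 'I_3 -> B) :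
  (forall b, d (E b) = E (d b) + (a 0 0 * E b + a 0 1 * F b + a 0 2%:R * H b)) ->
  (forall b, d (F b) = F (d b) + (a 1 0 * E b + a 1 1 * F b + a 1 2%:R * H b)) ->
  (forall b, d (H b) = H (d b) + (a 2%:R 0 * E b + a 2%:R 1 * F b + a 2%:R 2%:R * H b)) ->
  forall i r, d (field_col rho i r) = \sum_s a r s * field_col rho i s + \sum_j (d 'X_i)^`M(j) * field_col rho j r.
Proof.
move=> dE dF dH i; elim/ord3P; rewrite sum3 [RHS]addrC /field_col /=.
- by rewrite dE (chain (d 'X_i) (lE_der char0 rho) (lE_scal char0 rho)).
- by rewrite dF (chain (d 'X_i) (lF_der char0 rho) (lF_scal char0 rho)).
- by rewrite dH (chain (d 'X_i) (lH_der char0 rho) lH_scal).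
Qed.

(** Comparing the Lie derivatives of the minors and of the gradient gives E h = div(E) h. As E has
    no eigenvectors, E h = 0 and div(E) = 0; likewise for F. *)
Lemma multiple_invariant h : h != 0 -> (forall i, theta (field_col rho) i = h * tau^`M(i)) ->
  [/\ sl2_inv rho h, \sum_j (E 'X_j)^`M(j) = 0 & \sum_j (F 'X_j)^`M(j) = 0].
Proof.
move=> h0 hE; have [i0 ti0] := primitive_neq0 tau_prim.
have EF b : E (F b) = F (E b) + H b by rewrite /lH addrC subrK.
have EH b : E (H b) = H (E b) + - (E b *+ 2).
  by rewrite -(lHE_comm char0) opprB addrC subrK.
have FH b : F (H b) = H (F b) + F b *+ 2.
  by rewrite -[F b *+ 2]opprK -(lHF_comm char0) opprB addrC subrK.
have done_ (d : B -> B) : derivation idfun d -> (forall g a : B, d g = a * g -> d g = 0) ->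
    d tau = 0 -> d h * tau^`M(i0) + h * (d tau)^`M(i0) = (\sum_j (d 'X_j)^`M(j)) * h * tau^`M(i0) ->
    d h = 0 /\ \sum_j (d 'X_j)^`M(j) = 0.
  move=> dd noeig -> ; rewrite mderiv0 mulr0 addr0 => /(mulIf ti0) e.
  have dh := noeig _ _ e; split=> //; apply: (mulIf h0); by rewrite mul0r -e.
(* The rows express the brackets of E, and below those of F, with E, F and H; both matrices have
   trace 0. *)
pose aE (r s : 'I_3) : B := nth 0 (nth [::] [:: [:: 0; 0; 0]; [:: 0; 0; 1]; [:: - 2%:R; 0; 0]] r) s.
pose aF (r s : 'I_3) : B := nth 0 (nth [::] [:: [:: 0; 0; - 1]; [:: 0; 0; 0]; [:: 0; 2%:R; 0]] r) s.
have lE' := lie_multiple (lE_der char0 rho) (lE_scal char0 rho) hE (a := aE) _ _ i0.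
have lF' := lie_multiple (lF_der char0 rho) (lF_scal char0 rho) hE (a := aF) _ _ i0.
have [|Eh dE] := done_ _ (lE_der char0 rho) (@E_no_eig k char0 rho) tau_inv.1.
  apply: lE'; first by rewrite /aE /= !addr0.
  apply: lie_cols => b; rewrite /aE /=; first by ring.
  - by rewrite EF; ring.
  - by rewrite EH; ring.
have [|Fh dF] := done_ _ (lF_der char0 rho) (@F_no_eig k char0 rho) tau_inv.2.
  apply: lF'; first by rewrite /aF /= !addr0.
  apply: lie_cols => b; rewrite /aF /=.
  - by rewrite EF; ring.
  - by ring.
  - by rewrite FH; ring.
by split.
Unshelve. all: exact: char0.
Qed.

(** E and F are divergence-free, so divergence is an equivariant map from fields to functions. A
    quarter of the radial field has divergence 1, an invariant, which therefore lifts to a weight 0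
    field killed by E and F. *)
Lemma unit_divergence_field : exists xi : B -> B, [/\ derivation idfun xi, forall c, xi c%:A = 0,
  forall b, xi (E b) = E (xi b), forall b, xi (F b) = F (xi b) & \sum_j (xi 'X_j)^`M(j) = 1].
Proof.
have [h h0 hE] := theta_multiple; have [ih dE dF] := multiple_invariant h0 hE.
pose LE := mk_linear (lE_linear char0 rho); pose LF := mk_linear (lF_linear char0 rho).
pose LH := mk_linear (lH_linear char0 rho).
have dLE : derivation idfun LE := lE_der char0 rho.
have dLF : derivation idfun LF := lF_der char0 rho.
have dLH : derivation idfun LH := lH_der char0 rho.
have EF b : LE (LF b) = LF (LE b) + LH b by rewrite /= /lH addrC subrK.
have HE b : LH (LE b) = LE (LH b) + LE b *+ 2 by rewrite /= -(lHE_comm char0) addrC subrK.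
have HF b : LH (LF b) = LF (LH b) - LF b *+ 2.
  by rewrite /= -[LHS](subrK (F (H b))) (lHF_comm char0) addrC.
have aEF v : ad LE (ad LF v) = ad LF (ad LE v) + ad LH v.
  apply/ffunP => i; rewrite [RHS]ffunE !ad_comp // [ad LH v i]ffunE !EF alongD.
  by ring.
have aHE v : ad LH (ad LE v) = ad LE (ad LH v) + ad LE v *+ 2.
  apply/ffunP => i; rewrite [RHS]ffunE !ad_comp // ffunMnE [ad LE v i]ffunE !HE [along v (LE (LH _) + _)]alongD.
  rewrite alongMn2.
  by ring.
have aHF v : ad LH (ad LF v) = ad LF (ad LH v) - ad LF v *+ 2.
  apply/ffunP => i; rewrite [RHS]ffunE [X in _ = _ + X]ffunE !ad_comp // ffunMnE [ad LF v i]ffunE !HF [along v (LF (LH _) - _)]alongD.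
  rewrite [along v (- (_ *+ 2))]alongN alongMn2.
  by ring.
pose dv : {linear {ffun 'I_4 -> B} -> B} := @divergence k 4.
have dvE v : dv (ad LE v) = LE (dv v) by rewrite /= divergence_ad // dE (der_zero (along_der v)) subr0.
have dvF v : dv (ad LF v) = LF (dv v) by rewrite /= divergence_ad // dF (der_zero (along_der v)) subr0.
have dvH v : dv (ad LH v) = LH (dv v).
  have -> : ad LH v = ad LE (ad LF v) - ad LF (ad LE v) by rewrite aEF addrC addKr.
  by rewrite linearB dvE dvF dvF dvE.
pose v0 : {ffun 'I_4 -> B} := [ffun i => (4%:R^-1 : k) *: 'X_i].
have dv0 : dv v0 = 1.
  rewrite /= /divergence (eq_bigr (fun=> (4%:R^-1 : k)%:A)); last first.
    by move=> i _; rewrite ffunE mderivZ mderivXU eqxx.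
  rewrite sumr_const card_ord scalerMnl -[_ *+ 4]mulr_natr mulVf ?scale1r //.
  exact: (nat_neq0 char0 3).
have [||v [vE vH vdiv]] := highest_weight_lift char0 aEF aHE aHF (ad_nilp dLE (E_nilp char0 rho))
    (ad_nilp dLF (F_nilp char0 rho)) dvE dvF dvH (d := 0) (v := v0).
- by rewrite dv0; exact: (lE1 char0).
- by rewrite dv0 scale0r; exact: (lH1 char0).
have vF : ad LF v = 0.
  exact: (highest_weight_nilp char0 aEF aHF (ad_nilp dLF (F_nilp char0 rho)) vE vH).
have comm (d : {linear B -> B}) b : derivation idfun d -> ad d v = 0 -> along v (d b) = d (along v b).
  move=> dd v0'; apply/eqP; rewrite eq_sym -subr_eq0 -(along_ad dd) v0'.
  by rewrite /along big1 // => i _; rewrite ffunE mul0r.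
exists (along v); split.
- exact: along_der.
- exact: along_scal.
- by move=> b; apply: (comm LE).
- by move=> b; apply: (comm LF).
rewrite -dv0 -vdiv /= /divergence; apply: eq_bigr => j _; by rewrite alongX.
Unshelve. all: exact: char0.
Qed.

(** Invariance gives xi tau = P(tau). It remains to see that P is a nonzero multiple of X; xi is
    then rescaled. *)
Lemma euler_field : exists xi : B -> B, [/\ derivation idfun xi, forall c, xi c%:A = 0,
  forall b, xi (E b) = E (xi b), forall b, xi (F b) = F (xi b) & xi tau = tau].
Proof.
have [h h0 hE] := theta_multiple; have [ih _ _] := multiple_invariant h0 hE.
have [xi [dxi xic xiE xiF xidiv]] := unit_divergence_field.
have [xD xM] := dxi.
have xiN := der_opp dxi.
have xiH b : xi (H b) = H (xi b) by rewrite /lH xD xiN !(xiE, xiF).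
have itx : sl2_inv rho (xi tau).
  by split; rewrite -?xiE -?xiF ?tau_inv.1 ?tau_inv.2 (der_zero dxi).
have [P PE] := tau_gen itx; have [hp hpE] := tau_gen ih.
have [i0 ti0] := primitive_neq0 tau_prim.
have dm (Q : {poly k}) i : (horner_alg tau Q)^`M(i) = horner_alg tau Q^`() * tau^`M(i).
  rewrite (@horner_alg_der k B (fun p => p^`M(i)) tau Q (mderiv_der k i)) // => x.
  by rewrite alg_mpolyC mderivC.
(* With h = hp(tau), unit divergence turns [lie_multiple] into hp' P + hp P' = hp. *)
have eqh : (hp * P)^`() = hp.
  apply/eqP; rewrite -subr_eq0; apply/eqP.
  apply: (horner_tau_inj char0 tau_prim); rewrite rmorphB /= -hpE.
  apply/eqP; rewrite subr_eq0; apply/eqP/(mulIf ti0).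
  have := lie_multiple dxi xic hE (a := fun _ _ => 0) _ _ i0.
  rewrite xidiv mul1r => <-; last 2 first.
  - by rewrite !addr0.
  - by apply: lie_cols => b; rewrite !mul0r !addr0.
  rewrite PE dm hpE (horner_alg_der tau hp dxi xic) PE derivM !rmorphD !rmorphM /=.
  by move: (horner_alg tau _) (horner_alg tau _) (horner_alg tau _) (horner_alg tau _) => *; ring.
pose s := hp * P.
have hp0 : hp != 0 by apply: contraNneq h0 => h0; rewrite hpE h0 rmorph0.
have sE : s = s^`() * P by rewrite /s eqh.
have s0 : s != 0 by apply: contraNneq hp0 => s0; rewrite -eqh -/s s0 deriv0.
have P0 : P != 0 by apply: contraNneq s0 => P0; rewrite /s P0 mulr0.
(* If hp(0) is nonzero, the gradient of tau vanishes on X because the minors do, and so does xi tau.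
   Otherwise s = hp P has a zero at 0, and s = s' P forces one of P by comparing multiplicities. *)
have P00 : P.[0] = 0.
  have [hz|hnz] := eqVneq hp.[0] 0; last first.
    have dt0 i : phi tau^`M(i) = 0.
      have := phi_theta f_equiv i; rewrite hE phiM hpE (phi_horner phi_tau) mulr_algl => /eqP.
      by rewrite scaler_eq0 (negPf hnz) => /eqP.
    apply: (alg_neq0 char0); rewrite -(phi_horner phi_tau) -PE.
    rewrite (chain _ dxi xic) rmorph_sum big1 // => i _.
    by apply: etrans (phiM _ _ _) _; rewrite dt0 mul0r.
  have [m [q qn0 sq]] := multiplicity_XsubC s 0; rewrite s0 /= subr0 in qn0 sq.
  case: m sq => [|m] sq.
    by have : s.[0] != 0; [rewrite sq expr0 mulr1 | rewrite /s hornerM hz mul0r eqxx].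
  have e : q * 'X = (q^`() * 'X + q *+ m.+1) * P.
    apply: (mulIf (_ : 'X^m != 0)); first by rewrite expf_neq0 // polyX_eq0.
    transitivity s; first by rewrite sq exprS mulrA.
    rewrite sE sq derivM derivXn /= exprS; move: ('X^m) => Y.
    by rewrite -[Y *+ _]mulr_natr -[q *+ _]mulr_natr; ring.
  have := congr1 (fun p : {poly k} => p.[0]) e.
  rewrite !hornerM hornerX mulr0 hornerD hornerM hornerX mulr0 add0r hornerMn => /esym/eqP.
  rewrite mulf_eq0 -mulr_natr mulf_eq0 (negPf (nat_neq0 char0 m)) orbF.
  by have /negPf -> : q.[0] != 0 by []; move/eqP.
(* In characteristic 0, s' has degree one less than s, so P has degree 1 by s = s' P. *)
have sP : size P = 2%N.
  have ss : (size s^`()).+1 = size s.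
    have s' : s^`() != 0 by rewrite /s eqh.
    apply/eqP; rewrite eqn_leq lt_size_deriv //=.
    have : (1 < size s)%N.
      rewrite ltnNge; apply: contra s' => /size1_polyC ->; by rewrite derivC.
    case sz: (size s) => [|[|l]] // _; rewrite ltnS.
    rewrite leqNgt; apply/negP => lt; have /leq_sizeP/(_ l (leqnn l)) : (size s^`() <= l)%N by [].
    move/eqP; rewrite coef_deriv -mulr_natr mulf_eq0 (negPf (nat_neq0 char0 l)) orbF.
    have : lead_coef s != 0 by rewrite lead_coef_eq0.
    by rewrite lead_coefE sz /= => /negPf ->.
  have s'0 : s^`() != 0 by rewrite /s eqh.
  have e : size s = (size s^`() + size P).-1 by rewrite {1}sE size_mul.
  have s1 : (0 < size s^`())%N by rewrite lt0n size_poly_eq0.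
  by move: ss e s1; move: (size s) (size s^`()) (size P) => x z u; lia.
have PX : P = P`_1 *: 'X.
  apply/polyP => -[|[|j]]; rewrite coefZ coefX ?mulr0 ?mulr1 -?horner_coef0 //.
  by rewrite nth_default // sP.
have a0 : P`_1 != 0 by apply: contraNneq P0 => a0; rewrite PX a0 scale0r.
exists (fun b => (P`_1)^-1 *: xi b); split.
- split=> x y /=; first by rewrite xD scalerDr.
  by rewrite xM scalerDr !scalerAr.
- by move=> c; rewrite xic scaler0.
- by move=> b; rewrite xiE (lEZ char0).
- by move=> b; rewrite xiF (lFZ char0).
have PXt : horner_alg tau P = P`_1 *: tau by rewrite {1}PX -mul_polyC rmorphM /= horner_algC horner_algX mulr_algl.
by rewrite PE PXt scalerA mulVf ?scale1r.
Qed.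
End CommutingField.

Lemma dvr_exp_eq0 (k : fieldType) n (t d : {mpoly k[n]}) : (1 < msize t)%N ->
  (forall i, dvr (t ^+ i) d) -> d = 0.
Proof.
move=> t1 dt; apply/eqP/negPn/negP => d0.
have t0 : t != 0 by apply: contraTneq t1 => ->; rewrite msize0.
have st i : (i < msize (t ^+ i))%N.
  elim: i => [|i IH]; first by rewrite expr0 msize1.
  rewrite exprS msizeM ?expf_neq0 //; move: (msize t) t1 (msize (t ^+ i)) IH => a a1 b ib; lia.
have [c dE] := dt (msize d).
have c0 : c != 0 by apply: contraNneq d0 => c0; rewrite dE c0 mul0r.
have sc : (0 < msize c)%N by rewrite lt0n msize_poly_eq0.
have := st (msize d); have := congr1 (fun p : {mpoly k[n]} => msize p) dE.
rewrite /= msizeM ?expf_neq0 //; move: (msize c) sc => a a1; move: (msize (_ ^+ _)) => b; move: (msize d) => e; lia.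
Qed.

(** * Logarithmic derivatives and norm forms in one variable *)

Section PolynomialLemmas.
Variable k : closedFieldType.
Hypothesis char0 : [pchar k] =i pred0.
Implicit Types p q r s D a b e : {poly k}.

Lemma sqrt_closed (c : k) : exists x, x ^+ 2 = c.
Proof.
have [x hx] := @solve_monicpoly k 2 (fun j => if j == 0%N then c else 0) isT.
by exists x; rewrite hx !big_ord_recl big_ord0 /= expr0 mulr1 mul0r !addr0.
Qed.

Lemma deriv_eq0_const p : p^`() = 0 -> p = (p`_0)%:P.
Proof.
move=> dp; apply/polyP => -[|j]; rewrite coefC //=.
have := congr1 (fun q : {poly k} => q`_j) dp; rewrite coef_deriv coef0 -mulr_natr => /eqP.
by rewrite mulf_eq0 (pcharf0P k).1 // orbF => /eqP.
Qed.

(** Write q = s X^m with s(0) nonzero. Then s divides X s' and is prime to X, so it divides s',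
    which must be zero. *)
Lemma log_derivative_monomial q r : q != 0 -> 'X * q^`() = r * q ->
  exists c j, c != 0 /\ q = c *: 'X^j.
Proof.
move=> q0 e; have [m [s + sE]] := multiplicity_XsubC q 0; rewrite q0 /= => s00.
rewrite subr0 in sE.
have Xm0 : 'X^m != 0 :> {poly k} by rewrite expf_neq0 // polyX_eq0.
have es : 'X * s^`() = (r - m%:R) * s.
  apply: (mulIf Xm0); have := e; rewrite sE derivM derivXn.
  case: m {sE Xm0} => [|m] /=; first by rewrite mulr0n mulr0 addr0 expr0 !mulr1 => ->; ring.
  rewrite exprS => /eqP; rewrite -subr_eq0 => /eqP e'; apply/eqP; rewrite -subr_eq0 -[X in _ == X]e'.
  by apply/eqP; rewrite -(mulr_natr ('X^m)); ring.
have ds : s^`() = 0.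
  apply/eqP/negPn/negP => nz.
  have cop : coprimep s 'X.
    by have -> : 'X = 'X - 0%:P :> {poly k}; [rewrite polyC0 subr0 | rewrite coprimep_XsubC].
  have : s %| s^`() by rewrite -(Gauss_dvdpr _ cop) es dvdp_mull.
  by move/(dvdp_leq nz); rewrite leqNgt lt_size_deriv //; apply: contraNneq nz => ->; rewrite deriv0.
exists s`_0, m; split; last by rewrite sE [in LHS](deriv_eq0_const ds) mul_polyC.
by rewrite -horner_coef0.
Qed.

(** An explicit case of Tsen's theorem. For even j the form is hyperbolic; for odd j it is a norm
    form, and each linear factor of D is a norm up to a square. *)
Lemma norm_form_square (c : k) j D : c != 0 -> D != 0 ->
  exists a b e, e != 0 /\ (a ^+ 2 + b ^+ 2 * (c *: 'X^j)) * D = e ^+ 2.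
Proof.
move=> c0 D0; have [i i2] := sqrt_closed (-1); have [s s2] := sqrt_closed c.
have s0 : s != 0 by apply: contraNneq c0 => s0; rewrite -s2 s0 expr0n.
have two0 : 2%:R != 0 :> {poly k} by rewrite -polyC_natr polyC_eq0 (pcharf0P k).1.
have cE : c%:P = s%:P ^+ 2 by rewrite -s2 rmorphXn.
have iE : i%:P ^+ 2 = -1 :> {poly k} by rewrite -rmorphXn i2 rmorphN rmorph1.
have Xm0 m : 'X^m != 0 :> {poly k} by rewrite expf_neq0 // polyX_eq0.
rewrite -mul_polyC cE -(odd_double_half j); case: (odd j); last first.
  rewrite add0n -muln2 exprM; set q0 := s%:P * 'X^(j./2).
  (* Since i^2 = -1, the form takes the value q0^2 ((D+1)^2 - (D-1)^2) = 4 q0^2 D. *)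
  exists (q0 * (D + 1)), (i%:P * (D - 1)), (2%:R * q0 * D); split.
    by rewrite !mulf_neq0 // polyC_eq0.
  by rewrite [(i%:P * _) ^+ 2]exprMn iE /q0; move: ('X^_) (s%:P) => *; ring.
set m := j./2; set Q := s%:P ^+ 2 * _.
have QE : Q = s%:P ^+ 2 * ('X * 'X^m ^+ 2) by rewrite /Q -muln2 add1n ['X^_]exprS exprM.
have good : exists a b e, e != 0 /\ a ^+ 2 + b ^+ 2 * Q = D * e ^+ 2.
  have [rs DE] := closed_field_poly_normal D; rewrite DE.
  have [d d2] := sqrt_closed (lead_coef D).
  elim: rs {DE} => [|x rs [a [b [e [e0 IH]]]]].
    exists d%:P, 0, 1; rewrite big_nil oner_neq0; split=> //.
    by rewrite -rmorphXn d2 -mul_polyC /=; ring.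
  have [y y2] := sqrt_closed (- x).
  (* With y^2 = -x and b' = 1/s the form has the value (X - x) X^(2m). *)
  pose a' := y%:P * 'X^m; pose b' := (s^-1)%:P : {poly k}.
  have norm : a' ^+ 2 + b' ^+ 2 * Q = ('X - x%:P) * 'X^m ^+ 2.
    have sV : b' * s%:P = 1 by rewrite -rmorphM /= mulVf.
    have yE : y%:P ^+ 2 = - x%:P :> {poly k} by rewrite -rmorphXn y2 rmorphN.
    rewrite QE /a' exprMn yE; move: sV; move: b' (s%:P) ('X^m) (x%:P) => u v X z uv.
    transitivity ((- z) * X ^+ 2 + (u * v) ^+ 2 * ('X * X ^+ 2)); first by ring.
    by rewrite uv; ring.
  exists (a * a' - b * b' * Q), (a * b' + a' * b), (e * 'X^m); split; first by rewrite mulf_neq0.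
  rewrite big_cons.
  transitivity ((a ^+ 2 + b ^+ 2 * Q) * (a' ^+ 2 + b' ^+ 2 * Q)); first by ring.
  by rewrite IH norm -!mul_polyC; ring.
have [a [b [e [e0 abE]]]] := good.
exists a, b, (D * e); split; first by rewrite mulf_neq0.
by rewrite abE; ring.
Qed.
End PolynomialLemmas.

(** * Rank one matrices on the plane orthogonal to an eigenvector *)

Section PlaneProjector.
Variable R : idomainType.
Implicit Types (M : 'M[R]_3) (p q : 'I_3 -> R).

Lemma tr_adj3 M : \tr (adj3 M) *+ 2 = \tr M ^+ 2 - \tr (M *m M).
Proof. by rewrite !tr3 !mul3; entries; ring. Qed.

Lemma outer_mull p M i j : (M *m outer p p) i j = mulv M p i * p j.
Proof. by rewrite mul3 /mulv /dot !mxE; ring. Qed.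

Lemma skew_anti p M : M^T = M ->
  skew3 p *m M + M *m skew3 p = \tr M *: skew3 p - skew3 (mulv M p).
Proof.
move=> symM; have sM i j : M i j = M j i by rewrite -{1}symM mxE.
apply/matrixP; elim/ord3P; elim/ord3P; rewrite mxE [RHS]mxE [X in _ = X + _]mxE !mul3 tr3; entries;
  rewrite ?(sM 1 0) ?(sM 2%:R 0) ?(sM 2%:R 1); ring.
Qed.

Lemma skew_sq p : skew3 p *m skew3 p = outer p p - (dot p p)%:M.
Proof. by apply/matrixP; elim/ord3P; elim/ord3P; rewrite mul3; entries; ring. Qed.

Lemma tr_skew_sym p M : M^T = M -> \tr (skew3 p *m M) = 0.
Proof.
move=> symM; have sM i j : M i j = M j i by rewrite -{1}symM mxE.
by rewrite tr3 !mul3; entries; rewrite ?(sM 1 0) ?(sM 2%:R 0) ?(sM 2%:R 1); ring.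
Qed.

Lemma skew_tr p : (skew3 p)^T = - skew3 p.
Proof. by apply/matrixP; elim/ord3P; elim/ord3P; entries; ring. Qed.

(* On the plane orthogonal to an eigenvector [p], a rotation of the traceless part of [C] by [a + b [p x]]
   scales its square, up to the norm of [p], by [a^2 + b^2 (p . p)]. *)
Lemma plane_rank_one (C : 'M[R]_3) p (kap a b eps : R) :
  C^T = C -> \tr C = 1 -> (forall i, mulv C p i = kap * p i) -> dot p p != 0 -> 2%:R != 0 :> R ->
  let Q := dot p p in let t := 1 - kap in
  (a ^+ 2 + b ^+ 2 * Q) * (t ^+ 2 - (\tr (adj3 C) - kap * t) *+ 4) = eps ^+ 2 -> eps != 0 ->
  let P := outer p p in
  let c := Q *+ 2 *: C + (t - kap *+ 2) *: P - (t * Q)%:M in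
  let A := a *: c + b *: (skew3 p *m c) + eps *: (Q%:M - P) in
  [/\ A^T = A, adj3 A = 0, A != 0 & forall i, mulv A p i = 0].
Proof.
move=> symC trC Cp Q0 two0 Q t normE eps0 P c A.
have symP : P^T = P by apply/matrixP => i j; rewrite !mxE mulrC.
have symc : c^T = c by rewrite /c !linearB !linearD /= !linearZ /= symC symP tr_scalar_mx.
have CP : C *m P = kap *: P.
  by apply/matrixP => i j; rewrite outer_mull Cp !mxE mulrA.
have PC : P *m C = kap *: P by rewrite -[LHS]trmxK trmx_mul symC symP CP linearZ /= symP.
have PP : P *m P = Q *: P.
  by apply/matrixP => i j; rewrite outer_mull /mulv /dot !mxE /Q /dot; ring.
have trP : \tr P = Q by rewrite tr3 !mxE /Q /dot.
have cP : c *m P = 0.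
  rewrite /c mulmxBl mulmxDl -!scalemxAl CP PP mul_scalar_mx !scalerA -scalerDl -scalerBl.
  by rewrite (_ : _ - _ = 0) ?scale0r //; ring.
have Pc : P *m c = 0 by rewrite -[LHS]trmxK trmx_mul symc symP cP trmx0.
have trc : \tr c = 0.
  rewrite /c linearB linearD /= !mxtraceZ trC trP mxtrace_scalar /t -mulr_natr; ring.
have cp i : mulv c p i = 0.
  apply: (mulIf Q0); rewrite mul0r.
  have := congr1 (fun M => mulv M p i) cP; rewrite /= => e.
  transitivity (mulv (c *m P) p i); last by rewrite cP /mulv /dot !mxE; ring.
  by rewrite {2}/mulv /dot !outer_mull /dot; ring.
have anti : c *m skew3 p = - (skew3 p *m c).
  apply/eqP; rewrite -addr_eq0 addrC skew_anti // trc scale0r sub0r oppr_eq0.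
  by apply/eqP/matrixP; elim/ord3P; elim/ord3P; rewrite !mxE /= ?I3 ?cp ?oppr0.
pose Z := c *m c.
(* t^2 - 4 (e2 - kap t) is the discriminant of the two eigenvalues of C on the plane orthogonal to
   p, where e2 is the trace of the adjugate and t their sum. *)
have trZ : \tr Z = Q ^+ 2 * (t ^+ 2 - (\tr (adj3 C) - kap * t) *+ 4) *+ 2.
  have trCC : \tr (C *m C) = 1 - \tr (adj3 C) *+ 2 by rewrite tr_adj3 trC; ring.
  have -> : \tr Z = \tr (c *m (Q *+ 2 *: C - (t * Q)%:M)).
    by rewrite /Z {2}/c addrAC mulmxDr -scalemxAr cP scaler0 addr0.
  rewrite mulmxBr -scalemxAr mul_mx_scalar linearB /= !mxtraceZ trc mulr0 subr0.
  rewrite /c mulmxBl mulmxDl -!scalemxAl mul_scalar_mx linearB linearD /= !mxtraceZ trCC PC mxtraceZ trP trC.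
  by rewrite /t; ring.
set Rp := skew3 p in anti A *.
clearbody c.
have symZ : Z^T = Z by rewrite /Z trmx_mul symc.
have symRc : (Rp *m c)^T = Rp *m c by rewrite trmx_mul symc skew_tr mulmxN anti opprK.
have symN : (Q%:M - P)^T = Q%:M - P by rewrite linearB /= tr_scalar_mx symP.
have T3 (X Y W : 'M[R]_3) : (a *: X + b *: Y + eps *: W)^T = a *: X^T + b *: Y^T + eps *: W^T.
  by rewrite !linearD !linearZ.
have tr3l (X Y W : 'M[R]_3) : \tr (a *: X + b *: Y + eps *: W) = a * \tr X + b * \tr Y + eps * \tr W.
  by rewrite !linearD !linearZ.
have trN : \tr (Q%:M - P) = Q *+ 2 by rewrite linearB /= mxtrace_scalar trP -mulr_natr; ring.
have symA : A^T = A by rewrite /A T3 symc symRc symN.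
have trRc : \tr (Rp *m c) = 0 by exact: tr_skew_sym.
have PRc : P *m (Rp *m c) = 0.
  by rewrite -[LHS]trmxK trmx_mul symRc symP -mulmxA cP mulmx0 trmx0.
have RcP : Rp *m c *m P = 0 by rewrite -mulmxA cP mulmx0.
have trA : \tr A = eps * Q *+ 2.
  rewrite /A tr3l trc trRc trN; ring.
(* This is where [normE] enters; by [tr_adj3] it says that the adjugate of A has trace 0. *)
have trAA : \tr (A *m A) = \tr A ^+ 2.
  have e1 : c *m (Q%:M - P) = Q *: c by rewrite mulmxBr cP subr0 mul_mx_scalar.
  have e2 : (Q%:M - P) *m c = Q *: c by rewrite mulmxBl Pc subr0 mul_scalar_mx.
  have e3 : Rp *m c *m (Q%:M - P) = Q *: (Rp *m c) by rewrite mulmxBr RcP subr0 mul_mx_scalar.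
  have e4 : (Q%:M - P) *m (Rp *m c) = Q *: (Rp *m c) by rewrite mulmxBl PRc subr0 mul_scalar_mx.
  have e5 : (Q%:M - P) *m (Q%:M - P) = Q *: (Q%:M - P).
    by rewrite mulmxBr mul_mx_scalar mulmxBl PP mul_scalar_mx subrr subr0.
  have e6 : Rp *m c *m (Rp *m c) = Q *: Z.
    rewrite -mulmxA [c *m (Rp *m c)]mulmxA anti mulNmx mulmxN -mulmxA mulmxA skew_sq mulmxBl.
    by rewrite mulmxA Pc mul0mx sub0r opprK mul_scalar_mx.
  have e7 : \tr (c *m (Rp *m c)) = 0 by rewrite mulmxA anti mulNmx linearN /= -mulmxA tr_skew_sym ?oppr0.
  have e8 : \tr (Rp *m c *m c) = 0 by rewrite -mulmxA tr_skew_sym.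
  rewrite trA /A !(mulmxDl, mulmxDr) -!(scalemxAl, scalemxAr) e1 e2 e3 e4 e5 e6 -/Z.
  rewrite !mxtraceD !mxtraceZ e7 e8 trc trRc trZ trN.
  transitivity ((a ^+ 2 + b ^+ 2 * Q) * (t ^+ 2 - (\tr (adj3 C) - kap * t) *+ 4) * Q ^+ 2 *+ 2 + eps ^+ 2 * Q ^+ 2 *+ 2).
    by ring.
  by rewrite normE; ring.
have Ap i : mulv A p i = 0.
  have AP : A *m P = 0.
    rewrite /A !mulmxDl -!scalemxAl cP RcP mulmxBl PP mul_scalar_mx subrr.
    by rewrite !scaler0 !addr0.
  apply: (mulIf Q0); rewrite mul0r.
  transitivity (mulv (A *m P) p i); last by rewrite AP /mulv /dot !mxE; ring.
  by rewrite {2}/mulv /dot !outer_mull /dot; ring.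
have tradj : \tr (adj3 A) = 0.
  apply: (mulIf two0); rewrite mul0r mulr_natr tr_adj3 trAA subrr //.
split=> //.
  (* A p = 0 makes the adjugate proportional to p p^T, and its trace 0 makes it vanish since p . p
     is nonzero. *)
  have z j : dvr 0 (mulv A p j) by rewrite Ap; apply: dvr0.
  have K := adj3_kernel symA z.
  have {}K j l m r : adj3 A m r * p j * p l = adj3 A j l * p m * p r.
    by have [x] := K j l m r; rewrite mulr0 => /eqP; rewrite subr_eq0 => /eqP.
  apply/matrixP => i j; rewrite [RHS]mxE; apply: (mulIf Q0); rewrite mul0r.
  transitivity (\tr (adj3 A) * (p i * p j)); last by rewrite tradj mul0r.
  by rewrite tr3 /Q /dot !mulrDl !mulrDr !mulrA !(K i j).
apply/eqP => A0; move/eqP: trA; rewrite A0 mxtrace0 eq_sym -mulr_natr !mulf_eq0.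
by rewrite (negPf eps0) (negPf Q0) (negPf two0).
Qed.
End PlaneProjector.

(** * Adjoining a square root of tau and solving the cubic *)

Record rext (R : comNzRingType) (t : R) := Rext {rext_pair : R * R}.
Section RextRing.
Variables (R : comNzRingType) (t : R).
Local Notation S := (rext t).
HB.instance Definition _ := [isNew for @rext_pair R t].
HB.instance Definition _ := [Choice of S by <:].
Implicit Types x y z : S.
Definition re x := (rext_pair x).1.
Definition im x := (rext_pair x).2.
Definition mk a b : S := Rext t (a, b).
Lemma rext_eq x y : re x = re y -> im x = im y -> x = y.
Proof. by case: x y => [[a b]] [[c d]]; rewrite /re /im /= => -> ->. Qed.
Definition rext_add x y := mk (re x + re y) (im x + im y).
Definition rext_opp x := mk (- re x) (- im x).
(** Pairs stand for re + im s with s^2 = t; the type carries [t] so that each [t] has its own ring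
    structure. *)
Definition rext_mul x y := mk (re x * re y + t * im x * im y) (re x * im y + im x * re y).
Fact rext_addA : associative rext_add.
Proof. by move=> x y z; apply: rext_eq; rewrite /re /im /= addrA. Qed.
Fact rext_addC : commutative rext_add.
Proof. by move=> x y; apply: rext_eq; rewrite /re /im /= addrC. Qed.
Fact rext_add0 : left_id (mk 0 0) rext_add.
Proof. by move=> x; apply: rext_eq; rewrite /re /im /= add0r. Qed.
Fact rext_addN : left_inverse (mk 0 0) rext_opp rext_add.
Proof. by move=> x; apply: rext_eq; rewrite /re /im /= addNr. Qed.
HB.instance Definition _ := GRing.isZmodule.Build S rext_addA rext_addC rext_add0 rext_addN.
Fact rext_mulA : associative rext_mul.
Proof. by move=> [[a b]] [[c d]] [[e f]]; apply: rext_eq; rewrite /rext_mul /rext_add /mk /re /im /=; ring. Qed.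
Fact rext_mulC : commutative rext_mul.
Proof. by move=> [[a b]] [[c d]]; apply: rext_eq; rewrite /rext_mul /rext_add /mk /re /im /=; ring. Qed.
Fact rext_mul1 : left_id (mk 1 0) rext_mul.
Proof. by move=> [[a b]]; apply: rext_eq; rewrite /rext_mul /rext_add /mk /re /im /=; ring. Qed.
Fact rext_mulDl : left_distributive rext_mul rext_add.
Proof. by move=> [[a b]] [[c d]] [[e f]]; apply: rext_eq; rewrite /rext_mul /rext_add /mk /re /im /=; ring. Qed.
Fact rext_one_neq0 : mk 1 0 != 0.
Proof. by apply/eqP => /(congr1 re)/eqP; rewrite oner_eq0. Qed.
HB.instance Definition _ := GRing.Zmodule_isComNzRing.Build S
  rext_mulA rext_mulC rext_mul1 rext_mulDl rext_one_neq0.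

Lemma reD x y : re (x + y) = re x + re y. Proof. by []. Qed.
Lemma imD x y : im (x + y) = im x + im y. Proof. by []. Qed.
Lemma reM x y : re (x * y) = re x * re y + t * im x * im y. Proof. by []. Qed.
Lemma imM x y : im (x * y) = re x * im y + im x * re y. Proof. by []. Qed.

Definition emb0 (a : R) : S := mk a 0.
Fact emb0_zmod : zmod_morphism emb0.
Proof. by move=> a b; apply: rext_eq => //; rewrite /im /= subr0. Qed.
Fact emb0_monoid : monoid_morphism emb0.
Proof. by split=> // a b; apply: rext_eq; rewrite ?reM ?imM /re /im /=; ring. Qed.
HB.instance Definition _ := GRing.isZmodMorphism.Build R S emb0 emb0_zmod.
HB.instance Definition _ := GRing.isMonoidMorphism.Build R S emb0 emb0_monoid.

Definition rt : S := mk 0 1.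
Lemma rt_sq : rt * rt = emb0 t.
Proof. by apply: rext_eq; rewrite ?reM ?imM /re /im /=; ring. Qed.

Definition rnorm x := re x ^+ 2 - t * im x ^+ 2.
Lemma rnormM x y : rnorm (x * y) = rnorm x * rnorm y.
Proof. by rewrite /rnorm reM imM; ring. Qed.
End RextRing.

(** Comparison of orders at pi in N x'/x = M G'/G. Write x = x1 pi^e with x1 not divisible by pi;
    then (N e - M f) u G0 x1 is a multiple of pi. As u G0 is invertible modulo pi, a nonzero
    difference N e - M f would make pi divide x1. *)
Lemma content_order (A : comNzRingType) (d : A -> A) (pi u x G0 : A) (f N M : nat) :
  derivation idfun d ->
  (forall y z : A, y * z = 0 -> y = 0 \/ z = 0) ->
  (forall a b : nat, a <> b -> exists c : A, (a%:R - b%:R) * c = 1) ->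
  (forall y : A, (forall n, exists z, y = z * pi ^+ n) -> y = 0) -> pi <> 0 ->
  d pi = u -> (exists c z, u * G0 * c = 1 + z * pi) -> x <> 0 ->
  (pi ^+ f * G0) * d x *+ N = d (pi ^+ f * G0) * x *+ M -> exists e, (N * e = M * f)%N.
Proof.
move=> dd dom natinv cap pi0 dpi [c [z cE]] x0 rel; have [dD dM] := dd.
have [n Hn] : exists n, ~ exists z, x = z * pi ^+ n.
  by apply: contrapT => none; apply: x0; apply: cap => n; apply: contrapT => H; apply: none; exists n.
have [e [x1 [xE nd]]] : exists e x1, x = x1 * pi ^+ e /\ ~ exists y, x1 = y * pi.
  elim: n Hn => [|n IH] Hn; first by case: Hn; exists x; rewrite expr0 mulr1.
  have [[x1 xE]|/IH//] := pselect (exists z, x = z * pi ^+ n).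
  exists n, x1; split=> // -[y yE]; apply: Hn; exists y; by rewrite xE yE exprS mulrA.
exists e; apply: contrapT => ne; have [g gE] := natinv _ _ ne; apply: nd.
have dpow m : pi * d (pi ^+ m) = m%:R * u * pi ^+ m.
  elim: m => [|m IH]; first by rewrite expr0 (der_one dd) !mul0r mulr0.
  rewrite exprS dM dpi /= mulrDr mulrCA IH -[m.+1]addn1 natrD; ring.
have canc y y' m : y * pi ^+ m = y' * pi ^+ m -> y = y'.
  move=> e'; have : (y - y') * pi ^+ m = 0 by rewrite mulrBl e' subrr.
  case/dom => [/eqP|pm]; first by rewrite subr_eq0 => /eqP.
  by case: pi0; elim: m pm {e'} => [|m IH]; [rewrite expr0 => /eqP; rewrite oner_eq0 | rewrite exprS => /dom[//|/IH]].
have key : N%:R * G0 * (e%:R * u * x1 + pi * d x1) = M%:R * (f%:R * u * G0 + pi * d G0) * x1.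
  apply: (canc _ _ (e + f)%N).
  transitivity (pi * ((pi ^+ f * G0) * d x *+ N)).
    rewrite xE dM /= -mulr_natr exprD.
    transitivity (N%:R * G0 * pi ^+ f * (x1 * (pi * d (pi ^+ e)) + pi * pi ^+ e * d x1)); last by ring.
    by rewrite dpow; ring.
  rewrite rel xE dM /= -mulr_natr exprD.
  transitivity (M%:R * x1 * pi ^+ e * (G0 * (pi * d (pi ^+ f)) + pi * pi ^+ f * d G0)); first by ring.
  by rewrite dpow; ring.
exists (g * c * (M%:R * d G0 * x1 - N%:R * G0 * d x1) - z * x1).
have keq : ((N * e)%:R - (M * f)%:R) * (u * G0) * x1 = (M%:R * d G0 * x1 - N%:R * G0 * d x1) * pi.
  move/eqP: key; rewrite -subr_eq0 => /eqP key.
  by apply/eqP; rewrite -subr_eq0 -[X in _ == X]key; apply/eqP; rewrite !natrM; ring.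
rewrite mulrBl -[_ * pi]mulrA -keq.
transitivity ((1 + z * pi) * x1 - z * x1 * pi); first by ring.
rewrite -cE; congr (_ - _).
transitivity (((N * e)%:R - (M * f)%:R) * g * (u * G0 * c * x1)); first by rewrite gE mul1r.
by ring.
Qed.

Section PolyPowers.
Variable k : closedFieldType.
Hypothesis char0 : [pchar k] =i pred0.
Implicit Types D : {poly k}.

Lemma order_unique (b : k) f g D D' : ('X - b%:P) ^+ f * D = ('X - b%:P) ^+ g * D' ->
  D.[b] != 0 -> D'.[b] != 0 -> f = g.
Proof.
have aux f' g' D1 D2 : ('X - b%:P) ^+ f' * D1 = ('X - b%:P) ^+ g' * D2 -> D1.[b] != 0 -> (g' <= f')%N.
  move=> e D1b; rewrite leqNgt; apply/negP => lt.
  have : D1 = ('X - b%:P) ^+ (g' - f') * D2.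
    apply: (mulfI (_ : ('X - b%:P) ^+ f' != 0)); first by rewrite expf_neq0 // polyXsubC_eq0.
    by rewrite e mulrA -exprD subnKC // ltnW.
  move=> D1E; move/negP: D1b; apply; rewrite D1E hornerM horner_exp hornerXsubC subrr.
  by rewrite expr0n subn_eq0 leqNgt lt mul0r.
by move=> e Db D'b; apply/eqP; rewrite eqn_leq (aux _ _ _ _ (esym e) D'b) (aux _ _ _ _ e Db).
Qed.

Lemma closed_root N (c : k) : (0 < N)%N -> exists x, x ^+ N = c.
Proof.
move=> N0; have [x hx] := @solve_monicpoly k N (fun j => if j == 0%N then c else 0) N0.
exists x; rewrite hx; case: N N0 {hx} => // N _.
by rewrite big_ord_recl expr0 mulr1 big1 ?addr0 // => j _; rewrite mul0r.
Qed.

Lemma nth_power_of_orders N D : (0 < N)%N -> D != 0 ->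
  (forall b f D0, D = ('X - b%:P) ^+ f * D0 -> D0.[b] != 0 -> (N %| f)%N) ->
  exists L : {poly k}, D = L ^+ N.
Proof.
move=> N0; have [s] := ubnP (size D); elim: s => // s IH in D * => /ltnSE le_s D0 ord.
have [s1|] := boolP (size D == 1%N).
  have /size_poly1P[c c0 ->] := s1; have [x xE] := closed_root c N0.
  by exists x%:P; rewrite -rmorphXn xE.
case/closed_rootP => b rb.
have [m [D1 + DE]] := multiplicity_XsubC D b; rewrite D0 /= => D1b.
have Nm : (N %| m)%N by apply: (ord b m D1 _ D1b); rewrite mulrC.
have D10 : D1 != 0 by apply: contraNneq D1b => ->; rewrite root0.
have m0 : (0 < m)%N.
  by rewrite lt0n; apply: contraTneq rb => m0; rewrite DE m0 expr0 mulr1.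
have [L LE] : exists L, D1 = L ^+ N.
  apply: IH => //.
    apply: leq_trans le_s; rewrite DE size_mul ?expf_neq0 ?polyXsubC_eq0 // size_exp_XsubC.
    by rewrite addnS /= -addn1 leq_add2l.
  move=> a f D2 D1E D2a; have [e|ne] := eqVneq a b.
    move: D1b; rewrite /root D1E e hornerM horner_exp hornerXsubC subrr.
    by case: f {D1E} => // f; rewrite expr0n mul0r eqxx.
  apply: (ord a f (D2 * ('X - b%:P) ^+ m)); first by rewrite DE D1E mulrA.
  by rewrite hornerM mulf_neq0 // horner_exp hornerXsubC expf_neq0 // subr_eq0.
by exists (L * ('X - b%:P) ^+ (m %/ N)); rewrite exprMn -exprM divnK // -LE.
Qed.
End PolyPowers.

(* The Lagrange resolvent [p s - 3 v t] of the cubic [t^3 = p t + (u + v)] has logarithmic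
   derivative one sixth of that of [v^2 (u - v)^6]. *)
Lemma resolvent_derivative (A : comNzRingType) (p s t u v p' u' v' xs xt : A) :
  let q := u + v in let q' := u' + v' in
  let D := p ^+ 3 *+ 4 - q ^+ 2 *+ 27 in let al := p ^+ 2 * p' *+ 2 - q * q' *+ 9 in
  let be := p * q' *+ 2 - p' * q *+ 3 in
  p ^+ 3 = u * v *+ 27 -> p ^+ 2 * p' = (u' * v + u * v') *+ 9 ->
  D * xt = al * t + be * s *+ 3 -> D * xs = al * s *+ 2 + p * be * t *+ 2 ->
  (v ^+ 2 * (u - v) ^+ 6 * (p' * s + p * xs - (v' * t + v * xt) *+ 3) *+ 6
    - (v * v' * (u - v) ^+ 6 *+ 2 + v ^+ 2 * (u - v) ^+ 5 * (u' - v') *+ 6) * (p * s - v * t *+ 3))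
  * p ^+ 2 *+ 27 = 0.
Proof.
move=> q q' D al be e3 ep ht hs.
have DE : D = - ((u - v) ^+ 2 *+ 27) by rewrite /D e3 /q; ring.
have alE : al = - ((u - v) * (u' - v') *+ 9) by rewrite /al ep /q /q'; ring.
have beE : p ^+ 2 * be = (u * v *+ 27) * q' *+ 2 - ((u' * v + u * v') *+ 9) * q *+ 3.
  by rewrite -e3 -ep /be; ring.
set xr := p' * s + p * xs - (v' * t + v * xt) *+ 3.
have I1 : D * (p ^+ 2 * xr) = ((u' * v + u * v') *+ 9) * D * s + (al * (u * v *+ 27) * s *+ 2
    + p ^+ 2 * (p ^+ 2 * be) * t *+ 2) - D * v' * p ^+ 2 * t *+ 3
    - v * (al * p ^+ 2 * t + (p ^+ 2 * be) * s *+ 3) *+ 3.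
  rewrite -e3 -ep; transitivity (p ^+ 2 * p' * D * s + p ^+ 3 * (D * xs) - D * v' * p ^+ 2 * t *+ 3
     - v * p ^+ 2 * (D * xt) *+ 3); first by rewrite /xr; ring.
  by rewrite hs ht; ring.
transitivity (- (v ^+ 2 * (u - v) ^+ 4 * (D * (p ^+ 2 * xr)) *+ 6)
  - (v * v' * (u - v) ^+ 6 *+ 2 + v ^+ 2 * (u - v) ^+ 5 * (u' - v') *+ 6) * (p ^+ 3 * s - v * p ^+ 2 * t *+ 3) *+ 27).
  by rewrite DE; ring.
rewrite I1 beE e3 DE alE /q /q'; ring.
Qed.

Section CubicRoot.
Variable k : closedFieldType.
Hypothesis char0 : [pchar k] =i pred0.
Local Notation B := {mpoly k[4]}.
Variables (xi : B -> B) (tau : B).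
Hypotheses (xi_der : derivation idfun xi) (xi_scal : forall c, xi c%:A = 0) (xi_tau : xi tau = tau).
Hypothesis tau_size : (1 < msize tau)%N.
Hypothesis tau_prime : forall w : B, dvr tau (w * w) -> dvr tau w.
Local Notation S := (rext tau).
Let t0 : tau != 0. Proof. by apply: contraTneq tau_size => ->; rewrite msize0. Qed.
Let natk n : n.+1%:R != 0 :> k. Proof. by rewrite (pcharf0P k).1. Qed.

Definition iota (c : k) : S := emb0 tau c%:A.
Fact iota_zmod : zmod_morphism iota.
Proof. by move=> a b; rewrite /iota scalerBl rmorphB. Qed.
Fact iota_monoid : monoid_morphism iota.
Proof.
split=> [|a b]; first by rewrite /iota scale1r rmorph1.
by rewrite /iota -rmorphM /= -scalerAl mul1r scalerA.
Qed.
HB.instance Definition _ := GRing.isZmodMorphism.Build k S iota iota_zmod.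
HB.instance Definition _ := GRing.isMonoidMorphism.Build k S iota iota_monoid.

(** The extension of xi to B[s], s^2 = tau; the half is forced by xi tau = tau, since 2 s xi(s) =
    s^2. *)
Definition xi' (x : S) : S := mk tau (xi (re x)) (xi (im x) + 2%:R^-1 *: im x).
Let xD a b : xi (a + b) = xi a + xi b. Proof. by case: xi_der. Qed.
Let xM a b : xi (a * b) = a * xi b + b * xi a. Proof. by case: xi_der. Qed.
Let half (b : B) : (2%:R^-1 : k) *: b + 2%:R^-1 *: b = b.
Proof. by rewrite -scalerDl -mulr2n -[_ *+ 2]mulr_natr mulVf ?scale1r. Qed.

Lemma xi'_der : derivation idfun xi'.
Proof.
split=> [] [[a b]] [[c d]]; apply: rext_eq; rewrite ?reD ?imD ?reM ?imM /xi' /re /im /= ?reD ?imD ?reM ?imM /re /im /=.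
- by rewrite xD.
- by rewrite xD scalerDr; ring.
- rewrite !(xD, xM) xi_tau /= -!mul_mpolyC; have := half 1; rewrite -!mul_mpolyC !mulr1.
  move: (_%:MP) => h h1; apply/eqP; rewrite -subr_eq0; apply/eqP.
  by transitivity ((1 - (h + h)) * (tau * b * d)); [ring | rewrite h1 subrr mul0r].
- by rewrite !(xD, xM) scalerDr -!mul_mpolyC; ring.
Qed.

Lemma xi'_emb b : xi' (emb0 tau b) = emb0 tau (xi b).
Proof. by apply: rext_eq; rewrite /xi' /re /im //= (der_zero xi_der) scaler0 addr0. Qed.
Lemma xi'_iota c : xi' (iota c) = 0.
Proof. by rewrite xi'_emb xi_scal rmorph0. Qed.

Fact evs_comm : commr_rmorph iota (rt tau). Proof. by move=> c; apply: mulrC. Qed.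
Definition evs : {poly k} -> S := horner_morph evs_comm.
HB.instance Definition _ := GRing.RMorphism.on evs.
Lemma evsC c : evs c%:P = iota c. Proof. exact: horner_morphC. Qed.
Lemma evsX : evs 'X = rt tau. Proof. exact: horner_morphX. Qed.

(** On polynomials in s the field acts as (s/2) d/ds, whose only zero is s = 0. *)
Lemma xi'_evs G : xi' (evs G) = evs (2%:R^-1 *: ('X * G^`())).
Proof.
have [sD sM] := xi'_der.
rewrite -mul_polyC !rmorphM /= evsC evsX.
elim/poly_ind: G => [|G c IH]; first by rewrite deriv0 !rmorph0 !mulr0 (der_zero xi'_der).
rewrite derivD derivM derivX derivC addr0 mulr1 !rmorphD !rmorphM /= evsX evsC.
rewrite sD sM xi'_iota IH addr0 /=.
have -> : xi' (rt tau) = iota 2%:R^-1 * rt tau.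
  apply: rext_eq; rewrite ?reM ?imM /xi' /re /im /=.
    by rewrite (der_zero xi_der); ring.
  by rewrite (der_one xi_der) add0r; ring.
by ring.
Qed.

Lemma evs_parts G : exists A C : {poly k}, re (evs G) = horner_alg tau A /\ im (evs G) = horner_alg tau C.
Proof.
elim/poly_ind: G => [|G c [A [C [rE iE]]]]; first by exists 0, 0; rewrite !rmorph0.
exists ('X * C + c%:P), A; rewrite rmorphD rmorphM /= evsX evsC reD imD reM imM rE iE.
rewrite rmorphD rmorphM /= horner_algX horner_algC /re /im /=; split; ring.
Qed.

Lemma evs_comp G : evs (G \Po 'X^2) = emb0 tau (horner_alg tau G).
Proof.
elim/poly_ind: G => [|G c IH]; first by rewrite comp_poly0 !rmorph0.
rewrite comp_polyD comp_polyM comp_polyX comp_polyC rmorphD rmorphM /= IH evsC.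
by rewrite exprS expr1 rmorphM /= evsX rt_sq !(rmorphD, rmorphM) /= horner_algX horner_algC.
Qed.

(** Infinite descent: tau divides a, then b, and the quotients satisfy the same equation. *)
Lemma square_tau_dvr n a b : a ^+ 2 = tau * b ^+ 2 -> dvr (tau ^+ n) a /\ dvr (tau ^+ n) b.
Proof.
elim: n a b => [|n IH] a b e; first by split; [exists a | exists b]; rewrite expr0 mulr1.
have [c cE] : dvr tau a by apply: tau_prime; exists (b ^+ 2); rewrite -expr2 e mulrC.
have e1 : b ^+ 2 = tau * c ^+ 2 by apply: (mulfI t0); rewrite -e cE; ring.
have [d dE] : dvr tau b by apply: tau_prime; exists (c ^+ 2); rewrite -expr2 e1 mulrC.
have e2 : c ^+ 2 = tau * d ^+ 2 by apply: (mulfI t0); rewrite -e1 dE; ring.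
have [[g gE] [h hE]] := IH _ _ e2.
by split; [exists g; rewrite cE gE | exists h; rewrite dE hE]; rewrite exprS; ring.
Qed.

Lemma rnorm_eq0 (x : S) : rnorm x = 0 -> x = 0.
Proof.
move=> /eqP; rewrite subr_eq0 => /eqP e; apply: rext_eq; apply: (dvr_exp_eq0 tau_size) => n;
  by have [] := square_tau_dvr n e.
Qed.

Lemma rext_integral (x y : S) : x * y = 0 -> x = 0 \/ y = 0.
Proof.
move=> xy; have : rnorm x * rnorm y = 0.
  by rewrite -rnormM xy /rnorm /re /im /= !expr0n mulr0 subr0.
by move/eqP; rewrite mulf_eq0 => /orP[] /eqP/rnorm_eq0; [left | right].
Qed.

(** Orders are compared at pi = s - a. Its derivative s/2 is invertible modulo pi because a is
    nonzero, and its norm a^2 - tau is not constant, which bounds the power of pi dividing x. *)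
Lemma order_relation (x : S) (G G0 : {poly k}) a f N M : x <> 0 -> a != 0 ->
  G = ('X - a%:P) ^+ f * G0 -> G0.[a] != 0 ->
  evs G * xi' x *+ N = xi' (evs G) * x *+ M -> exists e, (N * e = M * f)%N.
Proof.
move=> x0 a0 GE G0a rel; pose pi := evs ('X - a%:P).
have piE : pi = rt tau - iota a by rewrite /pi rmorphB /= evsX evsC.
have npi : rnorm pi = (a ^+ 2)%:A - tau.
  rewrite piE /rnorm /re /im /= sub0r subr0 sqrrN expr1n mulr1; congr (_ - _).
  by rewrite exprZn expr1n.
have spi : (1 < msize (rnorm pi))%N.
  rewrite ltnNge; apply/negP => le; have := tau_size; rewrite ltnNge => /negP; apply.
  have -> : tau = (a ^+ 2)%:A - rnorm pi by rewrite npi subKr.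
  apply: leq_trans (msizeD_le _ _) _; rewrite geq_max msizeN le andbT.
  by rewrite alg_mpolyC msizeC; case: eqP.
have relE : (pi ^+ f * evs G0) * xi' x *+ N = xi' (pi ^+ f * evs G0) * x *+ M.
  by rewrite /pi -rmorphXn -rmorphM -GE.
apply: (content_order xi'_der rext_integral _ _ _ _ _ x0 relE (u := evs (2%:R^-1 *: 'X))).
- move=> b c ne; have nz : b%:R - c%:R != 0 :> k.
    by rewrite subr_eq0; apply/eqP => /(natr_inj_char0 char0).
  by exists (iota (b%:R - c%:R)^-1); rewrite -!(rmorph_nat iota) -rmorphB -rmorphM /= divff // rmorph1.
- move=> y yP; apply: rnorm_eq0; apply: (dvr_exp_eq0 spi) => n; have [z ->] := yP n.
  exists (rnorm z); rewrite rnormM; congr (_ * _).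
  elim: n => [|n IH]; last by rewrite !exprS rnormM IH.
  by rewrite !expr0 /rnorm /re /im /= expr1n expr0n mulr0 subr0.
- by move=> p0; move: spi; rewrite p0 /rnorm /re /im /= !expr0n mulr0 subr0 msize0.
- by rewrite /pi xi'_evs derivXsubC mulr1.
have Ha : (2%:R^-1 *: 'X * G0).[a] != 0.
  by rewrite hornerM hornerZ hornerX !mulf_neq0 // invr_neq0.
set h := _.[a] in Ha.
have /factor_theorem[K KE] : root (2%:R^-1 *: 'X * G0 * (h^-1)%:P - 1) a.
  by rewrite rootE hornerD hornerN hornerM !hornerC -/h divff // subrr.
exists (iota h^-1), (evs K).
have e : evs (2%:R^-1 *: 'X * G0 * (h^-1)%:P) = 1 + evs K * pi.
  by rewrite -[X in evs X](subrK 1) KE rmorphD rmorphM rmorph1 addrC.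
by rewrite !rmorphM /= evsC in e; exact: e.
Qed.

Section Depressed.
Variables (P Q : {poly k}) (I : finType) (t s : I -> B).
Let p := horner_alg tau P.
Let q := horner_alg tau Q.
Let al := p ^+ 2 * xi p *+ 2 - q * xi q *+ 9.
Let be := p * xi q *+ 2 - xi p * q *+ 3.
Let Del := P ^+ 3 *+ 4 - Q ^+ 2 *+ 27.
Let D := p ^+ 3 *+ 4 - q ^+ 2 *+ 27.
Hypotheses (P0 : P.[0] != 0) (p_neq0 : p != 0) (Del0 : Del != 0) (D0 : D != 0).
Hypothesis xi_t : forall i, D * xi (t i) = al * t i + be * s i *+ 3.
Hypothesis xi_s : forall i, D * xi (s i) = al * s i *+ 2 + p * be * t i *+ 2.
Hypothesis tt : \sum_i t i * t i = p *+ 2.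
Hypothesis ts : \sum_i t i * s i = q *+ 3.
Hypothesis ss : (\sum_i s i * s i) *+ 3 = p ^+ 2 *+ 2.

(** If t and s were parallel, their Gram determinant would vanish; it is D/3. *)
Lemma wedge_neq0 : exists i j, t i * s j - t j * s i <> 0.
Proof.
apply: contrapT => none.
have z i j : t i * s j = t j * s i.
  by apply/eqP; rewrite -subr_eq0; apply/negPn/negP => /eqP nz; apply: none; exists i, j.
have e j : p *+ 2 * s j = q *+ 3 * t j.
  rewrite -tt -ts !mulr_suml; apply: eq_bigr => i _.
  by rewrite -mulrA z; ring.
have : p *+ 2 * (\sum_i s i * s i) *+ 3 = q *+ 3 * (\sum_i t i * s i) *+ 3.
  congr (_ *+ 3); rewrite !mulr_sumr; apply: eq_bigr => i _; by rewrite mulrA e; ring.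
rewrite -mulrnAr ss ts => e'; move/negP: D0; apply; apply/eqP.
have n27 : 3%:R != 0 :> B by rewrite -(rmorph_nat (@mpolyC 4 k)) mpolyC_eq0 natk.
by rewrite /D; move: e'; move: (p) (q) => x y e'; transitivity (x *+ 2 * (x ^+ 2 *+ 2) - y *+ 3 * (y *+ 3) *+ 3); [ring | rewrite e' subrr].
Qed.

Let Dev : evs (Del \Po 'X^2) = emb0 tau D.
Proof. by rewrite evs_comp /Del !(rmorphB, rmorphMn, rmorphXn) -/p -/q. Qed.

Lemma comp_X2_neq0 (G : {poly k}) : G != 0 -> G \Po 'X^2 != 0.
Proof. move=> G0; apply: contraNneq G0 => e; apply/eqP/polyP => i.
have := congr1 (fun H : {poly k} => H`_(i * 2)) e.
by rewrite coef_comp_poly_Xn // dvdn_mull // mulnK // !coef0. Qed.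

(** A wedge w = t_i s_j - t_j s_i satisfies D xi(w) = 3 al w, while xi(D) = 6 al; hence 2 D xi(w) =
    xi(D) w and nonzero roots have even order. At 0 the order is even since the polynomial is in
    s^2. *)
Lemma discriminant_square : exists L : {poly k}, Del \Po 'X^2 = L ^+ 2.
Proof.
apply: nth_power_of_orders => //; first exact: comp_X2_neq0.
move=> b f G0 GE G0b; have [b0|b0] := eqVneq b 0.
  have [m [D1 + DE]] := multiplicity_XsubC Del 0; rewrite Del0 /= => D1b.
  move: GE G0b; rewrite b0 => GE G0b.
  have e : ('X - 0%:P) ^+ f * G0 = ('X - 0%:P) ^+ (2 * m) * (D1 \Po 'X^2).
    rewrite -GE DE comp_polyM polyC0 subr0 mulrC; congr (_ * _).
    by rewrite rmorphXn /= comp_polyX -exprM.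
  have D1b' : (D1 \Po 'X^2).[0] != 0 by rewrite horner_comp hornerXn expr0n.
  by rewrite (order_unique e G0b D1b') dvdn_mulr.
have [i [j w0]] := wedge_neq0.
have [||e eE] := @order_relation (emb0 tau (t i * s j - t j * s i)) _ _ _ _ 2 1 _ b0 GE G0b.
- by move/(congr1 (@re _ _)).
- rewrite Dev !xi'_emb -!rmorphM -!rmorphMn mulr1n; congr (emb0 _ _).
  rewrite xD (der_opp xi_der) !xM /=.
  transitivity ((s j * (D * xi (t i)) + t i * (D * xi (s j)) - s i * (D * xi (t j)) - t j * (D * xi (s i))) *+ 2); first by ring.
  have -> : xi D = al *+ 6.
    have xMn a n : xi (a *+ n) = xi a *+ n.
      by elim: n => [|n IH]; rewrite ?mulr0n ?(der_zero xi_der) // !mulrS xD IH.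
    rewrite /D xD (der_opp xi_der) !xMn !exprS !expr0 !xM (der_one xi_der) /al /=; ring.
  by rewrite !xi_t !xi_s; ring.
- by rewrite -(mul1n f) -eE dvdn_mulr.
Qed.

(** Cardano over k[s]: with a square root of the discriminant, q = u + v and p^3 = 27 u v. The
    resolvent vector shows that v is a cube; then so is u, and the sum of the cube roots solves the
    cubic. *)
Lemma cubic_root : exists L : {poly k},
  horner_alg tau L ^+ 3 = p * horner_alg tau L + q.
Proof.
have [L0 L0E] := discriminant_square.
(* Chosen so that del^2 = q^2 - 4 p^3 / 27, the discriminant of the quadratic with roots u and v. *)
have [c c2] := sqrt_closed (- 27%:R^-1 : k).
pose P2 := P \Po 'X^2; pose Q2 := Q \Po 'X^2; pose del := c *: L0.
have delE : del ^+ 2 *+ 27 = Q2 ^+ 2 *+ 27 - P2 ^+ 3 *+ 4.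
  rewrite /del exprZn c2 -L0E scaleNr mulNrn -scaler_nat scalerA divff ?scale1r //.
  by rewrite /Del !(rmorphB, rmorphMn, rmorphXn) /= opprB.
pose v := (2%:R^-1 : k) *: (Q2 - del); pose u := (2%:R^-1 : k) *: (Q2 + del).
have halfP (G : {poly k}) : (2%:R^-1 : k) *: G *+ 2 = G.
  by rewrite -scaler_nat scalerA divff ?scale1r.
have uvQ : u + v = Q2 by rewrite -scalerDr addrACA addrN addr0 -mulr2n -scalerMnr halfP.
have uvd : u - v = del by rewrite -scalerBr opprB [del - Q2]addrC addrACA subrr add0r -mulr2n -scalerMnr halfP.
have uvP : P2 ^+ 3 = u * v *+ 27.
  have four : (4%:R : k) != 0 by exact: natk 3.
  apply: (mulIf (_ : 4%:R%:P != 0)); first by rewrite polyC_eq0.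
  rewrite polyC_natr; transitivity ((u + v) ^+ 2 *+ 27 - (u - v) ^+ 2 *+ 27); last by ring.
  by rewrite uvQ uvd delE; ring.
have P20 : P2.[0] != 0 by rewrite /P2 horner_comp hornerXn expr0n.
have uv0 : u.[0] * v.[0] != 0.
  apply: contraNneq P20 => e; have := congr1 (fun G : {poly k} => G.[0]) uvP.
  by rewrite horner_exp hornerMn hornerM e mul0rn => /eqP; rewrite expf_eq0.
have [u00 v00] : u.[0] != 0 /\ v.[0] != 0 by apply/andP; rewrite -negb_or -mulf_eq0.
have v0 : v != 0 by apply: contraNneq v00 => ->; rewrite horner0.
have del0 : del != 0.
  have := comp_X2_neq0 Del0; rewrite L0E expf_eq0 /= => L00.
  rewrite /del scaler_eq0 negb_or L00 andbT; apply: contraNneq (natk 26) => c0.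
  by move/eqP: c2; rewrite c0 expr0n eq_sym oppr_eq0 invr_eq0.
have evsP : evs P2 = emb0 tau p by exact: evs_comp.
have evsQ : evs Q2 = emb0 tau q by exact: evs_comp.
have [sD sM] := xi'_der.
have sN := der_opp xi'_der.
have sMn a n : xi' (a *+ n) = xi' a *+ n.
  by elim: n => [|n IH]; rewrite ?mulr0n ?(der_zero xi'_der) // !mulrS sD IH.
have natS n (x : S) : x *+ n.+1 = 0 -> x = 0.
  move=> e; transitivity (iota (n.+1%:R^-1) * (x *+ n.+1)); last by rewrite e mulr0.
  by rewrite mulrnAr -mulrnAl -rmorphMn -[_ *+ n.+1]mulr_natr mulVf // rmorph1 mul1r.
have p0 : emb0 tau p <> 0.
  by move/(congr1 (@re _ _)) => e; move/eqP: p_neq0; apply.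
have DelE : Del \Po 'X^2 = - (del ^+ 2 *+ 27).
  by rewrite delE opprB /Del !(rmorphB, rmorphMn, rmorphXn).
have evd0 : evs del <> 0.
  move=> e; have : emb0 tau D = 0.
    by rewrite -Dev DelE rmorphN rmorphMn rmorphXn /= e expr0n mul0rn oppr0.
  by move/(congr1 (@re _ _)) => e'; move/eqP: D0; apply.
have evuv : evs u + evs v = emb0 tau q by rewrite -rmorphD uvQ.
pose r i : S := emb0 tau p * emb0 tau (s i) - evs v * emb0 tau (t i) *+ 3.
(* The sum of the t_i r_i is 3 p q - 6 p v = 3 p (u - v), which is nonzero. *)
have [i0 r0] : exists i, r i <> 0.
  apply: contrapT => none.
  have z i : r i = 0 by apply: contrapT => nz; apply: none; exists i.
  have : \sum_i emb0 tau (t i) * r i = 0 by rewrite big1 // => i _; rewrite z mulr0.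
  have -> : \sum_i emb0 tau (t i) * r i = emb0 tau p * emb0 tau (\sum_i t i * s i)
      - evs v * emb0 tau (\sum_i t i * t i) *+ 3.
    rewrite !rmorph_sum /= !mulr_sumr -sumrMnl -sumrB; apply: eq_bigr => i _.
    by rewrite !rmorphM /= /r; ring.
  rewrite ts tt !rmorphMn /= -evuv => e.
  have : (emb0 tau p * evs del) *+ 3 = 0 by rewrite -uvd rmorphB /= -[RHS]e; ring.
  by move/natS/rext_integral => [].
have e3 : emb0 tau p ^+ 3 = evs u * evs v *+ 27 by rewrite -evsP -rmorphXn uvP rmorphMn rmorphM.
have ep : emb0 tau p ^+ 2 * xi' (emb0 tau p) = (xi' (evs u) * evs v + evs u * xi' (evs v)) *+ 9.
  apply/eqP; rewrite -subr_eq0; apply/eqP/(natS 2%N).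
  have := congr1 xi' e3; rewrite sMn !exprS expr0 !sM (der_one xi'_der) /= => /eqP; rewrite -subr_eq0 => /eqP <-.
  by ring.
have rel i : evs (v ^+ 2 * del ^+ 6) * xi' (r i) *+ 6 = xi' (evs (v ^+ 2 * del ^+ 6)) * r i *+ 1.
  have qE : xi' (evs u) + xi' (evs v) = emb0 tau (xi q) by rewrite -sD evuv xi'_emb.
  have H := resolvent_derivative (s := emb0 tau (s i)) (t := emb0 tau (t i))
     (xs := emb0 tau (xi (s i))) (xt := emb0 tau (xi (t i))) e3 ep.
  lapply H; last first.
    rewrite evuv qE xi'_emb -!(rmorphM, rmorphXn, rmorphMn, rmorphB, rmorphD) /=; congr (emb0 _ _).
    by rewrite !(rmorphB, rmorphMn, rmorphXn) /=; exact: xi_t.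
  move=> {}H; lapply H; last first.
    rewrite evuv qE xi'_emb -!(rmorphM, rmorphXn, rmorphMn, rmorphB, rmorphD) /=; congr (emb0 _ _).
    by rewrite !(rmorphB, rmorphMn, rmorphXn) /=; exact: xi_s.
  move=> res.
  move/natS/rext_integral: res => [res|p2]; last first.
    by move: p2; rewrite expr2 => /rext_integral[].
  apply/eqP; rewrite mulr1n -subr_eq0 -[X in _ == X]res; apply/eqP.
  have -> : xi' (r i) = xi' (emb0 tau p) * emb0 tau (s i) + emb0 tau p * emb0 tau (xi (s i))
      - (xi' (evs v) * emb0 tau (t i) + evs v * emb0 tau (xi (t i))) *+ 3.
    by rewrite /r sD sN sMn !sM !xi'_emb /=; ring.
  have -> : evs (v ^+ 2 * del ^+ 6) = evs v ^+ 2 * (evs u - evs v) ^+ 6.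
    by rewrite rmorphM !rmorphXn /= -uvd rmorphB.
  have -> : xi' (evs v ^+ 2 * (evs u - evs v) ^+ 6) = evs v * xi' (evs v) * (evs u - evs v) ^+ 6 *+ 2
     + evs v ^+ 2 * (evs u - evs v) ^+ 5 * (xi' (evs u) - xi' (evs v)) *+ 6.
    move: (sD (evs u) (- evs v)); rewrite sN; move: (evs u - evs v) => w wE.
    by rewrite !exprS !expr0 !sM wE (der_one xi'_der) /=; ring.
  by [].
(* At a nonzero root [order_relation] gives 6 e = 2 f + 6 d, so 3 divides f; and 0 is not a root of
   v because P(0) is nonzero. *)
have [ro roE] : exists L : {poly k}, v = L ^+ 3.
  apply: nth_power_of_orders => // b f G0 vE G0b; have [b0|b0] := eqVneq b 0.
    case: f vE => // f vE; move/eqP: v00; case.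
    by rewrite vE b0 hornerM horner_exp hornerXsubC subr0 expr0n mul0r.
  have [d [d1 + dE]] := multiplicity_XsubC del b; rewrite del0 /= => d1b.
  have GE : v ^+ 2 * del ^+ 6 = ('X - b%:P) ^+ (2 * f + 6 * d) * (G0 ^+ 2 * d1 ^+ 6).
    rewrite vE dE !exprMn -!exprM exprD (mulnC f) (mulnC d).
    by move: (_ ^+ (2 * f)) (_ ^+ (6 * d)) => *; ring.
  have Gb : (G0 ^+ 2 * d1 ^+ 6).[b] != 0 by rewrite hornerM !horner_exp mulf_neq0 // expf_neq0.
  have [e eE] := order_relation r0 b0 GE Gb (rel i0).
  by clear -eE; apply/dvdnP; exists (e - d)%N; lia.
have ro0 : ro != 0 by apply: contraNneq v0 => ro0; rewrite roE ro0 expr0n.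
have [sg sgE] : exists sg : {poly k}, P2 = sg * ro *+ 3.
  have : ro %| P2 by rewrite -(@dvdp_pexp2r _ _ _ 3) // uvP roE -scaler_nat dvdpZr ?natk // dvdp_mull.
  move=> /dvdpP[g gE]; exists ((3%:R^-1 : k) *: g).
  by rewrite gE -scalerAl -[RHS]scaler_nat scalerA divff ?natk ?scale1r.
have uE : u = sg ^+ 3.
  apply: (mulIf (_ : ro ^+ 3 *+ 27 != 0)).
    by rewrite -scaler_nat scaler_eq0 negb_or natk expf_neq0.
  transitivity (P2 ^+ 3); first by rewrite uvP roE; ring.
  by rewrite sgE; ring.
have lam : evs (ro + sg) ^+ 3 = emb0 tau p * evs (ro + sg) + emb0 tau q.
  by rewrite -evsP -evsQ -rmorphXn -rmorphM -rmorphD; congr (evs _); rewrite -uvQ sgE uE roE; ring.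
have [A [C [rE iE]]] := evs_parts (ro + sg).
have l1 := congr1 (@re _ _) lam; have l2 := congr1 (@im _ _) lam.
rewrite !exprS expr0 mulr1 !(reD, imD, reM, imM) rE iE /re /im /= !mul0r ?mulr0 ?addr0 in l1 l2.
have [y0|y0] := eqVneq (horner_alg tau C) 0.
  by exists A; rewrite y0 !mulr0 !addr0 in l1; rewrite -l1; ring.
(* If the root A + C s is not in k[tau], its conjugate A - C s is a root too; the three roots have
   sum 0, so the third is -2 A. *)
exists (- (A *+ 2)); rewrite rmorphN rmorphMn /=.
move: l1 l2 y0; move: (horner_alg tau A) (horner_alg tau C) p q => x y pp qq l1 l2 y0.
have e : pp = x ^+ 2 *+ 3 + tau * y ^+ 2.
  move/eqP: l2; rewrite -subr_eq0 => /eqP l2; apply: (mulIf y0); apply/eqP.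
  by rewrite -subr_eq0 -[X in _ == X]oppr0 -l2; apply/eqP; ring.
have -> : qq = x ^+ 3 + x * tau * y ^+ 2 *+ 3 - pp * x.
  move/eqP: l1; rewrite -subr_eq0 => /eqP l1; apply/eqP.
  by rewrite -subr_eq0 -[X in _ == X]oppr0 -l1; apply/eqP; ring.
by rewrite e; ring.
Qed.
End Depressed.
End CubicRoot.

Section MatrixEntries.
Variable R : comNzRingType.
Implicit Types A M N : 'M[R]_3.

Lemma add_mxE A M i j : (A + M) i j = A i j + M i j. Proof. by rewrite mxE. Qed.
Lemma opp_mxE A i j : (- A) i j = - A i j. Proof. by rewrite mxE. Qed.
Lemma scale_mxE a A i j : (a *: A) i j = a * A i j. Proof. by rewrite mxE. Qed.
Lemma scalar_mxE a i j : (a%:M : 'M[R]_3) i j = a * (i == j)%:R.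
Proof. by rewrite mxE mulr_natr. Qed.

(** Since T commutes with its derivative Y, the cubic differentiates to 3 T^2 Y = p Y + p' T + q'.
    Multiplying by T and reducing with the cubic gives the last two equations, which are linear in
    Y, T Y and T^2 Y. *)
Lemma cubic_matrix_derivative (xi : R -> R) (T Y : 'M[R]_3) (p q : R) :
  derivation idfun xi -> (forall i j, xi (T i j) = Y i j) -> T *m Y = Y *m T ->
  T *m T *m T = p *: T + q%:M -> forall i j,
  [/\ xi ((T *m T) i j) = (T *m Y) i j *+ 2,
      (T *m T *m Y) i j *+ 3 = p * Y i j + xi p * T i j + xi q * (i == j)%:R,
      p * (T *m Y) i j *+ 2 + q * Y i j *+ 3 = xi p * (T *m T) i j + xi q * T i j
    & p * (T *m T *m Y) i j *+ 2 + q * (T *m Y) i j *+ 3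
      = xi p * (p * T i j + q * (i == j)%:R) + xi q * (T *m T) i j].
Proof.
move=> xi_der xT TY T3; have [xD xM] := xi_der; rewrite /= in xM.
have dmul (M N M' N' : 'M[R]_3) : (forall i j, xi (M i j) = M' i j) ->
    (forall i j, xi (N i j) = N' i j) -> forall i j, xi ((M *m N) i j) = (M' *m N + M *m N') i j.
  move=> hM hN i j; rewrite add_mxE [(M *m N) i j]mxE [(M' *m N) i j]mxE [(M *m N') i j]mxE !big_ord_recl !big_ord0.
  by rewrite !(xD, xM) (der_zero xi_der) /= !hM !hN; ring.
have xT2 i j : xi ((T *m T) i j) = (T *m Y + T *m Y) i j by rewrite (dmul T T Y Y) // TY.
have e1 i j : (T *m T *m Y) i j *+ 3 = p * Y i j + xi p * T i j + xi q * (i == j)%:R.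
  have := dmul _ _ _ _ xT2 xT i j; rewrite T3 mulmxDl -!mulmxA -TY add_mxE add_mxE scale_mxE scalar_mxE mulmxA.
  rewrite xD !xM xT add_mxE.
  have -> : xi ((i == j)%:R) = 0 by case: (i == j); rewrite ?(der_one xi_der) ?(der_zero xi_der).
  move: ((T *m T *m Y) i j) (Y i j) (T i j) ((i == j)%:R : R) => z y t d /= e.
  by transitivity (z + z + z); [ring | rewrite -e; ring].
have M1 : 3%:R *: (T *m T *m Y) = p *: Y + xi p *: T + (xi q)%:M.
  by apply/matrixP => i j; rewrite !(add_mxE, scale_mxE) scalar_mxE mulr_natl e1.
have e2 i j : p * (T *m Y) i j *+ 2 + q * Y i j *+ 3 = xi p * (T *m T) i j + xi q * T i j.
  have := congr1 (fun M : 'M[R]_3 => (T *m M) i j) M1.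
  have -> : T *m (3%:R *: (T *m T *m Y)) = 3%:R *: (p *: (T *m Y) + q *: Y).
    by rewrite -scalemxAr !mulmxA T3 mulmxDl -scalemxAl mul_scalar_mx.
  rewrite !mulmxDr -!scalemxAr mul_mx_scalar !(add_mxE, scale_mxE).
  move: ((T *m Y) i j) ((T *m T) i j) (Y i j) (T i j) => z t2 y t e.
  transitivity (3%:R * (p * z + q * y) - p * z); first by ring.
  by rewrite e; ring.
have M2 : (p *+ 2) *: (T *m Y) + (q *+ 3) *: Y = xi p *: (T *m T) + xi q *: T.
  by apply/matrixP => i j; rewrite !add_mxE !scale_mxE -e2; ring.
split=> //.
  by rewrite xT2 add_mxE mulr2n.
have := congr1 (fun M : 'M[R]_3 => (T *m M) i j) M2.
rewrite !mulmxDr -!scalemxAr !mulmxA T3 !add_mxE !scale_mxE add_mxE scale_mxE scalar_mxE => e.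
by rewrite -e; ring.
Qed.
End MatrixEntries.

(** * Exclusion of covariant vectors and the final contradiction *)

Section CovariantGeometry.
Variable k : closedFieldType.
Hypothesis char0 : [pchar k] =i pred0.
Local Notation B := {mpoly k[4]}.
Variables (U : comAlgType k) (phi : {rmorphism B -> U}).
Variables (E F : B -> B) (nE nF : 'I_3 -> B).
Hypotheses (E_der : derivation idfun E) (F_der : derivation idfun F).
Hypotheses (E_scal : forall c, E c%:A = 0) (F_scal : forall c, F c%:A = 0).
Hypothesis E_noeig : forall g a : B, E g = a * g -> E g = 0.
Hypothesis F_noeig : forall g a : B, F g = a * g -> F g = 0.
Implicit Types (a b h : B) (u v w p q : 'I_3 -> B) (A M : 'M[B]_3).

Definition cst a := E a = 0 /\ F a = 0.
Definition covv u := covV E nE u /\ covV F nF u.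
Definition covm A := covM E nE A /\ covM F nF A.

Hypothesis phi_covv : forall u, covv u -> forall j, phi (u j) = 0.
Variable C : 'M[B]_3.
Variable y : 'I_3 -> U.
Hypotheses (C_sym : C^T = C) (C_tr : \tr C = 1) (C_cov : covm C).
Hypotheses (phi_C : forall i j, phi (C i j) = y i * y j) (y_unit : dot y y = 1).
Variable tau : B.
Hypothesis tau_size : (1 < msize tau)%N.
Hypothesis tau_cst : cst tau.
Hypothesis tau_prime : forall w : B, dvr tau (w * w) -> dvr tau w.
Hypothesis tau_gen : forall b, cst b -> exists P : {poly k}, b = horner_alg tau P.
Hypothesis phi_horner : forall P : {poly k}, phi (horner_alg tau P) = (P.[0])%:A.

Let gcdB : gcd_domain B := @gcd_domain_mpoly k 4.
Let two0 : 2%:R != 0 :> B.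
Proof. by rewrite -(rmorph_nat (@mpolyC 4 k)) mpolyC_eq0 (pcharf0P k).1. Qed.
Let ED a b : E (a + b) = E a + E b. Proof. by case: E_der. Qed.
Let EM a b : E (a * b) = a * E b + b * E a. Proof. by case: E_der. Qed.
Let FD a b : F (a + b) = F a + F b. Proof. by case: F_der. Qed.
Let FM a b : F (a * b) = a * F b + b * F a. Proof. by case: F_der. Qed.

Lemma cst_scal c : cst c%:A. Proof. by split. Qed.
Lemma cst1 : cst 1. Proof. by split; exact: der_one. Qed.
Lemma cst0 : cst 0. Proof. by split; exact: der_zero. Qed.
Lemma cstD a b : cst a -> cst b -> cst (a + b).
Proof. by move=> [a1 a2] [b1 b2]; split; rewrite ?ED ?FD ?a1 ?a2 ?b1 ?b2 addr0. Qed.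
Lemma cstN a : cst a -> cst (- a).
Proof. by move=> [a1 a2]; split; rewrite ?(der_opp E_der) ?(der_opp F_der) ?a1 ?a2 oppr0. Qed.
Lemma cstB a b : cst a -> cst b -> cst (a - b).
Proof. by move=> ca cb; apply/cstD/cstN. Qed.
Lemma cstM a b : cst a -> cst b -> cst (a * b).
Proof. by move=> [a1 a2] [b1 b2]; split; rewrite ?EM ?FM ?a1 ?a2 ?b1 ?b2 !mulr0 addr0. Qed.
Lemma cstMn a n : cst a -> cst (a *+ n).
Proof. by move=> ca; elim: n => [|n IH]; rewrite ?mulr0n ?mulrS; [exact: cst0 | exact: cstD]. Qed.
Lemma cstX a n : cst a -> cst (a ^+ n).
Proof. by move=> ca; elim: n => [|n IH]; rewrite ?expr0 ?exprS; [exact: cst1 | exact: cstM]. Qed.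

Lemma covmB A M : covm A -> covm M -> covm (A - M).
Proof. by move=> [a1 a2] [b1 b2]; split; apply: covMB. Qed.
Lemma covmD A M : covm A -> covm M -> covm (A + M).
Proof. by move=> [a1 a2] [b1 b2]; split; apply: covMD. Qed.
Lemma covmM A M : covm A -> covm M -> covm (A *m M).
Proof. by move=> [a1 a2] [b1 b2]; split; apply: covMM. Qed.
Lemma covmZ a A : cst a -> covm A -> covm (a *: A).
Proof. by move=> [a1 a2] [b1 b2]; split; apply: covMZ. Qed.
Lemma covm_scal a : cst a -> covm a%:M.
Proof. by move=> [a1 a2]; split; apply: cov_scal. Qed.
Lemma covm_adj A : covm A -> covm (adj3 A).
Proof. by move=> [a1 a2]; split; apply: cov_adj. Qed.
Lemma covm_outer u v : covv u -> covv v -> covm (outer u v).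
Proof. by move=> [a1 a2] [b1 b2]; split; apply: cov_outer. Qed.
Lemma covm_skew u : covv u -> covm (skew3 u).
Proof. by move=> [a1 a2]; split; [exact: (cov_skew E_der a1) | exact: (cov_skew F_der a2)]. Qed.
Lemma covv_axial A : covm A -> covv (axial A).
Proof. by move=> [a1 a2]; split; apply: cov_axial. Qed.
Lemma covv_mulv A u : covm A -> covv u -> covv (mulv A u).
Proof. by move=> [a1 a2] [b1 b2]; split; apply: covMV. Qed.
Lemma covv_cross u v : covv u -> covv v -> covv (cross u v).
Proof. by move=> [a1 a2] [b1 b2]; split; apply: cov_cross. Qed.
Lemma cst_tr A : covm A -> cst (\tr A).
Proof. by move=> [a1 a2]; split; apply: cov_tr; eassumption. Qed.
Lemma cst_det A : covm A -> cst (det3 A).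
Proof. by move=> [a1 a2]; split; apply: cov_det; eassumption. Qed.
Lemma cst_dot u v : covv u -> covv v -> cst (dot u v).
Proof. by move=> [a1 a2] [b1 b2]; split; apply: cov_dot; eassumption. Qed.

Lemma cst_quotient a u v : (exists i, u i != 0) -> covv u -> covv v ->
  (forall i, v i = a * u i) -> cst a.
Proof.
move=> [i ui] [uE uF] [vE vF] va.
have aux d n : derivation idfun d -> covV d n u -> covV d n v -> d a = 0.
  move=> [dD dM] cu cv; apply: (mulIf ui); rewrite mul0r.
  have := cv i; rewrite va dM cu /cross !va => /eqP; rewrite -subr_eq0 => /eqP <- /=; ring.
by split; [apply: (aux E nE) | apply: (aux F nF)].
Qed.

Lemma rank_one_inv A : A^T = A -> covm A -> adj3 A = 0 -> A != 0 ->
  exists h u, [/\ primitive u, covv u & forall i j, A i j = h * u i * u j].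
Proof.
move=> sA [AE AF] adj0 A0; have [h [u [pu uE]]] := rank_one gcdB sA adj0 A0.
exists h, u; split=> //; split.
  by case: (rank_one_cov two0 E_der E_noeig AE A0 pu uE).
by case: (rank_one_cov two0 F_der F_noeig AF A0 pu uE).
Qed.

Lemma phi_trace A h u : covv u -> (forall i j, A i j = h * u i * u j) -> phi (\tr A) = 0.
Proof.
by move=> cu AE; rewrite tr3 !AE !rmorphD !rmorphM /= !(phi_covv cu) !mulr0 !addr0.
Qed.

Lemma phi_adjC i j : phi (adj3 C i j) = 0.
Proof. by rewrite mxE rmorphB !rmorphM /= !phi_C; ring. Qed.

Let e2 := \tr (adj3 C).
Let e3 := det3 C.
Lemma phi_e2 : phi e2 = 0. Proof. by rewrite /e2 tr3 !rmorphD /= !phi_adjC !addr0. Qed.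
Lemma phi_e3 : phi e3 = 0.
Proof. by rewrite /e3 /det3 !rmorphD !rmorphM /= !phi_adjC !mulr0 !addr0. Qed.
Lemma cst_e2 : cst e2. Proof. exact/cst_tr/covm_adj. Qed.
Lemma cst_e3 : cst e3. Proof. exact: cst_det. Qed.

Lemma detC_sub a : det3 (C - a%:M) = e3 - a * e2 + a ^+ 2 - a ^+ 3.
Proof. by rewrite det3_sub C_tr mulr1. Qed.
Lemma tr_adjC_sub a : \tr (adj3 (C - a%:M)) = e2 - a *+ 2 + a ^+ 2 *+ 3.
Proof. by rewrite tr_adj3_sub C_tr mulr1. Qed.
Lemma C_sub_sym a : (C - a%:M)^T = C - a%:M.
Proof. by rewrite linearB /= C_sym tr_scalar_mx. Qed.

(** The adjugate of C - a has vanishing 2 by 2 minors, so it would be h u u^T with u covariant, of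
    trace 0 on X; but its trace e2 - 2 a + 3 a^2 is 1 there. *)
Lemma no_unit_eigenvalue a : cst a -> phi a = 1 -> det3 (C - a%:M) = 0 -> False.
Proof.
move=> ca pa d0; pose A := adj3 (C - a%:M).
have phA : phi (\tr A) = 1.
  by rewrite /A tr_adjC_sub rmorphD rmorphB !rmorphMn rmorphXn /= phi_e2 pa; ring.
have A0 : A != 0.
  by apply/eqP => A0; move/eqP: phA; rewrite A0 mxtrace0 rmorph0 eq_sym oner_eq0.
have [|||h [u [_ cu AE]]] := @rank_one_inv A _ _ _ A0.
- by rewrite /A -adj3_tr C_sub_sym.
- by apply/covm_adj/covmB => //; apply: covm_scal.
- by rewrite /A adj3_adj3 d0 scale0r.
by move/eqP: phA; rewrite (phi_trace cu AE) eq_sym oner_eq0.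
Qed.

Lemma cst_tau_dvr a : cst a -> phi a = 0 -> dvr tau a.
Proof.
move=> /tau_gen[P ->]; rewrite phi_horner => /eqP; rewrite scaler_eq0 oner_eq0 orbF => P0.
have /factor_theorem[Q ->] : root P 0 by [].
by rewrite subr0 rmorphM /= horner_algX; apply/dvr_mull/dvrr.
Qed.

Lemma mulv_mul A M u i : mulv (A *m M) u i = mulv A (mulv M u) i.
Proof. by rewrite /mulv /dot !mul3; ring. Qed.

(** Modulo tau the adjugate of C - 1 is proportional to w w^T and has trace 1, so w_i^2 is a
    multiple of w . w, which vanishes on X and is divisible by tau. *)
Lemma cov_eigen_dvr w : covv w -> (forall i, dvr tau (mulv (C - 1%:M) w i)) -> forall i, dvr tau (w i).
Proof.
move=> cw tz i; have K := adj3_kernel (C_sub_sym 1) tz.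
have ww : dvr tau (dot w w).
  apply: cst_tau_dvr; first exact: cst_dot.
  by rewrite /dot !rmorphD !rmorphM /= !(phi_covv cw) !mulr0 !addr0.
have te2 : dvr tau e2 by apply: cst_tau_dvr; [exact: cst_e2 | exact: phi_e2].
apply: tau_prime.
have [[k0 k1] k2] := (K i i 0 0, K i i 1 1, K i i 2%:R 2%:R).
have e : \tr (adj3 (C - 1%:M)) = e2 + 1 by rewrite tr_adjC_sub expr1n; ring.
have -> : w i * w i = (adj3 (C - 1%:M) 0 0 * w i * w i - adj3 (C - 1%:M) i i * w 0 * w 0) +
   (adj3 (C - 1%:M) 1 1 * w i * w i - adj3 (C - 1%:M) i i * w 1 * w 1) +
   (adj3 (C - 1%:M) 2%:R 2%:R * w i * w i - adj3 (C - 1%:M) i i * w 2%:R * w 2%:R) +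
   adj3 (C - 1%:M) i i * dot w w - e2 * (w i * w i).
  transitivity (\tr (adj3 (C - 1%:M)) * (w i * w i) - e2 * (w i * w i)); first by rewrite e; ring.
  by rewrite tr3 /dot; move: (adj3 _ i i) (adj3 _ 0 0) (adj3 _ 1 1) (adj3 _ 2%:R 2%:R) => *; ring.
apply: dvrB; last exact: dvr_mulr.
apply: dvrD; last exact: dvr_mull.
exact: dvrD (dvrD k0 k1) k2.
Qed.

Lemma cayley : C *m C *m C = C *m C - e2 *: C + e3%:M.
Proof.
have := mul_adj3 C; rewrite adj3_poly C_tr scale1r -/e2 -/e3 mulmxDr mulmxBr mul_mx_scalar mulmxA => <-.
move: (C *m C *m C) => X; move: (C *m C) (e2 *: C) => Y Z; apply/matrixP => i j; rewrite !mxE; ring.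
Qed.

(** By Cayley-Hamilton (C - 1) C^2 = e3 - e2 C, and tau divides e2 and e3; so C^2 q is an
    eigenvector for 1 modulo tau. *)
Lemma square_dvr q : covv q -> exists q', covv q' /\ forall i, mulv (C *m C) q i = tau * q' i.
Proof.
move=> cq; pose w := mulv (C *m C) q.
have cw : covv w by apply: covv_mulv => //; apply: covmM.
have te2 : dvr tau e2 by apply: cst_tau_dvr; [exact: cst_e2 | exact: phi_e2].
have te3 : dvr tau e3 by apply: cst_tau_dvr; [exact: cst_e3 | exact: phi_e3].
have tw : forall i, dvr tau (w i).
  apply: cov_eigen_dvr => // i.
  have -> : mulv (C - 1%:M) w i = e3 * q i - e2 * mulv C q i.
    rewrite /w -mulv_mul mulmxBl mul1mx mulmxA cayley.
    have -> : C *m C - e2 *: C + e3%:M - C *m C = e3%:M - e2 *: C.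
      by rewrite addrAC [_ - _ - _]addrAC subrr sub0r addrC.
    by elim/ord3P: i; rewrite /mulv /dot !mxE /= ?mulr1n ?mulr0n; ring.
  by apply: dvrB; apply: dvr_mulr.
have [q' q'E] := choice tw; exists q'; split; last by move=> i; rewrite -/(w i) q'E mulrC.
have t0 : tau != 0 by apply: contraTneq tau_size => ->; rewrite msize0.
have aux d n : derivation idfun d -> d tau = 0 -> covV d n w -> covV d n q'.
  move=> [dD dM] dt dw i; apply: (mulIf t0); have := dw i.
  by rewrite q'E dM dt /cross !q'E /= mulr0 add0r mulrC => ->; ring.
by case: cw => wE wF; split; [apply: aux E_der tau_cst.1 wE | apply: aux F_der tau_cst.2 wF].
Qed.

(** For M = C^2, tr(M) times a determinant is the sum of the determinants with M applied to one
    column, each a multiple of tau. As tr(M) is 1 modulo tau, every power of tau divides the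
    determinant. *)
Lemma cov_dependent q1 q2 q3 : covv q1 -> covv q2 -> covv q3 -> dot (cross q1 q2) q3 = 0.
Proof.
move=> c1 c2 c3; apply: (dvr_exp_eq0 tau_size) => i.
elim: i q1 q2 q3 c1 c2 c3 => [|i IH] q1 q2 q3 c1 c2 c3.
  by exists (dot (cross q1 q2) q3); rewrite expr0 mulr1.
have [p1 [d1 e1]] := square_dvr c1; have [p2 [d2 e2']] := square_dvr c2.
have [p3 [d3 e3']] := square_dvr c3.
have trE : \tr (C *m C) * dot (cross q1 q2) q3 = tau * (dot (cross p1 q2) q3 + dot (cross q1 p2) q3 + dot (cross q1 q2) p3).
  transitivity (dot (cross (mulv (C *m C) q1) q2) q3 + dot (cross q1 (mulv (C *m C) q2)) q3
    + dot (cross q1 q2) (mulv (C *m C) q3)).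
    by rewrite tr3; move: (C *m C) => M; rewrite /dot /cross /mulv /dot ?I3; ring.
  by rewrite /dot /cross !e1 !e2' !e3' ?I3; ring.
have [g gE] : dvr tau (\tr (C *m C) - 1).
  apply: cst_tau_dvr; first by apply: cstB; [apply/cst_tr/covmM | exact: cst1].
  rewrite rmorphB rmorph1 /= tr3 !mul3 !rmorphD !rmorphM /= !phi_C.
  transitivity (dot y y * dot y y - 1); first by rewrite /dot; ring.
  by rewrite y_unit mulr1 subrr.
have -> : dot (cross q1 q2) q3 = tau * (dot (cross p1 q2) q3 + dot (cross q1 p2) q3 + dot (cross q1 q2) p3
   - g * dot (cross q1 q2) q3).
  rewrite mulrBr -trE; transitivity ((\tr (C *m C) - (\tr (C *m C) - 1)) * dot (cross q1 q2) q3).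
    by rewrite subKr mul1r.
  by rewrite gE; ring.
have D a : dvr (tau ^+ i) a -> dvr (tau ^+ i.+1) (tau * a).
  by case=> z ->; exists z; rewrite exprS; ring.
apply: D; apply: dvrB; last by apply/dvr_mull/IH.
by apply: dvrD; [apply: dvrD|]; apply: IH.
Qed.

(** An isotropic eigenvector makes [a] a double eigenvalue, so the third one is 1 - 2 a. Since e2
    and e3 vanish on X, so does [a], and the third eigenvalue is 1 there. *)
Lemma no_isotropic_eigenvector u a : covv u -> (exists i, u i != 0) -> cst a -> dot u u = 0 ->
  (forall i, mulv C u i = a * u i) -> False.
Proof.
move=> cu [i ui] ca uu Cu.
have Mu j : mulv (C - a%:M) u j = 0.
  have -> : mulv (C - a%:M) u j = mulv C u j - a * u j.
    by elim/ord3P: j; rewrite /mulv /dot !mxE /= ?mulr1n ?mulr0n; ring.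
  by rewrite Cu subrr.
have Mu0 j : dvr 0 (mulv (C - a%:M) u j) by rewrite Mu; apply: dvr0.
have K := adj3_kernel (C_sub_sym a) Mu0.
have {}K j l m r : adj3 (C - a%:M) m r * u j * u l = adj3 (C - a%:M) j l * u m * u r.
  by have [z] := K j l m r; rewrite mulr0 => /eqP; rewrite subr_eq0 => /eqP.
have tr0 : \tr (adj3 (C - a%:M)) = 0.
  apply: (mulIf (mulf_neq0 ui ui)); rewrite mul0r tr3.
  transitivity (adj3 (C - a%:M) i i * dot u u); last by rewrite uu mulr0.
  by rewrite /dot !mulrDl !mulrDr !mulrA !(K i i); ring.
have det0 : det3 (C - a%:M) = 0.
  apply: (mulIf ui); rewrite mul0r.
  transitivity (mulv (adj3 (C - a%:M) *m (C - a%:M)) u i).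
    rewrite adj3_mul; elim/ord3P: {ui} i; rewrite /mulv /dot !mxE /= ?mulr1n ?mulr0n; ring.
  by rewrite mulv_mul {1}/mulv /dot !Mu !mulr0 !addr0.
rewrite detC_sub in det0; rewrite tr_adjC_sub in tr0.
have e2E : e2 = a *+ 2 - a ^+ 2 *+ 3.
  by apply/eqP; rewrite -subr_eq0 -[X in _ == X]tr0; apply/eqP; ring.
have e3E : e3 = a ^+ 2 - a ^+ 3 *+ 2.
  by apply/eqP; rewrite -subr_eq0 -[X in _ == X]det0 e2E; apply/eqP; ring.
have pa : phi a = 0.
  have := phi_e2; have := phi_e3; rewrite e2E e3E !rmorphB !rmorphMn !rmorphXn /=.
  move: (phi a) => x x3 x2.
  have half (z : U) : z *+ 2 = 0 -> z = 0.
    by rewrite -scaler_nat => /eqP; rewrite scaler_eq0 (pcharf0P k).1 //= => /eqP.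
  have xx : x ^+ 2 = 0.
    transitivity ((x *+ 2 - x ^+ 2 *+ 3) * x *+ 2 - (x ^+ 2 - x ^+ 3 *+ 2) *+ 3); first by ring.
    by rewrite x3 x2 mul0r !mul0rn subrr.
  apply: half; move: x2; rewrite xx mul0rn subr0; done.
apply: (@no_unit_eigenvalue (1 - a *+ 2)).
- by apply: cstB; [exact: cst1 | exact: cstMn].
- by rewrite rmorphB rmorph1 rmorphMn /= pa mul0rn subr0.
by rewrite detC_sub e2E e3E; ring.
Qed.

Lemma parallel_eigen u w : primitive u -> covv u -> covv w ->
  (forall i j, w i * u j = w j * u i) -> exists2 a, cst a & forall i, w i = a * u i.
Proof.
move=> pu cu cw par; have [a aE] := parallel_primitive pu par.
by exists a => //; apply: (cst_quotient (primitive_neq0 pu) cu cw aE).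
Qed.

Lemma covv_primitive u : covv u -> (exists i, u i != 0) ->
  exists v, [/\ primitive v, covv v & exists h, h != 0 /\ forall i j, u i * u j = h * v i * v j].
Proof.
move=> cu [i ui]; have [||||h [v [pv cv hE]]] := @rank_one_inv (outer u u).
- by apply/matrixP => r s; rewrite !mxE mulrC.
- exact: covm_outer.
- by apply/matrixP => r s; rewrite !mxE; ring.
- by apply/eqP => /matrixP/(_ i i)/eqP; rewrite !mxE mulf_eq0 orbb (negPf ui).
exists v; split=> //; exists h; split; last by move=> r r'; rewrite -hE mxE.
apply: contraNneq ui => h0; have := hE i i; rewrite mxE h0 !mul0r => /eqP.
by rewrite mulf_eq0 orbb.
Qed.

Lemma dot_mulvC u v : dot (mulv C u) v = dot u (mulv C v).
Proof.
have sC i j : C i j = C j i by rewrite -{1}C_sym mxE.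
by rewrite /dot /mulv /dot (sC 1 0) (sC 2%:R 0) (sC 2%:R 1); ring.
Qed.

(** A nonzero cross product n = p x q is covariant, hence orthogonal to every covariant vector,
    itself included. C n is orthogonal to p and q, so n is an isotropic eigenvector. *)
Lemma cov_parallel p q : covv p -> covv q -> forall i j, p i * q j = p j * q i.
Proof.
move=> cp cq.
have [cr0|] := pselect (forall i, cross p q i = 0).
  have [[k0 k1] k2] := (cr0 0, cr0 1, cr0 2%:R); rewrite /cross !I3 in k0 k1 k2.
  move/eqP: k0; move/eqP: k1; move/eqP: k2; rewrite !subr_eq0 => /eqP k2 /eqP k1 /eqP k0.
  by elim/ord3P; elim/ord3P.
move=> crn; exfalso.
have [i ni] : exists i, cross p q i != 0.
  by apply: contrapT => none; apply: crn => i; apply/eqP/negPn/negP => nz; apply: none; exists i.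
have cn := covv_cross cp cq.
have [u [pu cu [h [h0 hE]]]] := covv_primitive cn (ex_intro (fun i => cross p q i != 0) i ni).
have orth r : covv r -> dot (cross p q) r = 0 by move=> cr; exact: cov_dependent.
have uu : dot u u = 0.
  apply: (mulfI h0); rewrite mulr0 -(orth _ cn) /dot !hE; ring.
have Cn_orth r : covv r -> dot (mulv C (cross p q)) r = 0.
  by move=> cr; rewrite dot_mulvC orth //; apply: covv_mulv.
have par := cross_orth (Cn_orth p cp) (Cn_orth q cq).
set n := cross p q in cn ni hE par *.
have hui : h * u i != 0.
  by apply: contraNneq (mulf_neq0 ni ni) => e; rewrite hE e mul0r.
have nu j : n i * n j = h * u i * u j by exact: hE.
have Cnu j : n i * mulv C n j = h * u i * mulv C u j.
  transitivity (dot (C j) (fun l => n i * n l)); first by rewrite /mulv /dot; ring.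
  by rewrite /mulv /dot !nu; ring.
have [a ca aE] : exists2 a, cst a & forall j, mulv C u j = a * u j.
  apply: (parallel_eigen pu cu); first exact: covv_mulv.
  move=> r s; apply: (mulfI (mulf_neq0 hui hui)).
  transitivity ((n i * mulv C n r) * (n i * n s)); first by rewrite Cnu nu; ring.
  transitivity ((n i * mulv C n s) * (n i * n r)); last by rewrite Cnu nu; ring.
  by rewrite mulrACA par -mulrACA; ring.
exact: (no_isotropic_eigenvector cu (primitive_neq0 pu) ca uu aE).
Qed.

(** Without covariant vectors, a symmetric covariant matrix with zero adjugate is zero. This applies
    first to the adjugate of C - a, then to C - a; but y y^T is not scalar. *)
Lemma no_eigenvalue (nocov : forall u, covv u -> forall i, u i = 0) a : cst a -> det3 (C - a%:M) <> 0.
Proof.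
move=> ca d0; have zero A : A^T = A -> covm A -> adj3 A = 0 -> A = 0.
  move=> sA cA adj0; apply/eqP/negPn/negP => A0.
  have [h [u [pu cu _]]] := rank_one_inv sA cA adj0 A0.
  by have [i /eqP[]] := primitive_neq0 pu; apply: nocov.
have cCa : covm (C - a%:M) by apply/covmB => //; apply: covm_scal.
have adj0 : adj3 (C - a%:M) = 0.
  apply: zero; [by rewrite -adj3_tr C_sub_sym | exact: covm_adj | by rewrite adj3_adj3 d0 scale0r].
have Ca : C = a%:M by apply/eqP; rewrite -subr_eq0; apply/eqP/zero => //; exact: C_sub_sym.
have z i j : i != j -> y i * y j = 0.
  by move=> ne; rewrite -phi_C Ca scal3 (negPf ne) rmorph0.
have yy i : y i * y i = phi a by rewrite -phi_C Ca scal3 eqxx.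
have pa : phi a = 0.
  transitivity (y 0 * y 0 * dot y y); first by rewrite y_unit mulr1 yy.
  transitivity (y 0 * y 0 * (y 0 * y 0) + y 0 * y 1 * (y 0 * y 1) + y 0 * y 2%:R * (y 0 * y 2%:R)).
    by rewrite /dot; ring.
  rewrite (z 0 1) // (z 0 2%:R) // !mulr0 !addr0 yy.
  transitivity (y 0 * y 0 * (y 1 * y 1)); first by rewrite !yy.
  by transitivity (y 0 * y 1 * (y 0 * y 1)); [ring | rewrite (z 0 1) // mulr0].
by move/eqP: y_unit; rewrite /dot !yy pa !addr0 eq_sym oner_eq0.
Qed.

Section EulerField.
Variable xi : B -> B.
Hypotheses (xi_der : derivation idfun xi) (xi_scal : forall c, xi c%:A = 0) (xi_tau : xi tau = tau).
Hypotheses (xi_E : forall b, xi (E b) = E (xi b)) (xi_F : forall b, xi (F b) = F (xi b)).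
Hypotheses (xi_nE : forall i, xi (nE i) = 0) (xi_nF : forall i, xi (nF i) = 0).
Hypothesis tau_inj : forall P : {poly k}, horner_alg tau P = 0 -> P = 0.
Let xD a b : xi (a + b) = xi a + xi b. Proof. by case: xi_der. Qed.
Let xM a b : xi (a * b) = a * xi b + b * xi a. Proof. by case: xi_der. Qed.
Let xN a : xi (- a) = - xi a. Proof. exact: der_opp xi_der a. Qed.
Let xMn a n : xi (a *+ n) = xi a *+ n.
Proof. by elim: n => [|n IH]; rewrite ?mulr0n ?(der_zero xi_der) // !mulrS xD IH. Qed.

Lemma covv_xi u : covv u -> covv (fun i => xi (u i)).
Proof.
move=> [uE uF]; split=> i.
  by rewrite -xi_E uE /cross xD xN !xM !xi_nE /= !mulr0 !addr0.
by rewrite -xi_F uF /cross xD xN !xM !xi_nF /= !mulr0 !addr0.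
Qed.

Lemma covm_xi A : covm A -> covm (\matrix_(i, j) xi (A i j)).
Proof.
move=> [AE AF]; split=> i j; rewrite mxE.
  by rewrite -xi_E AE /cross !(xD, xN, xM) !xi_nE /= !mulr0 !addr0 !mxE.
by rewrite -xi_F AF /cross !(xD, xN, xM) !xi_nF /= !mulr0 !addr0 !mxE.
Qed.

(** All covariant vectors are multiples of one primitive p, so p is an eigenvector of C and of xi.
    [norm_form_square] then feeds [plane_rank_one], whose matrix gives a covariant u both orthogonal
    and parallel to p, with p . p nonzero. *)
Lemma no_covariant_vector u0 : covv u0 -> forall i, u0 i = 0.
Proof.
move=> cu0 i; apply/eqP/negPn/negP => ui.
have [p [pp cp _]] := covv_primitive cu0 (ex_intro (fun i => u0 i != 0) i ui).
have pn := primitive_neq0 pp; have [i0 pi0] := pn.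
have [kap ckap Cp] := parallel_eigen pp cp (covv_mulv C_cov cp)
  (cov_parallel (covv_mulv C_cov cp) cp).
have Q0 : dot p p != 0.
  by apply/eqP => Q0; exact: (no_isotropic_eigenvector cp pn ckap Q0 Cp).
have [mm cmm xip] := parallel_eigen pp cp (covv_xi cp) (cov_parallel (covv_xi cp) cp).
set Q := dot p p in Q0.
have cQ : cst Q by exact: cst_dot.
have xQ : xi Q = mm * Q *+ 2 by rewrite /Q /dot !xD !xM /= !xip; ring.
have [Qp QE] := tau_gen cQ; have [mp mE] := tau_gen cmm.
have Qp0 : Qp != 0 by apply: contraNneq Q0 => z; rewrite QE z rmorph0.
(* xi Q = 2 mm Q, and on k[tau] the field is tau d/dtau, so Q is a monomial in tau. *)
have [c [j [c0 QpE]]] : exists c j, c != 0 /\ Qp = c *: 'X^j.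
  apply: (log_derivative_monomial char0 (r := mp *+ 2) Qp0).
  apply/eqP; rewrite -subr_eq0; apply/eqP/tau_inj.
  rewrite rmorphB !rmorphM rmorphMn /= horner_algX -QE -mE mulrC -[X in _ * X]xi_tau.
  by rewrite -(horner_alg_der tau Qp xi_der xi_scal) -QE xQ mulrnAl subrr.
have det0 : det3 (C - kap%:M) = 0.
  have Mp l : mulv (C - kap%:M) p l = 0.
    have -> : mulv (C - kap%:M) p l = mulv C p l - kap * p l.
      by elim/ord3P: l; rewrite /mulv /dot !mxE /= ?mulr1n ?mulr0n; ring.
    by rewrite Cp subrr.
  apply: (mulIf pi0); rewrite mul0r.
  transitivity (mulv (adj3 (C - kap%:M) *m (C - kap%:M)) p i0).
    rewrite adj3_mul; clear pi0; elim/ord3P: i0; rewrite /mulv /dot !mxE /= ?mulr1n ?mulr0n; ring.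
  by rewrite mulv_mul {1}/mulv /dot !Mp !mulr0 !addr0.
(* On X the eigenvalues of C are 0, 0 and 1, and 1 is excluded by [no_unit_eigenvalue]. Then [Del]
   is 1 on X, hence nonzero. *)
have phk : phi kap = 0.
  have [K KE] := tau_gen ckap.
  have := congr1 phi det0; rewrite detC_sub rmorph0.
  have := phi_e2; have := phi_e3; move: (e2) (e3) => ee2 ee3 z3 z2.
  rewrite !(rmorphD, rmorphN, rmorphM, rmorphXn) /= z2 z3.
  rewrite KE phi_horner; set x := K.[0].
  have hx n : x%:A ^+ n = (x ^+ n)%:A :> U by exact: (esym (rmorphXn (in_alg U) n x)).
  have [X XE] : exists X : U, X = x%:A by exists x%:A.
  rewrite -XE => e; have e' : X ^+ 2 - X ^+ 3 = 0 by rewrite -e; ring.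
  have : x ^+ 2 * (1 - x) = 0.
    apply/eqP; move/eqP: e'; rewrite XE !hx -scalerBl scaler_eq0 oner_eq0 orbF.
    by rewrite (_ : x ^+ 2 * (1 - x) = x ^+ 2 - x ^+ 3) //; ring.
  move/eqP; rewrite mulf_eq0 expf_eq0 /= => /orP[/eqP x00|]; first by rewrite XE x00 scale0r.
  rewrite subr_eq0 => /eqP x1; case: (@no_unit_eigenvalue kap) => //.
  by rewrite KE phi_horner -/x -x1 scale1r.
pose t := 1 - kap; pose Del := t ^+ 2 - (\tr (adj3 C) - kap * t) *+ 4.
have ct : cst t by apply: cstB => //; exact: cst1.
have cDel : cst Del.
  apply: cstB; first exact: cstX.
  by apply: cstMn; apply: cstB; [exact: cst_e2 | exact: cstM].
have [Dp DE] := tau_gen cDel.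
have phDel : phi Del = 1.
  have z : phi (\tr (adj3 C)) = 0 by exact: phi_e2.
  rewrite /Del /t; move: (\tr (adj3 C)) z => ee2 z.
  by rewrite !(rmorphD, rmorphN, rmorphM, rmorphMn, rmorphXn, rmorph1) /= z phk; ring.
have Dp0 : Dp != 0.
  by apply/eqP => z; move/eqP: phDel; rewrite DE z !rmorph0 eq_sym oner_eq0.
have [ap [bp [ep [ep0 nE']]]] := norm_form_square char0 j c0 Dp0.
pose a := horner_alg tau ap; pose b := horner_alg tau bp; pose eps := horner_alg tau ep.
have eps0 : eps != 0 by apply: contraNneq ep0 => /tau_inj ->.
have normE : (a ^+ 2 + b ^+ 2 * Q) * Del = eps ^+ 2.
  by rewrite QE QpE DE /a /b /eps -!rmorphXn -rmorphM -rmorphD -rmorphM nE'.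
have [symA adj0 A0 Ap] := plane_rank_one C_sym C_tr Cp Q0 two0 normE eps0.
move: symA adj0 A0 Ap; set A := (_ + _ : 'M[B]_3) => symA adj0 A0 Ap.
have chorner (P : {poly k}) : cst (horner_alg tau P).
  split; [rewrite (horner_alg_der tau P E_der E_scal) tau_cst.1 | rewrite (horner_alg_der tau P F_der F_scal) tau_cst.2];
  exact: mulr0.
have cA : covm A.
  have cP := covm_outer cp cp.
  have cc : covm (Q *+ 2 *: C + (t - kap *+ 2) *: outer p p - (t * Q)%:M).
    apply: covmB; last by apply/covm_scal/cstM.
    apply: covmD; apply: covmZ => //; first exact: cstMn.
    by apply: cstB => //; exact: cstMn.
  rewrite /A; apply: covmD; first apply: covmD.
  - exact: covmZ (chorner _) cc.
  - by apply: covmZ (chorner _) _; apply: covmM; [by apply: covm_skew | exact: cc].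
  - by apply: covmZ (chorner _) _; apply: covmB; [exact: covm_scal cQ | exact: cP].
have [h [u [pu cu AE]]] := rank_one_inv symA cA adj0 A0.
have h0 : h != 0.
  by apply: contraNneq A0 => h0; apply/eqP/matrixP => r s; rewrite AE h0 !mul0r mxE.
have [l ul] := primitive_neq0 pu.
have up : dot u p = 0.
  apply: (mulfI (mulf_neq0 h0 ul)); rewrite mulr0 -(Ap l) /mulv /dot !AE; ring.
move/negP: ul; apply; apply/eqP; apply: (mulIf Q0); rewrite mul0r.
transitivity (dot u p * p l); last by rewrite up mul0r.
have par := cov_parallel cu cp.
by rewrite /Q /dot !mulrDr !mulrDl !mulrA !(par l _); ring.
Qed.

(** [p] and [q] are the coefficients of the depressed cubic of T = 3 C - 1; a root l of it in k[tau]
    gives the eigenvalue (l + 1)/3 of C, contrary to [no_eigenvalue]. *)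
Lemma covariant_contradiction : False.
Proof.
pose p := 3%:R - e2 *+ 9; pose q := 2%:R - e2 *+ 9 + e3 *+ 27.
have cn n : cst (n%:R : B) by apply: cstMn; exact: cst1.
have cp : cst p by apply: cstB => //; apply/cstMn/cst_e2.
have cq : cst q by apply: cstD; [apply: cstB => //; apply/cstMn/cst_e2 | apply/cstMn/cst_e3].
have [P PE] := tau_gen cp; have [Q QE] := tau_gen cq.
have natk n : n.+1%:R != 0 :> k by rewrite (pcharf0P k).1.
have noroot (L : {poly k}) : horner_alg tau L ^+ 3 = p * horner_alg tau L + q -> False.
  set l := horner_alg tau L => lE.
  have cl : cst l.
    split; [rewrite (horner_alg_der tau L E_der E_scal) tau_cst.1 | rewrite (horner_alg_der tau L F_der F_scal) tau_cst.2];
    exact: mulr0.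
  pose r : B := (3%:R^-1 : k)%:A.
  have r3 : r *+ 3 = 1 by rewrite /r scalerMnl -[_ *+ 3]mulr_natr mulVf ?scale1r ?natk.
  apply: (no_eigenvalue no_covariant_vector (a := (l + 1) * r)).
    by apply: cstM; [apply: cstD => //; exact: cst1 | exact: cst_scal].
  rewrite detC_sub; have n27 : 27%:R != 0 :> B.
    by rewrite -(rmorph_nat (@mpolyC 4 k)) mpolyC_eq0 natk.
  apply: (mulfI n27); rewrite mulr0.
  transitivity (e3 *+ 27 - (l + 1) * (r *+ 3) * e2 *+ 9 + (l + 1) ^+ 2 * (r *+ 3) ^+ 2 *+ 3 - (l + 1) ^+ 3 * (r *+ 3) ^+ 3).
    by ring.
  rewrite r3; transitivity (p * l + q - l ^+ 3); first by rewrite /p /q; ring.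
  by rewrite lE subrr.
have php : phi p = 3%:R by rewrite /p rmorphB !rmorphMn rmorph1 phi_e2 mul0rn subr0.
have nU n : n.+1%:R != 0 :> U.
  by rewrite -(rmorph_nat (in_alg U)) /= scaler_eq0 negb_or natk oner_neq0.
have p0 : p != 0 by apply: contraTneq (nU 2%N) => z; rewrite -php z rmorph0 eqxx.
have P0 : P.[0] != 0.
  apply/eqP => z; move/eqP: php; rewrite PE phi_horner z scale0r eq_sym; exact/negP/nU.
pose Del := P ^+ 3 *+ 4 - Q ^+ 2 *+ 27.
have Del0 : Del != 0.
  (* With zero discriminant, 27 Q^2 = 4 P^3 gives Q = g P and 4 P = 27 g^2, and 3 g is a root. *)
  apply/eqP => /eqP; rewrite subr_eq0 => /eqP De.
  have Pn0 : P != 0 by apply: contraNneq P0 => ->; rewrite horner0.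
  have : P %| Q.
    rewrite -(@dvdp_pexp2r _ _ _ 2) // -(@dvdpZr _ 27%:R) ?natk // scaler_nat -De.
    have -> : P ^+ 3 *+ 4 = P ^+ 2 * (P *+ 4) by ring.
    exact: dvdp_mulIl.
  move=> /dvdpP[g gE].
  have e4 : P *+ 4 = g ^+ 2 *+ 27.
    apply: (mulIf (expf_neq0 2 Pn0)); move: De; rewrite gE => De.
    by transitivity (P ^+ 3 *+ 4); [ring | rewrite De; ring].
  apply: (noroot (g *+ 3)); rewrite PE QE -rmorphXn -rmorphM -rmorphD; congr (horner_alg _ _).
  have n4 : 4%:R != 0 :> {poly k} by rewrite -polyC_natr polyC_eq0 natk.
  apply: (mulfI n4); rewrite gE.
  transitivity (g ^+ 3 *+ 108); first by ring.
  transitivity ((P *+ 4) * g *+ 4); last by ring.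
  by rewrite e4; ring.
have hDel : horner_alg tau Del = p ^+ 3 *+ 4 - q ^+ 2 *+ 27.
  by rewrite /Del !(rmorphB, rmorphMn, rmorphXn) /= -PE -QE.
have D0 : p ^+ 3 *+ 4 - q ^+ 2 *+ 27 != 0.
  by rewrite -hDel; apply: contraNneq Del0 => /tau_inj ->.
pose X : 'M[B]_3 := \matrix_(i, j) xi (C i j).
have sC i j : C i j = C j i by rewrite -{1}C_sym mxE.
have symX : X^T = X by apply/matrixP => i j; rewrite !mxE sC.
(* The commutator of two symmetric covariant matrices is antisymmetric; its axial vector is
   covariant, hence zero. *)
have CX : C *m X = X *m C.
  apply/eqP; rewrite -subr_eq0; apply/eqP; set K := _ - _.
  have cK : covm K by apply: covmB; apply: covmM => //; exact: covm_xi.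
  have antiK : K^T = - K by rewrite /K linearB /= !trmx_mul symX C_sym opprB.
  have aK i j : K i j = - K j i by rewrite -[in LHS](trmxK K) mxE antiK mxE.
  have dbl (b : B) : b *+ 2 = 0 -> b = 0.
    by rewrite -mulr_natr => /eqP; rewrite mulf_eq0 (negPf two0) orbF => /eqP.
  have z := no_covariant_vector (covv_axial cK).
  have {}z i : K (i + 1) (i + 2%:R) = 0.
    by apply: dbl; rewrite mulr2n {2}aK; exact: z.
  have d i : K i i = 0 by apply: dbl; rewrite mulr2n {2}aK subrr.
  have [[z0 z1] z2] := (z 0, z 1, z 2%:R); rewrite !I3 in z0 z1 z2.
  apply/matrixP => i j; rewrite [RHS]mxE; elim/ord3P: i; elim/ord3P: j => //;
    by rewrite aK ?z0 ?z1 ?z2 oppr0.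
pose T : 'M[B]_3 := 3%:R *: C - 1%:M; pose Y : 'M[B]_3 := 3%:R *: X.
have TY : T *m Y = Y *m T.
  by rewrite /T /Y mulmxBl mulmxBr mul1mx mulmx1 -!scalemxAl -!scalemxAr CX.
have symT : T^T = T by rewrite /T linearB linearZ /= C_sym trmx1.
have sT i j : T i j = T j i by rewrite -{1}symT mxE.
have T3 : T *m T *m T = p *: T + q%:M.
  have -> : T *m T = 9%:R *: (C *m C) - 6%:R *: C + 1%:M.
    rewrite /T mulmxBl !mulmxBr mul1mx !mulmx1 -!scalemxAl -!scalemxAr; apply/matrixP => i j.
    by rewrite !(add_mxE, opp_mxE, scale_mxE); move: ((C *m C) i j) (C i j) ((1%:M : 'M[B]_3) i j) => *; ring.
  rewrite /T mulmxBr mulmx1 !mulmxDl mulNmx mul1mx -!scalemxAl -!scalemxAr cayley.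
  apply/matrixP => i j; rewrite /p /q !(add_mxE, opp_mxE, scale_mxE, scalar_mxE).
  by move: ((C *m C) i j) (C i j) ((i == j)%:R : B) (e2) (e3) => *; ring.
have xT i j : xi (T i j) = Y i j.
  rewrite !mxE xD xN xM /= xMn (der_one xi_der) mul0rn mulr0 addr0.
  by case: (i == j); rewrite ?mulr1n ?mulr0n ?(der_one xi_der) ?(der_zero xi_der) oppr0 addr0.
have trC : \tr T = 0 by rewrite /T linearB linearZ /= C_tr mxtrace1; ring.
have trT2 : \tr (T *m T) = p *+ 2.
  have := tr_adj3 C; rewrite C_tr -/e2 => e.
  rewrite {1}/T mulmxBl mul1mx -scalemxAl linearB linearZ /= trC subr0.
  rewrite /T mulmxBr mulmx1 -scalemxAr linearB linearZ /= C_tr.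
  have -> : \tr (C *m C) = 1 - e2 *+ 2 by rewrite e; ring.
  by rewrite /p; ring.
clearbody T Y; clearbody p q.
pose T2 := T *m T; pose y1 := T *m Y; pose y2 := T2 *m Y.
have xT2 i j : xi (T2 i j) = y1 i j *+ 2 by case: (cubic_matrix_derivative xi_der xT TY T3 i j).
have E1 i j : y2 i j *+ 3 = p * Y i j + xi p * T i j + xi q * (i == j)%:R.
  by case: (cubic_matrix_derivative xi_der xT TY T3 i j).
have E2 i j : p * y1 i j *+ 2 + q * Y i j *+ 3 = xi p * T2 i j + xi q * T i j.
  by case: (cubic_matrix_derivative xi_der xT TY T3 i j).
have E3 i j : p * y2 i j *+ 2 + q * y1 i j *+ 3 = xi p * (p * T i j + q * (i == j)%:R) + xi q * T2 i j.
  by case: (cubic_matrix_derivative xi_der xT TY T3 i j).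
pose r : B := (3%:R^-1 : k)%:A.
have r3 : r *+ 3 = 1 by rewrite /r scalerMnl -[_ *+ 3]mulr_natr mulVf ?scale1r ?natk.
pose tf (ij : 'I_3 * 'I_3) := T ij.1 ij.2.
(* The trace-free part of T^2, as T^2 has trace 2 p. The pair of vectors [tf], [sf] satisfies the
   closed linear system of [cubic_root]. *)
pose sf (ij : 'I_3 * 'I_3) := T2 ij.1 ij.2 - r * p * (ij.1 == ij.2)%:R *+ 2.
have n3 : 3%:R != 0 :> B by rewrite -(rmorph_nat (@mpolyC 4 k)) mpolyC_eq0 natk.
have xidel (b : bool) : xi b%:R = 0 by case: b; rewrite ?(der_one xi_der) ?(der_zero xi_der).
have ht (ij : 'I_3 * 'I_3) : (p ^+ 3 *+ 4 - q ^+ 2 *+ 27) * xi (tf ij) = (p ^+ 2 * xi p *+ 2 - q * xi q *+ 9) * tf ij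
    + (p * xi q *+ 2 - xi p * q *+ 3) * sf ij *+ 3.
  case: ij => i j; rewrite /tf /sf /= xT.
  have := E1 i j; have := E2 i j; have := E3 i j.
  move: (y1 i j) (y2 i j) (Y i j) (T i j) (T2 i j) ((i == j)%:R) (xi p) (xi q) => z1 z2 z t t2 d p' q' f3 f2 f1.
  transitivity (p * ((p * z2 *+ 2 + q * z1 *+ 3) *+ 3 - p * (z2 *+ 3 - p * z) *+ 2) *+ 2
     - q * (p * z1 *+ 2 + q * z *+ 3) *+ 9); first by ring.
  rewrite f3 f2 f1.
  transitivity (p * ((p' * (p * t + q * d) + q' * t2) *+ 3 - p * (p' * t + q' * d) *+ 2) *+ 2
     - q * (p' * t2 + q' * t) *+ 9); first by ring.
  transitivity ((p ^+ 2 * p' *+ 2 - q * q' *+ 9) * t + (p * q' *+ 2 - p' * q *+ 3) * (t2 *+ 3 - (r *+ 3) * p * d *+ 2)).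
    by rewrite r3; ring.
  by ring.
have hs (ij : 'I_3 * 'I_3) : (p ^+ 3 *+ 4 - q ^+ 2 *+ 27) * xi (sf ij) = (p ^+ 2 * xi p *+ 2 - q * xi q *+ 9) * sf ij *+ 2
    + p * (p * xi q *+ 2 - xi p * q *+ 3) * tf ij *+ 2.
  have := ht ij; case: ij => i j; rewrite /tf /sf /= xT xD xN xMn !xM xidel xi_scal xT2 /=.
  have := E2 i j.
  move: (y1 i j) (Y i j) (T i j) (T2 i j) ((i == j)%:R) (xi p) (xi q) => z1 z t t2 d p' q' f2 f1.
  apply: (mulfI (mulf_neq0 n3 p0)).
  transitivity ((p ^+ 3 *+ 4 - q ^+ 2 *+ 27) * ((p * z1 *+ 2 + q * z *+ 3) *+ 3) -
    q * ((p ^+ 3 *+ 4 - q ^+ 2 *+ 27) * z) *+ 9 - (p ^+ 3 *+ 4 - q ^+ 2 *+ 27) * (r *+ 3) * p' * p * d *+ 2).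
    by ring.
  rewrite f2 f1.
  transitivity ((p ^+ 3 *+ 4 - q ^+ 2 *+ 27) * (p' * t2 + q' * t) *+ 3 - q * ((p ^+ 2 * p' *+ 2 - q * q' *+ 9) * t
     + (p * q' *+ 2 - p' * q *+ 3) * (t2 *+ 3 - (r *+ 3) * p * d *+ 2)) *+ 9
     - (p ^+ 3 *+ 4 - q ^+ 2 *+ 27) * (r *+ 3) * p' * p * d *+ 2); first by ring.
  transitivity (p * ((p ^+ 2 * p' *+ 2 - q * q' *+ 9) * (t2 *+ 3 - (r *+ 3) * p * d *+ 2) *+ 2
     + p * (p * q' *+ 2 - p' * q *+ 3) * t *+ 6)); last by ring.
  by rewrite r3; ring.
have sumT (M N : 'M[B]_3) : N^T = N -> \sum_(ij : 'I_3 * 'I_3) M ij.1 ij.2 * N ij.1 ij.2 = \tr (M *m N).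
  move=> symN; rewrite -(pair_bigA _ (fun i j => M i j * N i j)); apply: eq_bigr => i _.
  by rewrite mxE; apply: eq_bigr => j _; rewrite -{1}symN mxE.
pose S : 'M[B]_3 := T2 - (r * p *+ 2)%:M.
have sfE (ij : 'I_3 * 'I_3) : sf ij = S ij.1 ij.2 by rewrite /sf add_mxE opp_mxE scalar_mxE; ring.
have symS : S^T = S by rewrite /S linearB /= /T2 trmx_mul symT tr_scalar_mx.
have tt : \sum_ij tf ij * tf ij = p *+ 2 by rewrite (sumT T T symT) trT2.
have trT2' : \tr T2 = p *+ 2 by exact: trT2.
have trT3 : \tr (T *m T2) = q *+ 3.
  by rewrite /T2 mulmxA T3 linearD linearZ /= trC mulr0 add0r mxtrace_scalar.
have ts : \sum_ij tf ij * sf ij = q *+ 3.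
  rewrite (eq_bigr (fun ij => T ij.1 ij.2 * S ij.1 ij.2)) => [|ij _]; last by rewrite sfE.
  by rewrite sumT // /S mulmxBr mul_mx_scalar linearB linearZ /= trC mulr0 subr0.
have ss : (\sum_ij sf ij * sf ij) *+ 3 = p ^+ 2 *+ 2.
  rewrite (eq_bigr (fun ij => S ij.1 ij.2 * S ij.1 ij.2)) => [|ij _]; last by rewrite !sfE.
  rewrite sumT // {1}/S mulmxBl mul_scalar_mx linearB linearZ /=.
  have -> : \tr S = p *+ 2 - r *+ 3 * p *+ 2.
    by rewrite /S linearB /= trT2' mxtrace_scalar; ring.
  have -> : \tr (T2 *m S) = p * (p *+ 2) - r * p * (p *+ 2) *+ 2.
    rewrite /S mulmxBr mul_mx_scalar linearB linearZ /= trT2' {1}/T2 -mulmxA.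
    have -> : T *m T2 = p *: T + q%:M by rewrite /T2 mulmxA T3.
    by rewrite mulmxDr -scalemxAr mul_mx_scalar linearD !linearZ /= -/T2 trT2' trC mulr0 addr0; ring.
  rewrite r3; transitivity (p * (p *+ 2) *+ 3 - (r *+ 3) * p * (p *+ 2) *+ 2); first by ring.
  by rewrite r3; ring.
have [L LE] : exists L, horner_alg tau L ^+ 3 = horner_alg tau P * horner_alg tau L + horner_alg tau Q.
  apply: (@cubic_root k char0 xi tau xi_der xi_scal xi_tau tau_size tau_prime P Q _ tf sf P0).
  - by rewrite -PE.
  - exact: Del0.
  - by rewrite -PE -QE.
  - by rewrite -PE -QE; exact: ht.
  - by rewrite -PE -QE; exact: hs.
  - by rewrite -PE.
  - by rewrite -QE.
  - by rewrite -PE.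
by apply: (noroot L); rewrite LE -PE -QE.
Qed.
End EulerField.
End CovariantGeometry.

Theorem no_equivariant_embedding4 (k : closedFieldType) (char0 : [pchar k] =i pred0)
    (rho : SL2_action {mpoly k[4]}) :
  ~ exists f : {lrmorphism {mpoly k[4]} -> Rring k},
      closed_embedding f /\ equivariant (X_action char0) rho f.
Proof.
move=> [f [f_onto f_equiv]].
have [i i2'] := closed_sqrt (- 1 : k).
have i2 : i ^+ 2 + 1 = 0 by rewrite i2' addNr.
have [c c2'] := closed_sqrt (2%:R^-1 : k).
have c2 : c ^+ 2 *+ 2 - 1 = 0.
  by rewrite c2' -mulr_natr mulVf ?subrr // (pcharf0P k).1.
have [C [C_sym C_tr CE CF phi_C]] := covariant_matrix f_onto f_equiv i2 c2.
pose psi : {rmorphism {mpoly k[4]} -> Dring k} := phi f.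
pose nE : 'I_3 -> {mpoly k[4]} := rotE i%:A c%:A.
pose nF : 'I_3 -> {mpoly k[4]} := rotF i%:A c%:A.
have C_cov : covm (lE rho) (lF rho) nE nF C by split.
have phi_cov u : covv (lE rho) (lF rho) nE nF u -> forall j, psi (u j) = 0.
  by move=> [uE uF]; exact: (cov_vanishes f_equiv i2 c2 uE uF).
have unit_pt : dot (pt i c) (pt i c) = 1 by exact: pt_unit.
have Ed := lE_der char0 rho; have Fd := lF_der char0 rho.
have Es := lE_scal char0 rho; have Fs := lF_scal char0 rho.
have En (g a : {mpoly k[4]}) : lE rho g = a * g -> lE rho g = 0 by exact: E_no_eig.
have Fn (g a : {mpoly k[4]}) : lF rho g = a * g -> lF rho g = 0 by exact: F_no_eig.
have C_phi a b : psi (C a b) = pt i c a * pt i c b by exact: phi_C.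
(* If every invariant were constant, e2 and e3, which vanish on X, would be 0, and C would have the
   eigenvalue 1. *)
have [tau0 tau0_inv tau0_ncst] : exists2 t, sl2_inv rho t & forall d, t <> d%:MP.
  apply: contrapT => none.
  have inv0 t : sl2_inv rho t -> psi t = 0 -> t = 0.
    move=> it ft; apply: contrapT => tn; apply: none; exists t => // d td.
    apply: tn; have : phi f d%:MP = 0 by rewrite -td; exact: ft.
    rewrite td -alg_mpolyC (phiZ f) (phi1 f) => /eqP.
    by rewrite scaler_eq0 oner_eq0 orbF => /eqP ->; rewrite scale0r.
  have z2 : \tr (adj3 C) = 0.
    apply: inv0; [apply: (cst_e2 (E := lE rho) (F := lF rho) (nE := nE) (nF := nF)) | apply: (phi_e2 (phi := psi))];
    first [eassumption | idtac].
  have z3 : det3 C = 0.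
    apply: inv0; [apply: (cst_e3 (E := lE rho) (F := lF rho) (nE := nE) (nF := nF)) | apply: (phi_e3 (phi := psi))];
    first [eassumption | idtac].
  eapply (@no_unit_eigenvalue) with (phi := psi) (E := lE rho) (F := lF rho) (nE := nE) (nF := nF) (C := C)
    (y := pt i c) (a := 1); first [eassumption | exact: rmorph1 | idtac].
    by split; exact: der_one.
  by rewrite det3_sub C_tr z2 z3; ring.
have [tau [tau_inv phi_tau tau_prim tau_gen]] := invariant_generator f_onto f_equiv tau0_inv tau0_ncst.
have [xi [xi_der xi_scal xi_E xi_F xi_tau]] := euler_field f_onto f_equiv tau_inv phi_tau tau_prim tau_gen.
have xiM a b : xi (a * b) = a * xi b + b * xi a by case: xi_der.
have xi_ic : xi (i%:A * c%:A) = 0 by rewrite xiM !xi_scal !mulr0 addr0.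
have xiN a : xi (- a) = - xi a by exact: (der_opp xi_der).
have xi0 : xi 0 = 0 by exact: (der_zero xi_der).
have xi2 a : xi (a *+ 2) = xi a *+ 2 by rewrite !mulr2n; case: xi_der.
have tau_size : (1 < msize tau)%N.
  rewrite ltnNge; apply/negP => le; have [l] := primitive_neq0 tau_prim.
  by rewrite (msize1_polyC le) mderivC eqxx.
eapply (@covariant_contradiction) with (phi := psi) (E := lE rho) (F := lF rho) (nE := nE) (nF := nF) (C := C)
    (y := pt i c) (tau := tau) (xi := xi); first [eassumption | idtac].
- by move=> w; exact: (tau_prime char0 tau_inv tau_prim tau_gen).
- by move=> P; exact: phi_horner.
- move=> l; rewrite /nE; elim/ord3P: l; rewrite /rotE /= ?xi2 ?xiN ?xi_ic ?xi_scal ?xi0 ?mul0rn ?oppr0 //.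
- move=> l; rewrite /nF; elim/ord3P: l; rewrite /rotF /= ?xi2 ?xiN ?xi_ic ?xi_scal ?xi0 ?mul0rn ?oppr0 //.
- by move=> P; exact: horner_tau_inj.
Qed.

Theorem theorem1p1 (k : closedFieldType) (char0 : [pchar k] =i pred0) :
  [/\ (* a *)
      exists f : {lrmorphism {mpoly k[5]} -> Rring k},
        closed_embedding f /\
        equivariant (X_action char0) (irreducible_module char0 4) f,
      (* b *)
      exists f : {lrmorphism {mpoly k[4]} -> Rring k}, closed_embedding f,
      (* c *)
      forall rho : SL2_action {mpoly k[4]},
        ~ exists f : {lrmorphism {mpoly k[4]} -> Rring k},
            closed_embedding f /\ equivariant (X_action char0) rho f,
      (* d *)
      ~ exists f : {lrmorphism {mpoly k[3]} -> Rring k}, closed_embedding f &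
      (* e *)
      ~ isomorphic (cylinder (Rring k)) (cylinder (Dring k))].
Proof.
split.
- by exists (alg_hom (emb5 k)); split; [exact: embedding5_onto | exact: embedding5_equivariant].
- exact: embedding4.
- exact: no_equivariant_embedding4.
- exact: no_embedding3.
- exact: cylinders_not_isomorphic.
Qed.
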